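(* Let $(\Delta x_k,\Delta t_k)_{k\in\mathbb N}$ be a sequence of admissible discretization parameters with $\Delta x_k\to0$ and $\Delta t_k\to 0$. For each $k$ let $(w^n_j)$ be a solution of the scheme $D_t^+w^n_j=B(w^{n+\theta}_j)D^2w^{n+\theta}_j$ with initial data $w^0_j=\frac1{\Delta x}\int_{x_{j-1/2}}^{x_{j+1/2}}w_0(x)\,dx$ for the parameters $(\Delta x,\Delta t)=(\Delta x_k,\Delta t_k)$, and let $w^{\Delta t_k}$ be its interpolation (piecewise linear in $x$, piecewise constant in $t$). Then a subsequence of $(w^{\Delta t_k})_k$ converges in $C([0,\infty),W^{1,1}(\Omega))$ to a weak solution $w$ of $$w_t=B(w)w_{xx}\quad (t>0,\ x\in\Omega),\qquad w(x,0)=w_0(x)\quad (x\in\Omega).$$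
   Context: Setting. $\Omega=\mathbb R$, or $\Omega=[0,1]$ with periodic boundary conditions (in the latter case all functions, including test functions, are periodically extended, i.e. are functions on the circle). Assumptions: $B\in C^2(\mathbb R)$ with $0\le B\le 1$; $w_0\in W^{1,1}(\Omega)\cap W^{1,\infty}(\Omega)$ and $w_{0,x}\in BV(\Omega)$. The parameter $\theta\in[0,1]$ is fixed. Grid. $x_j=j\Delta x$, $x_{j\pm1/2}=(j\pm\frac12)\Delta x$, $t^n=n\Delta t$, $n\ge 0$. If $\Omega=[0,1]$, then $\Delta x=1/N$ with $N\in\mathbb N$ and all grid functions are $N$-periodic in $j$. If $\Omega=\mathbb R$, then $j\in\mathbb Z$ and a solution of the scheme is understood to satisfy $\sum_j|w^n_j|<\infty$ for every $n$. The pair $(\Delta x,\Delta t)$ is admissible if $\Delta x,\Delta t>0$ and the CFL condition $\lambda=\Delta t/(\Delta x)^2<\frac{1}{2(1-\theta)}$ holds; for $\theta=1$ there is no restriction. Difference operators. $D_+a_j=\frac{a_{j+1}-a_j}{\Delta x}$, $D_-a_j=\frac{a_j-a_{j-1}}{\Delta x}$, $D_t^+a^n=\frac{a^{n+1}-a^n}{\Delta t}$, $D^2a_j=D_+D_-a_j$, and $w^{n+\theta}_j=\theta w^{n+1}_j+(1-\theta)w^n_j$. Interpolation. $w^{\Delta t}(x,t)=\frac{x_{j+1}-x}{\Delta x}w^n_j+\frac{x-x_j}{\Delta x}w^n_{j+1}$ for $x\in[x_j,x_{j+1})$, $t\in[t^n,t^{n+1})$. Convergence. Since $w^{\Delta t}$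 is piecewise constant in $t$, convergence $w^{\Delta t}\to w$ in $C([0,\infty),W^{1,1}(\Omega))$ means that $w\in C([0,\infty),W^{1,1}(\Omega))$ and $\sup_{t\in[0,T]}\|w^{\Delta t}(\cdot,t)-w(\cdot,t)\|_{W^{1,1}(\Omega)}\to0$ for every $T>0$. Weak solution. A function $w\in L^\infty(0,\infty;H^1(\Omega))\cap L^\infty(\Omega\times(0,\infty))$ is a weak solution of the Cauchy problem if $$\int_0^\infty\int_\Omega \big(w\,\phi_t-B(w)\,w_x\phi_x-B'(w)(w_x)^2\phi\big)\,dx\,dt+\int_\Omega w_0(x)\phi(x,0)\,dx=0$$ for all $\phi\in C_c^\infty(\Omega\times[0,\infty))$.
   Formalization: For Ω=ℝ the weak solution's L² norm is bounded only on bounded time intervals (w ∈ L^∞(0,T;H¹) for every T), with w bounded and the L² norm of w_x bounded uniformly in time; the bound in L^∞(0,∞;H¹) can fail when B vanishes at a value attained by w_0. *)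

(* Defs.v *)
From HB Require Import structures.
From mathcomp Require Import all_boot all_order all_algebra.
From mathcomp Require Import all_classical all_reals all_analysis.

Set Implicit Arguments.
Unset Strict Implicit.
Unset Printing Implicit Defensive.
Import Order.TTheory GRing.Theory Num.Theory.
Import numFieldNormedType.Exports.

Local Open Scope classical_set_scope.
Local Open Scope ring_scope.

(* Functions on the circle are represented by 1-periodic functions on the real
   line, and their integrals and norms are taken over the period [0, 1].
   Functions of time and space take the time first: [w t x]. *)
Inductive domain := Line | Circle.

Section definitions.
Context {R : realType}.
Local Notation mu := (@lebesgue_measure R).
Local Notation mR := (measurableTypeR R).
Implicit Types (Om : domain) (p : \bar R) (f g : R -> R).

Definition dom Om : set R :=
  match Om with Line => setT | Circle => `[0, 1] end.

Lemma measurable_dom Om : measurable (dom Om : set mR).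
Proof. by case: Om => /=; [exact: measurableT | exact: measurable_itv]. Qed.

Definition on_dom Om f : Prop :=
  match Om with Line => True | Circle => forall x, f (x + 1) = f x end.

Definition mu_dom Om : {measure set mR -> \bar R} :=
  mrestr mu (measurable_dom Om).

(* For an interval [I] of times: the Lebesgue measures of I and of I x Om. *)
Definition mu_time (I : interval R) : {measure set mR -> \bar R} :=
  mrestr mu (measurable_itv I).

Definition mu_spacetime (I : interval R) Om :
    {measure set (mR * mR) -> \bar R} :=
  mrestr (mu \x mu)%E (measurableX (measurable_itv I) (measurable_dom Om)).

Definition smooth f : Prop := forall n x, derivable (derive1n n f) x 1.

Definition test_fun Om f : Prop := smooth f /\
  match Om with
  | Line => exists M, forall x, M < `|x| -> f x = 0
  | Circle => on_dom Circle f
  end.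

Definition is_weak_derive Om f g : Prop :=
  [/\ on_dom Om f /\ on_dom Om g, locally_integrable setT f,
      locally_integrable setT g &
      forall phi, test_fun Om phi ->
        \int[mu]_(x in dom Om) (f x * derive1 phi x) =
        - \int[mu]_(x in dom Om) (g x * phi x)].

(* Weak derivatives are unique a.e.; the junk value 0 is taken when there is
   none. *)
Definition weak_derive Om f : R -> R :=
  xget (cst 0) [set g | is_weak_derive Om f g].

(* The Sobolev space W^{1,p}(Om); H^1 is the case p = 2. *)
Definition W1 Om p f : Prop :=
  [/\ f \in Lfun (mu_dom Om) p, exists g, is_weak_derive Om f g &
      weak_derive Om f \in Lfun (mu_dom Om) p].

(* The extended norm ||f||_p + ||f_x||_p, infinite outside W^{1,p}(Om). *)
Definition W1norm Om p f : \bar R :=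
  if `[< W1 Om p f >] then
    ('N[mu_dom Om]_p[EFin \o f] +
     'N[mu_dom Om]_p[EFin \o weak_derive Om f])%E
  else +oo%E.

(* BV is a space of classes of a.e. equal functions, hence the representative
   [g]. On the circle, [g] is periodic and so its variation over [0, 1] is its
   variation over the circle. *)
Definition BV_dom Om f : Prop :=
  f \in Lfun (mu_dom Om) 1%E /\
  exists g, [/\ on_dom Om g, f = g %[ae mu_dom Om] &
    exists M : R, forall a b : R, a <= b -> `[a, b] `<=` dom Om ->
      (total_variation a b g <= M%:E)%E].

Definition C2 f : Prop :=
  [/\ forall x, derivable f x 1, forall x, derivable (derive1 f) x 1 &
      continuous (derive1n 2 f)].

Definition partial_t (phi : R -> R -> R) : R -> R -> R :=
  fun t x => derive1 (fun s => phi s x) t.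
Definition partial_x (phi : R -> R -> R) : R -> R -> R :=
  fun t x => derive1 (phi t) x.

(* [iter_partial s phi] is the iterated partial derivative along the word [s],
   whose letters [true] and [false] stand for d/dt and d/dx. *)
Definition iter_partial (s : seq bool) (phi : R -> R -> R) : R -> R -> R :=
  foldr (fun b psi => if b then partial_t psi else partial_x psi) phi s.

Definition smooth2 (phi : R -> R -> R) : Prop :=
  forall s, let psi := iter_partial s phi in
  [/\ continuous (fun z : R * R => psi z.1 z.2),
      forall t x, derivable (fun r => psi r x) t 1 &
      forall t x, derivable (psi t) x 1].

(* C_c^oo(Om x [0, oo[) consists of the restrictions to nonnegative times of
   the elements of C_c^oo(Om x R); the latter are considered here, and only
   their values at nonnegative times are used. *)
Definition test_fun2 Om (phi : R -> R -> R) : Prop :=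
  [/\ smooth2 phi, forall t, on_dom Om (phi t) &
      exists M, forall t x,
        M < `|t| \/ (Om = Line /\ M < `|x|) -> phi t x = 0].

(* Membership in L^oo(Om x ]0, oo[) (the first three clauses) and in
   L^oo(0, oo; H^1(Om)). Since H^1(Om) is separable, strong measurability in
   time amounts to joint measurability of w. On the circle the clauses are
   equivalent to membership in L^oo(0, oo; H^1(Om)), since there boundedness
   of w bounds its L^2 norm uniformly in time. On the line the L^2 norm of w
   itself is only required to be bounded on bounded time intervals, while that
   of w_x is bounded uniformly in time. A bound for w that is uniform in time
   would be too strong: if B(1) = 0, B > 0 on [0, 1[, and w_0 has compact
   support, takes its values in [0, 1] and is equal to 1 on an interval, then
   the limits of the explicit scheme remain equal to 1 on that interval and
   have unbounded L^2 norm in time. *)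
Definition bounded_H1 Om (w : R -> R -> R) : Prop :=
  [/\ forall t, 0 <= t -> on_dom Om (w t),
      measurable_fun ((`]0, +oo[%classic : set mR) `*` [set: mR])
        (fun z : mR * mR => w z.1 z.2),
      finite_norm (mu_spacetime `]0, +oo[ Om) +oo%E
        (fun z : mR * mR => w z.1 z.2),
      forall T : R, ('N[mu_time `]0%R, T[]_+oo [W1norm Om 2%:E \o w] < +oo)%E &
      ('N[mu_time `]0%R, +oo[]_+oo
         [(fun t => 'N[mu_dom Om]_2%:E[EFin \o weak_derive Om (w t)])] < +oo)%E].

Definition weak_solution Om (B w0 : R -> R) (w : R -> R -> R) : Prop :=
  bounded_H1 Om w /\
  forall phi, test_fun2 Om phi ->
    \int[mu]_(t in `[0, +oo[) \int[mu]_(x in dom Om)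
      (let wx := weak_derive Om (w t) in
       w t x * partial_t phi t x - B (w t x) * wx x * partial_x phi t x
       - derive1 B (w t x) * wx x ^+ 2 * phi t x)
    + \int[mu]_(x in dom Om) (w0 x * phi 0 x) = 0.

(* For theta = 1 the bound 1 / (2 (1 - theta)) is infinite. *)
Definition admissible Om (theta dx dt : R) : Prop :=
  [/\ 0 < dx, 0 < dt,
      theta < 1 -> dt / dx ^+ 2 < (2 * (1 - theta))^-1 &
      match Om with
      | Line => True
      | Circle => exists2 N : nat, (0 < N)%N & dx = N%:R^-1
      end].

Definition grid_fun Om (dx : R) (a : int -> R) : Prop :=
  match Om with
  | Line => summable [set: int] (EFin \o a)
  | Circle => forall N : nat, dx = N%:R^-1 -> forall j, a (j + N%:Z) = a j
  end.

Definition Dplus (dx : R) (a : int -> R) : int -> R :=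
  fun j => (a (j + 1) - a j) / dx.
Definition Dminus (dx : R) (a : int -> R) : int -> R :=
  fun j => (a j - a (j - 1)) / dx.
Definition Dtplus (dt : R) (w : nat -> int -> R) : nat -> int -> R :=
  fun n j => (w n.+1 j - w n j) / dt.
Definition theta_mean (theta : R) (w : nat -> int -> R) : nat -> int -> R :=
  fun n j => theta * w n.+1 j + (1 - theta) * w n j.

Definition scheme_solution Om (theta : R) (B w0 : R -> R) (dx dt : R)
    (w : nat -> int -> R) : Prop :=
  [/\ forall n, grid_fun Om dx (w n),
      forall j : int, w 0%N j =
        dx^-1 * \int[mu]_(x in `[(j%:~R - 2^-1) * dx, (j%:~R + 2^-1) * dx]) w0 x &
      forall n j, Dtplus dt w n j =
        B (theta_mean theta w n j) *
        Dplus dx (Dminus dx (theta_mean theta w n)) j].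

(* For t >= 0 and x: n and j are such that t^n <= t < t^{n+1} and
   x_j <= x < x_{j+1}. *)
Definition interpolation (dx dt : R) (w : nat -> int -> R) : R -> R -> R :=
  fun t x =>
    let n := Num.truncn (t / dt) in
    let j := Num.floor (x / dx) in
    ((j + 1)%:~R * dx - x) / dx * w n j + (x - j%:~R * dx) / dx * w n (j + 1).

Definition continuous_W11 Om (w : R -> R -> R) : Prop :=
  forall t, 0 <= t -> W1 Om 1%E (w t) /\
    W1norm Om 1%E (w s \- w t) @[s --> within `[0, +oo[ (nbhs t)] --> 0%E.

Definition cvg_W11 Om (u : nat -> R -> R -> R) (w : R -> R -> R) : Prop :=
  continuous_W11 Om w /\
  forall T, 0 < T ->
    ereal_sup [set W1norm Om 1%E (u k t \- w t) | t in `[0, T]]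
      @[k --> \oo] --> 0%E.

End definitions.

(* Main.v *)
Require Import Defs.
From HB Require Import structures.
From mathcomp Require Import all_boot all_order all_algebra.
From mathcomp Require Import all_classical all_reals all_analysis.
From mathcomp Require Import measurable_realfun ess_sup_inf.
From mathcomp Require Import ring lra.
Set Implicit Arguments.
Unset Strict Implicit.
Unset Printing Implicit Defensive.
Import Order.TTheory GRing.Theory Num.Theory.
Import numFieldNormedType.Exports.
Local Open Scope classical_set_scope.
Local Open Scope ring_scope.

(** Let [d_j = w_(j+1) - 2 w_j + w_(j-1)] be the second difference of the
    numerical solution. The equation in nondivergence form gives, after one
    more second difference, the conservative relation
    [d^(n+1) - d^n = lam (Y_(j+1) - 2 Y_j + Y_(j-1))] with
    [Y = B(w^(n+theta)) d^(n+theta)] and [lam = dt / dx^2]. Under the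
    CFL condition its explicit part has nonnegative coefficients, hence the l^1
    norm of [d] does not increase in time ([step_estimate], [d_bound]).
    Initially it is [O(dx)], because the derivative of the datum has bounded
    variation ([BV_shift], [d0_weight]). Thus the discrete second derivative is
    bounded in L^1, uniformly in the mesh and in time. Together with the maximum
    principle ([sup_estimate]) this bounds the slopes ([grad_bound]), their L^1
    modulus of continuity in space ([p_shift]), their L^2 norm ([energy_bound])
    and, through the scheme, the L^1 speed in time ([u_time]). On the line, the
    same contraction with the weight [x^2 / (r^2 + x^2)] shows that the mass far
    from the origin is uniformly small ([uniform_far]). All these facts about
    one run of the scheme are collected in the record [run].

    Compactness follows. The interpolations are bounded, equi-Lipschitz in
    space and almost Lipschitz in time with values in L^1, so that along an
    ultrafilter they are uniformly Cauchy in L^1 on bounded time intervals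
    ([U_Y]). The inequality [AC_interpolation], which compares a derivative with
    its averages, upgrades this to the slopes ([U_W]); a rapidly convergent
    subsequence then has a limit [v] with derivative [q] ([compactness]).
    Because the slopes converge strongly in L^1 and are uniformly bounded, their
    squares converge as well, which is what the quadratic term [B'(w) w_x^2] of
    the weak formulation requires: multiplied by a test function and summed by
    parts, each step of the scheme is the limit equation up to a small error
    ([weak_step], [step_consistency]), and adding up the steps gives the weak
    formulation ([weak_sum], [weak_form]).

    Two devices keep both domains and all grids within one framework. A grid
    function is regarded as a step function on the line ([st]), periodic on the
    circle; sums become integrals over the domain, and summation by parts
    becomes the invariance of these integrals under translations ([I_shift]).
    An element of W^(1,1) is regarded as a pair of functions related by the
    fundamental theorem of calculus ([AC]), which [weak_derive_AC] and
    [is_weak_derive_AC] relate to weak derivatives. *)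

(** * Integrals over intervals and over the domain *)

Section Integration.
Context {R : realType}.
Local Notation mu := (@lebesgue_measure R).
Local Notation mR := (measurableTypeR R).
Implicit Types (Om : domain) (f g h : R -> R) (D : set R).

Definition ii (a b : R) f : R := \int[mu]_(x in `[a, b]) f x.

Definition LI f := measurable_fun (setT : set mR) f /\
  forall a b : R, mu.-integrable `[a, b] (EFin \o f).

Lemma measurable_shift (c : R) : measurable_fun (setT : set mR)
  (fun x : R => x + c).
Proof. by apply: measurable_funD => //; exact: measurable_id. Qed.

Lemma pushforward_shift (c : R) (A : set R) : measurable A ->
  pushforward mu (fun x : mR => (x + c : mR)) A = mu A.
Proof.
move=> mA; have mf : @measurable_fun _ _ mR mR setT (fun x : mR => (x + c : mR))
  := measurable_shift c.
pose f' : {mfun mR >-> mR} := HB.pack (fun x : mR => (x + c : mR))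
  (@isMeasurableFun.Build _ _ mR mR _ mf).
apply/esym/(@lebesgue_measure_unique R (pushforward mu f')) => //= _ [[a b]] _ <-.
rewrite /pushforward/=.
have -> : (fun x : R => x + c) @^-1` `]a, b] = `]a - c, b - c]%classic.
  by apply/seteqP; split=> x /=; rewrite !in_itv/= ltrBlDr lerBrDr.
rewrite !lebesgue_measure_itv/= !lte_fin ltrD2r.
by case: ifP => // _; rewrite -EFinB; congr EFin; ring.
Qed.

Lemma ge0_integral_shift (c : R) (D : set R) (F : R -> \bar R) : measurable D ->
  measurable_fun (setT : set mR) F -> (forall x, 0 <= F x)%E ->
  (\int[mu]_(x in [set x | D (x + c)%R]) F (x + c)%R = \int[mu]_(x in D) F x)%E.
Proof.
move=> mD mF F0.
have mf : @measurable_fun _ _ mR mR setT (fun x : mR => (x + c : mR))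
  := measurable_shift c.
pose f' : {mfun mR >-> mR} := HB.pack (fun x : mR => (x + c : mR))
  (@isMeasurableFun.Build _ _ mR mR _ mf).
have := @ge0_integral_pushforward _ _ mR mR R f' mf mu D F mD (measurable_funTS mF).
move=> <-//.
by apply: eq_measure_integral => A mA _; exact: pushforward_shift.
Qed.

Lemma measurable_preshift (c : R) (D : set R) : measurable D ->
  measurable ([set x | D (x + c)] : set mR).
Proof. by move=> mD; have := measurable_shift c measurableT mD; rewrite setTI. Qed.

Lemma integrable_shift (c : R) (D : set R) f : measurable D ->
  measurable_fun (setT : set mR) f -> mu.-integrable D (EFin \o f) ->
  mu.-integrable [set x | D (x + c)] (EFin \o (fun x => f (x + c))).
Proof.
move=> mD mf /integrableP[_ fi]; apply/integrableP; split.
  apply/measurable_EFinP/measurable_funTS.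
  exact: (measurableT_comp mf (measurable_shift c)).
rewrite (@ge0_integral_shift c D (fun x => `|(f x)%:E|)%E)//.
by apply: measurableT_comp => //; exact/measurable_EFinP.
Qed.

Lemma Rintegral_shift (c : R) (D : set R) f : measurable D ->
  measurable_fun (setT : set mR) f ->
  \int[mu]_(x in [set x | D (x + c)%R]) f (x + c)%R = \int[mu]_(x in D) f x.
Proof.
move=> mD mf; rewrite /Rintegral; congr fine.
have mE : measurable_fun (setT : set mR) (EFin \o f) by exact/measurable_EFinP.
rewrite integralE [RHS]integralE; congr (_ - _)%E.
- rewrite -[RHS](ge0_integral_shift c mD (measurable_funepos mE));
    last by move=> x; exact: funepos_ge0.
  by apply: eq_integral => x _; rewrite !funeposE.
- rewrite -[RHS](ge0_integral_shift c mD (measurable_funeneg mE));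
    last by move=> x; exact: funeneg_ge0.
  by apply: eq_integral => x _; rewrite !funenegE.
Qed.

Lemma itv_shift (a b c : R) : [set x : R | `[a, b]%classic (x + c)] = `[a - c,
  b - c]%classic.
Proof. by apply/seteqP; split=> x /=; rewrite !in_itv/= lerBlDr lerBrDr. Qed.

Lemma ii_shift (a b c : R) f : measurable_fun (setT : set mR) f ->
  ii a b (fun x => f (x + c)) = ii (a + c) (b + c) f.
Proof.
move=> mf; rewrite /ii -(@Rintegral_shift c `[a + c, b + c])//.
by rewrite itv_shift !addrK.
Qed.

Lemma LI_shift f (c : R) : LI f -> LI (fun x => f (x + c)).
Proof.
move=> [mf fi]; split; first exact: (measurableT_comp mf (measurable_shift c)).
move=> a b; have := @integrable_shift c `[a + c, b + c] f.
by rewrite itv_shift !addrK; apply.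
Qed.

Lemma LID f g : LI f -> LI g -> LI (fun x => f x + g x).
Proof.
move=> [mf fi] [mg gi]; split; first exact: measurable_funD.
by move=> a b; exact: (integrableD _ (fi a b) (gi a b)).
Qed.

Lemma LIZ (k : R) f : LI f -> LI (fun x => k * f x).
Proof.
move=> [mf fi]; split; first by apply: measurable_funM.
move=> a b; exact: (@integrableZl _ mR R mu `[a, b]%classic (measurable_itv _)
  k _ (fi a b)).
Qed.

Lemma LIN f : LI f -> LI (fun x => - f x).
Proof.
move=> /(LIZ (-1)); congr LI; apply/funext => x; rewrite mulN1r//.
Qed.

Lemma LIB f g : LI f -> LI g -> LI (fun x => f x - g x).
Proof. by move=> hf hg; apply: LID => //; exact: LIN. Qed.

Lemma LI_norm f : LI f -> LI (fun x => `|f x|).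
Proof.
move=> [mf fi]; split; first exact: measurableT_comp.
by move=> a b; exact: integrable_norm.
Qed.

Lemma LI_le f g : measurable_fun (setT : set mR) f -> LI g ->
  (forall x, `|f x| <= g x) -> LI f.
Proof.
move=> mf [mg gi] fg; split => // a b.
apply: le_integrable (gi a b) => //; first exact/measurable_EFinP/measurable_funTS.
by move=> x _ /=; rewrite lee_fin (le_trans (fg x))// ler_norm.
Qed.

Lemma LI_cst (c : R) : LI (fun=> c).
Proof.
split=> // a b.
apply/integrableP; split; first exact: measurable_cst.
rewrite integral_cst//= lebesgue_measure_itv/=.
by case: ifP => _; rewrite ?mule0 -?EFinB -?EFinM ltry.
Qed.

Lemma LI_bounded f (M : R) : measurable_fun (setT : set mR) f ->
  (forall x, `|f x| <= M) -> LI f.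
Proof. by move=> mf fM; apply: (LI_le mf (LI_cst M)). Qed.

Lemma LI_M f g (M : R) : LI f -> measurable_fun (setT : set mR) g ->
  (forall x, `|g x| <= M) -> LI (fun x => f x * g x).
Proof.
move=> fi mg gM; apply: (@LI_le _ (fun x => M * `|f x|)).
- by apply: measurable_funM => //; case: fi.
- exact/LIZ/LI_norm.
- by move=> x; rewrite normrM mulrC ler_wpM2r.
Qed.

Lemma iiD a b f g : LI f -> LI g -> ii a b (fun x => f x + g x)
  = ii a b f + ii a b g.
Proof. by move=> [mf fi] [mg gi]; exact: RintegralD. Qed.

Lemma iiB a b f g : LI f -> LI g -> ii a b (fun x => f x - g x)
  = ii a b f - ii a b g.
Proof. by move=> [mf fi] [mg gi]; exact: RintegralB. Qed.

Lemma iiZ a b k f : LI f -> ii a b (fun x => k * f x) = k * ii a b f.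
Proof. by move=> [mf fi]; exact: RintegralZl. Qed.

Lemma ii_cst a b k : a <= b -> ii a b (fun=> k) = k * (b - a).
Proof.
move=> ab; rewrite /ii Rintegral_cst//= lebesgue_measure_itv/= lte_fin.
have [_ //|ba] := ltP a b; have -> : b = a by apply/le_anti; rewrite ab ba.
by rewrite subrr.
Qed.

Lemma le_ii a b f g : LI f -> LI g -> (forall x, a <= x <= b -> f x <= g x) ->
  ii a b f <= ii a b g.
Proof. by move=> [mf fi] [mg gi] fg; apply: le_Rintegral => // x;
  rewrite /= in_itv. Qed.

Lemma ii_ge0 a b f : (forall x, a <= x <= b -> 0 <= f x) -> 0 <= ii a b f.
Proof. by move=> fg; apply: Rintegral_ge0 => // x; rewrite /= in_itv;
  exact: fg. Qed.

Lemma ii_norm a b f : LI f -> `|ii a b f| <= ii a b (fun x => `|f x|).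
Proof. by move=> [mf fi]; apply: le_normr_Rintegral. Qed.

Lemma ii_le_norm a b f g : LI f -> LI g -> (forall x, a <= x <= b ->
  `|f x| <= g x) ->
  `|ii a b f| <= ii a b g.
Proof. by move=> hf hg fg; rewrite (le_trans (ii_norm _ _ hf))//;
  apply: le_ii => //; exact: LI_norm. Qed.

Lemma ii_bound a b f (M : R) : a <= b -> LI f -> (forall x, a <= x <= b ->
  `|f x| <= M) ->
  `|ii a b f| <= M * (b - a).
Proof. by move=> ab hf fM; rewrite -(ii_cst _ ab); apply: ii_le_norm => //;
  exact: LI_cst. Qed.

Lemma eq_ii a b f g : (forall x, a <= x <= b -> f x = g x) -> ii a b f = ii a b g.
Proof. by move=> fg; apply: eq_Rintegral => x; rewrite inE/= in_itv; exact: fg. Qed.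

Lemma ii_split a c b f : LI f -> a <= c -> c <= b -> ii a b f = ii a c f + ii c b f.
Proof.
move=> [mf fi] ac cb.
have := @Rintegral_itvB R f (BLeft a) (BRight b) c (fi a b).
rewrite !bnd_simp => /(_ ac cb) H.
have {}H : ii a b f - ii a c f = \int[mu]_(x in `]c, b]) f x by exact: H.
have E : ii c b f = \int[mu]_(x in `]c, b]) f x.
  rewrite /ii Rintegral_itv_obnd_cbnd//.
  by apply: integrableS (fi c b) => //; apply: subset_itvr; rewrite bnd_simp.
by rewrite E -H addrC subrK.
Qed.

Lemma eq_ii_oo a b f g : LI f -> LI g -> (forall x, a < x < b -> f x = g x) ->
  ii a b f = ii a b g.
Proof.
move=> [mf fi] [mg gi] fg; rewrite /ii /Rintegral; congr fine.
have H F : mu.-integrable `[a, b] (EFin \o F) -> (\int[mu]_(x in `[a,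
  b]) (F x)%:E = \int[mu]_(x in `]a, b[) (F x)%:E)%E.
  move=> Fi; rewrite integral_itv_bndoo//.
  by apply: measurable_funS (measurable_int _ Fi) => //; apply: subset_itv;
    rewrite bnd_simp.
rewrite (H _ (fi a b)) (H _ (gi a b)).
by apply: eq_integral => x; rewrite inE/= in_itv/= => /fg ->.
Qed.

Definition Int Om f : R := \int[mu]_(x in dom Om) f x.

(** Measurability is required on the whole line, and periodicity on the
    circle, so that integrals over the domain are invariant under all
    translations. *)
Definition L1 Om f := [/\ on_dom Om f, measurable_fun (setT : set mR) f &
  mu.-integrable (dom Om) (EFin \o f)].

Lemma on_dom_comp Om (F : R -> R) f : on_dom Om f -> on_dom Om (fun x => F (f x)).
Proof. by case: Om => //= h x; rewrite h. Qed.

Lemma on_dom_comp2 Om (F : R -> R -> R) f g : on_dom Om f -> on_dom Om g ->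
  on_dom Om (fun x => F (f x) (g x)).
Proof. by case: Om => //= hf hg x; rewrite hf hg. Qed.

Lemma on_dom_shift Om f c : on_dom Om f -> on_dom Om (fun x => f (x + c)).
Proof. by case: Om => //= hf x; rewrite addrAC hf. Qed.

Lemma periodic_nat f (n : nat) : (forall x, f (x + 1) = f x) ->
  forall x, f (x + n%:R) = f x.
Proof.
move=> hf; elim: n => [|n IH] x; first by rewrite addr0.
by rewrite -natr1 addrA hf IH.
Qed.

Lemma periodic_int f (n : int) : (forall x, f (x + 1) = f x) ->
  forall x, f (x + n%:~R) = f x.
Proof.
move=> hf x; case: n => n; first exact: periodic_nat.
by rewrite NegzE mulrNz -[LHS](periodic_nat n.+1 hf) subrK.
Qed.

Lemma integrable_setU (A B : set R) f : measurable A -> measurable B ->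
  measurable_fun (setT : set mR) f ->
  mu.-integrable A (EFin \o f) -> mu.-integrable B (EFin \o f) ->
  mu.-integrable (A `|` B) (EFin \o f).
Proof.
move=> mA mB mf fA fB.
have mE D : measurable_fun (D : set mR) (EFin \o f)
  by exact/measurable_EFinP/measurable_funTS.
apply/integrableP; split; first exact: mE.
have mD : measurable (A `\` B) by exact: measurableD.
have -> : A `|` B = (A `\` B) `|` B.
  by apply/seteqP; split=> x /=; case: (pselect (B x)); tauto.
rewrite ge0_integral_setU//.
- apply: lte_add_pinfty; last by case/integrableP: fB.
  case/integrableP: fA => _; apply: le_lt_trans.
  by apply: ge0_subset_integral => //; exact: measurableT_comp.
- by apply: measurableT_comp => //.
- by rewrite disj_set2E setDE -setIA setICl setI0.
Qed.

Lemma L1_LI Om f : L1 Om f -> LI f.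
Proof.
case: Om => /= -[hf mf fi]; split => // a b.
  exact: (integrableS measurableT _ (@subsetT _ _) fi).
have fn (n : int) : mu.-integrable `[n%:~R, n%:~R + 1] (EFin \o f).
  have := @integrable_shift (- n%:~R) `[0, 1]%classic f (measurable_itv _) mf fi.
  rewrite itv_shift !opprK add0r (addrC 1); apply: eq_integrable => // x _ /=.
  by rewrite -mulrNz periodic_int.
have fN (m : int) (n : nat) : mu.-integrable `[m%:~R, (m + n%:Z)%:~R + 1]
  (EFin \o f).
  elim: n => [|n IH]; first by rewrite addr0.
  rewrite (_ : `[_, _]%classic = `[m%:~R, (m + n%:Z)%:~R + 1]
    `|` `[(m + n.+1%:Z)%:~R, (m + n.+1%:Z)%:~R + 1]).
    by apply: integrable_setU => //; exact: fn.
  have E : (m + n.+1%:Z)%:~R = (m + n%:Z)%:~R + 1 :> R.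
    by rewrite -[n.+1]addn1 PoszD addrA !intrD.
  apply/seteqP; split => x /=; rewrite !in_itv/= E.
    move=> /andP[h1 h2]; have [h|h] := leP x ((m + n%:Z)%:~R + 1); [left|right].
      by rewrite h1.
    by rewrite (ltW h).
  case=> /andP[h1 h2]; apply/andP; split => //.
  - by rewrite (le_trans h2)// lerDl.
  - by apply: le_trans h1; rewrite intrD -addrA lerDl.
have [ab|ba] := leP a b; last by rewrite set_itv_ge ?bnd_simp -?ltNge//;
  exact: integrable_set0.
apply: integrableS (fN (Num.floor a) `|Num.floor b - Num.floor a|%N) => //.
apply: subset_itv; rewrite bnd_simp; first exact: floor_le.
rewrite gez0_abs ?subr_ge0 ?le_floor// (addrC (Num.floor a)) subrK.
  rewrite -[X in _ + X]/(1%:~R) -intrD.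
exact/ltW/floorD1_gt.
Qed.

Lemma ii_period f c : LI f -> (forall x, f (x + 1) = f x) ->
  ii c (c + 1) f = ii 0 1 f.
Proof.
move=> fL hf; have [mf _] := fL.
pose m := Num.floor c; pose r := c - m%:~R.
have r0 : 0 <= r by rewrite subr_ge0 floor_le.
have r1 : r <= 1 by rewrite lerBlDl -[X in _ + X]/(1%:~R) -intrD;
  exact/ltW/floorD1_gt.
have -> : ii c (c + 1) f = ii r (r + 1) f.
  have := @ii_shift r (r + 1) m%:~R f mf.
  rewrite (addrAC r 1) /r !subrK => <-.
  by apply: eq_ii => x _; rewrite periodic_int.
rewrite (@ii_split r 1)//; last by rewrite lerDr.
rewrite [RHS](@ii_split 0 r)// addrC; congr (_ + _).
have := @ii_shift 0 r 1 f mf; rewrite add0r => <-.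
by apply: eq_ii => x _; rewrite hf.
Qed.

Lemma L1_shift Om f c : L1 Om f -> L1 Om (fun x => f (x + c)).
Proof.
move=> h; have fL := L1_LI h; case: h => hf mf fi; split.
- exact: on_dom_shift.
- exact: (measurableT_comp mf (measurable_shift c)).
- case: Om hf fi => /= hf fi; last by case: (LI_shift c fL).
  have := @integrable_shift c setT f measurableT mf fi.
  by rewrite (_ : [set x | setT (x + c)] = setT)//; apply/seteqP.
Qed.

(** On the circle, the integral over a period does not depend on where the
    period starts. Every summation by parts below is an instance of this
    lemma. *)
Lemma I_shift Om f c : L1 Om f -> Int Om (fun x => f (x + c)) = Int Om f.
Proof.
move=> h; have fL := L1_LI h; case: h => hf mf fi.
case: Om hf fi => /= hf fi; rewrite /Int /=.
  by rewrite -[RHS](@Rintegral_shift c setT f).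
have := @ii_shift 0 1 c f mf; rewrite /ii => ->; rewrite add0r addrC.
exact: ii_period.
Qed.

Lemma L1D Om f g : L1 Om f -> L1 Om g -> L1 Om (fun x => f x + g x).
Proof.
move=> [of_ mf fi] [og mg gi]; split.
- exact: on_dom_comp2.
- exact: measurable_funD.
- exact: (integrableD (measurable_dom Om) fi gi).
Qed.

Lemma L1Z Om k f : L1 Om f -> L1 Om (fun x => k * f x).
Proof.
move=> [of_ mf fi]; split.
- exact: on_dom_comp.
- by apply: measurable_funM.
- exact: (@integrableZl _ mR R mu _ (measurable_dom Om) k _ fi).
Qed.

Lemma L1N Om f : L1 Om f -> L1 Om (fun x => - f x).
Proof. by move=> /(L1Z (-1)); congr L1; apply/funext => x; rewrite mulN1r. Qed.

Lemma L1B Om f g : L1 Om f -> L1 Om g -> L1 Om (fun x => f x - g x).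
Proof. by move=> hf hg; apply: L1D => //; exact: L1N. Qed.

Lemma L1_norm Om f : L1 Om f -> L1 Om (fun x => `|f x|).
Proof.
move=> [of_ mf fi]; split.
- exact: on_dom_comp.
- exact: measurableT_comp.
- exact: integrable_norm.
Qed.

Lemma L1_le Om f g : on_dom Om f -> measurable_fun (setT : set mR) f -> L1 Om g ->
  (forall x, `|f x| <= g x) -> L1 Om f.
Proof.
move=> of_ mf [og mg gi] fg; split => //.
apply: le_integrable gi; first exact: measurable_dom.
- exact/measurable_EFinP/measurable_funTS.
- by move=> x _ /=; rewrite lee_fin (le_trans (fg x))// ler_norm.
Qed.

Lemma L1M Om f g (M : R) : L1 Om f -> on_dom Om g ->
  measurable_fun (setT : set mR) g ->
  (forall x, `|g x| <= M) -> L1 Om (fun x => f x * g x).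
Proof.
move=> fi og mg gM; apply: (@L1_le _ _ (fun x => M * `|f x|)).
- by apply: on_dom_comp2 => //; case: fi.
- by apply: measurable_funM => //; case: fi.
- exact/L1Z/L1_norm.
- by move=> x; rewrite normrM mulrC ler_wpM2r.
Qed.

Lemma I_D Om f g : L1 Om f -> L1 Om g -> Int Om (fun x => f x + g x)
  = Int Om f + Int Om g.
Proof. by move=> [_ _ fi] [_ _ gi]; apply: RintegralD => //;
  exact: measurable_dom. Qed.

Lemma I_B Om f g : L1 Om f -> L1 Om g -> Int Om (fun x => f x - g x)
  = Int Om f - Int Om g.
Proof. by move=> [_ _ fi] [_ _ gi]; apply: RintegralB => //;
  exact: measurable_dom. Qed.

Lemma I_Z Om k f : L1 Om f -> Int Om (fun x => k * f x) = k * Int Om f.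
Proof. by move=> [_ _ fi]; apply: RintegralZl => //; exact: measurable_dom. Qed.

Lemma I_0 Om : Int Om (fun=> 0) = 0.
Proof. by rewrite /Int Rintegral_cst ?mul0r//; exact: measurable_dom. Qed.

Lemma le_I Om f g : L1 Om f -> L1 Om g -> (forall x, f x <= g x) ->
  Int Om f <= Int Om g.
Proof. by move=> [_ _ fi] [_ _ gi] fg; apply: le_Rintegral => //;
  exact: measurable_dom. Qed.

Lemma I_ge0 Om f : (forall x, 0 <= f x) -> 0 <= Int Om f.
Proof. by move=> f0; apply: Rintegral_ge0. Qed.

Lemma I_norm Om f : L1 Om f -> `|Int Om f| <= Int Om (fun x => `|f x|).
Proof. by move=> [_ _ fi]; apply: le_normr_Rintegral => //;
  exact: measurable_dom. Qed.

Lemma le_I_norm Om f g : L1 Om f -> L1 Om g -> (forall x, `|f x| <= g x) ->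
  `|Int Om f| <= Int Om g.
Proof. by move=> hf hg fg; rewrite (le_trans (I_norm hf))//; apply: le_I => //;
  exact: L1_norm. Qed.

Lemma eq_I Om f g : (forall x, f x = g x) -> Int Om f = Int Om g.
Proof. by move=> fg; congr Int; apply/funext. Qed.

Lemma I_normD Om f g : L1 Om f -> L1 Om g ->
  Int Om (fun x => `|f x + g x|) <= Int Om (fun x => `|f x|)
    + Int Om (fun x => `|g x|).
Proof.
move=> hf hg; rewrite -I_D; try exact: L1_norm.
apply: le_I; [exact/L1_norm/L1D|by apply: L1D; exact: L1_norm|].
by move=> x; exact: ler_normD.
Qed.

Lemma I_integral Om f : L1 Om f -> (\int[mu]_(x in dom Om)
  (f x)%:E = (Int Om f)%:E)%E.
Proof.
move=> [_ _ fi]; rewrite /Int /Rintegral fineK//.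
exact: (integrable_fin_num (measurable_dom Om) fi).
Qed.

Lemma L1_bounded_integral Om f (K : R) : on_dom Om f ->
  measurable_fun (setT : set mR) f ->
  (\int[mu]_(x in dom Om) `|f x|%:E <= K%:E)%E -> L1 Om f /\
    Int Om (fun x => `|f x|) <= K.
Proof.
move=> of_ mf fK.
have h : L1 Om f.
  split => //; apply/integrableP; split; first
    exact/measurable_EFinP/measurable_funTS.
  exact: le_lt_trans fK (ltry _).
by split => //; rewrite -lee_fin -I_integral//; exact: L1_norm.
Qed.

(** An average of functions inherits their common L^1 bound. Bounds pass in
    this way from a function to its cell averages, and from a derivative to
    the increments of its primitive. *)
Lemma Tonelli Om (F : R -> R -> R) (a b K : R) : a <= b -> 0 <= K ->
  measurable_fun (setT : set (mR * mR)) (fun z => F z.1 z.2) ->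
  (forall s x, 0 <= F s x) ->
  (forall s, on_dom Om (F s)) ->
  (forall s, a <= s <= b -> (\int[mu]_(x in dom Om) (F s x)%:E <= K%:E)%E) ->
  L1 Om (fun x => ii a b (fun s => F s x)) /\
  Int Om (fun x => ii a b (fun s => F s x)) <= K * (b - a).
Proof.
move=> ab K0 mF F0 oF FK.
pose G (z : mR * mR) : \bar R := (F z.1 z.2 * \1_(`[a, b]%classic)
  z.1 * \1_(dom Om) z.2)%:E.
have mG : measurable_fun (setT : set (mR * mR)) G.
  apply/measurable_EFinP; apply: measurable_funM;
    first apply: measurable_funM => //.
    by apply: (measurableT_comp (f := \1_(`[a, b]%classic) : mR -> R)).
  apply: (measurableT_comp (f := \1_(dom Om) : mR -> R)) => //.
  by apply: measurable_indic; exact: measurable_dom.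
have G0 z : (0 <= G z)%E by rewrite lee_fin !mulr_ge0.
have E x : (\int[mu]_s G (s, x) = (\int[mu]_(s in `[a, b]) (F s x)%:E)
  * (\1_(dom Om) x)%:E)%E.
  rewrite [in RHS]integral_mkcond/= -ge0_integralZr//; last 2 first.
  - apply/(measurable_restrictT _ _).1 => //.
    apply/measurable_EFinP/measurable_funTS.
    exact: (measurableT_comp mF (pair2_measurable x)).
  - by move=> s _; apply: erestrict_ge0 => // r _; rewrite lee_fin.
  apply: eq_integral => s _; rewrite /G/= patchE indicE.
  by case: ifP => _; rewrite ?mulr1 ?mulr0 ?mul0r ?mul0e ?EFinM.
have E2 s : (\int[mu]_x G (s, x) = (\int[mu]_(x in dom Om) (F s x)%:E)
  * (\1_(`[a, b]%classic) s)%:E)%E.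
  rewrite [in RHS]integral_mkcond/= -ge0_integralZr//; last 2 first.
  - apply/(measurable_restrictT _ _).1; first exact: measurable_dom.
    apply/measurable_EFinP/measurable_funTS.
    exact: (measurableT_comp mF (pair1_measurable s)).
  - by move=> x _; apply: erestrict_ge0 => // r _; rewrite lee_fin.
  apply: eq_integral => x _; rewrite /G/= patchE !indicE.
  by case: (x \in dom Om); rewrite ?mulr1 ?mulr0 ?mul0r ?mul0e ?EFinM.
have mi : measurable_fun (setT : set mR) (fun x => ii a b (fun s => F s x)).
  pose H (z : mR * mR) : \bar R := (F z.1 z.2 * \1_(`[a, b]%classic) z.1)%:E.
  have mH : measurable_fun (setT : set (mR * mR)) H.
    apply/measurable_EFinP; apply: measurable_funM => //.
    by apply: (measurableT_comp (f := \1_(`[a, b]%classic) : mR -> R)).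
  have := @measurable_fun_fubini_tonelli_G _ _ mR mR R mu H mH.
  move=> /(_ (fun z => _)) mG'.
  have {}mG' : measurable_fun (setT : set mR) (fubini_G mu H).
    by apply: mG' => z; rewrite lee_fin mulr_ge0.
  have -> : (fun x => ii a b (fun s => F s x)) = fine \o fubini_G mu H.
    apply/funext => x; rewrite /ii /Rintegral /=; congr fine.
    rewrite integral_mkcond/=; apply: eq_integral => s _;
      rewrite patchE /H/= indicE.
    by case: ifP => _; rewrite ?mulr1 ?mulr0.
  exact: measurableT_comp (fine_measurable measurableT) mG'.
have i0 x : 0 <= ii a b (fun s => F s x) by apply: ii_ge0.
have [] := @L1_bounded_integral Om (fun x => ii a b (fun s => F s x))
  (K * (b - a)) => //.
- by case: Om oF {FK G mG G0 E E2 mi} => //= oF x; apply: eq_ii => s _; rewrite oF.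
- apply: (@le_trans _ _ (\int[mu]_x \int[mu]_s G (s, x))%E).
    rewrite integral_mkcond; apply: ge0_le_integral => //.
    + by move=> x _; apply: erestrict_ge0 => r _; rewrite lee_fin.
    + apply/(measurable_restrictT _ _).1; first exact: measurable_dom.
      by apply/measurable_EFinP/measurable_funTS; apply: measurableT_comp.
    + exact: measurable_fun_fubini_tonelli_G.
    + move=> x _; rewrite E patchE indicE; case: ifP => _; rewrite ?mule0// mule1.
      rewrite ger0_norm// /ii /Rintegral.
      have : (0 <= \int[mu]_(s in `[a, b]) (F s x)%:E)%E by apply: integral_ge0
        => s _; rewrite lee_fin.
      by case: (integral _ _ _) => //= r _; rewrite leey.
  rewrite -(fubini_tonelli (m1 := mu) (m2 := mu) _ mG G0).
  apply: (@le_trans _ _ (\int[mu]_(s in `[a, b]) K%:E)%E).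
    rewrite [leRHS]integral_mkcond; apply: ge0_le_integral => //.
    + by move=> x _; apply: integral_ge0.
    + exact: measurable_fun_fubini_tonelli_F.
    + exact/(measurable_restrictT _ _).1.
    + move=> s _; rewrite E2 patchE indicE; case: ifP => [|_];
      rewrite ?mule0// mule1.
      by rewrite inE/= in_itv/= => /FK.
  rewrite integral_cst//= lebesgue_measure_itv/= lte_fin -EFinB.
  have [_|ba] := ltP a b; first by rewrite lee_fin.
  by rewrite mule0 lee_fin mulr_ge0// subr_ge0.
- move=> h1 h2; split => //; apply: le_trans h2; apply: le_I => //.
    exact: L1_norm.
  by move=> x; rewrite ler_norm.
Qed.

Lemma ae_imp (P Q : R -> Prop) : (forall x, P x -> Q x) ->
  {ae mu, forall x, P x} -> {ae mu, forall x, Q x}.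
Proof.
by move=> PQ; apply: filterS => //; exact: (ae_filter_ringOfSetsType mu).
Qed.

Lemma ae_and (P Q : R -> Prop) : {ae mu, forall x, P x} -> {ae mu, forall x, Q x} ->
  {ae mu, forall x, P x /\ Q x}.
Proof.
by move=> hP hQ; apply: (@filterS2 _ _ (ae_filter_ringOfSetsType mu)
  P Q _ _ hP hQ) => x.
Qed.

End Integration.

(** * Smooth functions and bumps *)

Section Smooth.
Context {R : realType}.
Local Notation mu := (@lebesgue_measure R).
Local Notation mR := (measurableTypeR R).
Implicit Types (f g df phi : R -> R) (x : R).

Lemma is_derive_derive1 f (x : R) : derivable f x 1 ->
  is_derive x 1 f (derive1 f x).
Proof. by move=> h; rewrite derive1E; exact: derivableP. Qed.

Lemma is_derive_derive1E f (x d : R) : is_derive x 1 f d ->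
  derivable f x 1 /\ derive1 f x = d.
Proof. by move=> [h1 h2]; split => //; rewrite derive1E. Qed.

Lemma derive1_ext f df : (forall x : R, is_derive x 1 f (df x)) ->
  (forall x : R, derivable f x 1) /\ derive1 f = df.
Proof. by move=> h; split => [x|]; [|apply/funext => x];
  have [] := is_derive_derive1E (h x). Qed.

(** Finite orders of smoothness allow the closure properties to be proved by
    induction on the order. *)
Definition smoothn (n : nat) f := forall m (x : R), (m < n)%N ->
  derivable (derive1n m f) x 1.

Lemma smoothE f : smooth f <-> forall n, smoothn n f.
Proof.
by split=> [h n m x _|h n x]; [exact: h|exact: (h n.+1)].
Qed.

Lemma smoothn0 f : smoothn 0 f.
Proof. by move=> m x; rewrite ltn0. Qed.

Lemma smoothnS n f : smoothn n.+1 f <-> (forall x : R, derivable f x 1) /\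
  smoothn n (derive1 f).
Proof.
split=> [h|[h1 h2] [|m] x mn].
  split=> [x|m x mn]; first exact: (h 0%N).
  by rewrite -derive1Sn; exact: h.
- exact: h1.
- by rewrite derive1Sn; exact: h2.
Qed.

Lemma smoothn_le n f : smoothn n.+1 f -> smoothn n f.
Proof. by move=> h m x mn; apply: h; rewrite ltnS ltnW. Qed.

Lemma smooth_derive1 f : smooth f -> smooth (derive1 f).
Proof. by move=> h n x; rewrite -derive1Sn; exact: h. Qed.

Lemma smooth_intro f df : (forall x : R, is_derive x 1 f (df x)) -> smooth df ->
  smooth f.
Proof.
move=> /derive1_ext[h1 h2] sdf; apply/smoothE => -[|n] //.
by apply/smoothnS; rewrite h2; split => //; apply/smoothE: n.
Qed.

Lemma smoothn_intro n f df : (forall x : R, is_derive x 1 f (df x)) ->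
  smoothn n df -> smoothn n.+1 f.
Proof. by move=> /derive1_ext[h1 h2] sdf; apply/smoothnS; rewrite h2. Qed.

Lemma smoothn_is_derive n f : smoothn n.+1 f -> forall x : R,
  is_derive x 1 f (derive1 f x).
Proof. by move=> /smoothnS[h _] x; exact: is_derive_derive1. Qed.

Lemma smoothn_cst n (c : R) : smoothn n (fun=> c).
Proof.
elim: n c => [|n IH] c; first exact: smoothn0.
 apply: (@smoothn_intro _ _ (fun=> 0)) => //.
Qed.

Arguments smoothn_cst : clear implicits.

Lemma smoothnD n f g : smoothn n f -> smoothn n g -> smoothn n (fun x => f x + g x).
Proof.
elim: n f g => [|n IH] f g hf hg; first exact: smoothn0.
refine (@smoothn_intro _ _ (fun x => derive1 f x + derive1 g x) _ _).
  move=> x; have ? := smoothn_is_derive hf x; have ? := smoothn_is_derive hg x.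
  exact: is_deriveD.
by apply: IH; [have /smoothnS[] := hf|have /smoothnS[] := hg].
Qed.

Lemma smoothnM n f g : smoothn n f -> smoothn n g -> smoothn n (fun x => f x * g x).
Proof.
elim: n f g => [|n IH] f g hf hg; first exact: smoothn0.
refine (@smoothn_intro _ _ (fun x => derive1 f x * g x + f x * derive1 g x) _ _).
  move=> x; have h1 := smoothn_is_derive hf x; have h2 := smoothn_is_derive hg x.
  refine (is_derive_eq (is_deriveM h1 h2) _).
  by rewrite /GRing.scale/= addrC (mulrC (g x)).
have [_ hf'] := (smoothnS _ _).1 hf; have [_ hg'] := (smoothnS _ _).1 hg.
refine (smoothnD (IH _ _ hf' (smoothn_le hg)) (IH _ _ (smoothn_le hf) hg')).
Qed.

Lemma smoothnZ n (k : R) f : smoothn n f -> smoothn n (fun x => k * f x).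
Proof. by move=> hf; refine (smoothnM (smoothn_cst _ _) hf). Qed.

Lemma smoothn_affine n f (a b : R) : smoothn n f ->
  smoothn n (fun x => f (a * x + b)).
Proof.
elim: n f => [|n IH] f hf; first exact: smoothn0.
refine (@smoothn_intro _ _ (fun x => a * derive1 f (a * x + b)) _ _).
  move=> x; have h := smoothn_is_derive hf (a * x + b).
  have h2 : is_derive x 1 (fun x => a * x + b) a.
    refine (is_derive_eq (is_deriveD (is_deriveZ a (is_derive_id x 1))
      (is_derive_cst b x 1)) _).
    by rewrite /GRing.scale/= addr0 mulr1.
  refine (is_derive_eq (@is_derive1_comp _ f (fun x => a * x + b) x _ _ h h2) _).
  by rewrite mulrC.
by apply: smoothnZ; apply: IH; have /smoothnS[] := hf.
Qed.

Lemma smoothn_exp n f : smoothn n f -> smoothn n (fun x => expR (f x)).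
Proof.
elim: n f => [|n IH] f hf; first exact: smoothn0.
refine (@smoothn_intro _ _ (fun x => derive1 f x * expR (f x)) _ _).
  move=> x; have h := smoothn_is_derive hf x.
  refine (is_derive_eq (@is_derive1_comp _ expR f x _ _ (is_derive_expR _) h) _).
  by rewrite /= mulrC.
have [_ hf'] := (smoothnS _ _).1 hf.
refine (smoothnM hf' (IH _ (smoothn_le hf))).
Qed.

Lemma smoothD f g : smooth f -> smooth g -> smooth (fun x => f x + g x).
Proof. by move=> /smoothE hf /smoothE hg; apply/smoothE => n; exact: smoothnD. Qed.

Lemma smoothM f g : smooth f -> smooth g -> smooth (fun x => f x * g x).
Proof. by move=> /smoothE hf /smoothE hg; apply/smoothE => n; exact: smoothnM. Qed.

Lemma smooth_cst (c : R) : smooth (fun=> c).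
Proof. by apply/smoothE => n; exact: smoothn_cst. Qed.

Arguments smooth_cst : clear implicits.

Lemma smoothZ k f : smooth f -> smooth (fun x => k * f x).
Proof. by move=> /smoothE hf; apply/smoothE => n; exact: smoothnZ. Qed.

Lemma smooth_affine f (a b : R) : smooth f -> smooth (fun x => f (a * x + b)).
Proof. by move=> /smoothE hf; apply/smoothE => n; exact: smoothn_affine. Qed.

Lemma smooth_shift f (b : R) : smooth f -> smooth (fun x => f (x + b)).
Proof. by move=> /(@smooth_affine _ 1 b); congr smooth; apply/funext => x;
  rewrite mul1r. Qed.

Lemma smooth_exp f : smooth f -> smooth (fun x => expR (f x)).
Proof. by move=> /smoothE hf; apply/smoothE => n; exact: smoothn_exp. Qed.

Lemma smooth_continuous f : smooth f -> continuous f.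
Proof.
move=> hf x; apply: differentiable_continuous; apply/derivable1_diffP.
exact: (hf 0%N).
Qed.

Lemma derive1_near f g (x : R) : (\forall y \near x, f y = g y) ->
  (derivable g x 1 -> derivable f x 1) /\ derive1 f x = derive1 g x.
Proof.
move=> fg; split; first by apply: near_eq_derivable => //; near=> z; apply/esym;
  near: z.
by rewrite !derive1E; exact: near_eq_derive.
Unshelve. all: by end_near. Qed.

Lemma derive1n_open f g (U : set R) : open U -> (forall x, U x -> f x = g x) ->
  forall n x, U x -> derive1n n f x = derive1n n g x.
Proof.
move=> oU fg; elim=> [|n IH] x Ux; first exact: fg.
have nr : \forall y \near x, derive1n n f y = derive1n n g y.
  by apply: filterS (open_nbhs_nbhs (conj oU Ux)) => y Uy; exact: IH.
by rewrite !derive1nS; have [_] := derive1_near nr.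
Qed.

Lemma smooth_local f : (forall x, exists U g, [/\ open U, U x, smooth g &
  forall y, U y -> f y = g y]) -> smooth f.
Proof.
move=> h n x; have [U [g [oU Ux sg fg]]] := h x.
have nr : \forall y \near x, derive1n n f y = derive1n n g y.
  by apply: filterS (open_nbhs_nbhs (conj oU Ux)) => y Uy;
    exact: (derive1n_open oU).
by have [+ _] := derive1_near nr; apply; exact: sg.
Qed.

Definition flat (k : nat) (x : R) : R := if 0 < x then x^-1 ^+ k * expR (- x^-1)
  else 0.

Lemma flat_ge0 k x : 0 <= flat k x.
Proof.
by rewrite /flat; case: ifPn => // x0; rewrite mulr_ge0 ?expR_ge0// exprn_ge0//
  invr_ge0 ltW.
Qed.

(** The exponential dominates the term of order [k + 2] of its series.
    Quadratic vanishing at 0 is all that differentiability at 0 needs. *)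
Lemma flat_sq k x : `|flat k x| <= (k.+2)`!%:R * x ^+ 2.
Proof.
rewrite ger0_norm ?flat_ge0// /flat; case: ifPn => [x0|_]; last first.
  by rewrite mulr_ge0// sqr_ge0.
have y0 : 0 < x^-1 by rewrite invr_gt0.
have := expR_ge1Dxn k.+1 (ltW y0) => h.
have {}h : x^-1 ^+ k.+2 / k.+2`!%:R <= expR x^-1 by apply: le_trans h;
  rewrite lerDr.
rewrite expRN ler_pdivrMr ?expR_gt0//.
apply: (@le_trans _ _ (k.+2`!%:R * x ^+ 2 * (x^-1 ^+ k.+2 / k.+2`!%:R)));
  last first.
  by rewrite ler_wpM2l// mulr_ge0// sqr_ge0.
have f0 : (k.+2`!%:R : R) != 0 by rewrite pnatr_eq0 -lt0n fact_gt0.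
have -> : x^-1 ^+ k.+2 = x^-1 ^+ k * x^-1 ^+ 2 by rewrite -exprD addn2.
move: (k.+2`!%:R : R) f0 => c c0.
rewrite [leRHS](_ : _ = x^-1 ^+ k)//; move: (x^-1 ^+ k) => u.
by field; rewrite c0 gt_eqF.
Qed.

Lemma is_derive_sq f (C : R) : (forall x, `|f x| <= C * x ^+ 2) ->
  is_derive (0 : R) 1 f 0.
Proof.
move=> fC.
have f0 : f 0 = 0 by apply/eqP; rewrite -normr_eq0 eq_le normr_ge0 andbT
  (le_trans (fC 0))// expr0n/= mulr0.
have C0 : 0 <= C by have := fC 1; rewrite expr1n mulr1; apply: le_trans.
have H : (fun h : R => h^-1 *: (f (h *: (1:R) + 0) - f 0)) @ 0^' --> (0 : R).
  apply/cvgrPdist_le => e e0; near=> h.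
  rewrite sub0r normrN f0 subr0 addr0 /GRing.scale/= mulr1 normrM normfV.
  have h0 : 0 < `|h| by rewrite normr_gt0; near: h; exact: nbhs_dnbhs_neq.
  rewrite ler_pdivrMl// (le_trans (fC h))//.
  rewrite -[h ^+ 2]real_normK ?num_real// expr2 mulrA [leRHS]mulrC ler_wpM2r//.
  apply: (@le_trans _ _ (C * (e / (C + 1)))); last first.
    by rewrite mulrA ler_pdivrMr ?ltr_wpDl// mulrC (ler_wpM2l (ltW e0))// lerDl.
  rewrite ler_wpM2l//.
  near: h; apply: dnbhs0_le; rewrite divr_gt0// ltr_wpDl//.
by split; [apply/cvg_ex; exists 0|apply/cvg_lim].
Unshelve. all: by end_near. Qed.

(** The family is closed under differentiation, up to linear combinations, so
    that all its members are smooth by one induction on the order. *)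
Lemma is_derive_flat k (x : R) : is_derive x 1 (flat k)
  (flat k.+2 x - k%:R * flat k.+1 x).
Proof.
have [x0|x0|->] := ltgtP x 0.
- rewrite /flat ltNge (ltW x0)/= mulr0 subr0.
  refine (near_eq_is_derive _ (is_derive_cst (0 : R) x 1)).
  by near=> y; rewrite /flat ltNge ltW//=; near: y; exact: lt_nbhsl.
- have H : is_derive x 1 (fun y : R => y^-1 ^+ k * expR (- y^-1))
    (flat k.+2 x - k%:R * flat k.+1 x).
    have xn : x != 0 by rewrite gt_eqF.
    have h1 : is_derive x 1 (fun y : R => y^-1) (- x ^- 2).
      have := @is_deriveV _ id x 1 1 xn (is_derive_id x 1).
      by move=> h; apply: is_derive_eq; rewrite /GRing.scale/= mulr1.
    have h2 : is_derive x 1 (fun y : R => - y^-1) (x ^- 2).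
      by have := is_deriveN h1; rewrite opprK.
    have h3 : is_derive x 1 (expR \o (fun y : R => - y^-1)) (expR (- x^-1)
      * x ^- 2).
      exact: is_derive1_comp.
    have h4 : is_derive x 1 (fun y : R => y^-1 ^+ k) ((k%:R * x^-1 ^+ k.-1)
      *: - x ^- 2).
      have := is_deriveX k h1; congr (is_derive _ _ _ _).
      by apply/funext => y; elim: (k) => // m IH; rewrite !exprS -IH.
    refine (is_derive_eq (is_deriveM h4 h3) _).
    rewrite /GRing.scale/= /flat x0.
    case: k {h4} => [|k]; rewrite ?expr0 ?mul0r ?mulr0 ?addr0 ?subr0 ?mul1r
      -?exprVn; first by rewrite exprVn; ring.
    by rewrite /= [x^-1 ^+ k.+3]exprS [x^-1 ^+ k.+2]exprS [x^-1 ^+ k.+1]exprS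
      expr2; ring.
  apply: (near_eq_is_derive _ H).
  by near=> y; rewrite /flat ifT//; near: y; exact: lt_nbhsr.
- by rewrite /flat ltxx mulr0 subr0; exact: is_derive_sq (@flat_sq k).
Unshelve. all: by end_near. Qed.

Lemma smooth_flat k : smooth (flat k).
Proof.
apply/smoothE => n; elim: n k => [//|n IH] k.
apply: smoothn_intro; first by move=> x; exact: is_derive_flat.
apply: smoothnD; first exact: IH.
have -> : (fun x => - (k%:R * flat k.+1 x)) = (fun x => - k%:R * flat k.+1 x).
  by apply/funext => x; rewrite mulNr.
exact/smoothnZ/IH.
Qed.

Arguments smooth_flat : clear implicits.

(** Smooth functions supported in [[a, b]] that increase to the indicator of
    the open interval as [n] grows. *)
Definition bump (a b : R) (n : nat) (x : R) : R :=
  1 - expR (- (n%:R * (flat 0 (x - a) * flat 0 (b - x)))).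

Lemma smooth_bump a b n : smooth (bump a b n).
Proof.
have s1 := @smooth_shift _ (- a) (smooth_flat 0).
have s2 : smooth (fun x => flat 0 (b - x)).
  have := @smooth_affine _ (-1) b (smooth_flat 0); congr smooth.
  by apply/funext => x; rewrite mulN1r addrC.
have s3 := @smoothZ (-1) _ (smooth_exp (@smoothZ (- n%:R) _ (smoothM s1 s2))).
have := smoothD (smooth_cst 1) s3; congr smooth; apply/funext => x.
by rewrite /bump mulN1r mulNr.
Qed.

Arguments smooth_bump : clear implicits.

Lemma bump_out a b n x : ~~ (a < x < b) -> bump a b n x = 0.
Proof.
rewrite /bump /flat subr_gt0 subr_gt0; case: ifPn => //= _; case: ifPn => //= _ _.
- by rewrite !mulr0 oppr0 expR0 subrr.
- by rewrite mul0r mulr0 oppr0 expR0 subrr.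
- by rewrite mul0r mulr0 oppr0 expR0 subrr.
Qed.

Lemma bump_01 a b n x : 0 <= bump a b n x <= 1.
Proof.
rewrite /bump subr_ge0 lerBlDr lerDl expR_ge0 andbT -expR0 ler_expR oppr_le0.
by rewrite !mulr_ge0// flat_ge0.
Qed.

Lemma bump_cvg a b x : bump a b n x @[n --> \oo] --> (\1_(`]a, b[%classic) x : R).
Proof.
have [xab|xab] := boolP (a < x < b); last first.
  rewrite indicE memNset ?in_itv//=; last by apply/negP; rewrite in_itv.
  by under eq_fun do rewrite bump_out//; exact: cvg_cst.
rewrite indicE mem_set/= ?in_itv//.
rewrite -[X in _ --> X]subr0; apply: cvgB; first exact: cvg_cst.
set be := flat 0 (x - a) * flat 0 (b - x).
have be0 : 0 < be.
  by case/andP: xab => h1 h2; rewrite mulr_gt0 // /flat subr_gt0 ?h1 ?h2 expr0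
    mul1r expR_gt0.
under eq_fun do rewrite -mulrN expRM_natl.
by apply: cvg_expr; rewrite ger0_norm ?expR_ge0// -expR0 ltr_expR oppr_lt0.
Qed.

End Smooth.
Arguments smooth_bump {R} a b n.
Arguments smooth_flat {R} k.
Arguments smooth_cst {R} c.

(** * Absolutely continuous functions and weak derivatives *)

Section AbsCont.
Context {R : realType}.
Local Notation mu := (@lebesgue_measure R).
Local Notation mR := (measurableTypeR R).
Implicit Types (Om : domain) (f g h phi : R -> R) (x y a b : R).

(** [f] is the continuous representative of an element of W^(1,1)_loc and [g]
    its derivative. *)
Definition AC f g := LI g /\ forall x y, x <= y -> f y - f x = ii x y g.

Definition prim g x : R := if 0 <= x then ii 0 x g else - ii x 0 g.

Lemma ii_xx x f : ii x x f = 0.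
Proof. by rewrite /ii set_itv1 Rintegral_set1. Qed.

Lemma prim_AC g : LI g -> AC (prim g) g.
Proof.
move=> gL; split => // x y xy; rewrite /prim.
have [y0|y0] := leP 0 y; have [x0|x0] := leP 0 x.
- by rewrite (@ii_split _ 0 x y g)// addrC addKr.
- by rewrite (@ii_split _ x 0 y g)// ?ltW// opprK addrC.
- by move: (le_trans x0 xy); rewrite leNgt y0.
- by rewrite (@ii_split _ x y 0 g)// ?ltW// opprK addrC addrK.
Qed.

Lemma ACB f g f' g' : AC f g -> AC f' g' -> AC (fun x => f x - f' x)
  (fun x => g x - g' x).
Proof.
move=> [gL fg] [gL' fg']; split; first exact: LIB.
by move=> x y xy; rewrite iiB// -fg// -fg'//; ring.
Qed.

Lemma AC_continuous f g : AC f g -> continuous f.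
Proof.
move=> [[mg gi] fg] x.
have ab : x - 1 < x + 1 by lra.
have /(continuous_within_itvP _ ab)[+ _ _] := parameterized_integral_continuous
  (ltW ab) (gi (x - 1) (x + 1)).
have xin : x \in `]x - 1, x + 1[ by rewrite in_itv/=; apply/andP; split; lra.
move=> /(_ x xin) H.
have H2 : {for x, continuous (fun y => f (x - 1) + ii (x - 1) y g)}.
  by apply: cvgD; [exact: cvg_cst|exact: H].
have E : \forall y \near x, f (x - 1) + ii (x - 1) y g = f y.
  near=> y; rewrite -fg; last by apply: ltW; near: y; apply: lt_nbhsr; lra.
  by rewrite [LHS]addrC subrK.
rewrite /continuous_at -(nbhs_singleton E).
by apply: cvg_trans H2; apply: near_eq_cvg; apply: filterS E => y ->.
Unshelve. all: by end_near. Qed.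

Lemma continuous_LI f : continuous f -> LI f.
Proof.
move=> cf; split; first exact: continuous_measurable_fun.
move=> a b; apply: continuous_compact_integrable; first exact: segment_compact.
exact: continuous_subspaceT.
Qed.

Lemma AC_LI f g : AC f g -> LI f.
Proof. by move=> /AC_continuous/continuous_LI. Qed.

Lemma AC_is_derive f g : AC f g -> continuous g -> forall x, is_derive x 1 f (g x).
Proof.
move=> [[mg gi] fg] cg x.
have xu : x < x + 1 by lra.
have [||d1 d2] := @continuous_FTC1 R g (BLeft (x - 1)) x (x + 1) xu (gi (x - 1)
  (x + 1)).
- by rewrite /Order.lt/=; lra.
- exact: cg.
have H : is_derive x 1 (fun y => ii (x - 1) y g) (g x).
  by split; [exact: d1|rewrite -derive1E; exact: d2].
have H2 := is_deriveD (is_derive_cst (f (x - 1)) x 1) H.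
rewrite add0r in H2.
apply: (near_eq_is_derive _ H2); near=> y.
change (f (x - 1) + ii (x - 1) y g = f y).
rewrite -fg; last by apply: ltW; near: y; apply: lt_nbhsr; lra.
by rewrite [LHS]addrC subrK.
Unshelve. all: by end_near. Qed.

Lemma derive_AC f : (forall x, derivable f x 1) -> continuous (derive1 f) ->
  AC f (derive1 f).
Proof.
move=> df cf; split; first exact: continuous_LI.
move=> x y; rewrite le_eqVlt => /predU1P[<-|xy]; first by rewrite ii_xx subrr.
have cof : continuous f.
  by move=> z; apply: differentiable_continuous; apply/derivable1_diffP.
have h1 : {within `[x, y], continuous (derive1 f)} by exact: continuous_subspaceT.
have h2 : derivable_oo_LRcontinuous f x y.
  split; [by move=> z _; exact: df|exact: cvg_at_right_filter (cof x)|exact: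
    cvg_at_left_filter (cof y)].
have h3 : {in `]x, y[, derive1 f =1 derive1 f} by [].
have E := continuous_FTC2 xy h1 h2 h3.
by rewrite /ii /Rintegral E.
Qed.

Lemma smooth_AC f : smooth f -> AC f (derive1 f).
Proof.
move=> sf; apply: derive_AC; first exact: (sf 0%N).
exact/smooth_continuous/smooth_derive1.
Qed.

Lemma by_parts a b (G g K k : R -> R) : a <= b -> AC G g -> AC K k ->
  ii a b (fun x => G x * k x) = G b * K b - G a * K a - ii a b (fun x => g x * K x).
Proof.
move=> ab GA KA; have [gL Gg] := GA; have [kL Kk] := KA.
have [mg gi] := gL; have [mk ki] := kL.
have cG := AC_continuous GA; have cK := AC_continuous KA.
have GkL : LI (fun x => G x * k x).
  split; first by apply: measurable_funM => //; exact: continuous_measurable_fun.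
  move=> c d; have [M hM] : exists M : R, forall x, c <= x <= d -> `|G x| <= M.
    have [M [_ /(_ (M + 1))]] := compact_bounded (continuous_compact
      (continuous_subspaceT cG) (@segment_compact R c d)).
    rewrite ltrDl ltr01 => /(_ isT) hM; exists (M + 1) => x xcd.
    by apply: hM; exists x => //=; rewrite in_itv.
  apply: (@le_integrable _ mR R mu _ _ _ (fun x => (M * `|k x|)%:E)) => //.
  - apply/measurable_EFinP/measurable_funTS.
    by apply: measurable_funM => //; exact: continuous_measurable_fun.
  - move=> x /=; rewrite in_itv/= => /hM hx; rewrite lee_fin normrM normrM
      normr_id ler_wpM2r//.
    by rewrite (le_trans hx)// ler_norm.
  - by case: (LIZ M (LI_norm kL)).
have KgL : LI (fun x => g x * K x).
  split; first by apply: measurable_funM => //; exact: continuous_measurable_fun.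
  move=> c d; have [M hM] : exists M : R, forall x, c <= x <= d -> `|K x| <= M.
    have [M [_ /(_ (M + 1))]] := compact_bounded (continuous_compact
      (continuous_subspaceT cK) (@segment_compact R c d)).
    rewrite ltrDl ltr01 => /(_ isT) hM; exists (M + 1) => x xcd.
    by apply: hM; exists x => //=; rewrite in_itv.
  apply: (@le_integrable _ mR R mu _ _ _ (fun x => (M * `|g x|)%:E)) => //.
  - apply/measurable_EFinP/measurable_funTS.
    by apply: measurable_funM => //; exact: continuous_measurable_fun.
  - move=> x /=; rewrite in_itv/= => /hM hx; rewrite lee_fin normrM mulrC normrM
      normr_id ler_wpM2r//.
    by rewrite (le_trans hx)// ler_norm.
  - by case: (LIZ M (LI_norm gL)).
pose J x : R := \1_(`[a, b]%classic) x.
have mJ : measurable_fun (setT : set mR) J by exact: measurable_indic.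
pose T (z : mR * mR) : R := \1_([set r : R | 0 <= r]) (z.1 - z.2).
have mT : measurable_fun (setT : set (mR * mR)) T.
  apply: (measurableT_comp (f := \1_([set r : R | 0 <= r]) : mR -> R)).
    apply: measurable_indic.
    rewrite (_ : [set r : R | 0 <= r] = `[0, +oo[%classic); last first.
      by apply/seteqP; split => r /=; rewrite in_itv/= andbT.
    exact: measurable_itv.
  by apply: measurable_funB.
pose H (z : mR * mR) : \bar R := ((J z.1 * k z.1) * (J z.2 * g z.2) * T z)%:E.
have mJk : measurable_fun (setT : set (mR * mR)) (fun z => J z.1 * k z.1).
  by apply: measurable_funM; [exact: (measurableT_comp mJ)|exact:
    (measurableT_comp mk)].
have mJg : measurable_fun (setT : set (mR * mR)) (fun z => J z.2 * g z.2).
  by apply: measurable_funM; [exact: (measurableT_comp mJ)|exact: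
    (measurableT_comp mg)].
have mH : measurable_fun setT H.
  by apply/measurable_EFinP; apply: measurable_funM => //; exact: measurable_funM.
have J_int F : LI F -> mu.-integrable setT (fun x => (J x * F x)%:E).
  move=> [mF Fi]; have /integrable_mkcond := Fi a b.
  move=> /(_ (measurable_itv _)); apply: eq_integrable => // x _.
  by rewrite patchE /J indicE; case: ifP; rewrite ?mul1r ?mul0r.
have JE F : (\int[mu]_x (J x * F x)%:E = \int[mu]_(x in `[a, b]) (F x)%:E)%E.
  rewrite [RHS]integral_mkcond; apply: eq_integral => x _.
  by rewrite patchE /J indicE; case: ifP; rewrite ?mul1r ?mul0r.
have iE F : LI F -> (\int[mu]_(x in `[a, b]) (F x)%:E = (ii a b F)%:E)%E.
  move=> [mF Fi]; rewrite /ii /Rintegral fineK//.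
  exact: (@integrable_fin_num _ mR R mu _ (measurable_itv `[a, b]) _ (Fi a b)).
have iH : (mu \x mu)%E.-integrable setT H.
  apply/(integrable12ltyP _ _ mH).
  apply: (@le_lt_trans _ _ (\int[mu]_x ((`|J x * k x|)%:E * (ii a b (fun y => `|g
    y|))%:E))%E); last first.
    rewrite ge0_integralZr//.
    - have /integrableP[_ h1] := J_int _ kL.
      by apply: lte_mul_pinfty => //; [exact: integral_ge0|rewrite
        ge0_fin_numE//; exact: integral_ge0|rewrite ltry].
    - by apply/measurable_EFinP; apply: measurableT_comp => //;
        exact: measurable_funM.
    - by rewrite lee_fin; apply: ii_ge0.
  apply: ge0_le_integral => //.
  - by move=> x _; exact: integral_ge0.
  - by apply: (@measurable_fun_fubini_tonelli_F _ _ mR mR R mu (abse \o H))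
      => [|z]; [exact: measurableT_comp|exact: abse_ge0].
  - by apply/measurable_EFinP; apply: measurable_funM => //;
      apply: measurableT_comp => //; exact: measurable_funM.
  move=> x _; rewrite -iE; last exact: LI_norm.
  rewrite -JE -ge0_integralZl//; last 2 first.
  - by apply/measurable_EFinP; apply: measurable_funM => //;
      apply: measurableT_comp.
  - by move=> y _; rewrite lee_fin mulr_ge0// /J indicE.
  apply: ge0_le_integral => //.
  - apply: measurableT_comp => //; exact: (measurableT_comp mH (pair1_measurable
      x)).
  - apply/measurable_EFinP; apply: measurable_funM => //;
      apply: measurable_funM => //; exact: measurableT_comp.
  - move=> y _; rewrite /H/= lee_fin !normrM -[leRHS]mulr1.
    apply: ler_pM => //.
      by rewrite [`|J y|]ger0_norm ?/J ?indicE.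
    by rewrite /T indicE normr_nat; case: (_ \in _); rewrite ?ler01.
have := Fubini iH.
have E1 x : (\int[mu]_y H (x, y) = (J x * (k x * (G x - G a)))%:E)%E.
  rewrite /H/=; have [xab|xab] := boolP (x \in `[a, b]); last first.
    rewrite /J indicE memNset//=; last by move=> h; move: xab; rewrite h.
    by under eq_integral do rewrite !mul0r; rewrite integral0 mul0r.
  have ax : a <= x by move: xab; rewrite in_itv/= => /andP[].
  have xb : x <= b by move: xab; rewrite in_itv/= => /andP[].
  have -> : J x = 1 by rewrite /J indicE mem_set.
  rewrite Gg// !mul1r EFinM.
  rewrite /ii /Rintegral fineK; last exact: (@integrable_fin_num _ mR R mu _
    (measurable_itv `[a, x]) _ (gi a x)).
  rewrite -integralZl//.
  rewrite [RHS]integral_mkcond; apply: eq_integral => y _;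
    rewrite patchE /J /T/= !indicE.
  rewrite (_ : (y \in `[a, x]%classic) = (y \in `[a, b]%classic)
    && (x - y \in [set r | 0 <= r])); last first.
    apply/idP/andP.
      by rewrite inE/= in_itv/= => /andP[h1 h2]; split;
        rewrite inE/= ?in_itv/= ?subr_ge0// h1 (le_trans h2).
    by move=> []; rewrite !inE/= !in_itv/= subr_ge0 => /andP[h1 _] h3; rewrite h1.
  case: (y \in _) => /=; rewrite ?mul0r ?mulr0 ?mul0r// mul1r.
  by case: ifP; rewrite ?mulr1 ?mulr0// EFinM.
have E2 y : (\int[mu]_x H (x, y) = (J y * (g y * (K b - K y)))%:E)%E.
  rewrite /H/=; have [xab|xab] := boolP (y \in `[a, b]); last first.
    rewrite /J indicE memNset//=; last by move=> h; move: xab; rewrite h.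
    by under eq_integral do rewrite !mul0r mulr0 mul0r; rewrite integral0 mul0r.
  have ax : a <= y by move: xab; rewrite in_itv/= => /andP[].
  have xb : y <= b by move: xab; rewrite in_itv/= => /andP[].
  have -> : J y = 1 by rewrite /J indicE mem_set.
  rewrite Kk// !mul1r EFinM.
  rewrite /ii /Rintegral fineK; last exact: (@integrable_fin_num _ mR R mu _
    (measurable_itv `[y, b]) _ (ki y b)).
  rewrite -integralZl//.
  rewrite [RHS]integral_mkcond; apply: eq_integral => x _;
    rewrite patchE /J /T/= !indicE.
  rewrite (_ : (x \in `[y, b]%classic) = (x \in `[a, b]%classic)
    && (x - y \in [set r | 0 <= r])); last first.
    apply/idP/andP.
      by rewrite inE/= in_itv/= => /andP[h1 h2]; split;
        rewrite inE/= ?in_itv/= ?subr_ge0// h2 (le_trans ax h1).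
    by move=> []; rewrite !inE/= !in_itv/= subr_ge0 => /andP[_ h1] h3;
      rewrite h1 h3.
  case: (x \in _) => /=; rewrite ?mul0r ?mulr0 ?mul0r// mul1r.
  by case: ifP; rewrite ?mulr1 ?mulr0// mulrC EFinM.
under eq_integral do rewrite E1.
under [RHS]eq_integral do rewrite E2.
rewrite !JE.
have L1' : LI (fun x => k x * (G x - G a)).
  have := LIB GkL (LIZ (G a) kL); congr LI; apply/funext => x; ring.
have L2' : LI (fun x => g x * (K b - K x)).
  have := LIB (LIZ (K b) gL) KgL; congr LI; apply/funext => x; ring.
rewrite !iE// => -[].
have -> : (fun x => k x * (G x - G a)) = (fun x => G x * k x - G a * k x)
  by apply/funext => x; ring.
have -> : (fun x => g x * (K b - K x)) = (fun x => K b * g x - g x * K x)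
  by apply/funext => x; ring.
rewrite iiB//; last exact: LIZ.
rewrite iiB//; last exact: LIZ.
rewrite !iiZ// -Gg// -Kk// => h.
by rewrite -[LHS](subrK (G a * (K b - K a))) h; ring.
Qed.

Lemma ii_supp a b c d f : LI f -> c <= a -> a <= b -> b <= d ->
  (forall x, ~~ (a < x < b) -> f x = 0) -> ii c d f = ii a b f.
Proof.
move=> fL ca ab bd f0.
rewrite (@ii_split _ c a d)//; last exact: le_trans bd.
rewrite (@ii_split _ a b d)//.
rewrite (@eq_ii _ c a f (fun=> 0)); last first.
  by move=> x /andP[_ xa]; rewrite f0//; apply/negP => /andP[]; rewrite ltNge xa.
rewrite (@eq_ii _ b d f (fun=> 0)); last first.
  by move=> x /andP[bx _]; rewrite f0//; apply/negP => /andP[_]; rewrite ltNge bx.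
by rewrite !ii_cst// !mul0r addr0 add0r.
Qed.

Lemma Rintegral_supp (M : R) f : (forall x, M < `|x| -> f x = 0) ->
  \int[mu]_x f x = ii (- M) M f.
Proof.
move=> f0; rewrite /ii [RHS]Rintegral_mkcond; apply: eq_Rintegral => x _.
rewrite patchE; case: ifPn => //; rewrite notin_setE/= in_itv/= -ler_norml => /negP.
by rewrite -ltNge => /f0.
Qed.

(** Lebesgue differentiation of the vanishing primitives. *)
Lemma ae_zero_of_ii f : LI f -> (forall a b, a < b -> ii a b f = 0) ->
  {ae mu, forall x, f x = 0}.
Proof.
move=> [mf fi] f0.
have loc : locally_integrable setT f.
  split => //; first exact: openT.
  move=> K _ cK; have [M [_ /(_ (M + 1))]] := compact_bounded cK.
  rewrite ltrDl ltr01 => /(_ isT) hM.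
  have /integrableP[_] := fi (- (M + 1)) (M + 1); apply: le_lt_trans.
  apply: ge0_subset_integral => //.
  - exact: compact_measurable.
  - by apply/measurable_EFinP; apply: measurableT_comp => //;
      exact: measurable_funTS.
  - by move=> x /hM; rewrite /= in_itv/= -ler_norml.
have H : {ae mu, forall x (n : nat), - n%:R < x -> f x = 0}.
  apply: ae_foralln => n.
  have := FTC1 (a := BLeft (- n%:R)) (fun y => fi (- n%:R) y) loc.
  apply: ae_imp => x h nx; have [|_ <-] := h; first by rewrite /Order.lt/=; lra.
  rewrite (_ : (fun y => _) = cst 0); first by rewrite derive1_cst.
  apply/funext => y; have [xy|yx] := ltP (- n%:R) y; first exact: f0.
  have : ii (- n%:R) y f = 0; last by [].
  move: yx; rewrite le_eqVlt => /predU1P[->|yx]; first exact: ii_xx.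
  by rewrite /ii set_itv_ge ?Rintegral_set0// bnd_simp -ltNge.
apply: ae_imp H => x /(_ (Num.truncn `|x|).+1); apply.
by rewrite ltrNl (le_lt_trans _ (truncnS_gt _))// -normrN ler_norm.
Qed.

Lemma bump_ii_cvg a b f : LI f ->
  ii a b (fun x => f x * bump a b n x) @[n --> \oo] --> ii a b f.
Proof.
move=> fL; have [mf fi] := fL.
have mi : LI (fun x => f x * \1_(`]a, b[%classic) x).
  apply: (@LI_M _ _ _ 1) => //.
  by move=> x; rewrite indicE normr_nat; case: (_ \in _).
have mb n : LI (fun x => f x * bump a b n x).
  apply: (@LI_M _ _ _ 1) => //.
    by apply: continuous_measurable_fun; apply: smooth_continuous;
      exact: smooth_bump.
  by move=> x; have /andP[h1 h2] := bump_01 a b n x; rewrite ger0_norm.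
have -> : ii a b f = ii a b (fun x => f x * \1_(`]a, b[%classic) x).
  by apply: eq_ii_oo => // x xab; rewrite indicE mem_set ?mulr1//= in_itv.
apply: fine_cvg.
have D1 : {ae mu, forall x, `[a, b]%classic x ->
  (f x * bump a b n x)%:E @[n --> \oo] --> (f x * \1_(`]a, b[%classic) x)%:E}.
  apply: aeW => x _; apply: cvg_EFin; first exact: nearW.
  by apply: cvgM; [exact: cvg_cst|exact: bump_cvg].
have D2 : {ae mu, forall x n, `[a, b]%classic x ->
  (`|(f x * bump a b n x)%:E| <= (`|f x|)%:E)%E}.
  apply: aeW => x n _; rewrite /= lee_fin normrM ler_piMr//.
  by have /andP[h1 h2] := bump_01 a b n x; rewrite ger0_norm.
have [_ _] := @dominated_convergence _ mR R mu `[a, b]%classic (measurable_itv _)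
  (fun n x => (f x * bump a b n x)%:E) (fun x => (f x * \1_(`]a, b[%classic) x)%:E)
  (fun x => (`|f x|)%:E)
  (fun n => measurable_int _ ((mb n).2 a b)) (measurable_int _ (mi.2 a b)) D1
  ((LI_norm fL).2 a b) D2.
rewrite /= => H; rewrite fineK; last exact: (@integrable_fin_num _ mR R mu _
  (measurable_itv `[a, b]) _ (mi.2 a b)).
exact: H.
Qed.

Arguments bump_ii_cvg : clear implicits.

(** The tests with zero mean are built from a bump on an arbitrary interval by
    subtracting a multiple of one fixed bump. Letting the first bump increase
    to an indicator shows that [f] minus a constant has zero integral over
    every interval. *)
Lemma du_Bois_Reymond f : LI f ->
  (forall phi (M : R), 0 < M -> smooth phi -> (forall x, M <= `|x| -> phi x = 0) ->
    ii (- M) M phi = 0 -> ii (- M) M (fun x => f x * phi x) = 0) ->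
  exists c, {ae mu, forall x, f x = c}.
Proof.
move=> fL hf.
have bL a b n : LI (bump a b n) by apply: continuous_LI;
  apply: smooth_continuous; exact: smooth_bump.
have fbL h a b n : LI h -> LI (fun x => h x * bump a b n x).
  move=> hL; apply: (@LI_M _ _ _ 1) => //.
    by apply: continuous_measurable_fun; apply: smooth_continuous;
      exact: smooth_bump.
  by move=> x; have /andP[h1 h2] := bump_01 a b n x; rewrite ger0_norm.
have [n0 m0] : exists n : nat, ii (0 : R) 1 (bump 0 1 n) != 0.
  apply: contrapT => /forallNP h.
  have : ii 0 1 (fun x => 1 * bump 0 1 n x) @[n --> \oo]
    --> ii 0 1 (fun=> (1 : R)) := bump_ii_cvg _ _ _ (LI_cst 1).
  rewrite ii_cst// subr0 mulr1 (_ : (fun n => _) = cst 0); last first.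
    apply/funext => n; move/negP: (h n); rewrite negbK => /eqP h0.
    by rewrite -[RHS]h0; apply: eq_ii => x _; rewrite mul1r.
  move=> /(cvg_lim (@Rhausdorff R)); rewrite lim_cst// => /eqP.
  by rewrite eq_sym oner_eq0.
set m := ii 0 1 (bump 0 1 n0) in m0.
pose c := ii 0 1 (fun x => f x * bump 0 1 n0 x) / m.
exists c.
suff : {ae mu, forall x, f x - c = 0} by apply: ae_imp => x /eqP;
  rewrite subr_eq0 => /eqP.
have fcL : LI (fun x => f x - c) by apply: LIB => //; exact: LI_cst.
apply: ae_zero_of_ii => // a b ab.
have H := bump_ii_cvg a b _ fcL.
suff E : (fun n => ii a b (fun x => (f x - c) * bump a b n x)) = cst 0.
  by rewrite E in H; have := cvg_lim (@Rhausdorff R) H; rewrite lim_cst// => <-.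
apply/funext => n /=.
pose t := ii a b (bump a b n) / m.
pose psi x := bump a b n x - t * bump 0 1 n0 x.
pose M : R := `|a| + `|b| + 1.
have aM : - M <= a by have := ler_norm (- a); rewrite normrN /M;
  have := normr_ge0 b; lra.
have bM : b <= M by have := ler_norm b; rewrite /M; have := normr_ge0 a; lra.
have M1 : 1 <= M by rewrite /M; have := normr_ge0 a; have := normr_ge0 b; lra.
have M0 : - M <= 0 by lra.
have out h (A B : R) k : LI h -> - M <= A -> A <= B -> B <= M ->
    ii (- M) M (fun x => h x * bump A B k x) = ii A B (fun x => h x * bump A B k x).
  move=> hL MA AB BM; apply: ii_supp => //; first exact: fbL.
  by move=> x xAB; rewrite bump_out// mulr0.
have outb (A B : R) k : - M <= A -> A <= B -> B <= M ->
    ii (- M) M (bump A B k) = ii A B (bump A B k).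
  by move=> MA AB BM; apply: ii_supp => // x xAB; rewrite bump_out.
have spsi : smooth psi.
  have := smoothD (smooth_bump a b n) (@smoothZ R (- t) _ (smooth_bump 0 1 n0)).
  by congr smooth; apply/funext => x; rewrite /psi mulNr.
have psi0 : ii (- M) M psi = 0.
  rewrite /psi iiB//; last exact: LIZ.
  by rewrite iiZ// !outb ?(ltW ab)// -/m /t divfK// subrr.
have sup x : M <= `|x| -> psi x = 0.
  move=> Mx; rewrite /psi !bump_out ?mulr0 ?subr0//.
    by apply/negP => /andP[h1 h2]; move: Mx; rewrite leNgt ltr_norml; case/negP;
      apply/andP; split; lra.
  by apply/negP => /andP[h1 h2]; move: Mx; rewrite leNgt ltr_norml; case/negP;
    apply/andP; split; lra.
have M00 : 0 < M by lra.
have := hf psi M M00 spsi sup psi0.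
have -> : (fun x => f x * psi x) = (fun x => f x * bump a b n x - t * (f x * bump
  0 1 n0 x)).
  by apply/funext => x; rewrite /psi; ring.
rewrite iiB ?iiZ; try by [exact: fbL|apply: LIZ; exact: fbL].
rewrite !out ?(ltW ab)// => /eqP; rewrite subr_eq0 => /eqP E.
have -> : (fun x => (f x - c) * bump a b n x) = (fun x => f x * bump a b n x - c
  * bump a b n x).
  by apply/funext => x; ring.
rewrite iiB ?iiZ ?E//; try by [exact: fbL|exact: LIZ].
by rewrite /t /c; field.
Qed.

(** On the circle too, weak derivatives can be tested with functions supported
    in an interval of the line, which makes the two domains amenable to one
    argument. *)
Definition weak_line f g := forall phi (M : R), 0 < M -> smooth phi ->
  (forall x, M <= `|x| -> phi x = 0) ->
  ii (- M) M (fun x => f x * derive1 phi x) = - ii (- M) M (fun x => g x * phi x).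

(** A test function with zero mean is the derivative of a test function: this
    is what turns a weak derivative that vanishes into a constant. *)
Lemma smooth_prim phi (M : R) : 0 < M -> smooth phi -> (forall x, M <= `|x| ->
  phi x = 0) ->
  ii (- M) M phi = 0 -> exists2 psi, smooth psi /\ derive1 psi = phi & forall x,
    M <= `|x| -> psi x = 0.
Proof.
move=> M0 sphi phi0 iphi.
have pL : LI phi by exact/continuous_LI/smooth_continuous.
have [_ pA] := prim_AC pL.
have A : AC (fun x => prim phi x - prim phi (- M)) phi.
  by split => // x y xy; rewrite -pA//; ring.
exists (fun x => prim phi x - prim phi (- M)).
  have D := AC_is_derive A (smooth_continuous sphi).
  by split; [exact: smooth_intro D sphi|have [_] := derive1_ext D].
move=> x; rewrite ler_normr => /orP[Mx|xM].
  rewrite pA; last by lra.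
  rewrite (@ii_split _ _ M)//; last by lra.
  rewrite iphi add0r (@eq_ii _ _ _ _ (fun=> 0)) ?ii_cst ?mul0r//.
  by move=> y /andP[My _]; rewrite phi0// ler_normr My.
apply/eqP; rewrite -oppr_eq0 opprB pA; last by lra.
rewrite (@eq_ii _ _ _ _ (fun=> 0)) ?ii_cst ?mul0r//; first by lra.
by move=> y /andP[_ yM]; rewrite phi0// ler_normr lerNr yM orbT.
Qed.

Lemma weak_line_AC f g : LI f -> LI g -> weak_line f g ->
  exists c, {ae mu, forall x, f x = c + prim g x}.
Proof.
move=> fL gL wfg; have pA := prim_AC gL; have pL := AC_LI pA.
have [||c hc] := @du_Bois_Reymond (fun x => f x - prim g x); first exact: LIB.
  move=> phi M M0 sphi phi0 iphi.
  have [psi [spsi psiE] psi0] := smooth_prim M0 sphi phi0 iphi.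
  have cphi := smooth_continuous sphi.
  have MM : - M <= M by lra.
  have [B hB] : exists B : R, forall x, `|phi x| <= B.
    have [B [_ /(_ (B + 1))]] := compact_bounded (continuous_compact
      (continuous_subspaceT cphi) (@segment_compact R (-M) M)).
    rewrite ltrDl ltr01 => /(_ isT) hM; exists `|B + 1| => x.
    have [xM|xM] := leP M `|x|; first by rewrite phi0 ?normr0.
    rewrite (le_trans _ (ler_norm _))//.
    by apply: hM; exists x => //=; rewrite in_itv/= -ler_norml ltW.
  have mphi := continuous_measurable_fun cphi.
  have -> : (fun x => (f x - prim g x) * phi x)
    = (fun x => f x * phi x - prim g x * phi x).
    by apply/funext => x; ring.
  rewrite iiB; try exact: (@LI_M _ _ _ B).
  rewrite -psiE wfg//.
  rewrite (by_parts MM pA (smooth_AC spsi)) !psi0 ?normrN ?ger0_norm ?(ltW M0)//.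
  by ring.
by exists c; apply: ae_imp hc => x <-; rewrite subrK.
Qed.

Lemma LI_locally f : LI f <-> locally_integrable setT f.
Proof.
split=> [[mf fi]|[mf _ fi]].
  split => //; first exact: openT.
  move=> K _ cK; have [M [_ /(_ (M + 1))]] := compact_bounded cK.
  rewrite ltrDl ltr01 => /(_ isT) hM.
  have /integrableP[_] := fi (- (M + 1)) (M + 1); apply: le_lt_trans.
  apply: ge0_subset_integral => //.
  - exact: compact_measurable.
  - by apply/measurable_EFinP; apply: measurableT_comp => //;
      exact: measurable_funTS.
  - by move=> x /hM; rewrite /= in_itv/= -ler_norml.
split => // a b; apply/integrableP; split; first
  exact/measurable_EFinP/measurable_funTS.
by apply: fi => //; exact: segment_compact.
Qed.

Lemma derive1_out phi (M x : R) : (forall y, M <= `|y| -> phi y = 0) ->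
  M < `|x| -> derive1 phi x = 0.
Proof.
move=> h Mx; have nr : \forall y \near x, phi y = cst 0 y.
  move: Mx; rewrite ltr_normr => /orP[Mx|Mx]; near=> y; rewrite h// ltW// ltr_normr.
    by apply/orP; left; near: y; exact: lt_nbhsr.
  by apply/orP; right; rewrite ltrNr; near: y; apply: lt_nbhsl; rewrite ltrNr.
by have [_ ->] := derive1_near nr; rewrite derive1_cst.
Unshelve. all: by end_near. Qed.

Lemma LI_Mc f g : LI f -> continuous g -> LI (fun x => f x * g x).
Proof.
move=> fL cg; split; first by apply: measurable_funM;
  [case: fL|exact: continuous_measurable_fun].
move=> c d.
have [M [_ /(_ (M + 1))]] := compact_bounded (continuous_compact
  (continuous_subspaceT cg) (@segment_compact R c d)).
rewrite ltrDl ltr01 => /(_ isT) hM.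
apply: (@le_integrable _ mR R mu _ _ _ (fun x => ((M + 1) * `|f x|)%:E)) => //.
- apply/measurable_EFinP/measurable_funTS.
  by apply: measurable_funM; [case: fL|exact: continuous_measurable_fun].
- move=> x xcd; have hx : `|g x| <= M + 1 by apply: hM; exists x.
  by rewrite lee_fin normrM mulrC normrM normr_id ler_wpM2r// (le_trans hx)//
    ler_norm.
- by case: (LIZ (M + 1) (LI_norm fL)).
Qed.

Lemma weak_derive_Line f g : is_weak_derive Line f g -> weak_line f g.
Proof.
move=> [_ /LI_locally fL /LI_locally gL h] phi M M0 sphi phi0.
have /h : test_fun Line phi.
  by split => //; exists M => x Mx; rewrite phi0// ltW.
rewrite /= (@Rintegral_supp M) ?(@Rintegral_supp M (fun x => g x * phi x))//.
  by move=> x Mx; rewrite phi0 ?mulr0// ltW.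
by move=> x Mx; rewrite (derive1_out phi0 Mx) mulr0.
Qed.

Lemma ii_sum a b (F : nat -> R -> R) n : (forall i, LI (F i)) ->
  LI (fun x => \sum_(i < n) F i x) /\ ii a b (fun x => \sum_(i < n) F i x)
    = \sum_(i < n) ii a b (F i).
Proof.
move=> FL; elim: n => [|n [IH1 IH2]].
  have -> : (fun x => \sum_(i < 0) F i x) = fun=> 0 by apply/funext => x;
    rewrite big_ord0.
  split; first exact: LI_cst.
  by rewrite big_ord0 /ii Rintegral_cst// mul0r.
have -> : (fun x => \sum_(i < n.+1) F i x) = (fun x => \sum_(i < n) F i x + F n x).
  by apply/funext => x; rewrite big_ord_recr.
split; first exact: LID.
by rewrite iiD// IH2 big_ord_recr.
Qed.

Lemma ii_cat a f n : LI f -> \sum_(i < n) ii (a + i%:R) (a + i%:R + 1)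
  f = ii a (a + n%:R) f.
Proof.
move=> fL; elim: n => [|n IH]; first by rewrite big_ord0 addr0 ii_xx.
rewrite big_ord_recr/= IH [RHS](@ii_split _ a (a + n%:R))// -?natr1 ?addrA//.
- by rewrite lerDl.
- by rewrite lerDl.
Qed.

Section periodize.
Context (phi : R -> R) (K : nat) (sphi : smooth phi)
  (phi0 : forall x, K%:R <= `|x| -> phi x = 0).

Let S x := \sum_(i < (K.*2).+1) phi (x + (i%:R - K%:R)).
(** The sum of all the translates of [phi] by integers. Only finitely many do
    not vanish on a given period, whence the finite sum [S], anchored at the
    integer part. *)
Definition periodized x := S (x - (Num.floor x)%:~R).

Let S_smooth n : smooth (fun x => \sum_(i < n) phi (x + (i%:R - K%:R))).
Proof.
elim: n => [|n IH].
  by rewrite (_ : (fun x => _) = fun=> 0); [exact: smooth_cst|apply/funext => x;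
    rewrite big_ord0].
rewrite (_ : (fun x => _) = (fun x => \sum_(i < n) phi (x + (i%:R - K%:R))
  + phi (x + (n%:R - K%:R)))).
  exact (smoothD IH (smooth_shift sphi)).
by apply/funext => x; rewrite big_ord_recr.
Qed.

Let S_derive n x : derive1 (fun x => \sum_(i < n) phi (x + (i%:R - K%:R)))
  x = \sum_(i < n) derive1 phi (x + (i%:R - K%:R)).
Proof.
elim: n => [|n IH].
  rewrite (_ : (fun x => _) = cst 0); first by rewrite derive1_cst big_ord0.
  by apply/funext => y; rewrite big_ord0.
rewrite (_ : (fun x => _) = (fun x => \sum_(i < n) phi (x + (i%:R - K%:R))
  + phi (x + (n%:R - K%:R)))); last first.
  by apply/funext => y; rewrite big_ord_recr.
have d1 := is_derive_derive1 (@S_smooth n 0%N x).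
have d2 : is_derive x 1 (fun x => phi (x + (n%:R - K%:R)))
  (derive1 phi (x + (n%:R - K%:R))).
  have e1 := is_derive_derive1 (@sphi 0%N (x + (n%:R - K%:R))).
  have e2 : is_derive x 1 (fun x => x + (n%:R - K%:R)) 1.
    by refine (is_derive_eq (is_deriveD (is_derive_id x 1)
      (is_derive_cst (n%:R - K%:R : R) x 1)) _); rewrite addr0.
  by refine (is_derive_eq (@is_derive1_comp _ phi (fun x => x + (n%:R - K%:R))
    x _ _ e1 e2) _); rewrite mulr1.
have [_] := is_derive_derive1E (is_deriveD d1 d2).
by rewrite big_ord_recr/= -IH.
Qed.

Let S_shift x : -1 <= x < 0 -> S (x + 1) = S x.
Proof.
move=> /andP[x1 x0]; rewrite /S big_ord_recr [RHS]big_ord_recl/=.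
rewrite [X in _ + X = _]phi0 ?addr0; last first.
  rewrite ger0_norm -addnn natrD; first by lra.
  by have := ler0n R K; lra.
rewrite [X in _ = X + _]phi0 ?add0r; last first.
  by rewrite ler0_norm; have := ler0n R K; lra.
by apply: eq_bigr => i _; congr phi; rewrite /bump /= -natr1 ; ring.
Qed.

(** Around an integer the anchor may be taken on either side, so that
    [periodized] is smooth although the integer part jumps. *)
Lemma periodized_local (m : int) x : m%:~R - 1 < x < m%:~R + 1 ->
  periodized x = S (x - m%:~R).
Proof.
move=> /andP[h1 h2]; rewrite /periodized.
have [mx|xm] := leP m%:~R x.
  by rewrite (@floor_def _ x m)// mx intrD.
rewrite (@floor_def _ x (m - 1)); last first.
  by rewrite subrK xm andbT intrB mulr1z ltW.
rewrite intrB mulr1z opprB addrA addrAC S_shift//; apply/andP; split; lra.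
Qed.

Lemma smooth_periodized : smooth periodized.
Proof.
apply: smooth_local => x; pose m := Num.floor x.
exists `](m%:~R - 1), (m%:~R + 1)[%classic, (fun y => S (y - m%:~R)); split.
- exact: itv_open.
- rewrite /= in_itv/=; apply/andP; split.
    by apply: (@lt_le_trans _ _ m%:~R); [lra|exact: floor_le].
  by have := floorD1_gt x; rewrite intrD.
- exact/smooth_shift/S_smooth.
- by move=> y; rewrite /= in_itv/=; exact: periodized_local.
Qed.

Lemma periodized_period x : periodized (x + 1) = periodized x.
Proof.
rewrite /periodized floorDrz ?rpred1// floor1 intrD mulr1z; congr S; ring.
Qed.

Lemma periodized_int f : LI f -> (forall x, f (x + 1) = f x) ->
  ii 0 1 (fun x => f x * derive1 periodized x) = ii (- K%:R)
    K%:R (fun x => f x * derive1 phi x) /\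
  ii 0 1 (fun x => f x * periodized x) = ii (- K%:R) K%:R (fun x => f x * phi x).
Proof.
move=> fL fp.
have gen (P : R -> R) (p : R -> R) : continuous p -> continuous P ->
   (forall x, 0 < x < 1 -> P x = \sum_(i < (K.*2).+1) p (x + (i%:R - K%:R))) ->
   (forall x, K%:R < `|x| -> p x = 0) ->
   ii 0 1 (fun x => f x * P x) = ii (- K%:R) K%:R (fun x => f x * p x).
  move=> cp cP PE p0.
  have fpL : LI (fun x => f x * p x) by exact: LI_Mc.
  have sL i : LI (fun x => f (x + (i%:R - K%:R)) * p (x + (i%:R - K%:R)))
    by exact: LI_shift fpL.
  have [L0 E0] := @ii_sum 0 1 (fun i x => f (x + (i%:R - K%:R))
    * p (x + (i%:R - K%:R))) (K.*2).+1 sL.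
  transitivity (ii 0 1 (fun x => \sum_(i < (K.*2).+1) f (x + (i%:R - K%:R))
    * p (x + (i%:R - K%:R)))).
    apply: eq_ii_oo => //; first exact: LI_Mc.
    move=> x x01; rewrite PE// big_distrr/=; apply: eq_bigr => i _; congr (_ * _).
    by rewrite -[i%:R]/((i%:Z)%:~R) -[K%:R]/((K%:Z)%:~R) -intrB periodic_int.
  rewrite E0.
  transitivity (\sum_(i < (K.*2).+1) ii (- K%:R + i%:R) (- K%:R + i%:R + 1)
    (fun x => f x * p x)).
    apply: eq_bigr => i _; rewrite (@ii_shift _ 0 1 (i%:R - K%:R)
      (fun x => f x * p x)); last by case: fpL.
    by rewrite add0r (addrC i%:R) (addrC 1).
  rewrite ii_cat// (@ii_split _ _ K%:R)//; last 2 first.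
  - by have := ler0n R K; lra.
  - by rewrite -natr1 -addnn natrD; lra.
  rewrite (@eq_ii_oo _ K%:R _ _ (fun=> 0))//; last 2 first.
  - exact: LI_cst.
  - move=> x /andP[h _]; rewrite p0 ?mulr0// (lt_le_trans h)// ler_norm//.
  by rewrite /ii Rintegral_cst// mul0r addr0.
have P0 x : 0 < x < 1 -> periodized x = S x.
  by move=> /andP[x0 x1]; rewrite (@periodized_local 0) ?subr0//; apply/andP;
    split; lra.
split; apply: gen.
- exact/smooth_continuous/smooth_derive1.
- exact/smooth_continuous/smooth_derive1/smooth_periodized.
- move=> x x01; rewrite -S_derive.
  have nr : \forall y \near x, periodized y = S y.
    have oU : open (`]0, 1[%classic : set R) by exact: itv_open.
    have Ux : (`]0, 1[%classic : set R) x by rewrite /= in_itv.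
    by apply: filterS (open_nbhs_nbhs (conj oU Ux)) => y; rewrite /= in_itv/=;
      exact: P0.
  by have [_ ->] := derive1_near nr.
- by move=> x; exact: derive1_out.
- exact: smooth_continuous.
- exact/smooth_continuous/smooth_periodized.
- exact: P0.
- by move=> x Kx; rewrite phi0// ltW.
Qed.
End periodize.

Lemma ii_supp_sym (M N : R) f : 0 < M -> M <= N -> LI f ->
  (forall x, M < `|x| -> f x = 0) -> ii (- N) N f = ii (- M) M f.
Proof.
move=> M0 MN fL f0.
have N0 : - M <= N by lra.
have M00 : - M <= M by lra.
rewrite (@ii_split _ _ (- M) N f) ?lerN2// (@ii_split _ (- M) M N f)//.
rewrite (@eq_ii_oo _ _ (- M) _ (fun=> 0))//; last 2 first.
- exact: LI_cst.
- by move=> x /andP[_ h2]; rewrite f0// ltr_normr ltrNr h2 orbT.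
rewrite (@eq_ii_oo _ M _ _ (fun=> 0))//; last 2 first.
- exact: LI_cst.
- by move=> x /andP[h2 _]; rewrite f0// ltr_normr h2.
by rewrite /ii !Rintegral_cst// !mul0r addr0 add0r.
Qed.

(** Testing on the circle with the periodization of a function amounts to
    testing on the line with the function itself. *)
Lemma weak_derive_Circle f g : is_weak_derive Circle f g -> weak_line f g.
Proof.
move=> [[/= pf pg] /LI_locally fL /LI_locally gL h] phi M M0 sphi phi0.
have [K MK] : exists K : nat, M <= K%:R by exists (Num.truncn M).+1;
  apply/ltW/truncnS_gt.
have phiK x : K%:R <= `|x| -> phi x = 0 by move=> Kx; apply: phi0;
  exact: le_trans Kx.
have cphi := smooth_continuous sphi.
have cphi' := smooth_continuous (smooth_derive1 sphi).
have /h : test_fun Circle (periodized phi K).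
  by split; [exact: smooth_periodized|exact: periodized_period].
have [E1 _] := periodized_int sphi phiK fL pf.
have [_ E2] := periodized_int sphi phiK gL pg.
move=> E; have {}E : ii (- K%:R) K%:R (fun x => f x * derive1 phi x)
  = - ii (- K%:R) K%:R (fun x => g x * phi x).
  by rewrite -E1 -E2.
have red F := @ii_supp_sym M K%:R F M0 MK.
move: E; clear E1 E2 h.
have Z1 x : M < `|x| -> f x * derive1 phi x = 0 by move=> Mx;
  rewrite (derive1_out phi0 Mx) mulr0.
have Z2 x : M < `|x| -> g x * phi x = 0 by move=> Mx; rewrite phi0 ?mulr0// ltW.
by rewrite (red _ (LI_Mc fL cphi') Z1) (red _ (LI_Mc gL cphi) Z2).
Qed.

Lemma is_weak_derive_line Om f g : is_weak_derive Om f g ->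
  [/\ on_dom Om f /\ on_dom Om g, LI f, LI g & weak_line f g].
Proof.
move=> h; have [od /LI_locally fL /LI_locally gL _] := h; split => //.
by case: Om h {od} => h; [exact: weak_derive_Line|exact: weak_derive_Circle].
Qed.

Lemma weak_line_unique f g g' : LI g -> LI g' -> weak_line f g -> weak_line f g' ->
  {ae mu, forall x, g x = g' x}.
Proof.
move=> gL gL' h h'.
suff : {ae mu, forall x, g x - g' x = 0} by apply: ae_imp => x /eqP;
  rewrite subr_eq0 => /eqP.
have dL : LI (fun x => g x - g' x) by exact: LIB.
apply: ae_zero_of_ii => // a b ab.
have H := bump_ii_cvg a b _ dL.
suff E : (fun n => ii a b (fun x => (g x - g' x) * bump a b n x)) = cst 0.
  by rewrite E in H; have := cvg_lim (@Rhausdorff R) H; rewrite lim_cst// => <-.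
apply/funext => n /=.
pose M : R := `|a| + `|b| + 1.
have aM : - M <= a by have := ler_norm (- a); rewrite normrN /M;
  have := normr_ge0 b; lra.
have bM : b <= M by have := ler_norm b; rewrite /M; have := normr_ge0 a; lra.
have M0 : 0 < M by rewrite /M; have := normr_ge0 a; have := normr_ge0 b; lra.
have sb := smooth_bump a b n; have cb := smooth_continuous sb.
have b0 x : M <= `|x| -> bump a b n x = 0.
  move=> Mx; rewrite bump_out//; apply/negP => /andP[h1 h2].
  by move: Mx; rewrite leNgt ltr_norml; case/negP; apply/andP; split; lra.
have E := h _ M M0 sb b0; rewrite h'// in E.
have {}E : ii (- M) M (fun x => (g x - g' x) * bump a b n x) = 0.
  rewrite (_ : (fun x => _) = (fun x => g x * bump a b n x - g' x * bump a b n
    x)); last first.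
    by apply/funext => x; ring.
  by rewrite iiB; [lra|exact: LI_Mc|exact: LI_Mc].
rewrite -E; apply/esym/ii_supp => //; [exact: LI_Mc|exact: ltW|].
by move=> x xab; rewrite bump_out// mulr0.
Qed.

Lemma AC_is_weak_derive Om f g : on_dom Om f -> on_dom Om g -> AC f g ->
  is_weak_derive Om f g.
Proof.
move=> of_ og fg; split => //; [exact/LI_locally/(AC_LI fg)|by case: fg =>
  /LI_locally|].
move=> phi [sphi]; have pA := smooth_AC sphi.
case: Om of_ og => /= of_ og.
  move=> [M phi0].
  pose N : R := `|M| + 1.
  have N0 : - N <= N by rewrite /N; have := normr_ge0 M; lra.
  have phiN x : N <= `|x| -> phi x = 0.
    by move=> Nx; apply: phi0; apply: lt_le_trans Nx; rewrite /N;
      have := ler_norm M; lra.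
  rewrite (@Rintegral_supp N); last by move=> x Nx; rewrite (derive1_out phiN Nx)
    mulr0.
  rewrite (@Rintegral_supp N); last by move=> x Nx; rewrite phiN ?mulr0// ltW.
  rewrite (by_parts N0 fg pA) !phiN ?normrN; first by ring.
    by rewrite ler_norm.
  by rewrite ler_norm.
move=> pphi; have := by_parts ler01 fg pA; rewrite /ii => ->.
by rewrite -[1]add0r of_ pphi subrr sub0r add0r.
Qed.

(** A weak derivative is chosen by [weak_derive] up to a null set; for an
    absolutely continuous function it is the derivative of the pair. *)
Lemma weak_derive_AC Om f g : on_dom Om f -> on_dom Om g -> AC f g ->
  is_weak_derive Om f (weak_derive Om f) /\ {ae mu, forall x,
    weak_derive Om f x = g x}.
Proof.
move=> of_ og fg; have W := AC_is_weak_derive of_ og fg.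
have W' : is_weak_derive Om f (weak_derive Om f).
  exact: (@xgetPex _ (cst 0) [set g | is_weak_derive Om f g] (ex_intro _ g W)).
split => //.
have [_ _ gL' h'] := is_weak_derive_line W'.
have [_ _ gL h] := is_weak_derive_line W.
exact: weak_line_unique h' h.
Qed.

Lemma is_weak_derive_AC Om f g : is_weak_derive Om f g ->
  exists F, [/\ AC F g, {ae mu, forall x, f x = F x} & on_dom Om g].
Proof.
move=> /is_weak_derive_line[[of_ og] fL gL h].
have [c hc] := weak_line_AC fL gL h; exists (fun x => c + prim g x); split => //.
have [_ pA] := prim_AC gL; split => // x y xy; rewrite -pA//; ring.
Qed.

End AbsCont.

(** * Grid functions, contraction and maximum principle *)

Section Grid.
Context {R : realType}.
Local Notation mu := (@lebesgue_measure R).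
Local Notation mR := (measurableTypeR R).
Implicit Types (Om : domain) (f g u d psi b : R -> R) (x y h : R).

(** Monotone convergence over growing windows. *)
Lemma windows_L1 f (K : R) : LI f -> (forall x, 0 <= f x) ->
  (forall n : nat, ii (- n%:R) n%:R f <= K) ->
  L1 Line f /\ Int Line f <= K.
Proof.
move=> [mf fi] f0 hK.
have E : (\int[mu]_(x in dom Line) `|f x|%:E <= K%:E)%E.
  pose F (n : nat) : set R := `[- n%:R, n%:R]%classic.
  have FE : \bigcup_n F n = setT.
    apply/seteqP; split => // x _; exists (Num.truncn `|x|).+1 => //=.
    by rewrite /F /= in_itv/= -ler_norml ltW// truncnS_gt.
  have ndF : nondecreasing_seq F.
    move=> m n mn; apply/subsetPset; apply: subset_itv;
      rewrite bnd_simp ?lerN2 ler_nat//.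
  have mF n : measurable (F n) by exact: measurable_itv.
  have mE n : measurable_fun (F n) (fun x : mR => (`|f x|)%:E).
    by apply/measurable_EFinP; apply: measurableT_comp => //;
      exact: measurable_funTS.
  have C := @ge0_nondecreasing_set_cvg_integral _ mR R F (fun x => (`|f x|)%:E)
    mu ndF mF mE (fun n x _ => normr_ge0 (f x)).
  rewrite FE in C; rewrite /= -(cvg_lim _ C)//.
  apply: lime_le; first by apply/cvg_ex; eexists; exact: C.
  apply: nearW => n; rewrite (_ : integral _ _ _ = (ii (- n%:R) n%:R f)%:E)
    ?lee_fin//.
  rewrite /ii /Rintegral fineK; last exact: (@integrable_fin_num _ mR R mu _ (mF
    n) _ (fi _ _)).
  by apply: eq_integral => x _; rewrite ger0_norm.
have [] := @L1_bounded_integral R Line f K _ mf E => // h1 h2; split => //.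
by apply: le_trans h2; apply: le_I => //; [exact: L1_norm|move=> x;
  exact: ler_norm].
Qed.

Lemma ii_le_I Om f x y : x <= y -> y - x <= 1 -> L1 Om f ->
  (forall z, 0 <= f z) -> ii x y f <= Int Om f.
Proof.
move=> xy xy1 fL f0; have fLI := L1_LI fL.
case: Om fL => fL.
  rewrite /Int /= /ii [leLHS]Rintegral_mkcond; have [_ mf fi] := fL.
  apply: le_Rintegral => //.
    by have /integrable_mkcond := fLI.2 x y => /(_ (measurable_itv _));
      rewrite restrict_EFin.
  by move=> z _; rewrite patchE; case: ifP.
have [pf _ _] := fL.
rewrite /Int /= -/(ii 0 1 f) -(@ii_period _ f x)// (@ii_split _ x y (x + 1))//;
  last by lra.
by rewrite lerDl; apply: ii_ge0.
Qed.

(** Through this step function, sums over the grid become integrals, and shifts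
    of the index become translations by the mesh size. *)
Definition st h (a : int -> R) x : R := a (Num.floor (x / h)).

Lemma st_shift h a x (m : int) : 0 < h -> st h a (x + m%:~R * h)
  = st h (fun j => a (j + m)) x.
Proof.
move=> h0; rewrite /st mulrDl mulfK ?gt_eqF// floorDrz ?intr_int//.
by rewrite intrKfloor.
Qed.

Lemma st_shift1 h a x : 0 < h -> st h a (x + h) = st h (fun j => a (j + 1)) x.
Proof. by move=> h0; rewrite -st_shift// mul1r. Qed.

Lemma st_shiftN1 h a x : 0 < h -> st h a (x - h) = st h (fun j => a (j - 1)) x.
Proof. by move=> h0; rewrite -(st_shift _ _ (-1) h0) mulrN1z mulN1r. Qed.

Lemma st_eq h a x (j : int) : 0 < h -> j%:~R * h <= x < (j + 1)%:~R * h ->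
  st h a x = a j.
Proof.
by move=> h0 hj; rewrite /st (@floor_def _ _ j)// ler_pdivlMr// ltr_pdivrMr.
Qed.

Lemma measurable_floor : measurable_fun (setT : set mR)
  (fun x : R => (Num.floor x)%:~R : R).
Proof.
apply: nondecreasing_measurable => //.
by move=> x y xy; rewrite ler_int; exact: le_floor.
Qed.

Lemma measurable_floorT (d' : measure_display) (T' : measurableType d')
  (p : T' -> R) (a : int -> R) :
  measurable_fun (setT : set T') p -> measurable_fun (setT : set T')
    (fun z => a (Num.floor (p z))).
Proof.
move=> mp _ Y mY; rewrite setTI.
pose A (n : nat) : set T' := if unpickle n is Some j then
  if pselect (Y (a j)) then [set z | (Num.floor (p z))%:~R = j%:~R :> R]
    else set0 else set0.
rewrite (_ : _ @^-1` _ = \bigcup_n A n).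
  apply: bigcupT_measurable => n; rewrite /A; case: (unpickle n) => // j;
    case: (pselect (Y (a j))) => [Yj|nY] //=.
  have mq : measurable_fun (setT : set T') (fun z => (Num.floor (p z))%:~R : R).
    exact: (measurableT_comp (f := fun x : mR => (Num.floor x)%:~R : R)
      measurable_floor mp).
  have := mq measurableT [set j%:~R] (measurable_set1 _); rewrite setTI.
  by congr (measurable _).
apply/seteqP; split => z /=.
  have [q qE] : exists q, Num.floor (p z) = q by eexists.
  rewrite qE => Yq; exists (pickle q); first exact: Logic.I.
  rewrite /A pickleK; case: (pselect (Y (a q))) => [_|/(_ Yq)[]] /=.
  by rewrite qE.
move=> [n _]; rewrite /A; case: (unpickle n) => // j; case: (pselect (Y (a j)))
  => //= Yj /eqP.
by rewrite eqr_int => /eqP ->.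
Qed.

Lemma measurable_st h a : measurable_fun (setT : set mR) (st h a).
Proof.
by apply: (@measurable_floorT _ mR (fun x : R => x / h)); apply: mulrr_measurable.
Qed.

Lemma st_bounded_LI h a (M : R) : (forall j, `|a j| <= M) -> LI (st h a).
Proof. by move=> aM; apply: (@LI_bounded _ _ M); [exact: measurable_st|move=> x;
  exact: aM]. Qed.

Lemma ii_cell h a (j : int) : 0 < h -> LI (st h a) -> ii (j%:~R * h)
  ((j + 1)%:~R * h) (st h a) = a j * h.
Proof.
move=> h0 aL; rewrite (@eq_ii_oo _ _ _ _ (fun=> a j))//; last 2 first.
- exact: LI_cst.
- by move=> x /andP[h1 h2]; rewrite (@st_eq _ _ _ j)// ltW.
rewrite ii_cst; last by rewrite ler_pM2r// ler_int lerDl.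
by rewrite intrD mulrDl addrAC subrr add0r mul1r.
Qed.

Lemma ii_cells h a (m : int) (n : nat) : 0 < h -> LI (st h a) ->
  ii (m%:~R * h) ((m + n%:Z)%:~R * h) (st h a) = \sum_(i < n) a (m + i%:Z) * h.
Proof.
move=> h0 aL; elim: n => [|n IH]; first by rewrite addr0 big_ord0 ii_xx.
rewrite (@ii_split _ _ ((m + n%:Z)%:~R * h))//; last 2 first.
- by rewrite ler_pM2r// ler_int lerDl.
- by rewrite ler_pM2r// ler_int lerD2l lez_nat.
have E : m + n.+1%:Z = m + n%:Z + 1 by rewrite -[n.+1]addn1 PoszD addrA.
by rewrite IH big_ord_recr/= E ii_cell.
Qed.

Lemma st_on_dom Om h a : 0 < h -> (match Om with Line => True | Circle => exists2
  N : nat, (0 < N)%N & h = N%:R^-1 end) ->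
  grid_fun Om h a -> on_dom Om (st h a).
Proof.
case: Om => //= h0 [N N0 hN] ga x.
rewrite -[RHS](ga N hN) /st hN invrK mulrDl mul1r floorDrz;
  last by rewrite -[N%:R]/((N%:Z)%:~R) intr_int.
by rewrite -[N%:R]/((N%:Z)%:~R) intrKfloor.
Qed.

Lemma L1_st Om h a : 0 < h -> (match Om with Line => True | Circle => exists2 N :
  nat, (0 < N)%N & h = N%:R^-1 end) ->
  grid_fun Om h a -> L1 Om (st h a).
Proof.
move=> h0 hOm ga; have od := st_on_dom h0 hOm ga; have ma := measurable_st h a.
case: Om hOm ga od => /= [_ ga od|[N N0 hN] ga od].
  pose S := (\esum_(j in [set: int]) `|(EFin \o a) j|)%E.
  have SE (X : seq int) : uniq X -> \sum_(j <- X) `|a j| <= fine S.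
    move=> uX.
    rewrite -lee_fin fineK; last by rewrite ge0_fin_numE//; exact: esum_ge0.
    rewrite -sumEFin; apply: esum_ge; exists [set` X]; first by split => //;
      exact: finite_seq.
    by rewrite -fsbig_seq.
  have aM j : `|a j| <= fine S by have := SE [:: j] isT; rewrite big_seq1.
  have aL : LI (st h (fun j => `|a j|)).
    by apply: (@st_bounded_LI _ _ (fine S)) => j; rewrite normr_id.
  have [] := @windows_L1 (st h (fun j => `|a j|)) (fine S * h) aL.
  - by move=> x; rewrite /st.
  - move=> n; pose m := (Num.truncn (n%:R / h)).+1.
    have nm : n%:R <= m%:R * h by rewrite -ler_pdivrMr//; apply/ltW/truncnS_gt.
    apply: (@le_trans _ _ (ii ((- m%:Z)%:~R * h)
      ((- m%:Z + (m + m)%N%:Z)%:~R * h) (st h (fun j => `|a j|)))).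
      rewrite PoszD addrA addNr add0r mulrNz mulNr.
      rewrite [leRHS](@ii_split _ _ (- n%:R))// ?lerN2//;
        last by apply: le_trans nm; rewrite lerNl; apply: le_trans (ler0n _ n);
        rewrite oppr_le0.
      rewrite (@ii_split _ (- n%:R) n%:R (m%:R * h))//;
        last by apply: le_trans (ler0n _ n); rewrite oppr_le0.
      by rewrite addrCA lerDl addr_ge0//; apply: ii_ge0 => x _; rewrite /st.
    rewrite ii_cells// -mulr_suml (ler_wpM2r (ltW h0))//.
    rewrite -(big_mkord xpredT (fun i => `|a (- m%:Z + i%:Z)|)).
    rewrite -(big_map (fun i : nat => - m%:Z + i%:Z) xpredT (fun j => `|a j|)).
    by apply: SE; rewrite map_inj_uniq ?iota_uniq// => i j /addrI [].
  move=> [_ _ ai] _; split => //.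
  apply: le_integrable ai; [exact: measurable_dom|exact/measurable_EFinP|].
  by move=> x _; rewrite /= lee_fin normr_id.
split => //.
have [M hM] : exists M : R, forall j, `|a j| <= M.
  exists (\sum_(i < N) `|a i%:Z|) => j.
  have aN : forall (m : int) (q : nat), a (m + (q * N)%N%:Z) = a m.
    by move=> m; elim=> [|q IH]; rewrite ?mul0n ?addr0// mulSn addnC PoszD addrA ga.
  have aZ : forall m (q : int), a (m + q * N%:Z) = a m.
    move=> m [q|q]; first by rewrite -PoszM aN.
    by rewrite NegzE mulNr -PoszM -[LHS](aN _ q.+1) subrK.
  have N0' : (N%:Z != 0) by rewrite -lt0n.
  rewrite [j](divz_eq j N%:Z) addrC aZ.
  have := ltz_pmod j (N0 : (0 < N%:Z)); have := modz_ge0 j N0'.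
  case: (j %% N%:Z)%Z => // i _ iN.
  rewrite (bigD1 (Ordinal (iN : (i < N)%N)))//= lerDl sumr_ge0//.
exact: ((@st_bounded_LI h a M hM).2 0 1).
Qed.

(** When the implicit part is moved to the left, the CFL condition makes the
    coefficient of [d x] nonnegative, so that the triangle inequality loses
    nothing and the absolute values satisfy the inequality of the scheme.
    Integrated against the weight, with both second differences moved to it,
    only the second difference of the weight remains. The unweighted case [kap
    = 0] is the contraction in L^1. *)
Lemma step_estimate Om h (lam th kap : R) d d' b psi (Mp : R) : 0 <= lam ->
  0 <= th <= 1 -> 2 * (lam * (1 - th)) <= 1 ->
  L1 Om d -> L1 Om d' -> on_dom Om b -> measurable_fun (setT : set mR) b ->
    (forall x, 0 <= b x <= 1) ->
  on_dom Om psi -> measurable_fun (setT : set mR) psi ->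
    (forall x, 0 <= psi x <= Mp) ->
  0 <= kap -> (forall x, psi (x + h) - 2 * psi x + psi (x - h) <= kap) ->
  (forall x, let Y z := b z * (th * d' z + (1 - th) * d z) in
     d' x - d x = lam * (Y (x + h) - 2 * Y x + Y (x - h))) ->
  Int Om (fun x => psi x * `|d' x|) <= Int Om (fun x => psi x * `|d x|)
    + lam * kap * Int Om (fun x => th * `|d' x| + (1 - th) * `|d x|).
Proof.
move=> lam0 /andP[th0 th1] cfl dL dL' ob mb b01 op mp p0 kap0 pk eqd.
have th1' : 0 <= 1 - th by rewrite subr_ge0.
pose X x := th * `|d' x| + (1 - th) * `|d x|.
have X0 x : 0 <= X x by rewrite addr_ge0// mulr_ge0.
have XL : L1 Om X by apply: L1D; apply: L1Z; exact: L1_norm.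
have bn x : `|b x| <= 1 by have /andP[h1 h2] := b01 x; rewrite ger0_norm.
have pn x : `|psi x| <= Mp by have /andP[h1 h2] := p0 x; rewrite ger0_norm.
have Mp0 : 0 <= Mp by have /andP[h1 h2] := p0 0; exact: le_trans h2.
pose Y x := b x * X x.
have YL : L1 Om Y.
  by have := L1M XL ob mb bn; congr L1; apply/funext => x; rewrite /Y mulrC.
have Y0 x : 0 <= Y x by have /andP[h1 h2] := b01 x; rewrite mulr_ge0.
have YX x : Y x <= X x by have /andP[h1 h2] := b01 x; rewrite ler_piMl.
(* The absolute values satisfy the inequality of the scheme; [c0] is the CFL
   condition. *)
have pw x : `|d' x| + 2 * lam * Y x <= `|d x| + lam * (Y (x + h) + Y (x - h)).
  have /andP[b0 b1] := b01 x.
  pose D z := th * d' z + (1 - th) * d z.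
  have DX z : `|b z * D z| <= Y z.
    have /andP[bz0 bz1] := b01 z.
    rewrite normrM (ger0_norm bz0) ler_wpM2l// (le_trans (ler_normD _ _))// !normrM.
    by rewrite (ger0_norm th0) (ger0_norm th1').
  have E := eqd x; rewrite /= -/(D x) -/(D (x + h)) -/(D (x - h)) in E.
  have c0 : 0 <= 1 - 2 * (lam * (1 - th)) * b x.
    rewrite subr_ge0 (le_trans _ cfl)// ler_piMr// mulr_ge0// mulr_ge0//.
  have c1 : 0 <= 1 + 2 * (lam * th) * b x by rewrite addr_ge0// !mulr_ge0.
  have E2 : d' x * (1 + 2 * (lam * th) * b x) =
      d x * (1 - 2 * (lam * (1 - th)) * b x) + lam * (b (x + h) * D (x + h)
        + b (x - h) * D (x - h)).
    move: E; rewrite /D => E; apply/eqP; rewrite -subr_eq0; move/eqP: E;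
      rewrite -subr_eq0 => /eqP E.
    by apply/eqP; rewrite -[RHS]E; ring.
  have : `|d' x| * (1 + 2 * (lam * th) * b x) <=
      `|d x| * (1 - 2 * (lam * (1 - th)) * b x) + lam * (Y (x + h) + Y (x - h)).
    rewrite -{1}(ger0_norm c1) -normrM E2 (le_trans (ler_normD _ _))//.
    rewrite normrM (ger0_norm c0) lerD2l normrM (ger0_norm lam0) ler_wpM2l//.
    by rewrite (le_trans (ler_normD _ _))// lerD.
  rewrite -subr_ge0 => H; rewrite -subr_ge0.
  by apply: le_trans H _; rewrite le_eqVlt; apply/orP; left; apply/eqP;
    rewrite /Y /X; ring.
have pM f : L1 Om f -> L1 Om (fun x => psi x * f x).
  by move=> fL; have := L1M fL op mp pn; congr L1; apply/funext => x; rewrite mulrC.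
have pMs f c : L1 Om f -> L1 Om (fun x => psi (x + c) * f x).
  move=> fL; have ms : measurable_fun (setT : set mR) (fun x => psi (x + c)).
    exact: (measurableT_comp mp (measurable_shift c)).
  by have := L1M fL (on_dom_shift c op) ms (fun x => pn (x + c)); congr L1;
    apply/funext => x; rewrite mulrC.
have YLp := L1_shift h YL; have YLm := L1_shift (- h) YL.
have H1 : Int Om (fun x => psi x * `|d' x| + 2 * lam * (psi x * Y x)) <=
  Int Om (fun x => psi x * `|d x| + lam * (psi x * Y (x + h) + psi x * Y (x - h))).
  apply: le_I.
  - by apply: L1D; [apply/pM/L1_norm|apply/L1Z/pM].
  - by apply: L1D; [apply/pM/L1_norm|apply/L1Z/L1D; apply: pM].
  - move=> x; have /andP[px _] := p0 x; have := ler_wpM2l px (pw x).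
    by rewrite !mulrDr; congr (_ <= _); ring.
have S1 : Int Om (fun x => psi x * Y (x + h)) = Int Om (fun x => psi (x - h) * Y x).
  rewrite -(@I_shift _ Om (fun x => psi (x - h) * Y x) h); last exact: pMs.
  by apply: eq_I => x; rewrite addrK.
have S2 : Int Om (fun x => psi x * Y (x - h)) = Int Om (fun x => psi (x + h) * Y x).
  rewrite -(@I_shift _ Om (fun x => psi (x + h) * Y x) (- h)); last exact: pMs.
  by apply: eq_I => x; rewrite subrK.
rewrite I_D ?I_Z in H1; try (exact: pM); try (by apply: pM; exact: L1_norm);
  try (by apply: L1Z; exact: pM).
rewrite I_D in H1; try (by apply: pM; exact: L1_norm); try (by apply: L1Z;
  apply: L1D; exact: pM).
rewrite I_Z in H1; last by apply: L1D; exact: pM.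
rewrite I_D in H1; try exact: pM.
rewrite S1 S2 in H1.
(* The second difference of the weight is at most [kap]. *)
have H2 : Int Om (fun x => psi (x - h) * Y x) + Int Om (fun x => psi (x + h)
  * Y x) <=
   2 * Int Om (fun x => psi x * Y x) + kap * Int Om X.
  rewrite -!I_Z// -?I_D//; try (exact: pMs); try (by apply: L1Z; exact: pM);
    try exact: L1Z; try exact: pM.
  apply: le_I.
  - by apply: L1D; exact: pMs.
  - by apply: L1D; apply: L1Z => //; exact: pM.
  move=> x; have := ler_wpM2r (Y0 x) (pk x); have := ler_wpM2l kap0 (YX x).
  rewrite -!mulrDl; lra.
have := ler_wpM2l lam0 H2; rewrite -/X.
move: (Int Om (fun x => psi x * Y x)) H1 => q H1.
rewrite -/(Int Om X); lra.
Qed.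

(** If [T >= M] bounds [u'], then the implicit equation bounds it by the
    average [(M + C T) / (1 + C)] of [M] and [T]. For [T] the supremum this
    forces [T <= M]. *)
Lemma sup_estimate h (lam th M S : R) u u' b : 0 <= lam -> 0 <= th <= 1 ->
  2 * (lam * (1 - th)) <= 1 ->
  (forall x, 0 <= b x <= 1) -> (forall x, `|u x| <= M) ->
    (forall x, `|u' x| <= S) ->
  (forall x, let U z := th * u' z + (1 - th) * u z in
     u' x - u x = lam * (b x * (U (x + h) - 2 * U x + U (x - h)))) ->
  forall x, `|u' x| <= M.
Proof.
move=> lam0 /andP[th0 th1] cfl b01 uM uS equ.
have th1' : 0 <= 1 - th by rewrite subr_ge0.
pose C := 2 * lam * th.
have C0 : 0 <= C by rewrite !mulr_ge0.
(* The bound improves as long as it exceeds [M]. *)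
have key (T : R) : M <= T -> (forall x, `|u' x| <= T) ->
  forall x, `|u' x| <= (M + C * T) / (1 + C).
  move=> MT uT x; have /andP[b0 b1] := b01 x.
  have M0 : 0 <= M by exact: le_trans (uM 0).
  pose c := C * b x.
  have c0 : 0 <= c by rewrite mulr_ge0.
  have cC : c <= C by rewrite ler_piMr.
  have e0 : 0 <= 1 - 2 * (lam * (1 - th)) * b x.
    rewrite subr_ge0 (le_trans _ cfl)// ler_piMr// mulr_ge0// mulr_ge0//.
  have E2 : u' x * (1 + c) = u x * (1 - 2 * (lam * (1 - th)) * b x)
     + lam * b x * th * (u' (x + h) + u' (x - h)) + lam * b x * (1 - th)
       * (u (x + h) + u (x - h)).
    apply/eqP; rewrite -subr_eq0; have := equ x; move/eqP;
      rewrite -subr_eq0 => /eqP E.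
    by apply/eqP; rewrite -[RHS]E /c /C; ring.
  have k1 : 0 <= lam * b x * th by rewrite !mulr_ge0.
  have k2 : 0 <= lam * b x * (1 - th) by rewrite !mulr_ge0.
  have H : `|u' x| * (1 + c) <= M + c * T.
    have c1 : 0 <= 1 + c by rewrite addr_ge0.
    rewrite -{1}(ger0_norm c1) -normrM E2.
    apply: (@le_trans _ _ (M * (1 - 2 * (lam * (1 - th)) * b x)
      + lam * b x * th * (T + T) + lam * b x * (1 - th) * (M + M))).
      rewrite (le_trans (ler_normD _ _))// lerD//; last first.
        rewrite normrM (ger0_norm k2) ler_wpM2l// (le_trans (ler_normD _ _))//
          lerD//.
      rewrite (le_trans (ler_normD _ _))// lerD//.
        by rewrite normrM (ger0_norm e0) ler_wpM2r.
      by rewrite normrM (ger0_norm k1) ler_wpM2l// (le_trans (ler_normD _ _))//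
        lerD.
    by rewrite le_eqVlt; apply/orP; left; apply/eqP; rewrite /c /C; ring.
  have C1 : 0 < 1 + C by rewrite ltr_pwDl.
  have c1 : 0 < 1 + c by rewrite ltr_pwDl.
  have H' : `|u' x| <= (M + c * T) / (1 + c) by rewrite ler_pdivlMr.
  apply: le_trans H' _; rewrite ler_pdivrMr// [leRHS]mulrAC ler_pdivlMr//.
  rewrite -subr_ge0 (_ : _ - _ = (C - c) * (T - M)); last by ring.
  by rewrite mulr_ge0// subr_ge0.
have C1 : 0 < 1 + C by rewrite ltr_pwDl.
pose A := [set `|u' x| | x in setT].
have A0 : A !=set0 by exists `|u' 0|; exists 0.
have Aub : has_ubound A by exists S => _ [x _ <-]; exact: uS.
have uA x : `|u' x| <= sup A by apply: ub_le_sup => //; exists x.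
have [AM|MA] := leP (sup A) M; first by move=> x; exact: le_trans (uA x) AM.
have K := key _ (ltW MA) uA.
have : sup A <= (M + C * sup A) / (1 + C) by apply: ge_sup => // _ [x _ <-];
  exact: K.
rewrite ler_pdivlMr// mulrDr mulr1 (mulrC C) lerD2r => AM x.
by move: MA; rewrite ltNge AM.
Qed.

End Grid.

(** * The initial data: second differences and decay at infinity *)

Section Initial.
Context {R : realType}.
Local Notation mu := (@lebesgue_measure R).
Local Notation mR := (measurableTypeR R).
Implicit Types (Om : domain) (f g u d psi b F : R -> R) (x y h : R).

Definition grid_ok Om h : Prop := 0 < h /\
  match Om with Line => True | Circle => exists2 N : nat,
    (0 < N)%N & h = N%:R^-1 end.

Definition second_diff (a : int -> R) (j : int) : R := a (j + 1)
  - 2 * a j + a (j - 1).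

Lemma ii_le_ILine f x y : x <= y -> L1 Line f -> (forall z, 0 <= f z) ->
  ii x y f <= Int Line f.
Proof.
move=> xy fL f0; have fLI := L1_LI fL.
rewrite /Int /= /ii [leLHS]Rintegral_mkcond; have [_ mf fi] := fL.
apply: le_Rintegral => //.
  by have /integrable_mkcond := fLI.2 x y => /(_ (measurable_itv _));
    rewrite restrict_EFin.
by move=> z _; rewrite patchE; case: ifP.
Qed.

Lemma L1_st_bound Om h (a : int -> R) j : grid_ok Om h -> L1 Om (st h a) ->
  `|a j| * h <= Int Om (fun x => `|st h a x|).
Proof.
move=> [h0 hOm] aL; rewrite -(@ii_cell R h (fun j => `|a j|) j h0);
  last exact: (L1_LI (L1_norm aL)).
case: Om hOm aL => hOm aL.
  apply: (@ii_le_ILine (fun x => `|st h a x|)); [by rewrite (ler_pM2r h0)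
    ler_int lerDl|exact: L1_norm|by move=> z].
apply: (@ii_le_I R Circle (fun x => `|st h a x|)); [by rewrite (ler_pM2r h0)
  ler_int lerDl| |exact: L1_norm|by move=> z].
rewrite intrD mulrDl addrAC subrr add0r mul1r.
by have [N N0 ->] := hOm; rewrite invf_le1 ?ltr0n// ler1n.
Qed.

(** If one jump exceeded the sum of all the second differences, then all the
    following jumps would be larger than a positive constant, and [a] would
    increase at least linearly. That contradicts boundedness on the line and
    periodicity on the circle. *)
Lemma grad_bound_half Om h (a : int -> R) (K M : R) : grid_ok Om h ->
  L1 Om (st h (second_diff a)) ->
  grid_fun Om h a -> (forall j, `|a j| <= M) ->
    Int Om (fun x => `|st h (second_diff a) x|) <= K ->
  forall j, a (j + 1) - a j <= K / h.
Proof.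
move=> [h0 hOm] dL ga aM dK j; rewrite leNgt; apply/negP => aj.
pose e := a (j + 1) - a j - K / h.
have e0 : 0 < e by rewrite subr_gt0.
pose ok (m : nat) := match Om with Line => True | Circle => m%:R * h <= 1 end.
have tel (m : nat) : a (j + m%:Z + 1) - a (j + m%:Z) = a (j + 1)
  - a j + \sum_(i < m) second_diff a (j + 1 + i%:Z).
  elim: m => [|m IH]; first by rewrite big_ord0 !addr0.
  rewrite big_ord_recr/= addrA -IH /second_diff -[m.+1]addn1 PoszD.
  have -> : j + 1 + m%:Z = j + (m%:Z + 1%:Z) by ring.
  have -> : j + (m%:Z + 1%:Z) - 1 = j + m%:Z by ring.
  have -> : j + (m%:Z + 1%:Z) = j + m%:Z + 1 by ring.
  by ring.
have S (m : nat) : ok m -> \sum_(i < m) `|second_diff a (j + 1 + i%:Z)| <= K / h.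
  move=> okm; rewrite ler_pdivlMr// mulr_suml -(@ii_cells _ h (fun j =>
    `|second_diff a j|))//; last exact: (L1_LI (L1_norm dL)).
  apply: le_trans dK.
  have le : (j + 1)%:~R * h <= (j + 1 + m%:Z)%:~R * h by rewrite (ler_pM2r h0)
    ler_int lerDl.
  move: okm; rewrite /ok; case: (Om) dL => dL.
    by move=> _; exact: (@ii_le_ILine (fun x => `|st h (second_diff a) x|)
      _ _ le (L1_norm dL) (fun z => normr_ge0 _)).
  move=> mh; apply: (@ii_le_I R Circle (fun x => `|st h (second_diff a) x|)
    _ _ le _ (L1_norm dL)) => //.
  by rewrite [X in X * _ - _]intrD mulrDl addrAC subrr add0r.
have grow (m : nat) : ok m -> m%:R * e <= a (j + m%:Z) - a j.
  elim: m => [|m IH] okm; first by rewrite mul0r addr0 subrr.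
  have okm' : ok m.
    move: okm; rewrite /ok; case: (Om) => //; apply: le_trans.
    by rewrite (ler_pM2r h0) ler_nat.
  have := IH okm'; have := tel m; have := S m okm'.
  have : `|\sum_(i < m) second_diff a (j + 1 + i%:Z)| <= \sum_(i < m)
    `|second_diff a (j + 1 + i%:Z)| by exact: ler_norm_sum.
  have := ler_norm (- \sum_(i < m) second_diff a (j + 1 + i%:Z)).
  rewrite normrN -[m.+1]addn1 PoszD addrA natrD /e.
  move: (\sum_(i < m) second_diff _ _) (\sum_(i < m) `|second_diff _ _|)
    => s1 s2; move: (K / h) => kh.
  move: (a (j + m%:Z + 1)) (a (j + m%:Z)) => p q; nra.
move: hOm; rewrite /ok in grow; case: (Om) ga grow => ga grow.
  move=> _; pose m := (Num.truncn ((M + M) / e)).+1.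
  have mM : M + M < m%:R * e by rewrite -ltr_pdivrMr//; exact: truncnS_gt.
  have := grow m Logic.I; have := aM (j + m%:Z); have := aM j.
  by rewrite !ler_norml => /andP[h1 h2] /andP[h3 h4]; lra.
move=> [N N0 hN]; have := grow N; rewrite hN mulfV ?pnatr_eq0 -?lt0n// => /(_
  (lexx _)).
by rewrite (ga N hN) subrr; apply/negP; rewrite -ltNge mulr_gt0// ltr0n.
Qed.

Lemma grad_bound Om h (a : int -> R) (K M : R) : grid_ok Om h ->
  L1 Om (st h (second_diff a)) ->
  grid_fun Om h a -> (forall j, `|a j| <= M) ->
    Int Om (fun x => `|st h (second_diff a) x|) <= K ->
  forall j, `|a (j + 1) - a j| <= K / h.
Proof.
move=> hOm dL ga aM dK j; rewrite ler_norml; apply/andP; split;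
  last exact: (grad_bound_half hOm dL ga aM dK).
rewrite lerNl opprB.
have ddN : second_diff (fun j => - a j) = (fun j => - second_diff a j)
  by apply/funext => i; rewrite /second_diff; ring.
have := @grad_bound_half Om h (fun j => - a j) K M hOm.
rewrite ddN => /(_ (L1N dL)) H.
have := H _ _ _ j; rewrite opprK addrC; apply.
- case: Om {hOm dL dK H} ga => /=; last by move=> ga N hN i; rewrite ga.
  by apply: le_lt_trans; apply: le_esum => i _; rewrite /= normrN.
- by move=> i; rewrite normrN.
- by apply: le_trans dK; rewrite le_eqVlt; apply/orP; left; apply/eqP;
    apply: eq_I => x; rewrite /st normrN.
Qed.

(** Summation by parts turns the square of the increment into minus the
    product of [u] with its second difference. *)
Lemma energy_bound Om h u (M : R) : L1 Om u -> (forall x, `|u x| <= M) ->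
  L1 Om (fun x => (u (x + h) - u x) ^+ 2) /\
  Int Om (fun x => (u (x + h) - u x) ^+ 2) <= M * Int Om (fun x => `|u (x + h)
    - 2 * u x + u (x - h)|).
Proof.
move=> uL uM; have uLs := L1_shift h uL; have uLm := L1_shift (- h) uL.
have [ou mu_ _] := uL.
pose A x := u (x + h) - u x.
have AL : L1 Om A by exact: L1B.
have os : on_dom Om (fun x => u (x + h)) by exact: on_dom_shift.
have ms : measurable_fun (setT : set mR) (fun x => u (x + h)) by case: uLs.
have AuL : L1 Om (fun x => A x * u x) by exact: L1M AL ou mu_ uM.
have AsL : L1 Om (fun x => A x * u (x + h)) by apply: (L1M AL os ms) => x;
  exact: uM.
have AmL : L1 Om (fun x => A (x - h) * u x).
  have := L1_shift (- h) AsL; congr L1; apply/funext => x; by rewrite subrK.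
have E : (fun x => (u (x + h) - u x) ^+ 2) = (fun x => A x * u (x + h) - A x * u x).
  by apply/funext => x; rewrite /A; ring.
rewrite E; split; first exact: L1B.
rewrite I_B//.
have -> : Int Om (fun x => A x * u (x + h)) = Int Om (fun x => A (x - h) * u x).
  rewrite -(I_shift h AmL); apply: eq_I => x; by rewrite addrK.
have dL : L1 Om (fun x => u (x + h) - 2 * u x + u (x - h)) by apply: L1D => //;
  apply: L1B => //; exact: L1Z.
rewrite -I_B// -I_Z; last exact: L1_norm.
apply: le_I; [exact: L1B|exact/L1Z/L1_norm|].
move=> x; rewrite (_ : _ - _ = u x * - (u (x + h) - 2 * u x + u (x - h)));
  last by rewrite /A subrK; ring.
by rewrite (le_trans (ler_norm _))// normrM normrN ler_wpM2r.
Qed.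

(** The window [[x - 3 h / 2, x + h / 2]] contains the dual cell of the node
    [floor (x / h) h], over which the datum is averaged. *)
Lemma avg_bound Om h (k K Mp : R) f g psi : 0 < h -> 0 <= k -> 0 <= K ->
  L1 Om f -> (forall x, 0 <= f x) ->
  L1 Om g -> on_dom Om psi -> measurable_fun (setT : set mR) psi ->
    (forall x, 0 <= psi x <= Mp) ->
  (forall x, `|g x| <= k * ii (- (3 / 2 * h)) (h / 2) (fun s => f (x + s))) ->
  (forall s, - (3 / 2 * h) <= s <= h / 2 -> Int Om (fun x => psi x * f (x + s))
    <= K) ->
  Int Om (fun x => psi x * `|g x|) <= 2 * h * k * K.
Proof.
move=> h0 k0 K0 fL f0 gL op mp p0 gk fK.
have pn x : `|psi x| <= Mp by have /andP[h1 h2] := p0 x; rewrite ger0_norm.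
have pM q : L1 Om q -> L1 Om (fun x => psi x * q x).
  by move=> qL; have := L1M qL op mp pn; congr L1; apply/funext => x; rewrite mulrC.
have ab : - (3 / 2 * h) <= h / 2 by lra.
have [mf_ fi_] := L1_LI fL.
have [||||TL TI] := @Tonelli R Om (fun s x => psi x * f (x + s)) (- (3 / 2 * h))
  (h / 2) K ab K0.
- apply: measurable_funM; first exact: (measurableT_comp mp).
  apply: (measurableT_comp mf_).
  by apply: measurable_funD.
- by move=> s x; have /andP[px _] := p0 x; rewrite mulr_ge0.
- by move=> s; apply: on_dom_comp2 => //; apply: on_dom_shift; case: fL.
- move=> s hs; rewrite I_integral ?lee_fin; first exact: fK.
  by apply: pM; exact: L1_shift.
have iE x : ii (- (3 / 2 * h)) (h / 2) (fun s => psi x * f (x + s))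
  = psi x * ii (- (3 / 2 * h)) (h / 2) (fun s => f (x + s)).
  apply: iiZ; have := LI_shift x (L1_LI fL); congr LI; apply/funext => s;
    by rewrite addrC.
apply: (@le_trans _ _ (k * Int Om (fun x => ii (- (3 / 2 * h)) (h / 2)
  (fun s => psi x * f (x + s))))).
  rewrite -I_Z//; apply: le_I; [by apply: pM; exact: L1_norm|exact: L1Z|].
  move=> x; rewrite iE mulrCA; have /andP[px _] := p0 x; exact: ler_wpM2l.
apply: (@le_trans _ _ (k * (K * (h / 2 - - (3 / 2 * h)))));
  first by rewrite ler_wpM2l.
by rewrite le_eqVlt; apply/orP; left; apply/eqP; field.
Qed.

Lemma AC_shift_bound Om F g psi (h K Mp : R) : 0 <= h -> 0 <= K -> AC F g ->
  L1 Om F -> L1 Om g ->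
  on_dom Om psi -> measurable_fun (setT : set mR) psi ->
    (forall x, 0 <= psi x <= Mp) ->
  (forall s, 0 <= s <= h -> Int Om (fun x => psi x * `|g (x + s)|) <= K) ->
  Int Om (fun x => psi x * `|F (x + h) - F x|) <= h * K.
Proof.
move=> h0 K0 [_ Fg] FL gL op mp p0 gK.
have pn x : `|psi x| <= Mp by have /andP[h1 h2] := p0 x; rewrite ger0_norm.
have pM q : L1 Om q -> L1 Om (fun x => psi x * q x).
  by move=> qL; have := L1M qL op mp pn; congr L1; apply/funext => x; rewrite mulrC.
have [mg_ gi_] := L1_LI gL.
have [||||TL TI] := @Tonelli R Om (fun s x => psi x * `|g (x + s)|) 0 h K h0 K0.
- apply: measurable_funM; first exact: (measurableT_comp mp).
  apply: measurableT_comp => //; apply: (measurableT_comp mg_).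
  by apply: measurable_funD.
- by move=> s x; have /andP[px _] := p0 x; rewrite mulr_ge0.
- move=> s; apply: on_dom_comp2 => //; apply: (on_dom_comp (fun y => `|y|)).
  by apply: on_dom_shift; case: gL.
- move=> s hs; rewrite I_integral ?lee_fin; first exact: gK.
  by apply: pM; apply: L1_norm; exact: L1_shift.
have gs x : LI (fun s => g (x + s)).
  have := LI_shift x (L1_LI gL); congr LI; apply/funext => s; by rewrite addrC.
apply: (@le_trans _ _ (Int Om (fun x => ii 0 h (fun s => psi x * `|g (x + s)|)))).
  apply: le_I => //; first by apply: pM; apply: L1_norm; apply: L1B => //;
    exact: L1_shift.
  move=> x; rewrite (iiZ _ _ _ (LI_norm (gs x))); have /andP[px _] := p0 x;
    apply: ler_wpM2l => //.
  rewrite Fg ?lerDl//.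
  have -> : ii x (x + h) g = ii 0 h (fun s => g (x + s)).
    have := @ii_shift R 0 h x g mg_; rewrite add0r (addrC h) => <-.
    by apply: eq_ii => s _; rewrite addrC.
  exact: ii_norm.
by move: TI; rewrite subr0 mulrC.
Qed.

Lemma I1M Om f : Int Om (fun x => 1 * f x) = Int Om f.
Proof. by apply: eq_I => x; rewrite mul1r. Qed.

Lemma ae_shift (P : R -> Prop) (c : R) : {ae mu, forall x, P x} ->
  {ae mu, forall x, P (x + c)}.
Proof.
move=> [N [mN N0 PN]]; exists [set x | N (x + c)]; split.
- exact: measurable_preshift.
- by rewrite -N0 -(pushforward_shift c mN).
- by move=> x /= Px; apply: PN.
Qed.

Lemma ii_le_ae f (a b V : R) : a <= b -> LI f -> (forall x, 0 <= f x) -> 0 <= V ->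
  {ae mu, forall x, a <= x <= b -> f x <= V} -> ii a b f <= V * (b - a).
Proof.
move=> ab fL f0 V0 fV; rewrite -(ii_cst V ab).
have [mf fi] := fL; have [_ ci] := LI_cst V.
rewrite -lee_fin /ii /Rintegral !fineK.
- apply: ae_ge0_le_integral => //.
  + by move=> x _; rewrite lee_fin.
  + exact/measurable_EFinP/measurable_funTS.
- exact: (@integrable_fin_num _ mR R mu _ (measurable_itv `[a, b]) _ (ci a b)).
- exact: (@integrable_fin_num _ mR R mu _ (measurable_itv `[a, b]) _ (fi a b)).
Qed.

Lemma ii_cat_h (a h : R) f n : 0 <= h -> LI f -> \sum_(i < n) ii (a + i%:R * h)
  (a + i%:R * h + h) f = ii a (a + n%:R * h) f.
Proof.
move=> h0 fL; elim: n => [|n IH]; first by rewrite big_ord0 mul0r addr0 ii_xx.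
have E : a + n.+1%:R * h = a + n%:R * h + h by rewrite -natr1 mulrDl mul1r addrA.
rewrite big_ord_recr/= IH E [RHS](@ii_split _ a (a + n%:R * h))//.
- by rewrite lerDl mulr_ge0.
- by rewrite lerDl.
Qed.

(** Integrating over [n] cells is integrating over one cell the sums along the
    translates of the grid; for almost every translate these sums are sums of
    jumps of the representative of bounded variation. *)
Lemma ii_jumps g g' (a h V : R) (n : nat) : 0 < h -> 0 <= V -> LI g ->
  {ae mu, forall x, g x = g' x} ->
  (forall s, a <= s <= a + h -> \sum_(i < n) `|g' (s + i%:R * h + h)
    - g' (s + i%:R * h)| <= V) ->
  ii a (a + n%:R * h) (fun x => `|g (x + h) - g x|) <= h * V.
Proof.
move=> h0 V0 gL gg' hV.
pose G x : R := `|g (x + h) - g x|.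
have GL : LI G by apply: LI_norm; apply: LIB => //; exact: LI_shift.
rewrite -ii_cat_h ?(ltW h0)//.
change (\sum_(i < n) ii (a + i%:R * h) (a + i%:R * h + h) G <= h * V).
have E i : ii (a + i%:R * h) (a + i%:R * h + h) G = ii a (a + h)
  (fun x => G (x + i%:R * h)).
  by have [mG _] := GL; rewrite ii_shift// (addrAC a h).
rewrite (eq_bigr (fun i : 'I_n => ii a (a + h) (fun x => G (x + i%:R * h))));
  last by move=> i _; exact: E.
have [SL SE] := @ii_sum R a (a + h) (fun i x => G (x + i%:R * h))
  n (fun i => LI_shift _ GL).
rewrite -SE mulrC (_ : V * h = V * (a + h - a)); last by ring.
apply: ii_le_ae => //.
- by rewrite lerDl ltW.
- by move=> x; apply: sumr_ge0 => i _; rewrite /G.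
have H : {ae mu, forall x, forall i : nat, g (x + i%:R * h) = g' (x + i%:R * h)}.
  by apply: ae_foralln => i; exact: ae_shift gg'.
apply: ae_imp H => x Hx ax; apply: le_trans (hV x ax).
rewrite le_eqVlt; apply/orP; left; apply/eqP; apply: eq_bigr => i _.
rewrite /G Hx; have := Hx i.+1; rewrite -natr1 mulrDl mul1r addrA => ->//.
Qed.

Lemma jumps_TV g' (s h : R) n : 0 <= h ->
  ((\sum_(i < n) `|g' (s + i%:R * h + h) - g' (s + i%:R * h)|)%:E <=
    total_variation s (s + n%:R * h) g')%E.
Proof.
move=> h0; elim: n => [|n IH]; first by rewrite big_ord0 mul0r addr0
  total_variationxx.
have E : s + n.+1%:R * h = s + n%:R * h + h by rewrite -natr1 mulrDl mul1r addrA.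
have h1 : s <= s + n%:R * h by rewrite lerDl mulr_ge0.
have h2 : s + n%:R * h <= s + n%:R * h + h by rewrite lerDl.
rewrite E big_ord_recr/= (total_variationD _ h1 h2) EFinD leeD//.
exact: total_variation_ge.
Qed.

Lemma TV_mono g' (a b c d : R) : a <= c -> c <= d -> d <= b ->
  (total_variation c d g' <= total_variation a b g')%E.
Proof.
move=> ac cd db; rewrite (total_variationD _ ac (le_trans cd db))
  (total_variationD _ cd db).
have h1 := total_variation_ge0 g' ac; have h2 := total_variation_ge0 g' db.
by apply: le_trans (leeDr _ h1); apply: leeDl.
Qed.

Lemma BV_window g g' (a b h V : R) : 0 < h -> 0 <= V -> LI g ->
  {ae mu, forall x, g x = g' x} -> a <= b ->
  (total_variation a (b + 2 * h) g' <= V%:E)%E -> ii a b (fun x => `|g (x + h)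
    - g x|) <= h * V.
Proof.
move=> h0 V0 gL gg' ab hV; pose n := (Num.truncn ((b - a) / h)).+1.
have n1 : b <= a + n%:R * h by rewrite -lerBlDl -ler_pdivrMr//;
  apply/ltW/truncnS_gt.
have n2 : n%:R * h <= b - a + h.
  rewrite -natr1 mulrDl mul1r lerD2r -ler_pdivlMr//.
  by rewrite truncn_le divr_ge0 ?subr_ge0// ltW.
pose G x : R := `|g (x + h) - g x|.
have GL : LI G by apply: LI_norm; apply: LIB => //; exact: LI_shift.
apply: (@le_trans _ _ (ii a (a + n%:R * h) G)).
  by rewrite [leRHS](@ii_split _ a b)// lerDl; apply: ii_ge0 => x _; rewrite /G.
apply: (@ii_jumps g g') => // s /andP[s1 s2]; rewrite -lee_fin.
apply: le_trans hV; apply: le_trans (jumps_TV g' s n (ltW h0)) _.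
by apply: TV_mono => //; [rewrite lerDl mulr_ge0// ltW|lra].
Qed.

(** On the circle the last jump straddles the end of the period. It is the
    difference between the values at the two ends of the other jumps, which
    costs the variation a second time: hence the factor 2. *)
Lemma BV_shift Om g g' h (V : R) : grid_ok Om h -> h <= 1 -> 0 <= V -> L1 Om g ->
  {ae mu, forall x, g x = g' x} ->
  on_dom Om g' ->
  (forall a b : R, a <= b -> `[a, b] `<=` dom Om ->
    (total_variation a b g' <= V%:E)%E) ->
  Int Om (fun x => `|g (x + h) - g x|) <= 2 * V * h.
Proof.
move=> [h0 hOm] h1 V0 gL gg' og' hV; have gLI := L1_LI gL.
have V2 : h * V <= 2 * V * h by have := mulr_ge0 V0 (ltW h0); nra.
case: Om hOm gL og' hV => /=.
  move=> _ gL _ hV; apply: le_trans V2.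
  have GL : L1 Line (fun x => `|g (x + h) - g x|) by apply: L1_norm;
    apply: L1B => //; exact: L1_shift.
  have [] // := @windows_L1 R (fun x => `|g (x + h) - g x|) (h * V) (L1_LI GL).
  move=> n; apply: (@BV_window g g') => //; first by rewrite (@le_trans _ _ 0)//
    oppr_le0.
  apply: hV => //; rewrite (@le_trans _ _ 0)// ?oppr_le0// addr_ge0// mulr_ge0//
    ltW//.
move=> [N N0 hN] gL pg' hV.
have E : Int Circle (fun x => `|g (x + h) - g x|) = ii 0 (0 + N%:R * h)
  (fun x => `|g (x + h) - g x|).
  by rewrite add0r hN mulfV// pnatr_eq0 -lt0n.
rewrite E [leRHS]mulrC; clear E; have V02 : 0 <= 2 * V by rewrite mulr_ge0.
refine (ii_jumps h0 V02 gLI gg' _).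
move=> s; rewrite add0r => /andP[s0 sh].
case: N N0 hN => // N _ hN.
have Nh : N%:R * h = 1 - h.
  have : N.+1%:R * h = 1 by rewrite hN mulfV// pnatr_eq0.
  by rewrite -natr1 mulrDl mul1r => /(canRL (addrK _)).
have sN0 : s <= s + N%:R * h by rewrite lerDl mulr_ge0// ltW.
have TV1 : (total_variation s (s + N%:R * h) g' <= V%:E)%E.
  by apply: hV => //; apply: subset_itv; rewrite bnd_simp//; lra.
rewrite big_ord_recr/= (_ : 2 * V = V + V); last by ring.
apply: lerD; rewrite -lee_fin; first exact: le_trans (jumps_TV _ _ _ (ltW h0)) TV1.
have -> : s + N%:R * h + h = s + 1 by rewrite Nh; ring.
rewrite pg' distrC; exact: le_trans (total_variation_ge _ sN0) TV1.
Qed.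

(** The variation over [[- n, n]] increases to a finite supremum. By
    additivity, little variation is left outside a window that almost attains
    it. *)
Lemma TV_tail g' (V e : R) : 0 < e ->
  (forall a b : R, a <= b -> (total_variation a b g' <= V%:E)%E) ->
  exists n0 : nat, forall b : R, n0%:R <= b ->
    (total_variation n0%:R b g' <= e%:E)%E /\ (total_variation (- b) (- n0%:R)
      g' <= e%:E)%E.
Proof.
move=> e0 hV.
have nn (n : nat) : - n%:R <= n%:R :> R by rewrite (@le_trans _ _ 0)// oppr_le0.
have fn (a b : R) : a <= b -> (total_variation a b g' \is a fin_num)%E.
  move=> ab; rewrite ge0_fin_numE; last exact: total_variation_ge0.
  exact: le_lt_trans (hV a b ab) (ltry _).
pose T (n : nat) := fine (total_variation (- n%:R) n%:R g').
have TE n : (total_variation (- n%:R) n%:R g' = (T n)%:E)%E by rewrite /T fineK//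
  fn.
pose A := [set T n | n in setT].
have hA : has_sup A.
  split; first by exists (T 0%N); exists 0%N.
  by exists V => _ [n _ <-]; rewrite -lee_fin -TE hV.
have [_ [n0 _ <-] h] := sup_adherent e0 hA.
exists n0 => b nb.
pose n := (maxn n0 (Num.truncn b).+1).
have n0n : (n0 <= n)%N by rewrite leq_maxl.
have bn : b <= n%:R.
  by apply/ltW/(lt_le_trans (truncnS_gt _)); rewrite ler_nat leq_maxr.
have n0n' : n0%:R <= n%:R :> R by rewrite ler_nat.
have Tn : T n <= sup A by apply: ub_le_sup; [case: hA|exists n].
have := TE n; rewrite (@total_variationD _ _ _ (- n0%:R))
  ?lerN2// ?(le_trans (nn n0))//.
rewrite (@total_variationD _ (- n0%:R) _ n0%:R)// TE.
have f1 := fn (- n%:R) (- n0%:R); have f2 := fn n0%:R n%:R; rewrite lerN2 in f1.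
rewrite -(fineK (f1 n0n')) -(fineK (f2 n0n')) -!EFinD => -[] H.
have t1 : 0 <= fine (total_variation (- n%:R) (- n0%:R) g')
  by rewrite fine_ge0// total_variation_ge0// lerN2.
have t2 : 0 <= fine (total_variation n0%:R n%:R g')
  by rewrite fine_ge0// total_variation_ge0.
split.
  apply: (@le_trans _ _ (total_variation n0%:R n%:R g')); first exact: TV_mono.
  rewrite -(fineK (f2 n0n')) lee_fin; lra.
apply: (@le_trans _ _ (total_variation (- n%:R) (- n0%:R) g'));
  first by apply: TV_mono; rewrite ?lerN2.
rewrite -(fineK (f1 n0n')) lee_fin; lra.
Qed.

Lemma L1_tail f (e : R) : 0 < e -> L1 Line f -> (forall x, 0 <= f x) ->
  exists n0 : nat, forall b : R, n0%:R <= b -> ii n0%:R b f <= e /\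
    ii (- b) (- n0%:R) f <= e.
Proof.
move=> e0 fL f0; have fLI := L1_LI fL.
have [n0 hn0] : exists n : nat, Int Line f - e < ii (- n%:R) n%:R f.
  apply: contrapT => /forallNP h.
  have [] := @windows_L1 R f (Int Line f - e) fLI f0.
    by move=> n; rewrite leNgt; apply/negP; exact: h.
  by move=> _; rewrite leNgt ltrBlDr ltrDl e0.
exists n0 => b nb.
have h1 : - n0%:R <= n0%:R :> R by rewrite (@le_trans _ _ 0)// oppr_le0.
have h2 : - n0%:R <= b by exact: le_trans nb.
have h3 : - b <= - n0%:R by rewrite lerN2.
have h4 : - b <= n0%:R by exact: le_trans h1.
have k1 := ii_le_ILine h2 fL f0; have k2 := ii_le_ILine h4 fL f0.
rewrite (@ii_split _ _ n0%:R)// in k1; rewrite (@ii_split _ _ (- n0%:R))// in k2.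
split; lra.
Qed.

(** A smooth substitute for the indicator of the points beyond [r]: it is
    small on bounded sets, at least 1/2 beyond [r], and its second differences
    are small enough to be absorbed over bounded times when [r] is large. *)
Definition weight (r x : R) : R := x ^+ 2 / (r ^+ 2 + x ^+ 2).

Lemma weight_01 r x : 0 < r -> 0 <= weight r x <= 1.
Proof.
move=> r0; have d0 : 0 < r ^+ 2 + x ^+ 2 by rewrite ltr_pwDl ?exprn_gt0// sqr_ge0.
rewrite /weight divr_ge0 ?sqr_ge0 ?(ltW d0)//= ler_pdivrMr// mul1r lerDr sqr_ge0//.
Qed.

Lemma weight_small r x (c : R) : 0 < r -> `|x| <= c ->
  weight r x <= c ^+ 2 / r ^+ 2.
Proof.
move=> r0 xc; have d0 : 0 < r ^+ 2 + x ^+ 2 by rewrite ltr_pwDl ?exprn_gt0//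
  sqr_ge0.
have r2 : 0 < r ^+ 2 by rewrite exprn_gt0.
apply: ler_pM; rewrite ?sqr_ge0 ?invr_ge0 ?(ltW d0)//.
  by rewrite -(real_normK (num_real x)) lerXn2r ?nnegrE// (le_trans _ xc).
by rewrite lef_pV2 ?posrE// lerDl sqr_ge0.
Qed.

Lemma weight_big r x : 0 < r -> r <= `|x| -> 1 / 2 <= weight r x.
Proof.
move=> r0 rx; have d0 : 0 < r ^+ 2 + x ^+ 2 by rewrite ltr_pwDl ?exprn_gt0//
  sqr_ge0.
have : r ^+ 2 <= x ^+ 2 by rewrite -(real_normK (num_real x)) lerXn2r ?nnegrE// ltW.
rewrite /weight ler_pdivlMr//; lra.
Qed.

Lemma weight_dd r x h : 0 < r -> weight r (x + h)
  - 2 * weight r x + weight r (x - h) <= 4 * h ^+ 2 / r ^+ 2.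
Proof.
move=> r0; have r2 : 0 < r ^+ 2 by rewrite exprn_gt0.
rewrite /weight.
have d0 y : 0 < r ^+ 2 + y ^+ 2 by rewrite ltr_pwDl// sqr_ge0.
have E y : y ^+ 2 / (r ^+ 2 + y ^+ 2) = 1 - r ^+ 2 / (r ^+ 2 + y ^+ 2).
  by field; rewrite gt_eqF.
rewrite !E.
have d1 := d0 (x + h); have d2 := d0 x; have d3 := d0 (x - h).
rewrite -subr_ge0.
have -> : 4 * h ^+ 2 / r ^+ 2 - (1 - r ^+ 2 / (r ^+ 2 + (x + h) ^+ 2)
  - 2 * (1 - r ^+ 2 / (r ^+ 2 + x ^+ 2)) +
   (1 - r ^+ 2 / (r ^+ 2 + (x - h) ^+ 2))) =
  2 * h ^+ 2 * (2 * ((r ^+ 2 + (x + h) ^+ 2) * (r ^+ 2 + x ^+ 2)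
    * (r ^+ 2 + (x - h) ^+ 2)) + r ^+ 4 * (3 * x ^+ 2 - r ^+ 2 - h ^+ 2))
   / (r ^+ 2 * ((r ^+ 2 + (x + h) ^+ 2) * (r ^+ 2 + x ^+ 2) * (r ^+ 2 + (x - h)
     ^+ 2))).
  by field; rewrite !gt_eqF.
apply: divr_ge0; last by rewrite !mulr_ge0// ltW.
apply: mulr_ge0; first by rewrite mulr_ge0// sqr_ge0.
(* The numerator is a combination of [k1] to [k6] with nonnegative
   coefficients. *)
set X := x ^+ 2; set H := h ^+ 2; set Q := r ^+ 2 in r2 *.
have X0 : 0 <= X by rewrite sqr_ge0.
have H0 : 0 <= H by rewrite sqr_ge0.
have -> : r ^+ 4 = Q ^+ 2 by rewrite /Q -exprM.
have -> : (Q + (x + h) ^+ 2) * (Q + X) * (Q + (x - h) ^+ 2) = ((Q + X + H)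
  ^+ 2 - 4 * X * H) * (Q + X).
  by rewrite /X /H; ring.
have -> : (Q + X + H) ^+ 2 - 4 * X * H = Q ^+ 2 + 2 * Q * (X + H) + (X - H)
  ^+ 2 by ring.
have Q0 := ltW r2.
have k1 : 0 <= (X - H) ^+ 2 * (Q + X) by rewrite mulr_ge0 ?sqr_ge0// addr_ge0.
have k2 : 0 <= Q * X * X by apply: mulr_ge0 => //; apply: mulr_ge0.
have k3 : 0 <= Q * X * H by apply: mulr_ge0 => //; apply: mulr_ge0.
have k4 : 0 <= Q * Q * H by apply: mulr_ge0 => //; apply: mulr_ge0.
have k5 : 0 <= Q * Q * X by apply: mulr_ge0 => //; apply: mulr_ge0.
have k6 : 0 <= Q * Q * Q by apply: mulr_ge0 => //; apply: mulr_ge0.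
rewrite (_ : _ + _ = Q * Q * Q + 9 * (Q * Q * X) + 3 * (Q * Q * H)
  + 4 * (Q * X * X) + 4 * (Q * X * H) + 2 * ((X - H) ^+ 2 * (Q + X))).
  by rewrite !addr_ge0// mulr_ge0.
by ring.
Qed.

Lemma measurable_weight r : 0 < r -> measurable_fun (setT : set mR) (weight r).
Proof.
move=> r0; apply: continuous_measurable_fun => x; apply: cvgM.
  exact: exprn_continuous.
apply: cvgV; first by rewrite gt_eqF// ltr_pwDl ?exprn_gt0// sqr_ge0.
by apply: cvgD; [exact: cvg_cst|exact: exprn_continuous].
Qed.

(** The mass beyond [n0] is small, and on the remaining bounded set, enlarged
    by the translation, the weight is small. *)
Lemma tail_weight f (K e r c : R) (n0 : nat) : L1 Line f ->
  (forall x, 0 <= f x) -> Int Line f <= K ->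
  (forall b : R, n0%:R <= b -> ii n0%:R b f <= e /\ ii (- b) (- n0%:R) f <= e) ->
  0 < r -> `|c| <= 3 -> Int Line (fun x => weight r x * f (x + c))
    <= K * ((n0%:R + 3) ^+ 2 / r ^+ 2) + 2 * e.
Proof.
move=> fL f0 fK tl r0 c3; have fLI := L1_LI fL; have [_ mf fi] := fL.
have w01 x := weight_01 x r0.
have mw := measurable_weight r0.
have mws : measurable_fun (setT : set mR) (fun x => weight r (x - c)).
  exact: (measurableT_comp mw (measurable_shift (- c))).
have wn x : `|weight r (x - c)| <= 1 by have /andP[h1 h2] := w01 (x - c);
  rewrite ger0_norm.
have wfL : L1 Line (fun x => weight r (x - c) * f x).
  by have := L1M fL (Logic.I : on_dom Line (fun x => weight r (x - c))) mws wn;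
    congr L1; apply/funext => x; rewrite mulrC.
have -> : Int Line (fun x => weight r x * f (x + c))
  = Int Line (fun x => weight r (x - c) * f x).
  by rewrite -(I_shift c wfL); apply: eq_I => x; rewrite addrK.
pose f1 x : R := if n0%:R < x then f x else 0.
pose f2 x : R := if x < - n0%:R then f x else 0.
have mf1 : measurable_fun (setT : set mR) f1.
  apply: measurable_fun_ifT => //; apply: measurable_fun_ltr => //.
have mf2 : measurable_fun (setT : set mR) f2.
  apply: measurable_fun_ifT => //; apply: measurable_fun_ltr => //.
have f1L : L1 Line f1.
  by apply: (L1_le _ mf1 fL) => // x; rewrite /f1; case: ifP => _;
    rewrite ?normr0// ger0_norm.
have f2L : L1 Line f2.
  by apply: (L1_le _ mf2 fL) => // x; rewrite /f2; case: ifP => _;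
    rewrite ?normr0// ger0_norm.
have f10 x : 0 <= f1 x by rewrite /f1; case: ifP.
have f20 x : 0 <= f2 x by rewrite /f2; case: ifP.
have nn : - n0%:R <= n0%:R :> R by rewrite (@le_trans _ _ 0)// oppr_le0.
have I1 : Int Line f1 <= e.
  have [] // := @windows_L1 R f1 e (L1_LI f1L) f10.
  move=> n; pose N : R := n%:R + n0%:R.
  have nN : n%:R <= N by rewrite lerDl.
  have n0N : n0%:R <= N by rewrite lerDr.
  apply: (@le_trans _ _ (ii (- N) N f1)).
    rewrite [leRHS](@ii_split _ _ (- n%:R))//; last 3 first.
    - exact: L1_LI f1L.
    - by rewrite lerN2.
    - by rewrite (le_trans _ nN)// (@le_trans _ _ 0)// oppr_le0.
    rewrite (@ii_split _ (- n%:R) n%:R N)//; last 2 first.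
    - exact: L1_LI f1L.
    - by rewrite (@le_trans _ _ 0)// oppr_le0.
    by rewrite addrCA lerDl addr_ge0//; apply: ii_ge0.
  rewrite (@ii_split _ _ n0%:R)//; last 2 first.
  - exact: L1_LI f1L.
  - by rewrite (@le_trans _ _ 0)// oppr_le0 (le_trans _ n0N).
  rewrite (@eq_ii _ _ _ f1 (fun=> 0)); last first.
    by move=> x /andP[_ xn]; rewrite /f1 ltNge xn.
  rewrite /ii {1}Rintegral_cst// mul0r add0r -/(ii n0%:R N f1).
  have [h1 _] := tl N n0N; apply: le_trans h1.
  apply: le_ii => //; first exact: L1_LI f1L.
  by move=> x _; rewrite /f1; case: ifP.
have I2 : Int Line f2 <= e.
  have [] // := @windows_L1 R f2 e (L1_LI f2L) f20.
  move=> n; pose N : R := n%:R + n0%:R.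
  have nN : n%:R <= N by rewrite lerDl.
  have n0N : n0%:R <= N by rewrite lerDr.
  apply: (@le_trans _ _ (ii (- N) N f2)).
    rewrite [leRHS](@ii_split _ _ (- n%:R))//; last 3 first.
    - exact: L1_LI f2L.
    - by rewrite lerN2.
    - by rewrite (le_trans _ nN)// (@le_trans _ _ 0)// oppr_le0.
    rewrite (@ii_split _ (- n%:R) n%:R N)//; last 2 first.
    - exact: L1_LI f2L.
    - by rewrite (@le_trans _ _ 0)// oppr_le0.
    by rewrite addrCA lerDl addr_ge0//; apply: ii_ge0.
  rewrite (@ii_split _ _ (- n0%:R))//; last 3 first.
  - exact: L1_LI f2L.
  - by rewrite lerN2.
  - by rewrite (@le_trans _ _ 0)// ?oppr_le0// (le_trans _ n0N).
  rewrite [X in _ + X](@eq_ii _ _ _ f2 (fun=> 0)); last first.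
    by move=> x /andP[xn _]; rewrite /f2 ltNge xn.
  have -> : ii (- n0%:R) N (fun=> 0 : R) = 0 by rewrite /ii Rintegral_cst// mul0r.
  rewrite addr0.
  have [_ h1] := tl N n0N; apply: le_trans h1.
  apply: le_ii => //; first exact: L1_LI f2L.
  by move=> x _; rewrite /f2; case: ifP.
set q := (n0%:R + 3) ^+ 2 / r ^+ 2.
have q0 : 0 <= q by rewrite divr_ge0// sqr_ge0.
apply: (@le_trans _ _ (Int Line (fun x => q * f x + (f1 x + f2 x)))).
  apply: le_I => //; first by apply: L1D; [exact: L1Z|exact: L1D].
  move=> x; have /andP[w0 w1] := w01 (x - c).
  have [xn|nx] := leP `|x| n0%:R.
    apply: (@le_trans _ _ (q * f x)); last by rewrite lerDl addr_ge0.
    rewrite ler_wpM2r// weight_small// (le_trans (ler_normB _ _))// lerD//.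
  apply: (@le_trans _ _ (f1 x + f2 x)); last by rewrite lerDr mulr_ge0.
  apply: (@le_trans _ _ (f x)); first by rewrite ler_piMl.
  move: nx; rewrite ltr_normr => /orP[h|h].
    by rewrite /f1 h lerDl.
  by rewrite /f2 ltrNr h lerDr.
rewrite I_D; [|exact: L1Z|exact: L1D].
rewrite I_Z// I_D//.
have := ler_wpM2l q0 fK; rewrite -/q; lra.
Qed.

End Initial.

(** * Sobolev norms and the hypotheses on the data *)

Section Data.
Context {R : realType}.
Local Notation mu := (@lebesgue_measure R).
Local Notation mR := (measurableTypeR R).
Implicit Types (Om : domain) (f g u d psi b F : R -> R) (x y h : R).

Lemma integral_mrestr (D : set R) (mD : measurable (D : set mR)) (F : R -> \bar R) :
  measurable_fun (setT : set mR) F -> (forall x, 0 <= F x)%E ->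
  (\int[mrestr mu mD]_x F x = \int[mu]_(x in D) F x)%E.
Proof.
move=> mF F0.
have mDC : measurable (~` D : set mR) by exact: measurableC.
rewrite (@ge0_negligible_integral _ mR R (mrestr mu mD) setT (~` D) F)//;
  last first.
  by rewrite /= /mrestr setICl measure0.
rewrite setTD setCK; apply: eq_measure_integral => A mA AD.
by rewrite /= /mrestr setIidl.
Qed.

(** Countably many translates of one period cover the line. *)
Lemma ae_dom_inv Om (P : R -> Prop) : (Om = Circle -> forall x,
  P (x + 1) <-> P x) ->
  {ae mu_dom Om, forall x, P x} -> {ae mu, forall x, P x}.
Proof.
move=> per [N [mN N0 PN]].
have {N0 mN PN} H : {ae mu, forall x, dom Om x -> P x}.
  exists (N `&` dom Om); split => //; first by apply: measurableI => //;
    exact: measurable_dom.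
  by move=> x /= /not_implyP[Dx Px]; split => //; exact: PN.
case: Om per H => /= [_|/(_ erefl) per H].
  by apply: ae_imp => x; apply.
have pern (n : nat) x : P (x + n%:R) <-> P x.
  elim: n x => [|n IH] x; first by rewrite addr0.
  by rewrite -natr1 addrA per.
have Hn : {ae mu, forall x, forall n : nat, (0 <= x + n%:R <= 1 ->
  P x) /\ (0 <= x - n%:R <= 1 -> P x)}.
  apply: ae_foralln => n; apply: ae_and.
    apply: ae_imp (ae_shift n%:R H) => x Hx; move=> h.
    by apply/(pern n); apply: Hx; rewrite /= in_itv/= h.
  apply: ae_imp (ae_shift (- n%:R) H) => x Hx; move=> h.
  by rewrite -(subrK n%:R x); apply/(pern n); apply: Hx; rewrite /= in_itv/= h.
apply: ae_imp Hn => x Hx.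
have [h1 h2] := (Num.Theory.floor_le x, Num.Theory.floorD1_gt x).
case E : (Num.floor x) h1 h2 => [n|n] h1 h2; have [k1 k2] := Hx n.
  by apply: k2; apply/andP; split; move: h1 h2; rewrite intrD -pmulrn; lra.
have [{}k1 _] := Hx n.+1; apply: k1; move: h1 h2;
  rewrite NegzE intrD intrN -pmulrn => h1 h2.
by apply/andP; split; lra.
Qed.

Lemma Lfun1_L1 Om f : on_dom Om f -> f \in Lfun (mu_dom Om) 1%E -> L1 Om f.
Proof.
move=> of_ /Lfun1_integrable /integrableP[mf fi].
have mf' : measurable_fun (setT : set mR) f by exact/measurable_EFinP.
split => //; apply/integrableP; split; first
  exact/measurable_EFinP/measurable_funTS.
rewrite -(@integral_mrestr _ (measurable_dom Om))//.
by apply: measurableT_comp => //; exact/measurable_EFinP.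
Qed.

Lemma mrestr_normE Om f : L1 Om f -> (\int[mu_dom Om]_x `|(f x)%:E| = (Int Om
  (fun x => `|f x|))%:E)%E.
Proof.
move=> [of_ mf fi]; rewrite integral_mrestr//; last first.
  by apply: measurableT_comp => //; exact/measurable_EFinP.
by rewrite -I_integral//; apply: L1_norm.
Qed.

Lemma L1_Lfun1 Om f : L1 Om f -> f \in Lfun (mu_dom Om) 1%E.
Proof.
move=> fL; have [of_ mf fi] := fL; apply/Lfun1_integrable/integrableP; split.
  exact/measurable_EFinP.
by rewrite mrestr_normE// ltry.
Qed.

Lemma Lnorm1E Om f : L1 Om f -> ('N[mu_dom Om]_1[EFin \o f]
  = (Int Om (fun x => `|f x|))%:E)%E.
Proof. by move=> fL; rewrite Lnorm1 mrestr_normE. Qed.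

Lemma L1_ae Om f g : L1 Om f -> on_dom Om g -> measurable_fun (setT : set mR) g ->
  {ae mu, forall x, f x = g x} -> L1 Om g /\ Int Om g = Int Om f.
Proof.
move=> fL og mg fg; have [of_ mf fi] := fL.
have mD := measurable_dom (R := R) Om.
have E : (\int[mu]_(x in dom Om) `|(g x)%:E| = (Int Om (fun x => `|f x|))%:E)%E.
  rewrite -I_integral; last exact: L1_norm.
  apply: ge0_ae_eq_integral => //.
  - by apply: measurableT_comp => //; exact/measurable_EFinP/measurable_funTS.
  - by apply/measurable_EFinP; apply: measurableT_comp => //;
      exact: measurable_funTS.
  - by apply: ae_imp fg => x -> _.
split; first by apply: (@L1_bounded_integral R Om g (Int Om (fun x => `|f x|))
  _ _ _).1 => //; rewrite -E.
rewrite /Int /Rintegral; congr fine; apply: ae_eq_integral => //.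
- exact/measurable_EFinP/measurable_funTS.
- exact/measurable_EFinP/measurable_funTS.
- by apply: ae_imp fg => x -> _.
Qed.

Lemma ii_ae f g (a c : R) : LI f -> LI g -> {ae mu, forall x, f x = g x} ->
  ii a c f = ii a c g.
Proof.
move=> [mf _] [mg _] fg; rewrite /ii /Rintegral; congr fine;
  apply: ae_eq_integral => //.
- exact/measurable_EFinP/measurable_funTS.
- exact/measurable_EFinP/measurable_funTS.
- by apply: ae_imp fg => x -> _.
Qed.

(** Norms in W^(1,1) become integrals of the members of the pair, which is the
    form in which they are estimated. *)
Lemma W1norm_AC Om f g : AC f g -> L1 Om f -> L1 Om g -> W1 Om 1%E f /\
  W1norm Om 1%E f = (Int Om (fun x => `|f x|) + Int Om (fun x => `|g x|))%:E.
Proof.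
move=> fg fL gL; have [of_ mf _] := fL; have [og mg _] := gL.
have [W wg] := weak_derive_AC of_ og fg.
have [[_ ow] _ [mw _] _] := is_weak_derive_line W.
have gw : {ae mu, forall x, `|g x| = `|weak_derive Om f x|} by apply: ae_imp wg
  => x ->.
have [wL _] := L1_ae gL ow mw (ae_imp (fun x (h : weak_derive Om f x = g x)
  => esym h) wg).
have [_ E] := L1_ae (L1_norm gL) (on_dom_comp _ ow)
  (measurableT_comp (@normr_measurable R setT) mw) gw.
have H : W1 Om 1%E f by split; [exact: L1_Lfun1|exists g;
  exact: AC_is_weak_derive|exact: L1_Lfun1].
split => //; rewrite /W1norm asboolT// !Lnorm1E// EFinD; congr (_ + _)%E;
  congr EFin.
exact: E.
Qed.

Lemma Lnorm2E Om f : measurable_fun (setT : set mR) f ->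
  L1 Om (fun x => f x ^+ 2) ->
  ('N[mu_dom Om]_2%:E[EFin \o f] = (Int Om (fun x => f x ^+ 2) `^ 2^-1)%:E)%E.
Proof.
move=> mf f2L; rewrite unlock /Lnorm.
have -> : (\int[mu_dom Om]_x `|(EFin \o f) x| `^ 2 = (Int Om (fun x => f x ^+
  2))%:E)%E.
  rewrite -I_integral// -(@integral_mrestr _ (measurable_dom Om)); first last.
  - by move=> x; rewrite lee_fin sqr_ge0.
  - by have [_ mf2 _] := f2L; exact/measurable_EFinP.
  by apply: eq_integral => x _ /=; rewrite powR_mulrn// real_normK// num_real.
by rewrite poweR_EFin.
Qed.

Lemma Lnorm2_weak Om f g : AC f g -> on_dom Om f -> on_dom Om g ->
  L1 Om (fun x => g x ^+ 2) ->
  ('N[mu_dom Om]_2%:E[EFin \o weak_derive Om f] = (Int Om (fun x => g x ^+ 2)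
    `^ 2^-1)%:E)%E.
Proof.
move=> fg of_ og gL.
have [W wg] := weak_derive_AC of_ og fg.
have [[_ ow] _ [mw _] _] := is_weak_derive_line W.
have gw : {ae mu, forall x, g x ^+ 2 = weak_derive Om f x ^+ 2} by apply: ae_imp
  wg => x ->.
have [wL E] := L1_ae gL (on_dom_comp (fun y => y ^+ 2) ow) (measurable_funX 2 mw)
  gw.
by rewrite (Lnorm2E mw wL) E.
Qed.

Lemma W1norm2_AC Om f g : AC f g -> on_dom Om f -> on_dom Om g ->
  L1 Om (fun x => f x ^+ 2) ->
  L1 Om (fun x => g x ^+ 2) ->
  W1norm Om 2%:E f = (Int Om (fun x => f x ^+ 2)
    `^ 2^-1 + Int Om (fun x => g x ^+ 2) `^ 2^-1)%:E.
Proof.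
move=> fg of_ og fL gL.
have [W _] := weak_derive_AC of_ og fg.
have [_ [mf _] [mw _] _] := is_weak_derive_line W.
have N1 := Lnorm2E mf fL; have N2 := Lnorm2_weak fg of_ og gL.
have inL u r : measurable_fun (setT : set mR) u -> ('N[mu_dom Om]_2%:E[EFin \o u]
  = r%:E)%E -> u \in Lfun (mu_dom Om) 2%:E.
  by move=> mu_ Nu; rewrite inE; apply/andP; split;
    rewrite inE//= /finite_norm Nu ltry.
have H : W1 Om 2%:E f.
  split; [exact: inL mf N1|exists g; exact: AC_is_weak_derive|exact: inL mw N2].
by rewrite /W1norm asboolT// N1 N2.
Qed.

(** Since [g] is periodic, the increment of [F] over a period is constant; it
    is 0 because [F] agrees almost everywhere with a periodic function. *)
Lemma AC_periodic F g w0 : AC F g -> on_dom Circle g -> on_dom Circle w0 ->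
  {ae mu, forall x, w0 x = F x} -> on_dom Circle F.
Proof.
move=> [gL Fg] og ow wF x.
have cst y z : y <= z -> F (y + 1) - F y = F (z + 1) - F z.
  move=> yz; have [mg _] := gL.
  have := Fg _ _ yz; have yz1 : y + 1 <= z + 1 by rewrite lerD2r.
  have := Fg _ _ yz1; rewrite -(ii_shift _ _ _ mg).
  rewrite (@eq_ii _ _ _ (fun x => g (x + 1)) g); last by move=> *; exact: og.
  lra.
have : {ae mu, forall y, F (y + 1) = F y}.
  by apply: ae_imp (ae_and wF (ae_shift 1 wF)) => y [<- <-]; exact: ow.
move=> [N [mN N0 PN]].
have [y yN] : exists y, ~ N y.
  apply: contrapT => /forallNP h.
  have NT : N = setT by apply/seteqP; split => // z _; exact: contrapT (h z).
  have : (mu (`[0%R, 1%R]%classic : set R) <= mu N)%E by apply: le_measure;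
    rewrite ?inE// NT.
  by rewrite N0 lebesgue_measure_itv/= lte_fin ltr01 sube0 lee_fin leNgt ltr01.
have Fy : F (y + 1) = F y by apply: contrapT => h; exact: yN (PN _ h).
by case: (leP x y) => [/cst|/ltW/cst]; lra.
Qed.

(** Here [F] is the absolutely continuous representative of the datum, and
    [g'] a representative of bounded variation of its derivative [g]. *)
Lemma initial_data Om w0 : W1 Om 1%E w0 -> W1 Om +oo%E w0 ->
  BV_dom Om (weak_derive Om w0) ->
  exists F g g' (V M : R), [/\ AC F g, L1 Om F, L1 Om g, {ae mu, forall x,
    w0 x = F x} & LI w0] /\
   [/\ 0 <= M, {ae mu, forall x, `|F x| <= M}, 0 <= V,
      {ae mu, forall x, g x = g' x} /\ on_dom Om g' &
    forall a b : R, a <= b -> `[a, b] `<=` dom Om ->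
      (total_variation a b g' <= V%:E)%E].
Proof.
move=> [w1 [g0 hg0] wd1] [woo _ _] [_ [g' [og' gg' [V hV]]]].
have W : is_weak_derive Om w0 (weak_derive Om w0).
  exact: (@xgetPex _ (cst 0) [set g | is_weak_derive Om w0 g] (ex_intro _ g0 hg0)).
have [[ow od] wL gL _] := is_weak_derive_line W.
have [F [FA wF _]] := is_weak_derive_AC W.
have oF : on_dom Om F.
  by clear - ow od wF FA; case: Om ow od FA wF => //= ow od FA wF;
    exact: AC_periodic FA od ow wF.
have [FL _] := L1_ae (Lfun1_L1 ow w1) oF (AC_LI FA).1 wF.
exists F, (weak_derive Om w0), g', `|V|.
have [M [M0 hM]] : exists M : R, 0 <= M /\ {ae mu, forall x, `|w0 x| <= M}.
  move: woo; rewrite inE => /andP[_]; rewrite inE /= /finite_norm unlock /Lnorm.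
  have muT : (0 < mu_dom Om (setT : set mR))%E.
    have -> : mu_dom Om (setT : set mR) = mu (dom Om) by rewrite /= /mrestr setTI.
    case: (Om) => /=.
      apply: (@lt_le_trans _ _ (mu (`[0%R, 1%R]%classic : set R))).
        by rewrite lebesgue_measure_itv/= lte_fin ltr01 sube0 lte_fin ltr01.
      by apply: le_measure; rewrite ?inE.
    by rewrite lebesgue_measure_itv/= lte_fin ltr01 sube0 lte_fin ltr01.
  rewrite muT => h.
  have [M hM] : exists M : R, (ess_sup (mu_dom Om) (abse \o (EFin \o w0))
    <= M%:E)%E.
    case E : (ess_sup _ _) h => [r| |] //= _; first by exists r.
    by exists 0; rewrite leNye.
  exists (Num.max M 0); split; first by rewrite le_max lexx orbT.
  apply: (@ae_dom_inv Om) => [Oc x|]; first by move: ow; rewrite Oc /= => ->.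
  have /ess_supP := hM; apply: filterS => x /=; rewrite lee_fin => /le_trans; apply.
  by rewrite le_max lexx.
exists M; split; split => //.
- exact: Lfun1_L1.
- by apply: ae_imp (ae_and wF hM) => x [<-].
- split => //; apply: (@ae_dom_inv Om).
    by move=> Oc x; move: od og'; rewrite Oc /= => -> ->.
  case: gg' => N [mN N0 H]; exists N; split => // x Px; apply: H => h.
  by apply: Px; exact: (h Logic.I).
- by move=> a b ab abD; apply: le_trans (hV a b ab abD) _; rewrite lee_fin ler_norm.
Qed.

End Data.

(** * A priori estimates for the scheme *)

Section SchemeOuter.
Context {R : realType}.
Local Notation mu := (@lebesgue_measure R).
Local Notation mR := (measurableTypeR R).

(** The average over a cell to the right. Applied to a step function it is the
    piecewise linear interpolation ([y_formula]), with derivative [slope h f]. *)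
Definition average (h : R) (f : R -> R) (x : R) : R := h^-1 * ii x (x + h) f.
Definition slope (h : R) (f : R -> R) (x : R) : R := (f (x + h) - f x) / h.

(** What the passage to the limit uses of one run of the scheme. The constant
    [C] is four times the variation of the derivative of the datum. *)
Record run Om (B F : R -> R) (th C M K h dt : R) (w : nat -> int ->
  R) (u : nat -> R -> R) : Prop := Run {
  run_uL : forall n, L1 Om (u n);
  run_yL : forall n, L1 Om (average h (u n));
  run_pL : forall n, L1 Om (slope h (u n));
  run_AC : forall n, AC (average h (u n)) (slope h (u n));
  run_uM : forall n x, `|u n x| <= M;
  run_yM : forall n x, `|average h (u n) x| <= M;
  run_pC : forall n x, `|slope h (u n) x| <= C;
  run_p2L : forall n, L1 Om (fun x => slope h (u n) x ^+ 2);
  run_p2 : forall n, Int Om (fun x => slope h (u n) x ^+ 2) <= M * C;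
  run_shift : forall n s, 0 <= s ->
    Int Om (fun x => `|slope h (u n) (x + s) - slope h (u n) x|) <= C * (s + h);
  run_time : forall n k,
    Int Om (fun x => `|average h (u (n + k)%N) x - average h (u n) x|)
      <= 2 * (k%:R * dt * C);
  run_yu : forall n x, `|average h (u n) x - u n x| <= h * `|slope h (u n) x|;
  run_yle : forall n x, `|average h (u n) x| <= `|u n x| + `|u n (x + h)|;
  run_init : Int Om (fun x => `|u 0 x - F x|) <= 2 * h * K;
  run_interp : forall t, interpolation h dt w t = average h (u (Num.truncn (t /
    dt)));
  run_weak : forall n f (k : R), on_dom Om f -> measurable_fun (setT : set mR)
    f -> (forall x, `|f x| <= k) ->
    let U x := th * u n.+1 x + (1 - th) * u n x in
    Int Om (fun x => (u n.+1 x - u n x) * f x) =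
    - (dt * Int Om (fun x => slope h U x * (slope h (fun x => B (U x))
        x * f (x + h) + B (U x) * slope h f x))) }.

Section Scheme.
Context (Om : domain) (h dt th V M : R) (B w0 F g g' : R -> R) (w : nat -> int ->
  R).
Context (hgrid : grid_ok Om h) (h1 : h <= 1) (dt0 : 0 < dt) (th01 : 0 <= th <= 1)
  (cfl : 2 * (dt / h ^+ 2 * (1 - th)) <= 1)
  (B01 : forall s, 0 <= B s <= 1) (mB : measurable_fun (setT : set mR) B)
  (scheme : scheme_solution Om th B w0 h dt w)
  (FA : AC F g) (FL : L1 Om F) (gL : L1 Om g) (w0F : {ae mu, forall x,
    w0 x = F x}) (w0L : LI w0)
  (M0 : 0 <= M) (FM : {ae mu, forall x, `|F x| <= M}) (V0 : 0 <= V)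
  (gg' : {ae mu, forall x, g x = g' x}) (og' : on_dom Om g')
  (gV : forall a b : R, a <= b -> `[a, b] `<=` dom Om ->
    (total_variation a b g' <= V%:E)%E).

Let u n := st h (w n).
Let d n := st h (second_diff (w n)).
Let lam := dt / h ^+ 2.
Let U n x := th * u n.+1 x + (1 - th) * u n x.
Let b n x := B (U n x).

Let h0 : 0 < h. Proof. by case: hgrid. Qed.
Let hne : h != 0. Proof. by rewrite gt_eqF. Qed.
Let lam0 : 0 <= lam. Proof. by rewrite divr_ge0// ?(ltW dt0)// sqr_ge0. Qed.

Lemma ddE (a : int -> R) x : st h (second_diff a) x = st h a (x + h)
  - 2 * st h a x + st h a (x - h).
Proof. by rewrite st_shift1// st_shiftN1. Qed.

Lemma w_grid n : grid_fun Om h (w n).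
Proof. by case: scheme. Qed.

Lemma u_L1 n : L1 Om (u n).
Proof. by case: hgrid => H0 H; apply: L1_st => //; exact: w_grid. Qed.

Lemma d_L1 n : L1 Om (d n).
Proof.
have uL := u_L1 n.
have := L1D (L1B (L1_shift h uL) (L1Z 2 uL)) (L1_shift (- h) uL).
by congr L1; apply/funext => x; rewrite /d ddE.
Qed.

Lemma scheme_u n x : u n.+1 x - u n x = lam * (b n x * (U n (x + h)
  - 2 * U n x + U n (x - h))).
Proof.
case: scheme => _ _ /(_ n (Num.floor (x / h))).
rewrite /Dtplus /Dplus /Dminus /theta_mean addrK => E.
have -> : u n.+1 x - u n x = dt * ((u n.+1 x - u n x) / dt) by field;
  rewrite gt_eqF.
rewrite /U /b /u !st_shift1// !st_shiftN1// /st E /lam -/(st h _ x).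
by field.
Qed.

(** The coefficient of the scheme is outside the second difference; taking the
    second difference of the scheme puts it inside, which is the conservative
    form that contracts in L^1. *)
Lemma scheme_d n x : let Y z := b n z * (th * d n.+1 z + (1 - th) * d n z) in
  d n.+1 x - d n x = lam * (Y (x + h) - 2 * Y x + Y (x - h)).
Proof.
move=> Y.
have E z : u n.+1 z - u n z = lam * Y z.
  rewrite scheme_u /Y /d !ddE; congr (_ * (_ * _)); rewrite /U /u; ring.
rewrite /d !ddE -/(u n.+1) -/(u n).
have e1 := E (x + h); have e2 := E x; have e3 := E (x - h).
rewrite !mulrDr mulrN [lam * (2 * _)]mulrCA -e1 -e2 -e3; ring.
Qed.

Lemma w0_avg j : w 0%N j = h^-1 * ii ((j%:~R - 2^-1) * h) ((j%:~R + 2^-1) * h) F.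
Proof.
case: scheme => _ -> _; congr (_ * _).
by rewrite -(ii_ae _ _ w0L (AC_LI FA) w0F).
Qed.

Lemma w_bound n j : `|w n j| <= M.
Proof.
elim: n j => [|n IH] j.
  rewrite w0_avg normrM ger0_norm ?invr_ge0 ?(ltW h0)// mulrC ler_pdivrMr//.
  set x1 := (_ - _) * h; set x2 := (_ + _) * h.
  have x12 : x2 - x1 = h by rewrite /x1 /x2; field.
  have xx : x1 <= x2 by rewrite -subr_ge0 x12 ltW.
  apply: le_trans (ii_norm _ _ (AC_LI FA)) _.
  rewrite -x12; apply: ii_le_ae => //; first exact/LI_norm/(AC_LI FA).
  by apply: ae_imp FM => x Fx _.
pose x := j%:~R * h.
have E a : st h a x = a j.
  by rewrite /st /x mulfK//; congr a; rewrite intrKfloor.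
rewrite -E.
have uL := u_L1 n.+1.
apply: (@sup_estimate R h lam th M (Int Om (fun x => `|u n.+1 x|) / h) (u n)
  (u n.+1) (b n)) => //.
- by move=> z; exact: B01.
- by move=> z; rewrite /u /st.
- move=> z; rewrite ler_pdivlMr//; exact: (L1_st_bound (Num.floor (z / h))
    hgrid uL).
- by move=> z; exact: scheme_u.
Qed.

Lemma b_meas n : on_dom Om (b n) /\ measurable_fun (setT : set mR) (b n).
Proof.
have [od1 md1 _] := u_L1 n; have [od2 md2 _] := u_L1 n.+1; split.
  exact: (on_dom_comp2 (fun x y => B (th * x + (1 - th) * y)) od2 od1).
apply: (measurableT_comp mB); apply: measurable_funD; exact: measurable_funM.
Qed.

Section weighted.
Context (psi : R -> R) (opsi : on_dom Om psi) (mpsi : measurable_fun (setT : set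
  mR) psi)
  (psi01 : forall x, 0 <= psi x <= 1).

Lemma cell_in x : let j := Num.floor (x / h) in
  x - 3 / 2 * h <= (j%:~R - 2^-1) * h /\ (j%:~R + 2^-1) * h <= x + h / 2.
Proof.
move=> j; have k1 : j%:~R <= x / h := Num.Theory.floor_le _.
have k2 : x / h < (j + 1)%:~R := Num.Theory.floorD1_gt _.
rewrite intrD ltr_pdivrMr// in k2; rewrite ler_pdivlMr// in k1.
rewrite !mulrDl mul1r mulNr in k2 *; split; lra.
Qed.

Lemma cell_le x f : let j := Num.floor (x / h) in LI f -> (forall y, 0 <= f y) ->
  ii ((j%:~R - 2^-1) * h) ((j%:~R + 2^-1) * h) f <= ii (- (3 / 2 * h)) (h / 2)
    (fun s => f (x + s)).
Proof.
move=> j fL f0; have [c1 c2] := cell_in x.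
have -> : ii (- (3 / 2 * h)) (h / 2) (fun s => f (x + s)) = ii (x - 3 / 2 * h)
  (x + h / 2) f.
  rewrite (_ : (fun s => _) = (fun s => f (s + x))); last by apply/funext => s;
    rewrite addrC.
  by rewrite ii_shift; [rewrite addrC [h / 2 + _]addrC|case: fL].
have c3 : (j%:~R - 2^-1) * h <= (j%:~R + 2^-1) * h by rewrite ler_pM2r//; lra.
rewrite [leRHS](@ii_split _ _ ((j%:~R - 2^-1) * h))//; last exact: le_trans c2.
rewrite [X in _ <= _ + X](@ii_split _ _ ((j%:~R + 2^-1) * h))//.
rewrite addrCA lerDl addr_ge0//; apply: ii_ge0 => *; exact: f0.
Qed.

Lemma u0_weight (K : R) : 0 <= K -> (forall s, - (3 / 2 * h) <= s <= h / 2 ->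
  Int Om (fun x => psi x * `|F (x + s)|) <= K) ->
  Int Om (fun x => psi x * `|u 0 x|) <= 2 * K.
Proof.
move=> K0 HK; have hi : 0 <= h^-1 by rewrite invr_ge0 ltW.
have -> : 2 * K = 2 * h * h^-1 * K by field.
apply: (@avg_bound R Om h h^-1 K 1 (fun x => `|F x|)) => //;
  [exact: L1_norm|exact: u_L1|].
move=> x; rewrite /u /st w0_avg normrM (ger0_norm hi) ler_wpM2l//.
apply: le_trans (ii_norm _ _ (AC_LI FA)) _.
by apply: cell_le => //; exact/LI_norm/(AC_LI FA).
Qed.

(** The second difference of the cell averages is the average of the second
    difference of [F], and the latter is an increment of the increment [F1] of
    [F], hence an integral of an increment of [g]. *)
Lemma d0_weight (K : R) : 0 <= K -> (forall c, - (3 / 2 * h) <= c <= 3 / 2 * h ->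
  Int Om (fun x => psi x * `|g (x + c) - g (x + c - h)|) <= K) ->
  Int Om (fun x => psi x * `|d 0 x|) <= 2 * (h * K).
Proof.
move=> K0 HK; have hi : 0 <= h^-1 by rewrite invr_ge0 ltW.
pose D x := F (x + h) - 2 * F x + F (x - h).
have DL : L1 Om D by exact: L1D (L1B (L1_shift h FL) (L1Z 2 FL)) (L1_shift (- h)
  FL).
have -> : 2 * (h * K) = 2 * h * h^-1 * (h * K) by field.
have hK : 0 <= h * K by rewrite mulr_ge0// ltW.
apply: (@avg_bound R Om h h^-1 (h * K) 1 (fun x => `|D x|)) => //;
  [exact: L1_norm|exact: d_L1| |].
  move=> x; rewrite /d /st /second_diff !w0_avg; set j := Num.floor _.
  have FLI := L1_LI FL; have mF := FLI.1.
  have -> : h^-1 * ii (((j + 1)%:~R - 2^-1) * h) (((j + 1)%:~R + 2^-1) * h) F -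
   2 * (h^-1 * ii ((j%:~R - 2^-1) * h) ((j%:~R + 2^-1) * h) F) +
   h^-1 * ii (((j - 1)%:~R - 2^-1) * h) (((j - 1)%:~R + 2^-1) * h) F =
   h^-1 * ii ((j%:~R - 2^-1) * h) ((j%:~R + 2^-1) * h) D.
    rewrite iiD; [|exact: LIB (LI_shift h FLI) (LIZ 2 FLI)|exact: (LI_shift (- h)
      FLI)].
    rewrite iiB; [|exact: (LI_shift h FLI)|exact: (LIZ 2 FLI)].
    rewrite iiZ// !ii_shift// !intrD intrN.
    have -> : (j%:~R + 1 - 2^-1) * h = (j%:~R - 2^-1) * h + h by ring.
    have -> : (j%:~R + 1 + 2^-1) * h = (j%:~R + 2^-1) * h + h by ring.
    have -> : (j%:~R - 1 - 2^-1) * h = (j%:~R - 2^-1) * h - h by ring.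
    have -> : (j%:~R - 1 + 2^-1) * h = (j%:~R + 2^-1) * h - h by ring.
    ring.
  rewrite normrM (ger0_norm hi) ler_wpM2l//.
  apply: le_trans (ii_norm _ _ (L1_LI DL)) _.
  by apply: cell_le => //; exact/LI_norm/(L1_LI DL).
move=> s /andP[s1 s2].
pose F1 x := F (x + s) - F (x + s - h); pose g1 x := g (x + s) - g (x + s - h).
have shA c : AC (fun x => F (x + c)) (fun x => g (x + c)).
  have [gLI Fg] := FA; split; first exact: LI_shift.
  by move=> x y xy; rewrite Fg ?lerD2r// ii_shift//; case: gLI.
have F1A : AC F1 g1.
  have := ACB (shA s) (shA (s - h)); congr AC; apply/funext => x; by rewrite !addrA.
have F1L : L1 Om F1.
  by have := L1B (L1_shift s FL) (L1_shift (s - h) FL); congr L1;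
    apply/funext => x; rewrite !addrA.
have g1L : L1 Om g1.
  by have := L1B (L1_shift s gL) (L1_shift (s - h) gL); congr L1;
    apply/funext => x; rewrite !addrA.
rewrite (@eq_I _ Om _ (fun x => psi x * `|F1 (x + h) - F1 x|)); last first.
  move=> x; congr (_ * `|_|); rewrite /F1 /D.
  have -> : x + h + s - h = x + s by ring.
  have -> : x + h + s = x + s + h by ring.
  ring.
apply: (@AC_shift_bound R Om F1 g1 psi h K 1) => //; first exact: ltW.
move=> r /andP[r0 rh].
have := HK (s + r); rewrite (@eq_I _ Om _ (fun x => psi x * `|g1 (x + r)|));
  last first.
  move=> x; congr (_ * `|_|); rewrite /g1.
  have -> : x + r + s = x + (s + r) by ring.
  by [].
apply; apply/andP; split; lra.
Qed.

(** The second difference of the weight is integrated in time against a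
    quantity that [d_bound] controls. *)
Lemma d_weight (kap C0 K : R) : 0 <= kap -> (forall x, psi (x + h)
  - 2 * psi x + psi (x - h) <= kap) ->
  (forall n, Int Om (fun x => `|d n x|) <= K) ->
    Int Om (fun x => psi x * `|d 0 x|) <= C0 ->
  forall n, Int Om (fun x => psi x * `|d n x|) <= C0 + n%:R * (lam * kap * K).
Proof.
move=> kap0 Hk HK H0; elim=> [|n IH]; first by rewrite mul0r addr0.
have [ob mb] := b_meas n; have dL := d_L1 n; have dL' := d_L1 n.+1.
have /andP[t0 t1] := th01.
have H := @step_estimate R Om h lam th kap (d n) (d n.+1) (b n)
  psi 1 lam0 th01 cfl dL dL' ob mb
  (fun x => B01 _) opsi mpsi psi01 kap0 Hk (scheme_d n).
apply: le_trans H _; rewrite -natr1 mulrDl mul1r addrA; apply: lerD => //.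
apply: ler_wpM2l; first exact: mulr_ge0.
have nL := L1_norm dL; have nL' := L1_norm dL'.
rewrite I_D; [|exact: L1Z|exact: L1Z]; rewrite !I_Z//.
have a1 := ler_wpM2l t0 (HK n.+1); have t1' : 0 <= 1 - th by rewrite subr_ge0.
have a2 := ler_wpM2l t1' (HK n).
apply: le_trans (lerD a1 a2) _; rewrite -mulrDl addrC subrK mul1r//.
Qed.

(** Each step of the scheme changes [u] by at most [lam] times a mean of two
    second differences, so that decay of the latter is inherited. *)
Lemma u_weight (D K0 : R) : (forall n, L1 Om (fun x => psi x * `|u n x|)) ->
  forall N : nat, (forall n, (n <= N)%N -> Int Om (fun x => psi x * `|d n x|)
    <= h ^+ 2 * D) ->
  forall n, (n <= N)%N -> Int Om (fun x => psi x * `|u n x|)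
    <= Int Om (fun x => psi x * `|u 0 x|) + n%:R * (dt * D).
Proof.
move=> puL N HD; elim=> [_|n IH nN]; first by rewrite mul0r addr0.
have /andP[t0 t1] := th01.
have pdL k : L1 Om (fun x => psi x * `|d k x|).
  have pb x : `|psi x| <= 1 by have /andP[p0 p1] := psi01 x; rewrite ger0_norm.
  by have := L1M (L1_norm (d_L1 k)) opsi mpsi pb; congr L1; apply/funext => x;
    rewrite mulrC.
pose Dn x := th * (psi x * `|d n.+1 x|) + (1 - th) * (psi x * `|d n x|).
have DnL : L1 Om Dn by exact: L1D (L1Z _ (pdL _)) (L1Z _ (pdL _)).
have : Int Om (fun x => psi x * `|u n.+1 x|) <= Int Om (fun x => psi x * `|u n x|
  + lam * Dn x).
  apply: le_I => //; first exact: L1D (puL n) (L1Z _ DnL).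
  move=> x; have /andP[p0 p1] := psi01 x; have /andP[b0 b1] := B01 (U n x).
  have := scheme_u n x; set b1' := b n x.
  have -> : U n (x + h) - 2 * U n x + U n (x - h) = th * d n.+1 x + (1 - th)
    * d n x.
    by rewrite /d !ddE /U /u; ring.
  move=> E; have -> : u n.+1 x = u n x + lam * (b1' * (th * d n.+1 x + (1 - th)
    * d n x)) by rewrite -E; ring.
  have -> : psi x * `|u n x| + lam * Dn x = psi x * (`|u n x| + lam * (th * `|d
    n.+1 x| + (1 - th) * `|d n x|)).
    by rewrite /Dn; ring.
  apply: ler_wpM2l => //; apply: le_trans (ler_normD _ _) _;
    rewrite lerD2l normrM (ger0_norm lam0).
  apply: ler_wpM2l => //; rewrite normrM (ger0_norm b0) -[leRHS]mul1r;
    apply: ler_pM => //.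
  apply: le_trans (ler_normD _ _) _; have t1' : 0 <= 1 - th by rewrite subr_ge0.
  by rewrite !normrM (ger0_norm t0) (ger0_norm t1').
move/le_trans; apply.
rewrite I_D; [|exact: puL|exact: L1Z]; rewrite I_Z// /Dn I_D;
  [|exact: L1Z|exact: L1Z].
rewrite !I_Z//.
have -> : n.+1%:R * (dt * D) = n%:R * (dt * D)
  + dt * D by rewrite [n.+1%:R](_ : _ = n%:R + 1) ?natr1//; ring.
rewrite addrA; apply: lerD; first by apply: IH; exact: ltnW.
have -> : dt * D = lam * (h ^+ 2 * D) by rewrite /lam; field.
apply: ler_wpM2l => //.
have a1 := ler_wpM2l t0 (HD n.+1 nN); have t1' : 0 <= 1 - th by rewrite subr_ge0.
have a2 := ler_wpM2l t1' (HD n (ltnW nN)).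
apply: le_trans (lerD a1 a2) _; rewrite -mulrDl addrC subrK mul1r//.
Qed.

End weighted.


Let one_dom : on_dom Om (fun=> 1 : R). Proof. by case: (Om). Qed.
Let one_01 (x : R) : 0 <= (fun=> 1 : R) x <= 1. Proof. by rewrite ler01 lexx. Qed.

(** The initial bound comes from the bounded variation of [g], and the
    contraction propagates it. *)
Lemma d_bound n : Int Om (fun x => `|d n x|) <= 4 * V * h ^+ 2.
Proof.
have m1 : measurable_fun (setT : set mR) (fun=> 1 : R) by [].
have VH : 0 <= 2 * V * h by rewrite !mulr_ge0// ltW.
have H0 : Int Om (fun x => `|d 0 x|) <= 4 * V * h ^+ 2.
  rewrite -I1M; have -> : 4 * V * h ^+ 2 = 2 * (h * (2 * V * h)) by ring.
  apply: (@d0_weight (fun=> 1)) => // c _; rewrite I1M.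
  pose G x := `|g (x + h) - g x|.
  have GL : L1 Om G by apply: L1_norm; apply: L1B => //; exact: L1_shift.
  rewrite (@eq_I _ Om _ (fun x => G (x + (c - h)))); last first.
    by move=> x; rewrite /G; congr `|g _ - g _|; ring.
  by rewrite I_shift//; exact: BV_shift gg' og' gV.
elim: n => [//|n IH].
have [ob mb] := b_meas n.
have /andP[t0 t1] := th01.
have k0 (x : R) : 1 - 2 * 1 + 1 <= 0 :> R by lra.
have := @step_estimate R Om h lam th 0 (d n) (d n.+1) (b n) (fun=> 1)
  1 lam0 th01 cfl (d_L1 n) (d_L1 n.+1) ob mb
  (fun x => B01 _) one_dom m1 one_01 (lexx 0) k0 (scheme_d n).
by rewrite !I1M mulr0 mul0r addr0 => /le_trans; apply.
Qed.

Let p n x := (u n (x + h) - u n x) / h.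

Lemma p_bound n x : `|p n x| <= 4 * V.
Proof.
have H := @grad_bound R Om h (w n) (4 * V * h ^+ 2) M hgrid (d_L1 n) (w_grid n)
  (w_bound n) (d_bound n) (Num.floor (x / h)).
rewrite /p /u st_shift1// normrM normfV (gtr0_norm h0) ler_pdivrMr//.
apply: le_trans H _; rewrite le_eqVlt; apply/orP; left; apply/eqP; field;
  exact: hne.
Qed.

Lemma p_sq n : L1 Om (fun x => p n x ^+ 2) /\ Int Om (fun x => p n x ^+ 2)
  <= M * (4 * V).
Proof.
have [eL eI] := @energy_bound R Om h (u n) M (u_L1 n) (fun x => w_bound n _).
have E : (fun x => p n x ^+ 2) = (fun x => h ^- 2 * (u n (x + h) - u n x) ^+ 2).
  by apply/funext => x; rewrite /p expr_div_n mulrC.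
rewrite E; split; first exact: L1Z.
rewrite I_Z// mulrC ler_pdivrMr ?exprn_gt0//; apply: le_trans eI _.
rewrite -mulrA; apply: ler_wpM2l => //.
rewrite (@eq_I _ Om _ (fun x => `|d n x|)); first exact: d_bound.
by move=> x; rewrite /d ddE.
Qed.

Lemma u_diff n x : `|u n.+1 x - u n x| <= lam * (th * `|d n.+1 x| + (1 - th)
  * `|d n x|).
Proof.
have /andP[t0 t1] := th01; have t1' : 0 <= 1 - th by rewrite subr_ge0.
have /andP[b0 b1] := B01 (U n x).
rewrite scheme_u normrM (ger0_norm lam0); apply: ler_wpM2l => //.
have -> : U n (x + h) - 2 * U n x + U n (x - h) = th * d n.+1 x + (1 - th) * d n x.
  by rewrite /d !ddE /U /u; ring.
rewrite normrM (ger0_norm b0) -[leRHS]mul1r; apply: ler_pM => //.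
by apply: le_trans (ler_normD _ _) _; rewrite !normrM (ger0_norm t0)
  (ger0_norm t1').
Qed.

Lemma u_step n : Int Om (fun x => `|u n.+1 x - u n x|) <= dt * (4 * V).
Proof.
have /andP[t0 t1] := th01; have t1' : 0 <= 1 - th by rewrite subr_ge0.
have nL k := L1_norm (d_L1 k).
have DL : L1 Om (fun x => th * `|d n.+1 x| + (1 - th) * `|d n x|) by apply: L1D;
  exact: L1Z.
have uL : L1 Om (fun x => `|u n.+1 x - u n x|) by apply/L1_norm/L1B; exact: u_L1.
apply: le_trans (le_I uL (L1Z lam DL) (u_diff n)) _.
rewrite I_Z// I_D; [|exact: L1Z|exact: L1Z]; rewrite !I_Z//.
have -> : dt * (4 * V) = lam * (4 * V * h ^+ 2) by rewrite /lam; field.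
apply: ler_wpM2l => //.
have a1 := ler_wpM2l t0 (d_bound n.+1).
have a2 := ler_wpM2l t1' (d_bound n).
apply: le_trans (lerD a1 a2) _; rewrite -mulrDl addrC subrK mul1r//.
Qed.

Lemma u_time n k : Int Om (fun x => `|u (n + k)%N x - u n x|)
  <= k%:R * dt * (4 * V).
Proof.
elim: k => [|k IH].
  rewrite addn0 !mul0r (@eq_I _ Om _ (fun=> 0)) ?I_0// => x.
  by rewrite subrr normr0.
rewrite addnS; have uL k' : L1 Om (u k') := u_L1 k'.
rewrite (@eq_I _ Om _ (fun x => `|(u (n + k).+1 x - u (n + k)%N x)
  + (u (n + k)%N x - u n x)|)); last first.
  by move=> x; congr `|_|; ring.
apply: le_trans (I_normD (L1B (uL _) (uL _)) (L1B (uL _) (uL _))) _.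
have -> : k.+1%:R * dt * (4 * V) = dt * (4 * V) + k%:R * dt * (4 * V).
  by rewrite [k.+1%:R](_ : _ = k%:R + 1) ?natr1//; ring.
by apply: lerD IH; exact: u_step.
Qed.

(** On the window around [x], the values of [F] differ from [F x] by at most
    the integral of [|g|]. *)
Lemma u0_F : Int Om (fun x => `|u 0 x - F x|) <= 2 * h * Int Om (fun x => `|g x|).
Proof.
have m1 : measurable_fun (setT : set mR) (fun=> 1 : R) by [].
rewrite -I1M; have -> : 2 * h * Int Om (fun x => `|g x|)
  = 2 * h * 1 * Int Om (fun x => `|g x|) by ring.
apply: (@avg_bound R Om h 1 _ 1 (fun x => `|g x|)) => //.
- exact: I_ge0.
- exact: L1_norm.
- by apply: L1B => //; exact: u_L1.
- move=> x; rewrite mul1r; set G := ii _ _ _.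
  have [gLI Fg] := FA; have mg := gLI.1.
  have GE : G = ii (x - 3 / 2 * h) (x + h / 2) (fun y => `|g y|).
    rewrite /G (_ : (fun s => _) = (fun s => `|g (s + x)|));
      last by apply/funext => s; rewrite addrC.
    rewrite (@ii_shift _ _ _ x (fun y => `|g y|))
      ?[- _ + x]addrC ?[h / 2 + _]addrC//.
    exact: measurableT_comp.
  have [c1 c2] := cell_in x.
  set j := Num.floor (x / h) in c1 c2.
  rewrite /u /st w0_avg -/j.
  set x1 := (_ - _) * h in c1 *; set x2 := (_ + _) * h in c2 *.
  have x12 : x2 - x1 = h by rewrite /x1 /x2; field.
  have xx : x1 <= x2 by rewrite -subr_ge0 x12 ltW.
  have -> : h^-1 * ii x1 x2 F - F x = h^-1 * ii x1 x2 (fun y => F y - F x).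
    rewrite iiB; [|exact: AC_LI FA|exact: LI_cst]; rewrite ii_cst// x12; by field.
  rewrite normrM normfV (gtr0_norm h0) mulrC ler_pdivrMr// -x12.
  apply: ii_bound => //; first by apply: LIB; [exact: AC_LI FA|exact: LI_cst].
  have sub y z : x - 3 / 2 * h <= y -> y <= z -> z <= x + h / 2 ->
    `|F z - F y| <= G.
    move=> yl yz zr; rewrite Fg//; apply: le_trans (ii_norm _ _ gLI) _; rewrite GE.
    have gN := LI_norm gLI.
    rewrite [leRHS](@ii_split _ _ y)//; last by apply: le_trans zr.
    rewrite [X in _ <= _ + X](@ii_split _ _ z)//.
    by rewrite addrCA lerDl addr_ge0//; apply: ii_ge0.
  move=> y /andP[y1 y2]; have hh := h0; case: (leP x y) => [xy|/ltW yx].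
    by apply: sub => //; lra.
  by rewrite distrC; apply: sub => //; lra.
- by move=> s _; rewrite I1M (I_shift s (L1_norm gL)).
Qed.


Lemma p_L1 n : L1 Om (p n).
Proof.
have := L1Z h^-1 (L1B (L1_shift h (u_L1 n)) (u_L1 n)).
by congr L1; apply/funext => x; rewrite mulrC.
Qed.

Lemma p_st n x : p n x = st h (fun j => (w n (j + 1) - w n j) / h) x.
Proof. by rewrite /p /u st_shift1. Qed.

(** A translation by [h] changes the slope by a second difference. Since the
    slope is a step function, a translation by less than [h] changes it at no
    point more than the translation by [h]; other translations are
    compositions of these. *)
Lemma p_shift n (s : R) : 0 <= s -> Int Om (fun x => `|p n (x + s) - p n x|)
  <= 4 * V * (s + h).
Proof.
move=> s0; have pL := p_L1 n.
have hstep : Int Om (fun x => `|p n (x + h) - p n x|) <= 4 * V * h.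
  rewrite (@eq_I _ Om _ (fun x => h^-1 * `|d n (x + h)|)); last first.
    move=> x; rewrite /d ddE addrK /p -/(u n).
    have -> : (u n (x + h + h) - u n (x + h)) / h - (u n (x + h) - u n x)
      / h = h^-1 * (u n (x + h + h) - 2 * u n (x + h) + u n x) by field.
    by rewrite normrM [`|h^-1|]gtr0_norm ?invr_gt0.
  have dL := L1_norm (L1_shift h (d_L1 n)).
  rewrite I_Z// (I_shift h (L1_norm (d_L1 n))) mulrC ler_pdivrMr//.
  have -> : 4 * V * h * h = 4 * V * h ^+ 2 by ring.
  exact: d_bound.
have msteps m : Int Om (fun x => `|p n (x + m%:R * h) - p n x|)
  <= m%:R * (4 * V * h).
  elim: m => [|m IH].
    rewrite [leRHS]mul0r (@eq_I _ Om _ (fun=> 0)) ?I_0// => x.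
    by rewrite mul0r addr0 subrr normr0.
  have mS : (m.+1%:R : R) = m%:R + 1 by rewrite natr1.
  rewrite (@eq_I _ Om _ (fun x => `|(p n (x + m%:R * h + h) - p n (x + m%:R * h))
    + (p n (x + m%:R * h) - p n x)|)); last first.
    move=> x; rewrite mS; have -> : x + (m%:R + 1) * h = x + m%:R * h + h by ring.
    by congr `|_|; ring.
  have a1 : L1 Om (fun x => p n (x + m%:R * h + h) - p n (x + m%:R * h)).
    exact: L1_shift (L1B (L1_shift h pL) pL).
  have a2 : L1 Om (fun x => p n (x + m%:R * h) - p n x) by apply: L1B => //;
    exact: L1_shift.
  apply: le_trans (I_normD a1 a2) _.
  have -> : m.+1%:R * (4 * V * h) = 4 * V * h + m%:R * (4 * V * h) by rewrite mS;
    ring.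
  apply: lerD IH.
  by rewrite (I_shift (m%:R * h) (L1_norm (L1B (L1_shift h pL) pL))).
pose m := Num.truncn (s / h); pose r := s - m%:R * h.
have sh0 : 0 <= s / h by rewrite divr_ge0// ltW.
have m1 : m%:R * h <= s by rewrite -ler_pdivlMr// truncn_le.
have m2 : s < m%:R * h + h.
  have := Num.Theory.truncnS_gt (s / h); rewrite -natr1 ltr_pdivrMr//.
  by rewrite -/m mulrDl mul1r.
have r0 : 0 <= r by rewrite /r subr_ge0.
have rh : r < h by rewrite /r; lra.
have rstep : Int Om (fun x => `|p n (x + r) - p n x|) <= 4 * V * h.
  apply: le_trans hstep; apply: le_I; [by apply/L1_norm/L1B => //;
    exact: L1_shift|by apply/L1_norm/L1B => //; exact: L1_shift|].
  move=> x; rewrite !p_st (@st_shift1 _ h _ x)//.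
  set a := fun j => _; rewrite {2 4}/st; set j := Num.floor (x / h).
  have k1 : j%:~R <= x / h := Num.Theory.floor_le _.
  have k2 : x / h < (j + 1)%:~R := Num.Theory.floorD1_gt _.
  rewrite ler_pdivlMr// in k1; rewrite ltr_pdivrMr// in k2.
  case: (ltP (x + r) ((j + 1)%:~R * h)) => k3.
    have -> : st h a (x + r) = a j by apply: st_eq => //; apply/andP;
      split => //; lra.
    by rewrite subrr normr0.
  have -> : st h a (x + r) = a (j + 1) => //.
  apply: st_eq => //; apply/andP; split => //.
  by move: k2; rewrite !intrD !mulrDl !mul1r; lra.
rewrite (@eq_I _ Om _ (fun x => `|(p n (x + m%:R * h + r) - p n (x + m%:R * h))
  + (p n (x + m%:R * h) - p n x)|)); last first.
  move=> x; have -> : x + m%:R * h + r = x + s by rewrite /r; ring.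
  by congr `|_|; ring.
have a1 : L1 Om (fun x => p n (x + m%:R * h + r) - p n (x + m%:R * h)).
  exact: L1_shift (L1B (L1_shift r pL) pL).
have a2 : L1 Om (fun x => p n (x + m%:R * h) - p n x) by apply: L1B => //;
  exact: L1_shift.
apply: le_trans (I_normD a1 a2) _.
rewrite (I_shift (m%:R * h) (L1_norm (L1B (L1_shift r pL) pL))).
apply: le_trans (lerD rstep (msteps m)) _.
have -> : 4 * V * h + m%:R * (4 * V * h) = 4 * V * (m%:R * h + h) by ring.
by apply: ler_wpM2l; [rewrite mulr_ge0|rewrite lerD2r].
Qed.

Let y n := average h (u n).

Lemma y_AC n : AC (y n) (p n).
Proof.
have uL := L1_LI (u_L1 n); split; first exact: L1_LI (p_L1 n).
move=> x z xz; have hh := ltW h0.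
have xh : x <= x + h by rewrite lerDl.
have zh : z <= z + h by rewrite lerDl.
have xzh : x + h <= z + h by rewrite lerD2r.
have e1 : ii x (z + h) (u n) = ii x z (u n) + ii z (z + h) (u n)
  by rewrite (@ii_split _ _ z).
have e2 : ii x (z + h) (u n) = ii x (x + h) (u n) + ii (x + h) (z + h) (u n)
  by rewrite (@ii_split _ _ (x + h)).
have -> : ii x z (p n) = h^-1 * (ii x z (fun t => u n (t + h)) - ii x z (u n)).
  rewrite -iiB//; last exact: LI_shift.
  by rewrite -iiZ; [apply: eq_ii => t _; rewrite /p mulrC|exact: LIB (LI_shift h
    uL) uL].
rewrite ii_shift//; last exact: uL.1.
rewrite /y /average -mulrBr; congr (_ * _); lra.
Qed.

Lemma y_formula n x : let j := Num.floor (x / h) in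
  y n x = ((j + 1)%:~R * h - x) / h * w n j + (x - j%:~R * h) / h * w n (j + 1).
Proof.
move=> j; have uL := L1_LI (u_L1 n).
have k1 : j%:~R <= x / h := Num.Theory.floor_le _.
have k2 : x / h < (j + 1)%:~R := Num.Theory.floorD1_gt _.
rewrite ler_pdivlMr// in k1; rewrite ltr_pdivrMr// in k2.
have k3 : (j + 1)%:~R * h <= x + h by rewrite intrD mulrDl mul1r lerD2r.
rewrite /y /average (@ii_split _ _ ((j + 1)%:~R * h))//; last exact: ltW.
rewrite (@eq_ii_oo _ _ _ (u n) (fun=> w n j))//; last 2 first.
- exact: LI_cst.
- by move=> z /andP[z1 z2]; apply: st_eq => //;
    rewrite z2 andbT (le_trans k1)// ltW.
rewrite (@eq_ii_oo _ ((j + 1)%:~R * h) _ (u n) (fun=> w n (j + 1)))//; last 2 first.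
- exact: LI_cst.
- move=> z /andP[z1 z2]; apply: st_eq => //; rewrite (ltW z1)/= (lt_trans z2)//.
  by rewrite [(j + 1 + 1)%:~R]intrD [ltRHS]mulrDl mul1r ltrD2r.
rewrite !ii_cst//; last exact: ltW.
have -> : x + h - (j + 1)%:~R * h = x - j%:~R * h by rewrite intrD; ring.
by field.
Qed.

Lemma y_interp n x : exists2 s : R, 0 <= s <= 1 & y n x = u n x + s * (u n (x +
  h) - u n x).
Proof.
have E := y_formula n x; move: E; set j := Num.floor (x / h) => E.
have k1 : j%:~R <= x / h := Num.Theory.floor_le _.
have k2 : x / h < (j + 1)%:~R := Num.Theory.floorD1_gt _.
exists (x / h - j%:~R); first by rewrite intrD in k2; apply/andP; split; lra.
rewrite /y in E *; rewrite E /u st_shift1// /st -/j intrD; by field.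
Qed.

Lemma y_bound n x : `|y n x| <= M.
Proof.
have [s /andP[s0 s1] ->] := y_interp n x.
have a1 : `|u n x| <= M by apply: w_bound.
have a2 : `|u n (x + h)| <= M by apply: w_bound.
have -> : u n x + s * (u n (x + h) - u n x) = (1 - s) * u n x + s * u n (x + h)
  by ring.
have s1' : 0 <= 1 - s by rewrite subr_ge0.
apply: le_trans (ler_normD _ _) _; rewrite !normrM (ger0_norm s0) (ger0_norm s1').
by have b1 := ler_wpM2l s0 a2; have b2 := ler_wpM2l s1' a1; lra.
Qed.

Lemma y_u n x : `|y n x - u n x| <= h * `|p n x|.
Proof.
have [s /andP[s0 s1] ->] := y_interp n x.
have -> : u n x + s * (u n (x + h) - u n x) - u n x = s * h * p n x by rewrite
  /p; field.
have s0h : 0 <= s * h by rewrite mulr_ge0// ltW.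
by rewrite normrM (ger0_norm s0h); apply: ler_wpM2r => //; rewrite ger_pMl.
Qed.

Lemma y_diff n m x : `|y n x - y m x| <= `|u n x - u m x| + `|u n (x + h)
  - u m (x + h)|.
Proof.
have := y_formula n x; have := y_formula m x; set j := Num.floor (x / h) => -> ->.
have k1 : j%:~R <= x / h := Num.Theory.floor_le _.
have k2 : x / h < (j + 1)%:~R := Num.Theory.floorD1_gt _.
set s := x / h - j%:~R.
have s0 : 0 <= s by rewrite subr_ge0.
have s1 : s <= 1 by rewrite /s; rewrite intrD in k2; lra.
have -> : ((j + 1)%:~R * h - x) / h = 1 - s by rewrite /s intrD; field.
have -> : (x - j%:~R * h) / h = s by rewrite /s; field.
rewrite /u !st_shift1// /st -/j.
have s1' : 0 <= 1 - s by rewrite subr_ge0.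
have -> : (1 - s) * w n j + s * w n (j + 1) - ((1 - s) * w m j + s * w m (j + 1)) =
 (1 - s) * (w n j - w m j) + s * (w n (j + 1) - w m (j + 1)) by ring.
apply: le_trans (ler_normD _ _) _; rewrite !normrM (ger0_norm s0) (ger0_norm s1').
by apply: lerD; rewrite ler_piMl// lerBlDr lerDl.
Qed.

Lemma y_le n x : `|y n x| <= `|u n x| + `|u n (x + h)|.
Proof.
have [s /andP[s0 s1] ->] := y_interp n x.
have -> : u n x + s * (u n (x + h) - u n x) = (1 - s) * u n x + s * u n (x + h)
  by ring.
have s1' : 0 <= 1 - s by rewrite subr_ge0.
apply: le_trans (ler_normD _ _) _; rewrite !normrM (ger0_norm s0) (ger0_norm s1').
by apply: lerD; rewrite ler_piMl// lerBlDr lerDl.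
Qed.

Lemma y_L1 n : L1 Om (y n).
Proof.
have uL := u_L1 n; have nL := L1_norm uL; have nLs := L1_norm (L1_shift h uL).
have oy : on_dom Om (y n).
  have mu_ : measurable_fun (setT : set mR) (u n) by case: uL.
  have ou : on_dom Om (u n) by case: uL.
  move: ou; case: (Om) => //= ou x; rewrite /y /average; congr (_ * _).
  have -> : x + 1 + h = x + h + 1 by ring.
  by rewrite -ii_shift//; apply: eq_ii => z _; rewrite ou.
apply: (L1_le oy (AC_LI (y_AC n)).1 (L1D nL nLs)); exact: y_le.
Qed.

Lemma y_time n k : Int Om (fun x => `|y (n + k)%N x - y n x|)
  <= 2 * (k%:R * dt * (4 * V)).
Proof.
pose e x := `|u (n + k)%N x - u n x|.
have eL : L1 Om e by apply/L1_norm/L1B; exact: u_L1.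
have yL : L1 Om (fun x => `|y (n + k)%N x - y n x|) by apply/L1_norm/L1B;
  exact: y_L1.
apply: le_trans (le_I yL (L1D eL (L1_shift h eL)) (y_diff (n + k) n)) _.
rewrite I_D//; last exact: L1_shift.
by rewrite (I_shift h eL); have := u_time n k; rewrite -/e; lra.
Qed.

(** The discrete form of testing [B w_xx] with [f]: summation by parts moves
    one difference to the product of the coefficient and [f], and the
    difference of the product is split by the Leibniz rule. *)
Lemma weak_step n f (k : R) : on_dom Om f -> measurable_fun (setT : set mR) f ->
  (forall x, `|f x| <= k) ->
  Int Om (fun x => (u n.+1 x - u n x) * f x) =
  - (dt * Int Om (fun x => slope h (U n) x * (slope h (b n) x * f (x + h)
      + b n x * slope h f x))).
Proof.
move=> of_ mf fk; have [ob mb] := b_meas n.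
have UL : L1 Om (U n) by apply: L1D; apply: L1Z; exact: u_L1.
pose A x := U n (x + h) - U n x.
have AL : L1 Om A by apply: L1B => //; exact: L1_shift.
pose c x := b n x * f x.
have oc : on_dom Om c by exact: on_dom_comp2.
have mc : measurable_fun (setT : set mR) c by exact: measurable_funM.
have ck x : `|c x| <= k.
  have /andP[b0 b1] := B01 (U n x).
  rewrite /c normrM (ger0_norm b0) -[leRHS]mul1r; exact: ler_pM.
have cA : L1 Om (fun x => A x * c x) by exact: L1M AL oc mc ck.
have cAs : L1 Om (fun x => A (x - h) * c x) by exact: L1M (L1_shift (- h) AL)
  oc mc ck.
have cA' : L1 Om (fun x => A x * c (x + h)).
  by have := L1_shift h cAs; congr L1; apply/funext => x; rewrite addrK.
rewrite (@eq_I _ Om _ (fun x => lam * (A x * c x - A (x - h) * c x))); last first.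
  by move=> x; rewrite scheme_u /A /c subrK; ring.
rewrite I_Z; last exact: L1B.
rewrite I_B//.
have -> : Int Om (fun x => A (x - h) * c x) = Int Om (fun x => A x * c (x + h)).
  by rewrite -(I_shift h cAs); apply: eq_I => x; rewrite addrK.
rewrite -I_B//.
have -> : (fun x => slope h (U n) x * (slope h (b n) x * f (x + h)
  + b n x * slope h f x)) =
   (fun x => - h ^- 2 * (A x * c x - A x * c (x + h))).
  by apply/funext => x; rewrite /slope /c /A; field.
rewrite I_Z; last exact: L1B.
by rewrite /lam; ring.
Qed.

Lemma run_estimates : run Om B F th (4 * V) M (Int Om (fun x => `|g x|)) h dt w u.
Proof.
split.
- exact: u_L1.
- exact: y_L1.
- exact: p_L1.
- exact: y_AC.
- by move=> n x; exact: w_bound.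
- exact: y_bound.
- exact: p_bound.
- by move=> n; case: (p_sq n).
- by move=> n; case: (p_sq n).
- exact: p_shift.
- exact: y_time.
- exact: y_u.
- exact: y_le.
- exact: u0_F.
- by move=> t; apply/funext => x; rewrite /interpolation -y_formula.
- exact: weak_step.
Qed.

Section tails.
Context (OmL : Om = Line) (n0 : nat) (e T r : R) (e0 : 0 <= e) (T0 : 0 <= T)
  (r0 : 0 < r)
 (tF : forall c : R, n0%:R <= c -> ii n0%:R c (fun x => `|F x|) <= e /\
   ii (- c) (- n0%:R) (fun x => `|F x|) <= e)
 (tV : forall c : R, n0%:R <= c -> (total_variation n0%:R c g' <= e%:E)%E /\
   (total_variation (- c) (- n0%:R) g' <= e%:E)%E).

Let KF := Int Om (fun x => `|F x|).
Let D := 2 * (2 * V * ((n0.+2%:R + 3) ^+ 2 / r ^+ 2) + 2 * e)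
  + 4 * T / r ^+ 2 * (4 * V).

Let psi := weight r.
Let opsi : on_dom Om psi. Proof. by rewrite OmL. Qed.
Let mpsi : measurable_fun (setT : set mR) psi. Proof. exact: measurable_weight. Qed.
Let psi01 x : 0 <= psi x <= 1. Proof. exact: weight_01. Qed.

Lemma u0_tail : Int Om (fun x => psi x * `|u 0 x|) <= 2 * (KF * ((n0%:R + 3)
  ^+ 2 / r ^+ 2) + 2 * e).
Proof.
have KF0 : 0 <= KF by apply: I_ge0.
have q0 : 0 <= (n0%:R + 3) ^+ 2 / r ^+ 2 :> R by rewrite divr_ge0 ?sqr_ge0.
apply: u0_weight => //; first by apply: addr_ge0; apply: mulr_ge0.
move=> s /andP[s1 s2].
have FL' : L1 Line (fun x => `|F x|) by apply: L1_norm; rewrite -OmL.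
rewrite OmL; apply: (@tail_weight R (fun x => `|F x|) KF e r s n0 FL') => //;
  first by rewrite /KF OmL.
by have hh := h0; have hh1 := h1; rewrite ler_norml; apply/andP; split; lra.
Qed.

Lemma d0_tail : Int Om (fun x => psi x * `|d 0 x|)
  <= h ^+ 2 * (2 * (2 * V * ((n0.+2%:R + 3) ^+ 2 / r ^+ 2) + 2 * e)).
Proof.
have q0 : 0 <= (n0.+2%:R + 3) ^+ 2 / r ^+ 2 :> R by rewrite divr_ge0 ?sqr_ge0.
have hh := ltW h0.
have q1 : 0 <= 2 * V * ((n0.+2%:R + 3) ^+ 2 / r ^+ 2) + 2 * e.
  by apply: addr_ge0; apply: mulr_ge0 => //; apply: mulr_ge0.
have -> : h ^+ 2 * (2 * (2 * V * ((n0.+2%:R + 3) ^+ 2 / r ^+ 2) + 2 * e)) =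
  2 * (h * (h * (2 * V * ((n0.+2%:R + 3) ^+ 2 / r ^+ 2) + 2 * e))) by ring.
apply: d0_weight => //; first exact: mulr_ge0.
move=> c /andP[c1 c2].
pose G x := `|g (x + h) - g x|.
have GL : L1 Om G by apply: L1_norm; apply: L1B => //; exact: L1_shift.
rewrite (@eq_I _ Om _ (fun x => psi x * G (x + (c - h)))); last first.
  by move=> x; rewrite /G; congr (_ * `|g _ - g _|); ring.
have -> : h * (2 * V * ((n0.+2%:R + 3) ^+ 2 / r ^+ 2) + 2 * e) =
  2 * V * h * ((n0.+2%:R + 3) ^+ 2 / r ^+ 2) + 2 * (h * e) by ring.
have GI : Int Om G <= 2 * V * h by exact: BV_shift gg' og' gV.
have GL' : L1 Line G by rewrite -OmL.
have gLI := L1_LI gL.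
have n2 : (n0.+2%:R : R) = n0%:R + 2 by rewrite -addn2 natrD.
have GI' : Int Line G <= 2 * V * h by rewrite -OmL.
rewrite OmL; apply: (@tail_weight R G _ (h * e) r (c - h) n0.+2 GL' _ GI') => //;
  first by move=> x; rewrite /G.
  move=> b'; rewrite n2 => b2; have hh1 := h1; have := h0 => hpos; split.
    apply: (BV_window hpos e0 gLI gg' b2).
    have [|k1 _] := tV (c := b' + 2 * h); first lra.
    by apply: le_trans k1; apply: TV_mono => //; lra.
  have b3 : - b' <= - (n0%:R + 2) by rewrite lerN2.
  apply: (BV_window hpos e0 gLI gg' b3).
  have [|_ k2] := tV (c := b'); first lra.
  by apply: le_trans k2; apply: TV_mono => //; lra.
by have hh1 := h1; rewrite ler_norml; apply/andP; split; lra.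
Qed.

Lemma u_tail n : n%:R * dt <= T ->
  Int Om (fun x => psi x * `|u n x|) <= 2 * (KF * ((n0%:R + 3) ^+ 2 / r ^+ 2)
    + 2 * e) + T * D.
Proof.
move=> nT.
have D0 : 0 <= D.
  have q0 : 0 <= (n0.+2%:R + 3) ^+ 2 / r ^+ 2 :> R by rewrite divr_ge0 ?sqr_ge0.
  have q1 : 0 <= 4 * T / r ^+ 2 * (4 * V) by apply: mulr_ge0; [apply: divr_ge0;
    [exact: mulr_ge0|exact: sqr_ge0]|exact: mulr_ge0].
  apply: addr_ge0 => //; apply: mulr_ge0 => //; apply: addr_ge0;
    apply: mulr_ge0 => //; exact: mulr_ge0.
have kap0 : 0 <= 4 * h ^+ 2 / r ^+ 2 by rewrite divr_ge0 ?sqr_ge0// mulr_ge0//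
  sqr_ge0.
have HD m : (m <= n)%N -> Int Om (fun x => psi x * `|d m x|) <= h ^+ 2 * D.
  move=> mn.
  apply: le_trans (@d_weight psi opsi mpsi psi01 _ _ _ kap0 (fun x => weight_dd x
    h r0) d_bound d0_tail m) _.
  have -> : m%:R * (lam * (4 * h ^+ 2 / r ^+ 2) * (4 * V * h ^+ 2))
    = h ^+ 2 * (4 * (m%:R * dt) / r ^+ 2 * (4 * V)).
    by rewrite /lam; field; rewrite hne gt_eqF.
  rewrite -mulrDr; apply: ler_wpM2l; first exact: sqr_ge0.
  rewrite lerD2l; apply: ler_wpM2r; first exact: mulr_ge0.
  apply: ler_wpM2r; first by rewrite invr_ge0 sqr_ge0.
  apply: ler_wpM2l => //; apply: le_trans nT; apply: ler_wpM2r; first exact: ltW.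
  by rewrite ler_nat.
have puL k : L1 Om (fun x => psi x * `|u k x|).
  have pb x : `|psi x| <= 1 by have /andP[p0 p1] := psi01 x; rewrite ger0_norm.
  by have := L1M (L1_norm (u_L1 k)) opsi mpsi pb; congr L1; apply/funext => x;
    rewrite mulrC.
apply: le_trans (@u_weight psi opsi mpsi psi01 D 0 puL n HD n (leqnn n)) _.
apply: lerD; first exact: u0_tail.
by rewrite mulrA; apply: ler_wpM2r.
Qed.

Lemma u_far n : n%:R * dt <= T ->
  Int Om (fun x => if r <= `|x| then `|u n x| else 0) <=
  2 * (2 * (KF * ((n0%:R + 3) ^+ 2 / r ^+ 2) + 2 * e) + T * D).
Proof.
move=> nT; apply: (@le_trans _ _ (2 * Int Om (fun x => psi x * `|u n x|)));
  last first.
  by apply: ler_wpM2l => //; exact: u_tail.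
have uL := L1_norm (u_L1 n).
have pb x : `|psi x| <= 1 by have /andP[p0 p1] := psi01 x; rewrite ger0_norm.
have puL : L1 Om (fun x => psi x * `|u n x|).
  by have := L1M uL opsi mpsi pb; congr L1; apply/funext => x; rewrite mulrC.
rewrite -I_Z//; apply: le_I; [|exact: L1Z|].
  apply: (L1_le _ _ uL); first by rewrite OmL.
    by apply: measurable_fun_ifT => //; [apply: measurable_fun_ler => //|have [_
      mu_ _] := uL].
  by move=> x; case: ifP => _; rewrite ?normr0// normr_id.
move=> x; case: ifP => [rx|_]; last by have /andP[p0 _] := psi01 x;
  do ![apply: mulr_ge0 => //].
have := weight_big r0 rx; rewrite -/psi mulrA => pw.
by rewrite -[leLHS]mul1r; apply: ler_wpM2r => //; lra.
Qed.

End tails.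

End Scheme.

Lemma small_inv_sq (a e : R) : 0 <= a -> 0 < e -> exists2 r : R,
  0 < r & a / r ^+ 2 <= e.
Proof.
move=> a0 e0; exists (a / e + 1); first by rewrite ltr_wpDl// divr_ge0// ltW.
set r := _ + 1; have r1 : 1 <= r by rewrite lerDr divr_ge0// ltW.
have r0 : 0 < r by apply: lt_le_trans r1.
rewrite ler_pdivrMr ?exprn_gt0// expr2 mulrA.
apply: (@le_trans _ _ (e * r)); last by rewrite ler_peMr// mulr_ge0// ltW.
by rewrite mulrC -ler_pdivrMr// lerDl.
Qed.

(** First the tails of the datum are made small, then [r] is chosen so large
    that the contributions of order [r ^- 2] are small over the time interval
    considered. *)
Lemma uniform_far (Om : domain) (th V : R) (B w0 F g g' : R -> R) (h dt : nat ->
  R) (w : nat -> nat -> int -> R) :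
  (forall k, grid_ok Om (h k)) -> (forall k, h k <= 1) -> (forall k, 0 < dt k) ->
    0 <= th <= 1 ->
  (forall k, 2 * (dt k / h k ^+ 2 * (1 - th)) <= 1) ->
  (forall s, 0 <= B s <= 1) -> measurable_fun (setT : set mR) B ->
  (forall k, scheme_solution Om th B w0 (h k) (dt k) (w k)) ->
  AC F g -> L1 Om F -> L1 Om g -> {ae mu, forall x, w0 x = F x} -> LI w0 ->
    0 <= V ->
  {ae mu, forall x, g x = g' x} -> on_dom Om g' ->
  (forall a b : R, a <= b -> `[a, b] `<=` dom Om ->
    (total_variation a b g' <= V%:E)%E) ->
  Om = Line -> forall e T : R, 0 < e -> 0 <= T -> exists2 r : R, 0 < r &
    forall k n, n%:R * dt k <= T -> Int Om (fun x => if r <= `|x| then `|st (h k)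
      (w k n) x| else 0) <= e.
Proof.
move=> hg h1 dt0 th01 cfl B01 mB sc FA FL gL wF wL V0 gg' og' gV OmL e T e0 T0.
pose e1 := e / (16 * (1 + T)).
have T1 : 0 < 1 + T by rewrite ltr_pwDl.
have e10 : 0 < e1 by rewrite divr_gt0// mulr_gt0.
have FL' : L1 Line (fun x => `|F x|) by apply: L1_norm; rewrite -OmL.
have [nA hA] := @L1_tail R (fun x => `|F x|) e1 e10 FL' (fun x => normr_ge0 _).
have gV' : forall a b : R, a <= b -> (total_variation a b g' <= V%:E)%E.
  by move=> a b ab; apply: gV => //; rewrite OmL.
have [nB hB] := @TV_tail R g' V e1 e10 gV'.
pose n0 := maxn nA nB.
have nAn : nA%:R <= n0%:R :> R by rewrite ler_nat leq_maxl.
have nBn : nB%:R <= n0%:R :> R by rewrite ler_nat leq_maxr.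
have tF c : n0%:R <= c -> ii n0%:R c (fun x => `|F x|) <= e1 /\
  ii (- c) (- n0%:R) (fun x => `|F x|) <= e1.
  move=> nc; have [] := hA c; first by apply: le_trans nc.
  have FLI := L1_LI FL'.
  have nc' : - c <= - n0%:R by rewrite lerN2.
  have nAn' : - n0%:R <= - nA%:R :> R by rewrite lerN2.
  rewrite (@ii_split _ nA%:R n0%:R c)// (@ii_split _ (- c) (- n0%:R) (- nA%:R))//.
  have i1 : 0 <= ii nA%:R n0%:R (fun x => `|F x|) by apply: ii_ge0.
  have i2 : 0 <= ii (- n0%:R) (- nA%:R) (fun x => `|F x|) by apply: ii_ge0.
  by split; lra.
have tV c : n0%:R <= c -> (total_variation n0%:R c g' <= e1%:E)%E /\
  (total_variation (- c) (- n0%:R) g' <= e1%:E)%E.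
  move=> nc; have [|b1 b2] := hB c; first by apply: le_trans nc.
  split; [apply: le_trans b1|apply: le_trans b2]; apply: TV_mono => //;
    rewrite ?lerN2//.
pose KF := Int Om (fun x => `|F x|).
have KF0 : 0 <= KF by apply: I_ge0.
pose a1 : R := (n0%:R + 3) ^+ 2; pose a2 : R := (n0.+2%:R + 3) ^+ 2.
have a10 : 0 <= a1 by exact: sqr_ge0.
have a20 : 0 <= a2 by exact: sqr_ge0.
pose a := 2 * (2 * (KF * a1) + T * (2 * (2 * V * a2) + 4 * T * (4 * V))).
have a0 : 0 <= a.
  apply: mulr_ge0 => //; apply: addr_ge0; first by do ![apply: mulr_ge0 => //].
  by apply: mulr_ge0 => //; apply: addr_ge0; do ![apply: mulr_ge0 => //].
have [|r r0 hr] := @small_inv_sq a (e / 2) a0; first by rewrite divr_gt0.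
exists r => // k n nT.
have := @u_far Om (h k) (dt k) th V B w0 F g g' (w k) (hg k) (h1 k) (dt0 k)
  th01 (cfl k) B01 mB (sc k) FA FL gL wF wL V0
  gg' og' gV OmL n0 e1 T r (ltW e10) T0 r0 tF tV n nT.
move=> /le_trans; apply.
have -> : e = 2 * (2 * (2 * e1) + T * (2 * (2 * e1))) + e / 2.
  by rewrite /e1; field; rewrite gt_eqF.
rewrite -/KF -/a1 -/a2.
have -> : 2 * (2 * (KF * (a1 / r ^+ 2) + 2 * e1)
  + T * (2 * (2 * V * (a2 / r ^+ 2) + 2 * e1) + 4 * T / r ^+ 2 * (4 * V))) =
  2 * (2 * (2 * e1) + T * (2 * (2 * e1))) + a / r ^+ 2 by rewrite /a; ring.
by rewrite lerD2l.
Qed.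

End SchemeOuter.

(** * An interpolation inequality and the completeness of L^1 *)

Section Compactness.
Context {R : realType}.
Local Notation mu := (@lebesgue_measure R).
Local Notation mR := (measurableTypeR R).
Implicit Types (Om : domain) (f g q y : R -> R) (x r h : R).

(** The average of [q] over [[x, x + r]] is a difference quotient of [y], of
    L^1 norm at most [2 |y| / r]; the distance of [q] to its average is
    controlled by its translates. *)
Lemma AC_interpolation Om y q r (D : R) : 0 < r -> 0 <= D -> AC y q -> L1 Om y ->
  L1 Om q ->
  (forall s, 0 <= s <= r -> Int Om (fun x => `|q (x + s) - q x|) <= D) ->
  Int Om (fun x => `|q x|) <= 2 * Int Om (fun x => `|y x|) / r + D.
Proof.
move=> r0 D0 [qLI yq] yL qL qD; have mq := qLI.1.
have r0' := ltW r0.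
have [||||TL TI] := @Tonelli R Om (fun s x => `|q (x + s) - q x|) 0 r D r0' D0.
- apply: measurableT_comp => //; apply: measurable_funB.
    by apply: (measurableT_comp mq); exact: measurable_funD.
  exact: (measurableT_comp mq).
- by [].
- move=> s; apply: (on_dom_comp (fun z => `|z|)); have [oq _ _] := qL.
  exact: (on_dom_comp2 (fun u v => u - v) (on_dom_shift s oq) oq).
- move=> s hs; rewrite I_integral ?lee_fin; first exact: qD.
  by apply: L1_norm; apply: L1B => //; exact: L1_shift.
pose G x := ii 0 r (fun s => `|q (x + s) - q x|).
have yr : L1 Om (fun x => `|y (x + r)|) by apply: L1_norm; exact: L1_shift.
have ptw x : `|q x| <= r^-1 * (`|y (x + r)| + `|y x| + G x).
  have qs : LI (fun s => q (x + s)).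
    by have := LI_shift x qLI; congr LI; apply/funext => s; rewrite addrC.
  have dL : LI (fun s => q (x + s) - q x) by apply: LIB => //; exact: LI_cst.
  have E : ii 0 r (fun s => q (x + s)) = y (x + r) - y x.
    rewrite yq ?lerDl//; have := @ii_shift R 0 r x q mq;
      rewrite add0r (addrC r) => <-.
    by apply: eq_ii => s _; rewrite addrC.
  have -> : q x = r^-1 * ((y (x + r) - y x) - ii 0 r (fun s => q (x + s) - q x)).
    by rewrite iiB//; [rewrite E ii_cst// subr0; field;
      rewrite gt_eqF|exact: LI_cst].
  rewrite normrM [`|r^-1|]gtr0_norm ?invr_gt0//; apply: ler_wpM2l;
    first by rewrite invr_ge0.
  apply: le_trans (ler_normB _ _) _; apply: lerD; first exact: ler_normB.
  exact: ii_norm.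
have sL : L1 Om (fun x => `|y (x + r)| + `|y x|) by apply: L1D => //;
  exact: L1_norm.
apply: le_trans (le_I (L1_norm qL) (L1Z r^-1 (L1D sL TL)) ptw) _.
rewrite I_Z; last exact: L1D.
rewrite I_D// I_D//; last exact: L1_norm.
rewrite (I_shift r (L1_norm yL)) subr0 in TI *.
rewrite mulrC ler_pdivrMr// mulrDl mulfVK ?gt_eqF//.
rewrite (_ : _ + _ + _ = 2 * Int Om (fun x => `|y x|)
  + Int Om (fun x => ii 0 r (fun s => `|q (x + s) - q x|))).
  by rewrite lerD2l.
by ring.
Qed.

Lemma half_sum n : \sum_(0 <= i < n) (2^-1 : R) ^+ i <= 2.
Proof.
have H : \sum_(0 <= i < n) (2^-1 : R) ^+ i = 2 - 2 * 2^-1 ^+ n.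
  elim: n => [|n IH]; first by rewrite big_geq// expr0; ring.
  by rewrite big_nat_recr//= IH exprS; field.
by rewrite H lerBlDr lerDl mulr_ge0// exprn_ge0.
Qed.

(** Riesz and Fischer: the series of the increments converges almost
    everywhere, and together with [|q 0|] it dominates the sequence. The
    pointwise construction also preserves a uniform bound and periodicity. *)
Lemma L1_complete Om (C : R) (q : nat -> R -> R) : (forall i, L1 Om (q i)) ->
  (forall i x, `|q i x| <= C) ->
  (forall i, Int Om (fun x => `|q i.+1 x - q i x|) <= 2^-1 ^+ i) ->
  exists p, [/\ L1 Om p, forall x, `|p x| <= C &
    Int Om (fun x => `|q i x - p x|) @[i --> \oo] --> 0].
Proof.
move=> qL qC qI.
have mD := measurable_dom (R := R) Om.
have mq i : measurable_fun (setT : set mR) (q i) by have [_ ? _] := qL i.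
have oq i : on_dom Om (q i) by have [? _ _] := qL i.
pose a i x := `|q i.+1 x - q i x|.
have aL i : L1 Om (a i) by apply/L1_norm/L1B.
have ma i : measurable_fun (setT : set mR) (EFin \o a i)
  by apply/measurable_EFinP; have [_ ? _] := aL i.
pose S x := (\sum_(0 <= i <oo) (a i x)%:E)%E.
have mS : measurable_fun (setT : set mR) S.
  apply: (@ge0_emeasurable_sum _ _ R setT (fun i x => (a i x)%:E) predT) => //.
    by move=> k x _ _; rewrite lee_fin /a.
  by move=> k _; exact: ma.
have S0 x : (0 <= S x)%E by apply: nneseries_ge0 => k _ _; rewrite lee_fin /a.
have SI : (\int[mu]_(x in dom Om) S x <= 2%:E)%E.
  rewrite integral_nneseries//; first last.
  - by move=> n x _; rewrite lee_fin /a.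
  - by move=> n; exact: (measurable_funS measurableT (@subsetT _ _) (ma n)).
  apply: lime_le; first by apply: is_cvg_nneseries => n _ _;
    apply: integral_ge0 => x _; rewrite lee_fin /a.
  apply: nearW => n.
  rewrite (eq_bigr (fun i => (Int Om (a i))%:E)); last by move=> i _;
    rewrite I_integral.
  rewrite sumEFin lee_fin; apply: le_trans (half_sum n).
  by apply: ler_sum => i _; exact: qI.
have SiL : mu.-integrable (dom Om) S.
  apply/integrableP; split; first exact: (measurable_funS measurableT (@subsetT _
    _) mS).
  have -> : (fun x => `|S x|%E) = S by apply/funext => x; rewrite gee0_abs.
  exact: le_lt_trans SI (ltry _).
(* The sequence is replaced by 0 on the null set where the series of the
   increments diverges. *)
pose hq i x := if (S x < +oo)%E then q i x else 0.
pose p x := limn (fun i => hq i x).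
have ncvg x : cvgn (fun i => hq i x).
  rewrite /hq; case Sx : (S x < +oo)%E; last exact: is_cvg_cst.
  have -> : (fun i => q i x) = (fun n => q 0%N x + series (telescope (fun i => q
    i x)) n).
    by apply/funext => n; exact: (@eq_sum_telescope R (fun i => q i x) n).
  apply: is_cvgD; first exact: is_cvg_cst.
  apply: normed_cvg; apply: nondecreasing_is_cvgn.
    by apply: nondecreasing_series => n _ _; exact: normr_ge0.
  exists (fine (S x)) => _ [n _ <-].
  have Sf : S x \is a fin_num by rewrite ge0_fin_numE.
  rewrite -lee_fin fineK// /series /= -sumEFin.
  by apply: (@nneseries_lim_ge R (fun i => (a i x)%:E)) => i _ _;
    rewrite lee_fin /a.
have hp x : hq i x @[i --> \oo] --> p x by exact: ncvg.
have mhq i : measurable_fun (setT : set mR) (hq i).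
  apply: measurable_fun_ifT => //; apply: measurable_fun_lte => //.
have mp : measurable_fun (setT : set mR) p.
  by apply: (measurable_fun_cvg mhq) => x _; exact: hp.
have oS : Om = Circle -> forall x, S (x + 1) = S x.
  move=> OmC x; apply: eq_eseriesr => i _; rewrite /a.
  by move: (oq i) (oq i.+1); rewrite OmC /= => -> ->.
have ohq i : on_dom Om (hq i).
  move: oS (oq i); case: (Om) => //= oS' oq' x.
  by rewrite /hq oS'// oq'.
have op : on_dom Om p.
  move: ohq; clear; case: (Om) => //= ohq x; rewrite /p.
  by congr (limn _); apply/funext => i; exact: ohq.
have pC x : `|p x| <= C.
  have C0 : 0 <= C by exact: le_trans (qC 0%N 0).
  have hC i : `|hq i x| <= C by rewrite /hq; case: ifP => _; rewrite ?normr0.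
  rewrite ler_norml; apply/andP; split; [apply: limr_ge|apply: limr_le];
    rewrite ?ncvg//; apply: nearW => i;
    by have := hC i; rewrite ler_norml => /andP[].
pose gg x := ((`|q 0%N x|)%:E + S x)%E.
have ggL : mu.-integrable (dom Om) gg.
  apply: integrableD => //; have [_ _ h1] := L1_norm (qL 0%N); exact: h1.
have [|||||pi cv _] := @dominated_convergence _ mR R mu (dom Om)
  mD (fun i => EFin \o hq i) (EFin \o p) gg.
- by move=> n; exact/measurable_EFinP/measurable_funTS.
- exact/measurable_EFinP/measurable_funTS.
- by apply: aeW => x _; apply: cvg_EFin; [exact: nearW|exact: hp].
- exact: ggL.
- apply: aeW => x n _ /=; rewrite /hq /gg; case: ifPn => Sx;
    last by rewrite normr0; apply: adde_ge0.
  have Sf : S x \is a fin_num by rewrite ge0_fin_numE.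
  rewrite -(fineK Sf) -EFinD lee_fin (@eq_sum_telescope R (fun i => q i x) n).
  apply: le_trans (ler_normD _ _) _; rewrite lerD2l;
    apply: le_trans (ler_norm_sum _ _ _) _.
  rewrite -lee_fin fineK// -sumEFin.
  by apply: (@nneseries_lim_ge R (fun i => (a i x)%:E)) => i _ _;
    rewrite lee_fin /a.
have pL : L1 Om p by split.
exists p; split => //.
have E i : (\int[mu]_(x in dom Om) `|(hq i x)%:E - (p x)%:E| = (Int Om (fun x =>
  `|q i x - p x|))%:E)%E.
  rewrite -I_integral; last exact/L1_norm/L1B.
  have fa := integrable_ae mD SiL.
  apply: ge0_ae_eq_integral => //.
  - by apply/measurable_EFinP; apply: measurableT_comp => //;
      apply: measurable_funB; exact: measurable_funTS.
  - by apply/measurable_EFinP; apply: measurableT_comp => //;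
      apply: measurable_funB; exact: measurable_funTS.
  - apply: ae_imp fa => x Sx Dx; rewrite /hq ifT//.
    by have := Sx Dx; rewrite ge0_fin_numE.
have {}cv : (Int Om (fun x => `|q i x - p x|))%:E @[i --> \oo] --> (0 : R)%:E.
  by apply: cvg_trans cv; apply: near_eq_cvg; apply: nearW => i /=; rewrite E.
by move/fine_cvgP: cv => [_].
Qed.

End Compactness.

(** * Limits of absolutely continuous functions, and ultrafilters *)

Section Limits.
Context {R : realType}.
Local Notation mu := (@lebesgue_measure R).
Local Notation mR := (measurableTypeR R).
Implicit Types (Om : domain) (f g q : R -> R) (x y r h : R).

Lemma L1_fatou Om (K : R) (f : nat -> R -> R) g : (forall i, L1 Om (f i)) ->
  (forall i, Int Om (fun x => `|f i x|) <= K) -> (forall x,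
    f i x @[i --> \oo] --> g x) ->
  L1 Om g /\ Int Om (fun x => `|g x|) <= K.
Proof.
move=> fL fK fg; have mD := measurable_dom (R := R) Om.
have mf i : measurable_fun (setT : set mR) (f i) by have [_ ? _] := fL i.
have mg : measurable_fun (setT : set mR) g.
  by apply: (measurable_fun_cvg mf) => x _; exact: fg.
have og : on_dom Om g.
  have of_ i : on_dom Om (f i) by have [? _ _] := fL i.
  case: (Om) of_ => //= of_ x; have h1 := cvg_lim (@Rhausdorff R) (fg x);
    have h2 := cvg_lim (@Rhausdorff R) (fg (x + 1)).
  by rewrite -h1 -h2; congr (limn _); apply/funext => i.
apply: L1_bounded_integral => //.
have := @fatou _ mR R mu (dom Om) mD (fun i x => `|f i x|%:E).
have mnf i : measurable_fun (dom Om) (fun x : mR => `|f i x|%:E).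
  by have [_ mn _] := L1_norm (fL i); apply/measurable_EFinP;
    exact: (measurable_funS measurableT (@subsetT _ _) mn).
have n0 (i : nat) (x : mR) : dom Om x -> (0 <= `|f i x|%:E)%E by move=> _;
  rewrite lee_fin.
move=> /(_ mnf n0) H.
have E x : limn_einf (fun i => `|f i x|%:E) = `|g x|%:E.
  apply: (cvg_limn_einf_sup _).1; apply: cvg_EFin; first exact: nearW.
  exact: cvg_norm (fg x).
have {}E : (fun x : mR => limn_einf (fun i => `|f i x|%:E))
  = (fun x => `|g x|%:E) by apply/funext.
rewrite E in H; apply: le_trans H _; rewrite limn_einf_lim; apply: lime_le;
  first exact: is_cvg_einfs.
apply: nearW => n; apply: (@le_trans _ _ (Int Om (fun x => `|f n x|))%:E);
  last by rewrite lee_fin.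
rewrite -I_integral; last exact: L1_norm.
by apply: ereal_inf_lbound; exists n => //=.
Qed.

(** On [[x, x + 1]] the function is within the integral of [|g|] of its value
    at [x]. *)
Lemma AC_sup Om f g x : AC f g -> L1 Om f -> L1 Om g ->
  `|f x| <= Int Om (fun z => `|f z|) + Int Om (fun z => `|g z|).
Proof.
move=> fg fL gL; have [gLI Fg] := fg; have fLI := AC_LI fg.
have x1 : x <= x + 1 by rewrite lerDl.
have x11 : x + 1 - x <= 1 by rewrite addrC addKr.
have a1 := ii_le_I x1 x11 (L1_norm fL) (fun z => normr_ge0 _).
have a2 := ii_le_I x1 x11 (L1_norm gL) (fun z => normr_ge0 _).
apply: le_trans (lerD a1 a2).
set G := ii x (x + 1) (fun z => `|g z|).
have G0 : `|f x| - G <= ii x (x + 1) (fun z => `|f z|).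
  rewrite -[leLHS]mulr1 -{1}(addKr x 1) (addrC (- x)) -(ii_cst _ x1).
  apply: le_ii; [exact: LI_cst|exact: LI_norm|] => z /andP[xz zx].
  have : `|f z - f x| <= G.
    rewrite Fg//; apply: le_trans (ii_norm _ _ gLI) _.
    rewrite /G [leRHS](@ii_split _ _ z)//; last exact: LI_norm.
    by rewrite lerDl; apply: ii_ge0.
  by have := ler_normB (f z) (f z - f x); rewrite subKr; lra.
lra.
Qed.

Lemma ii_le_nI Om f x y (n : nat) : x <= y -> y <= x + n%:R -> L1 Om f ->
  (forall z, 0 <= f z) ->
  ii x y f <= n%:R * Int Om f.
Proof.
move=> xy yn fL f0; have fLI := L1_LI fL.
elim: n y xy yn => [|n IH] y xy yn.
  have -> : y = x by apply/eqP; rewrite eq_le xy andbT; rewrite addr0 in yn.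
  by rewrite ii_xx mul0r.
have nS : (n.+1%:R : R) = n%:R + 1 by rewrite natr1.
rewrite nS mulrDl mul1r.
have I0 : 0 <= Int Om f by apply: I_ge0.
case: (leP y (x + 1)) => y1.
  apply: (@le_trans _ _ (Int Om f)); first by apply: ii_le_I => //; lra.
  by rewrite lerDr mulr_ge0.
rewrite (@ii_split _ _ (y - 1))//; [|lra|lra].
apply: lerD; first by apply: IH; rewrite ?nS in yn *; lra.
by apply: ii_le_I => //; lra.
Qed.

Lemma ii_close Om f g x y (n : nat) : x <= y -> y <= x + n%:R -> L1 Om f ->
  L1 Om g ->
  `|ii x y f - ii x y g| <= n%:R * Int Om (fun z => `|f z - g z|).
Proof.
move=> xy yn fL gL; rewrite -iiB; [|exact: L1_LI fL|exact: L1_LI gL].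
have dL := L1B fL gL.
apply: le_trans (ii_norm _ _ (L1_LI dL)) _.
by apply: ii_le_nI => //; exact: L1_norm.
Qed.

(** Convergence in L^1 of the derivatives suffices to pass to the limit in
    integrals over bounded intervals. *)
Lemma AC_limit Om (f q : nat -> R -> R) v p : (forall i, AC (f i) (q i)) ->
  (forall i, L1 Om (q i)) -> L1 Om p ->
  (forall x, f i x @[i --> \oo] --> v x) -> Int Om (fun x => `|q i x - p x|)
    @[i --> \oo] --> 0 -> AC v p.
Proof.
move=> fq qL pL fv qp; split; first exact: L1_LI pL.
move=> x y xy; pose n := (Num.truncn (y - x)).+1.
have yn : y <= x + n%:R by rewrite -lerBlDl; apply/ltW/truncnS_gt.
have c1 : f i y - f i x @[i --> \oo] --> v y - v x by apply: cvgB; exact: fv.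
have c2 : ii x y (q i) @[i --> \oo] --> ii x y p.
  apply/cvgrPdist_lt => e e0.
  have n0 : 0 < n%:R :> R by rewrite ltr0n.
  have e1 : 0 < e / n%:R by rewrite divr_gt0.
  have /cvgrPdist_lt/(_ _ e1) := qp; apply: filterS => i.
  rewrite sub0r normrN ger0_norm ?I_ge0// ltr_pdivlMr// mulrC => h.
  by rewrite distrC; apply: le_lt_trans h; exact: ii_close.
have E : (fun i => f i y - f i x) = (fun i => ii x y (q i)).
  by apply/funext => i; have [_ ->] := fq i.
rewrite E in c1; exact: (cvg_unique (@Rhausdorff R) c1 c2).
Qed.

Lemma cvg_half (a : nat -> R) (c : R) : (forall i,
  `|a i.+1 - a i| <= c * 2^-1 ^+ i) -> cvgn a.
Proof.
move=> ac.
have -> : a = (fun n => a 0%N + series (telescope a) n).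
  by apply/funext => n; exact: (@eq_sum_telescope R a n).
apply: is_cvgD; first exact: is_cvg_cst.
apply: normed_cvg; apply: nondecreasing_is_cvgn.
  by apply: nondecreasing_series => n _ _; exact: normr_ge0.
exists (c * 2) => _ [n _ <-].
have c0 : 0 <= c by have := ac 0%N; rewrite expr0 mulr1; apply: le_trans.
apply: (@le_trans _ _ (c * \sum_(0 <= i < n) 2^-1 ^+ i));
  last by apply: ler_wpM2l => //; exact: half_sum.
by rewrite mulr_sumr /series /=; apply: ler_sum => i _; exact: ac.
Qed.

Lemma half_small (e : R) : 0 < e -> exists n : nat, forall k, (n <= k)%N ->
  (2^-1 : R) ^+ k <= e.
Proof.
move=> e0; have h1 : `|2^-1 : R| < 1 by rewrite ger0_norm//; lra.
have /cvgrPdist_lt/(_ _ e0) [n _ hn] := @cvg_geometric R 1 2^-1 h1.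
exists n => k nk; have := hn k nk; rewrite /geometric /= mul1r sub0r normrN
  ger0_norm ?exprn_ge0//.
exact: ltW.
Qed.

Lemma measurable_switch (d : measure_display) (T : measurableType d) (c : T ->
  R) (G : nat -> T -> R) :
  measurable_fun (setT : set T) c -> (forall n, measurable_fun (setT : set T)
    (G n)) ->
  measurable_fun (setT : set T) (fun z => G (Num.truncn (c z)) z).
Proof.
move=> mc mG _ Y mY; rewrite setTI.
pose A (n : nat) : set T := [set z | (Num.truncn (c z))%:R = n%:R :> R]
  `&` (G n @^-1` Y).
rewrite (_ : _ @^-1` _ = \bigcup_n A n).
  apply: bigcupT_measurable => n; apply: measurableI;
    last by rewrite -[_ @^-1` _]setTI; exact: mG.
  have mq : measurable_fun (setT : set T) (fun z => (Num.truncn (c z))%:R : R).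
    have := measurable_floorT (fun j => (match j with Posz n => n | _ => 0%N
      end)%:R : R) mc.
    by congr measurable_fun; apply/funext => z; rewrite truncEfloor.
  have := mq measurableT [set n%:R] (measurable_set1 _); rewrite setTI.
  by congr (measurable _).
apply/seteqP; split => z /=; first by move=> h; exists (Num.truncn (c z)).
by move=> [n _ [/= /eqP]]; rewrite eqr_nat => /eqP ->.
Qed.

(** Finitely many intervals of length [e] cover the range of the sequence; the
    ultrafilter selects one of them. *)
Lemma ultra_close (U : set_system nat) (a : nat -> R) (M e : R)
  : UltraFilter U -> (forall k, `|a k| <= M) -> 0 < e ->
  exists A, U A /\ forall k l, A k -> A l -> `|a k - a l| <= e.
Proof.
move=> UU aM e0; have UP := @ultra_proper _ U UU.
have H (n : nat) c : U [set k | c <= a k <= c + n%:R * e] ->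
  exists A, U A /\ forall k l, A k -> A l -> `|a k - a l| <= e.
  elim: n c => [|n IH] c Uc.
    exists [set k | c <= a k <= c + 0%:R * e]; split => // k l /= hk hl.
    by rewrite ler_norml; apply/andP; split; lra.
  have nS : (n.+1%:R : R) = n%:R + 1 by rewrite natr1.
  case: (in_ultra_setVsetC [set k | a k <= c + n%:R * e] UU) => h.
    apply: (IH c); apply: filterS (filterI Uc h) => k /= [/andP[h1 _] h2].
    by apply/andP.
  exists [set k | c + n%:R * e <= a k <= c + n%:R * e + e]; split.
    apply: filterS (filterI Uc h) => k /= [/andP[_ h1] /negP].
    by rewrite -ltNge => h2; rewrite (ltW h2)/=; apply: le_trans h1 _;
      rewrite nS mulrDl mul1r addrA.
  by move=> k l /= hk hl; rewrite ler_norml; apply/andP; split; lra.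
apply: (H (Num.truncn (2 * M / e)).+1 (- M)).
apply: filterS filterT => k _ /=; have := aM k; rewrite ler_norml => /andP[-> h] /=.
have := Num.Theory.truncnS_gt (2 * M / e); rewrite ltr_pdivrMr// => /ltW h2.
lra.
Qed.

Lemma ultra_forall (U : set_system nat) (n : nat) (Q : nat -> nat -> nat ->
  Prop) : Filter U ->
  (forall i, (i < n)%N -> exists A, U A /\ forall k l, A k -> A l -> Q i k l) ->
  exists A, U A /\ forall k l, A k -> A l -> forall i, (i < n)%N -> Q i k l.
Proof.
move=> UF; elim: n => [|n IH] H; first by exists setT; split => //; exact: filterT.
have [A [UA hA]] := IH (fun i (h : (i < n)%N) => H i (ltnW h)).
have [A' [UA' hA']] := H n (ltnSn n).
exists (A `&` A'); split; first exact: filterI.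
move=> k l [Ak A'k] [Al A'l] i; rewrite ltnS leq_eqVlt => /orP[/eqP ->|iN];
  first exact: hA'.
exact: hA.
Qed.

End Limits.

(** * Extraction of a convergent subsequence *)

Section Extract.
Context {R : realType}.
Local Notation mu := (@lebesgue_measure R).
Local Notation mR := (measurableTypeR R).
Context (Om : domain) (B F : R -> R) (th C M K : R) (h dt : nat -> R) (w : nat ->
  nat -> int -> R)
  (u : nat -> nat -> R -> R).
Context (Hrun : forall k, run Om B F th C M K (h k) (dt k) (w k) (u k))
  (h0 : forall k, 0 < h k) (h1 : forall k, h k <= 1) (dt0 : forall k, 0 < dt k)
  (hc : h k @[k --> \oo] --> 0) (dtc : dt k @[k --> \oo]
    --> 0) (C0 : 0 <= C) (M0 : 0 <= M)
  (far : Om = Line -> forall e T : R, 0 < e -> 0 <= T -> exists2 r : R, 0 < r &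
    forall k n, n%:R * dt k <= T -> Int Om (fun x => if r <= `|x| then `|u k n x|
      else 0) <= e).

Definition interp_at (h dt : R) (u : nat -> R -> R) (t : R) : R ->
  R := average h (u (Num.truncn (t / dt))).
Definition slope_at (h dt : R) (u : nat -> R -> R) (t : R) : R ->
  R := slope h (u (Num.truncn (t / dt))).
Let Y k t := interp_at (h k) (dt k) (u k) t.
Let P k t := slope_at (h k) (dt k) (u k) t.

Let YL k t : L1 Om (Y k t). Proof. exact: (run_yL (Hrun k)). Qed.
Let PL k t : L1 Om (P k t). Proof. exact: (run_pL (Hrun k)). Qed.
Let YP k t : AC (Y k t) (P k t). Proof. exact: (run_AC (Hrun k)). Qed.
Let YM k t x : `|Y k t x| <= M. Proof. exact: (run_yM (Hrun k)). Qed.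
Let PC k t x : `|P k t x| <= C. Proof. exact: (run_pC (Hrun k)). Qed.

Let dY k l s t : L1 Om (fun x => Y k s x - Y l t x). Proof. exact: L1B. Qed.
Let dP k l s t : L1 Om (fun x => P k s x - P l t x). Proof. exact: L1B. Qed.

Lemma Y_lip k t x z : `|Y k t x - Y k t z| <= C * `|x - z|.
Proof.
wlog xz : x z / x <= z.
  by move=> H; case: (leP x z) => [/H//|/ltW/H]; rewrite distrC (distrC z).
have [PLI E] := YP k t.
rewrite distrC E// [`|x - z|]distrC (ger0_norm (_ : 0 <= z - x)) ?subr_ge0//.
by apply: ii_bound => // y _; exact: PC.
Qed.

Lemma Y_time k s t : 0 <= s -> s <= t -> Int Om (fun x => `|Y k t x - Y k s x|)
  <= 2 * C * (t - s + dt k).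
Proof.
move=> s0 st; set n := Num.truncn (s / dt k); set m := Num.truncn (t / dt k).
have dk := dt0 k.
have nm : (n <= m)%N by apply: le_truncn; rewrite ler_pM2r ?invr_gt0.
have sd : 0 <= s / dt k by rewrite divr_ge0// ltW.
have td : 0 <= t / dt k by apply: divr_ge0; [exact: le_trans st|exact: ltW].
have a1 : s < n%:R * dt k + dt k.
  by have := Num.Theory.truncnS_gt (s / dt k);
    rewrite -natr1 ltr_pdivrMr// mulrDl mul1r.
have a2 : m%:R * dt k <= t by rewrite -ler_pdivlMr// truncn_le.
have := run_time (Hrun k) n (m - n); rewrite subnKC// => /le_trans; apply.
have -> : 2 * ((m - n)%:R * dt k * C) = 2 * C * (m%:R * dt k - n%:R * dt k)
  by rewrite natrB//; ring.
apply: ler_wpM2l; first by rewrite mulr_ge0.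
by lra.
Qed.

(** The interpolation inequality, applied to the difference of two
    interpolations, whose slopes inherit a modulus of continuity from
    [p_shift]. *)
Lemma Y_P k l s t r : 0 < r ->
  Int Om (fun x => `|P k s x - P l t x|) <= 2 * Int Om (fun x => `|Y k s x - Y l
    t x|) / r + C * (2 * r + h k + h l).
Proof.
move=> r0; have D0 : 0 <= C * (2 * r + h k + h l).
  by have := h0 k; have := h0 l => hl hk; apply: mulr_ge0 => //; lra.
apply: (@AC_interpolation R Om _ _ r _ r0 D0 (ACB (YP k s) (YP l t)))
  => // z /andP[z0 zr].
pose e1 x := P k s (x + z) - P k s x; pose e2 x := P l t (x + z) - P l t x.
have e1L : L1 Om e1 by apply: L1B => //; exact: L1_shift.
have e2L : L1 Om e2 by apply: L1B => //; exact: L1_shift.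
have b1 : Int Om (fun x => `|e1 x|) <= C * (z + h k) := run_shift (Hrun k) _ z0.
have b2 : Int Om (fun x => `|e2 x|) <= C * (z + h l) := run_shift (Hrun l) _ z0.
have nL := L1D (L1_norm e1L) (L1_norm e2L).
apply: (@le_trans _ _ (Int Om (fun x => `|e1 x| + `|e2 x|))).
  apply: le_I => //.
    by apply/L1_norm/L1B => //; exact: (L1_shift z (dP k l s t)).
  move=> x; apply: le_trans (ler_normB _ _); rewrite le_eqVlt; apply/orP; left;
    apply/eqP.
  by congr `|_|; rewrite /e1 /e2; ring.
rewrite I_D; [|exact: L1_norm|exact: L1_norm].
apply: le_trans (lerD b1 b2) _; rewrite -mulrDr; apply: ler_wpM2l => //; lra.
Qed.

(** On the line the mass outside a large window is uniformly small; on the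
    circle a window that contains a period suffices. *)
Lemma Y_far (e T : R) : 0 < e -> 0 <= T -> exists rho : nat, (0 < rho)%N /\
  forall k l t, 0 <= t <= T ->
  Int Om (fun x => `|Y k t x - Y l t x|) <= ii (- rho%:R)
    rho%:R (fun x => `|Y k t x - Y l t x|) + e.
Proof.
move=> e0 T0.
have [OmC|OmL] : Om = Circle \/ Om = Line by case: (Om); [right|left].
  exists 1%N; split => // k l t _; apply: ler_wpDr; first exact: ltW.
  have fLI := LI_norm (L1_LI (dY k l t t)).
  have m10 : - 1 <= 0 :> R by lra.
  rewrite OmC /Int /= -/(ii 0 1 _) [leRHS](@ii_split _ (- 1) 0 1)//.
  by rewrite lerDr; apply: ii_ge0.
have e4 : 0 < e / 4 by rewrite divr_gt0.
have [r r0 hr] := far OmL e4 T0.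
exists (Num.truncn r).+2; split => // k l t /andP[t0 tT].
set rho := _.+2.
have rr : r + 1 <= rho%:R.
  by have := Num.Theory.truncnS_gt r; rewrite /rho -[_.+2%:R]natr1 lerD2r => /ltW.
pose cut (f : R -> R) x := if r <= `|x| then `|f x| else 0.
have cutL f : L1 Om f -> L1 Om (cut f).
  move=> fL; apply: (L1_le _ _ (L1_norm fL)); first by rewrite OmL.
    by apply: measurable_fun_ifT => //; [apply: measurable_fun_ler => //|have [_
      ? _] := L1_norm fL].
  by move=> x; rewrite /cut; case: ifP => _; rewrite ?normr0// normr_id.
pose E k x := cut (u k (Num.truncn (t / dt k))) x.
have uL k' := run_uL (Hrun k') (Num.truncn (t / dt k')).
have EL k' : L1 Om (E k') by exact: cutL.
have EI k' : Int Om (E k') <= e / 4.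
  apply: hr; apply: le_trans tT; rewrite -ler_pdivlMr// truncn_le//.
  by rewrite divr_ge0// ltW.
pose G k x := E k x + E k (x + h k).
have GL k' : L1 Om (G k') by apply: L1D => //; exact: L1_shift.
have GI k' : Int Om (G k') <= e / 2.
  rewrite I_D//; last exact: L1_shift.
  rewrite (I_shift (h k') (EL k')); have := EI k'; lra.
have YG k' x : rho%:R <= `|x| -> `|Y k' t x| <= G k' x.
  move=> rx; apply: le_trans (run_yle (Hrun k') _ x) _.
  rewrite /G /E /cut ifT; last by lra.
  rewrite ifT//.
  have := lerB_normD x (h k'); rewrite [`|h k'|]ger0_norm ?(ltW (h0 _))//;
    have := h1 k'; lra.
pose f x := `|Y k t x - Y l t x|.
have fL : L1 Om f by exact: L1_norm.
pose f1 x := if `|x| <= rho%:R then f x else 0.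
have f1L : L1 Om f1.
  apply: (L1_le _ _ fL); first by rewrite OmL.
    by apply: measurable_fun_ifT => //; [apply: measurable_fun_ler => //|have [_
      ? _] := fL].
  by move=> x; rewrite /f1; case: ifP => _; rewrite ?normr0 /f ?normr_id.
apply: (@le_trans _ _ (Int Om (fun x => f1 x + (G k x + G l x)))).
  apply: le_I => //; first by apply: L1D => //; exact: L1D.
  have G0 k' x : 0 <= G k' x by rewrite /G /E /cut; do 2 case: ifP => _;
    rewrite ?addr0 ?add0r// addr_ge0.
  move=> x; rewrite /f1; case: ifPn => [_|]; first by rewrite /f lerDl addr_ge0.
  rewrite -ltNge add0r => /ltW rx; apply: le_trans (ler_normB _ _) _.
  by apply: lerD; exact: YG.
rewrite I_D//; last exact: L1D.
rewrite (I_D (GL k) (GL l)); apply: lerD; last by have := GI k; have := GI l; lra.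
have -> : Int Om f1 = ii (- rho%:R) rho%:R f1.
  rewrite OmL /Int /=; apply: Rintegral_supp => x;
    rewrite /f1 ltNge => /negbTE ->//.
apply: le_ii; [exact: L1_LI f1L|exact: L1_LI fL|].
by move=> x _; rewrite /f1; case: ifP => //; rewrite /f.
Qed.

Section ultra.
Context (U : set_system nat) (UU : UltraFilter U) (Uoo : \oo `<=` U).

Let UP : ProperFilter U. Proof. exact: ultra_proper. Qed.

Lemma U_small (a : nat -> R) (e : R) : a k @[k --> \oo] --> 0 -> 0 < e ->
  U [set k | `|a k| <= e].
Proof.
move=> a0 e0; apply: Uoo; have /cvgrPdist_lt/(_ _ e0) := a0.
by apply: filterS => k /=; rewrite sub0r normrN => /ltW.
Qed.

(** The interpolations are equi-Lipschitz in space and, up to the time step,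
    Lipschitz in time with values in L^1. Hence it suffices that they are
    close at finitely many points of a time-space grid, which the ultrafilter
    ensures; it replaces a diagonal extraction. *)
Lemma U_Y (e T : R) : 0 < e -> 0 <= T -> exists A, U A /\ forall k l, A k -> A l ->
  forall t, 0 <= t <= T -> Int Om (fun x => `|Y k t x - Y l t x|) <= e.
Proof.
move=> e0 T0.
have e4 : 0 < e / 4 by rewrite divr_gt0.
have [rho [rho0 hrho]] := Y_far e4 T0.
have rr : 0 < rho%:R :> R by rewrite ltr0n.
pose tau := e / (16 * (C + 1)).
have C1 : 0 < C + 1 by rewrite ltr_wpDl.
have tau0 : 0 < tau by rewrite divr_gt0// mulr_gt0.
have Ctau : 8 * C * tau <= e / 2.
  have -> : e / 2 = 8 * (C + 1) * tau by rewrite /tau; field; rewrite gt_eqF.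
  by apply: ler_wpM2r; [exact: ltW|lra].
pose eta := e / (16 * rho%:R).
have eta0 : 0 < eta by rewrite divr_gt0// mulr_gt0.
pose N := (Num.truncn (2 * C / eta)).+1.
have N0 : 0 < N%:R :> R by rewrite ltr0n.
have CN : 2 * C / N%:R <= eta.
  have /ltW := Num.Theory.truncnS_gt (2 * C / eta).
  by rewrite -/N !ler_pdivrMr// [N%:R * _]mulrC.
pose nT := (Num.truncn (T / tau)).+1.
pose nX := (Num.truncn (2 * rho%:R * N%:R : R)).+1.
pose Q i k l := forall m, (m < nX)%N -> `|Y k (i%:R * tau)
  (- rho%:R + m%:R / N%:R) - Y l (i%:R * tau) (- rho%:R + m%:R / N%:R)| <= eta.
have [A [UA hA]] : exists A, U A /\ forall k l, A k -> A l ->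
  forall i, (i < nT)%N -> Q i k l.
  apply: ultra_forall => i _; apply: ultra_forall => m _.
  exact: (@ultra_close R U (fun k => Y k (i%:R * tau) (- rho%:R + m%:R / N%:R))
    M eta UU (fun k => YM _ _ _) eta0).
exists (A `&` [set k | `|dt k| <= tau]); split; first by apply: filterI => //;
  exact: U_small.
move=> k l [Ak /= dk] [Al /= dl] t /andP[t0 tT].
rewrite gtr0_norm// in dk; rewrite gtr0_norm// in dl.
pose i := Num.truncn (t / tau).
have tt0 : 0 <= t / tau by rewrite divr_ge0// ltW.
have iT : (i < nT)%N by rewrite ltnS; apply: le_truncn; rewrite ler_pM2r ?invr_gt0.
have it1 : i%:R * tau <= t by rewrite -ler_pdivlMr// truncn_le.
have it2 : t < i%:R * tau + tau.
  by have := Num.Theory.truncnS_gt (t / tau); rewrite -natr1 ltr_pdivrMr// mulrDl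
    mul1r.
have it0 : 0 <= i%:R * tau by rewrite mulr_ge0// ltW.
pose s := i%:R * tau.
have grid : Int Om (fun x => `|Y k s x - Y l s x|) <= e / 2.
  have sT : 0 <= s <= T by apply/andP; split => //; apply: le_trans tT.
  apply: le_trans (hrho k l s sT) _.
  have fLI := L1_LI (dY k l s s).
  have rr2 : - rho%:R <= rho%:R :> R by rewrite (@le_trans _ _ 0)// ?oppr_le0 ltW.
  have : `|ii (- rho%:R) rho%:R (fun x => `|Y k s x - Y l s x|)| <= 2 * eta *
    (rho%:R - - rho%:R).
    apply: ii_bound => //; first exact: LI_norm.
    move=> x /andP[x1 x2]; rewrite normr_id.
    pose m := Num.truncn ((x + rho%:R) * N%:R).
    have xr0 : 0 <= x + rho%:R by lra.
    have xN0 : 0 <= (x + rho%:R) * N%:R by rewrite mulr_ge0// ltW.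
    have mX : (m < nX)%N by rewrite ltnS; apply: le_truncn; rewrite ler_pM2r//; lra.
    pose z : R := - rho%:R + m%:R / N%:R.
    have xz : `|x - z| <= N%:R^-1.
      have m1 : m%:R <= (x + rho%:R) * N%:R by rewrite truncn_le.
      have m2 := Num.Theory.truncnS_gt ((x + rho%:R) * N%:R).
      rewrite -/m -natr1 in m2.
      have -> : x - z = ((x + rho%:R) * N%:R - m%:R) / N%:R by rewrite /z; field;
        rewrite gt_eqF.
      rewrite ger0_norm ?divr_ge0// ?subr_ge0// ?(ltW N0)// -[leRHS]mul1r;
        apply: ler_wpM2r; first by rewrite invr_ge0 ltW.
      lra.
    have hz : `|Y k s z - Y l s z| <= eta := hA k l Ak Al i iT m mX.
    have l1 : `|Y k s x - Y k s z| <= C / N%:R.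
      by apply: le_trans (Y_lip k s x z) _; apply: ler_wpM2l.
    have l2 : `|Y l s z - Y l s x| <= C / N%:R.
      by rewrite distrC; apply: le_trans (Y_lip l s x z) _; apply: ler_wpM2l.
    have -> : Y k s x - Y l s x = (Y k s x - Y k s z) + (Y k s z - Y l s z)
      + (Y l s z - Y l s x) by ring.
    apply: le_trans (ler_normD _ _) _; have := ler_normD (Y k s x - Y k s z)
      (Y k s z - Y l s z).
    have : C / N%:R + C / N%:R <= eta by rewrite -mulrDl -mulr2n mulr_natl in CN *.
    lra.
  rewrite ger0_norm; last by apply: ii_ge0.
  have -> : 2 * eta * (rho%:R - - rho%:R) = e / 4 by rewrite /eta; field;
    rewrite gt_eqF.
  lra.
have tk := Y_time k it0 it1; have tl := Y_time l it0 it1.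
rewrite -/s in tk tl.
have sum3 : Int Om (fun x => `|Y k t x - Y l t x|) <=
   Int Om (fun x => `|Y k t x - Y k s x|) + Int Om (fun x => `|Y k s x - Y l s
     x|) + Int Om (fun x => `|Y l t x - Y l s x|).
  rewrite -I_D; [|exact/L1_norm/dY|exact/L1_norm/dY].
  rewrite -I_D; [|by apply: L1D; exact/L1_norm/dY|exact/L1_norm/dY].
  apply: le_I; [exact/L1_norm/dY|by do 2?[apply: L1D]; exact/L1_norm/dY|].
  move=> x; have -> : Y k t x - Y l t x = (Y k t x - Y k s x)
    + (Y k s x - Y l s x) - (Y l t x - Y l s x) by ring.
  by apply: le_trans (ler_normB _ _) _; rewrite lerD2r; exact: ler_normD.
apply: le_trans sum3 _.
have C20 : 0 <= 2 * C by rewrite mulr_ge0.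
have ts : t - s <= tau by rewrite lerBlDl /s; exact: ltW.
have a1 : 2 * C * (t - s + dt k) <= 2 * C * (tau + tau)
  by apply: ler_wpM2l => //; exact: lerD.
have a2 : 2 * C * (t - s + dt l) <= 2 * C * (tau + tau)
  by apply: ler_wpM2l => //; exact: lerD.
apply: le_trans (lerD (lerD (le_trans tk a1) grid) (le_trans tl a2)) _.
have -> : 2 * C * (tau + tau) + e / 2 + 2 * C * (tau + tau)
  = 8 * C * tau + e / 2 by ring.
have -> : e = e / 2 + e / 2 by field.
have -> : (e / 2 + e / 2) / 2 = e / 2 by field.
by rewrite lerD2r.
Qed.

Lemma U_W (e T : R) : 0 < e -> 0 <= T -> exists A, U A /\ forall k l, A k -> A l ->
  forall t, 0 <= t <= T -> Int Om (fun x => `|Y k t x - Y l t x|) <= e /\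
    Int Om (fun x => `|P k t x - P l t x|) <= e.
Proof.
move=> e0 T0.
pose r := e / (8 * (C + 1)).
have C1 : 0 < C + 1 by rewrite ltr_wpDl.
have r0 : 0 < r by rewrite divr_gt0// mulr_gt0.
have Cr : C * (4 * r) <= e / 2.
  have -> : e / 2 = (C + 1) * (4 * r) by rewrite /r; field; rewrite gt_eqF.
  by apply: ler_wpM2r; [rewrite mulr_ge0// ltW|lra].
pose del := Num.min e (e * r / 4).
have del0 : 0 < del by rewrite lt_min e0/= divr_gt0// mulr_gt0.
have [A [UA hA]] := U_Y del0 T0.
exists (A `&` [set k | `|h k| <= r]); split; first by apply: filterI => //;
  exact: U_small.
move=> k l [Ak /= dk] [Al /= dl] t tT.
rewrite gtr0_norm// in dk; rewrite gtr0_norm// in dl.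
have H := hA k l Ak Al t tT.
split; first by apply: le_trans H _; rewrite ge_min lexx.
apply: le_trans (Y_P k l t t r0) _.
have a1 : 2 * Int Om (fun x => `|Y k t x - Y l t x|) / r <= e / 2.
  rewrite ler_pdivrMr//; have : del <= e * r / 4 by rewrite ge_min lexx orbT.
  lra.
have a2 : C * (2 * r + h k + h l) <= C * (4 * r) by apply: ler_wpM2l => //; lra.
lra.
Qed.

End ultra.

(** A set of the ultrafilter is infinite, and finite intersections of such
    sets are again in it, so that increasing indices can be picked one after
    the other. *)
Lemma extraction : exists sigma : nat -> nat, {homo sigma : m n / (m < n)%N} /\
  forall i j t, (i <= j)%N -> 0 <= t <= i%:R ->
    Int Om (fun x => `|Y (sigma i) t x - Y (sigma j) t x|) <= 2^-1 ^+ i /\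
    Int Om (fun x => `|P (sigma i) t x - P (sigma j) t x|) <= 2^-1 ^+ i.
Proof.
have [U [UU Uoo]] := @ultraFilterLemma nat \oo _.
have UP : ProperFilter U by exact: ultra_proper.
have H i : exists A, U A /\ forall k l, A k -> A l ->
  forall t, 0 <= t <= i%:R -> Int Om (fun x => `|Y k t x - Y l t x|)
    <= 2^-1 ^+ i /\ Int Om (fun x => `|P k t x - P l t x|) <= 2^-1 ^+ i.
  apply: U_W => //; rewrite exprn_gt0//.
have [A hA] := choice H.
have UB n : U [set k | forall i, (i <= n)%N -> A i k].
  elim: n => [|n IH].
    by apply: filterS (proj1 (hA 0%N)) => k Ak i; rewrite leqn0 => /eqP ->.
  apply: filterS (filterI IH (proj1 (hA n.+1))) => k [Bk Ak] i.
  by rewrite leq_eqVlt => /orP[/eqP ->//|]; exact: Bk.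
have next (nm : nat * nat) : exists k, (nm.2 < k)%N /\ forall i, (i <= nm.1)%N ->
  A i k.
  have h2 : U [set k | (nm.2 < k)%N] by apply: Uoo; exists nm.2.+1.
  by have [k [Bk lk]] := filter_ex (filterI (UB nm.1) h2); exists k.
have [f hf] := choice next.
(* The [n]-th index lies in the first [n + 1] sets and exceeds the previous
   index. *)
pose sigma := fix s n := if n is n'.+1 then f (n'.+1, s n') else f (0%N, 0%N).
have sA i j : (i <= j)%N -> A i (sigma j).
  case: j => [|j] ij /=; first by have [_] := hf (0%N, 0%N); apply.
  by have [_] := hf (j.+1, sigma j); apply.
exists sigma; split; last first.
  move=> i j t ij ti; have [_ hi] := hA i; apply: hi => //; exact: sA.
apply: homo_ltn; first exact: ltn_trans.
by move=> n /=; have [] := hf (n.+1, sigma n).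
Qed.

Let shiftE n (a : nat -> R) (l : R) : (a (j + n)%N @[j --> \oo]
  --> l) = (a i @[i --> \oo] --> l).
Proof. exact: (cvg_shiftn n a (nbhs l)). Qed.

(** The convergence is fast enough for the pointwise limit of the
    interpolations and the L^1 limit of the slopes to exist at every time
    without any further extraction. *)
Lemma compactness : exists (sigma : nat -> nat) (v q : R -> R ->
  R), [/\ {homo sigma : m n / (m < n)%N},
  forall t, 0 <= t -> [/\ L1 Om (v t), L1 Om (q t), AC (v t) (q t), (forall x,
    `|v t x| <= M) & forall x, `|q t x| <= C],
  forall t x, 0 <= t -> Y (sigma i) t x @[i --> \oo] --> v t x,
  forall i t, 0 <= t <= i%:R -> Int Om (fun x => `|Y (sigma i) t x - v t x|)
    <= 2^-1 ^+ i /\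
    Int Om (fun x => `|P (sigma i) t x - q t x|) <= 2^-1 ^+ i &
  forall t, 0 <= t -> L1 Om (fun x => q t x ^+ 2) /\ Int Om (fun x => q t x ^+ 2)
    <= M * C].
Proof.
have [sigma [sh sc]] := extraction.
pose v t x := limn (fun i => Y (sigma i) t x).
have hn (t : R) : 0 <= t -> exists n : nat, t <= n%:R.
  by move=> t0; exists (Num.truncn t).+1; apply/ltW/truncnS_gt.
have hlow (n j : nat) : (2^-1 : R) ^+ (n + j) <= 2^-1 ^+ j.
  by rewrite exprD ler_piMl ?exprn_ge0// exprn_ile1//; lra.
have vcv t x : 0 <= t -> Y (sigma i) t x @[i --> \oo] --> v t x.
  move=> t0; have [n tn] := hn t t0.
  suff H : cvgn (fun j => Y (sigma (j + n)%N) t x).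
    have E : Y (sigma i) t x @[i --> \oo] --> limn (fun j => Y (sigma (j + n)%N)
      t x).
      by rewrite -(shiftE n (fun i => Y (sigma i) t x)); exact: H.
    by rewrite /v (cvg_lim (@Rhausdorff R) E).
  apply: (@cvg_half R _ 2) => j.
  have tj : 0 <= t <= (n + j)%:R by rewrite t0/= natrD (le_trans tn)// lerDl.
  have [s1 s2] := sc (n + j)%N (n + j).+1 t (leqnSn _) tj.
  apply: le_trans (AC_sup x (ACB (YP _ _) (YP _ _)) (dY _ _ _ _) (dP _ _ _ _)) _.
  rewrite (@eq_I _ Om _ (fun x => `|Y (sigma (n + j)%N)
    t x - Y (sigma (n + j).+1) t x|)); last first.
    by move=> z; rewrite distrC [(j + n)%N]addnC addSn [(j + n)%N]addnC.
  rewrite (@eq_I _ Om (fun x => `|P _ _ x - P _ _ x|)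
    (fun x => `|P (sigma (n + j)%N) t x - P (sigma (n + j).+1) t x|)); last first.
    by move=> z; rewrite distrC [(j + n)%N]addnC addSn [(j + n)%N]addnC.
  by apply: le_trans (lerD s1 s2) _; have := hlow n j; lra.
have vI i t : 0 <= t <= i%:R -> L1 Om (fun x => Y (sigma i) t x - v t x) /\
  Int Om (fun x => `|Y (sigma i) t x - v t x|) <= 2^-1 ^+ i.
  move=> ti; have /andP[t0 _] := ti.
  apply: (@L1_fatou R Om _ (fun j x => Y (sigma i) t x - Y (sigma (j + i)%N) t x)).
  - by move=> j; exact: dY.
  - by move=> j; have [] := sc i (j + i)%N t (leq_addl _ _) ti.
  - move=> x; apply: cvgB; first exact: cvg_cst.
    by rewrite (shiftE i (fun i => Y (sigma i) t x)); exact: vcv.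
have vL t : 0 <= t -> L1 Om (v t).
  move=> t0; have [n tn] := hn t t0; have [|L _] := vI n t; first by rewrite t0.
  have := L1B (YL (sigma n) t) L; congr L1; apply/funext => x; by rewrite subKr.
have qex t : exists p, 0 <= t -> [/\ L1 Om p, forall x, `|p x| <= C, AC (v t) p &
   forall i, 0 <= t <= i%:R -> Int Om (fun x => `|P (sigma i) t x - p x|)
     <= 2^-1 ^+ i].
  have [t0|t0] : 0 <= t \/ t < 0 by case: (ltP t 0); [right|left].
    2: by exists (fun=> 0) => t1; move: (le_lt_trans t1 t0); rewrite ltxx.
 
  have [n tn] := hn t t0.
  have [|||p [pL pC pcv]] := @L1_complete R Om C (fun j => P (sigma (n + j)%N) t).
  - by move=> i; exact: PL.
  - by move=> i x; exact: PC.
  - move=> i; have ti : 0 <= t <= (n + i)%:R by rewrite t0/= natrD (le_trans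
      tn)// lerDl.
    have [_ s2] := sc (n + i)%N (n + i).+1 t (leqnSn _) ti.
    rewrite (@eq_I _ Om _ (fun x => `|P (sigma (n + i)%N)
      t x - P (sigma (n + i).+1) t x|)); last first.
      by move=> z; rewrite distrC addnS.
    by apply: le_trans s2 _; exact: hlow.
  exists p => _; split => //.
    apply: (@AC_limit R Om (fun j => Y (sigma (n + j)%N) t)
      (fun j => P (sigma (n + j)%N) t)) => //.
    move=> x; rewrite (_ : (fun j => _) = (fun j => Y (sigma (j + n)%N) t x)).
      by rewrite (shiftE n (fun i => Y (sigma i) t x)); exact: vcv.
    by apply/funext => j; rewrite addnC.
  move=> i ti; apply/ler_addgt0Pr => e e0.
  have /cvgrPdist_lt/(_ _ e0)[m _ hm] := pcv.
  have := hm (m + i)%N (leq_addr _ _); rewrite sub0r normrN ger0_norm ?I_ge0// =>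
    he.
  have ij : (i <= n + (m + i))%N by rewrite addnA leq_addl.
  have [_ s2] := sc i (n + (m + i))%N t ij ti.
  pose e1 x := P (sigma i) t x - P (sigma (n + (m + i))%N) t x.
  pose e2 x := P (sigma (n + (m + i))%N) t x - p x.
  have e1L : L1 Om e1 by exact: L1B.
  have e2L : L1 Om e2 by exact: L1B.
  rewrite (@eq_I _ Om _ (fun x => `|e1 x + e2 x|)); last by move=> x;
    rewrite /e1 /e2; congr `|_|; ring.
  by apply: le_trans (I_normD e1L e2L) _; apply: lerD => //; exact: ltW.
have [q hq] := choice qex.
exists sigma, v, q; split => //.
- move=> t t0; have [h2 h3 h4 _] := hq t t0; split => //; first exact: vL.
  move=> x; have vc := vcv t x t0.
  rewrite ler_norml; apply/andP; split.
    apply: limr_ge; first exact: cvgP vc.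
    by apply: nearW => i; have := YM (sigma i) t x; rewrite ler_norml => /andP[].
  apply: limr_le; first exact: cvgP vc.
  by apply: nearW => i; have := YM (sigma i) t x; rewrite ler_norml => /andP[].
- move=> i t ti; have /andP[t0 _] := ti; have [_ _ _ h4] := hq t t0.
  by split; [have [_ ?] := vI i t ti|exact: h4].
- move=> t t0; have [qL qC _ qI] := hq t t0.
  have [oq mq _] := qL.
  have q2L : L1 Om (fun x => q t x ^+ 2).
    by have := L1M qL oq mq qC; congr L1.
  split => //; apply/ler_addgt0Pr => e e0.
  have C1 : 0 < 2 * C + 1 by rewrite ltr_wpDl// mulr_ge0.
  have [|m hm] := @half_small R (e / (2 * C + 1)); first by rewrite divr_gt0.
  have [n tn] := hn t t0; pose k := maxn m n.
  have tk : 0 <= t <= k%:R by rewrite t0/= (le_trans tn)// ler_nat leq_maxr.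
  have hk := hm k (leq_maxl _ _).
  have dL : L1 Om (fun x => P (sigma k) t x - q t x) by exact: L1B.
  have p2L := run_p2L (Hrun (sigma k)) (Num.truncn (t / dt (sigma k))).
  have p2 := run_p2 (Hrun (sigma k)) (Num.truncn (t / dt (sigma k))).
  apply: (@le_trans _ _ (Int Om (fun x => P (sigma k)
    t x ^+ 2 + 2 * C * `|P (sigma k) t x - q t x|))).
    apply: le_I => //; first by apply: L1D => //; apply/L1Z/L1_norm.
    move=> x; set a := P (sigma k) t x; set b := q t x.
    have ha : `|a| <= C by exact: PC.
    have hb : `|b| <= C by exact: qC.
    have : `|(b - a) * (b + a)| <= `|a - b| * (2 * C).
      rewrite normrM distrC; apply: ler_pM => //; apply: le_trans (ler_normD _ _)
        _; lra.
    have := ler_norm ((b - a) * (b + a)).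
    have -> : (b - a) * (b + a) = b ^+ 2 - a ^+ 2 by ring.
    rewrite [`|a - b| * _]mulrC => k1 k2; rewrite -lerBlDl; exact: le_trans k1 k2.
  rewrite I_D//; last by apply/L1Z/L1_norm.
  rewrite I_Z; last exact: L1_norm.
  apply: lerD => //.
  apply: (@le_trans _ _ ((2 * C + 1) * (e / (2 * C + 1))));
    last by rewrite mulrC mulfVK// gt_eqF.
  apply: ler_pM => //; [by rewrite mulr_ge0|exact: I_ge0|by rewrite lerDl|].
  by apply: le_trans (qI k tk) hk.
Qed.

End Extract.

(** * Test functions *)

Section TestFunctions.
Context {R : realType}.
Local Notation mu := (@lebesgue_measure R).
Local Notation mR := (measurableTypeR R).
Implicit Types (Om : domain) (f g : R -> R) (phi psi : R -> R -> R).

Lemma mean_value f (a b : R) : (forall x, derivable f x 1) ->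
  exists c : R, [/\ `|c - a| <= `|b - a|, `|c - b| <= `|b - a| & f b - f a =
    derive1 f c * (b - a)].
Proof.
move=> df.
have isd (x : R) : is_derive x 1 f (derive1 f x) by exact: is_derive_derive1.
have cf : continuous f by move=> x;
  apply/differentiable_continuous/derivable1_diffP.
have [ab|/ltW ba] := leP a b.
  have [c] := MVT_segment ab (fun x _ => isd x) (continuous_subspaceT cf).
  rewrite in_itv/= => /andP[ac cb] E; exists c; split => //.
    by rewrite !ger0_norm ?subr_ge0// lerD2r.
  by rewrite distrC !ger0_norm ?subr_ge0// lerD2l lerN2.
have [c] := MVT_segment ba (fun x _ => isd x) (continuous_subspaceT cf).
rewrite in_itv/= => /andP[bc ca] E; exists c; split.
- by rewrite !ler0_norm ?subr_le0// !opprB lerD2l lerN2.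
- by rewrite [leRHS]distrC !ger0_norm ?subr_ge0// lerD2r.
- by rewrite -opprB E; ring.
Qed.

Lemma derivable_continuous f : (forall x, derivable f x 1) -> continuous f.
Proof. by move=> df x; apply/differentiable_continuous/derivable1_diffP. Qed.

Lemma locally_bounded f (M : R) : continuous f -> exists2 L : R,
  0 <= L & forall x, `|x| <= M -> `|f x| <= L.
Proof.
move=> cf.
have [L [_ /(_ (L + 1))]] := compact_bounded (continuous_compact
  (continuous_subspaceT cf) (@segment_compact R (-M) M)).
rewrite ltrDl ltr01 => /(_ isT) hM; exists `|L + 1| => // x xM.
rewrite (le_trans _ (ler_norm _))//.
by apply: hM; exists x => //=; rewrite in_itv/= -ler_norml.
Qed.

Lemma locally_lipschitz f (M : R) : (forall x, derivable f x 1) ->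
  continuous (derive1 f) ->
  exists2 L : R, 0 <= L & forall x y, `|x| <= M -> `|y| <= M ->
    `|f x - f y| <= L * `|x - y|.
Proof.
move=> df cdf; have [L L0 hL] := @locally_bounded _ (3 * `|M|) cdf.
exists L => // x y xM yM; have [c [cy _ ->]] := mean_value y x df.
rewrite normrM; apply: ler_wpM2r => //; apply: hL.
have := ler_normD (c - y) y; rewrite subrK; have := ler_normB x y;
  have := ler_norm M; lra.
Qed.

Lemma test_partial_t Om phi : test_fun2 Om phi -> test_fun2 Om (partial_t phi).
Proof.
move=> [sp op [M hM]]; split.
- move=> s; have := sp (rcons s true); rewrite /iter_partial foldr_rcons; exact.
- move=> t; case: Om op {hM} => //= op x; rewrite /partial_t.
  by congr (derive1 _ t); apply/funext => r; exact: op.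
- exists M => t x [Mt|[OmL Mx]].
    have : \forall s \near t, (fun s => phi s x) s = (fun=> 0) s.
      have : \forall s \near t, M < `|s|.
        exact: (cvgr_gt `|t| (@norm_continuous _ R^o t) M Mt).
      by apply: filterS => s Ms; apply: hM; left.
    by move=> /derive1_near[_ E]; rewrite /partial_t E derive1_cst.
  rewrite /partial_t (_ : (fun s => phi s x) = cst 0) ?derive1_cst//.
  by apply/funext => s; apply: hM; right.
Qed.

Lemma test_partial_x Om phi : test_fun2 Om phi -> test_fun2 Om (partial_x phi).
Proof.
move=> [sp op [M hM]]; split.
- move=> s; have := sp (rcons s false); rewrite /iter_partial foldr_rcons; exact.
- move=> t; case: Om op {hM} => //= op x; rewrite /partial_x.
  have [_ _ /(_ t) d] := sp [::].
  have E : (fun y => phi t (y + 1)) = phi t by apply/funext => y; exact: op.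
  have d1 : is_derive (x + 1) 1 (phi t) (derive1 (phi t) (x + 1))
    by apply: is_derive_derive1.
  have d2 : is_derive x 1 (fun y : R => y + 1) 1.
    by have := @is_deriveD R R^o R^o id (cst (1 : R)) x 1 1 0 (is_derive_id _ _)
      (is_derive_cst _ _ _); rewrite addr0.
  have := @is_derive1_comp R (phi t) (fun y => y + 1) x _ _ d1 d2.
  rewrite (_ : phi t \o _ = phi t); last by apply/funext => y /=; exact: op.
  by rewrite mulr1 => d3; have [_ ->] := is_derive_derive1E d3.
- exists M => t x [Mt|[OmL Mx]].
    rewrite /partial_x (_ : phi t = cst 0) ?derive1_cst//.
    by apply/funext => s; apply: hM; left.
  have : \forall y \near x, phi t y = (fun=> 0) y.
    have : \forall y \near x, M < `|y|.
      exact: (cvgr_gt `|x| (@norm_continuous _ R^o x) M Mx).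
    by apply: filterS => y My; apply: hM; right.
  by move=> /derive1_near[_ E]; rewrite /partial_x E derive1_cst.
Qed.

Lemma test_bounded Om phi : test_fun2 Om phi -> exists2 L : R,
  0 <= L & forall t x, `|phi t x| <= L.
Proof.
move=> [sp op [M hM]]; have [cphi _ _] := sp [::].
have cK : compact ((`[- `|M|, `|M|] : set R) `*` (`[- (`|M| + 1),
  `|M| + 1] : set R)).
  by apply: compact_setX; exact: segment_compact.
have [L [_ /(_ (L + 1))]] := compact_bounded (continuous_compact
  (continuous_subspaceT cphi) cK).
rewrite ltrDl ltr01 => /(_ isT) hL; exists `|L + 1| => // t x.
have main z : `|z| <= `|M| + 1 -> `|phi t z| <= `|L + 1|.
  move=> zM; have [Mt|tM] := ltP M `|t|; first by rewrite hM ?normr0//; left.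
  apply: le_trans (ler_norm _); apply: hL; exists (t, z) => //=; split;
    rewrite /= in_itv/= -ler_norml//.
  by apply: le_trans tM _; exact: ler_norm.
have [xM|xM] := leP `|x| (`|M| + 1); first exact: main.
have [OmL|OmC] : Om = Line \/ Om = Circle by case: (Om); [left|right].
  by rewrite hM ?normr0//; right; split => //; have := ler_norm M; lra.
move: (op t); rewrite OmC => /= per.
rewrite -(@periodic_int _ (phi t) (- Num.floor x) per); apply: main.
have h1 := Num.Theory.floor_le x; have h2 := Num.Theory.floorD1_gt x.
rewrite intrD in h2; rewrite intrN ger0_norm; last by rewrite subr_ge0.
have := normr_ge0 M; lra.
Qed.

Lemma test_lipschitz Om phi : test_fun2 Om phi -> exists2 L : R, 0 <= L &
  forall t x s y, `|phi t x - phi s y| <= L * (`|t - s| + `|x - y|).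
Proof.
move=> tp; have [L1 L10 h1] := test_bounded (test_partial_t tp).
have [L2 L20 h2] := test_bounded (test_partial_x tp).
exists (L1 + L2); first exact: addr_ge0.
move=> t x s y; have [sp _ _] := tp; have [_ dt_ dx_] := sp [::].
have [c [_ _ e1]] := mean_value s t (fun r => dt_ r x).
have [c' [_ _ e2]] := mean_value y x (dx_ s).
have -> : phi t x - phi s y = (phi t x - phi s x) + (phi s x - phi s y) by ring.
rewrite e1 e2; apply: le_trans (ler_normD _ _) _; rewrite !normrM.
have a1 : `|derive1 (fun r => phi r x) c| <= L1 by exact: h1.
have a2 : `|derive1 (phi s) c'| <= L2 by exact: h2.
have n1 : 0 <= `|t - s| by []; have n2 : 0 <= `|x - y| by [].
have b1 := ler_wpM2r n1 a1; have b2 := ler_wpM2r n2 a2.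
apply: le_trans (lerD b1 b2) _; rewrite mulrDl !mulrDr.
have c1 : 0 <= L1 * `|x - y| by apply: mulr_ge0.
have c2 : 0 <= L2 * `|t - s| by apply: mulr_ge0.
lra.
Qed.

(** One constant serves for all: test functions are bounded, and so are their
    partial derivatives, which are again test functions. *)
Lemma test_estimates Om phi : test_fun2 Om phi -> exists2 L : R, 0 <= L &
  [/\ forall t x, [/\ `|phi t x| <= L, `|partial_t phi t x| <= L & `|partial_x
    phi t x| <= L],
   forall t x s y, `|phi t x - phi s y| <= L * (`|t - s| + `|x - y|),
   forall t x s h, 0 < h -> 0 <= s <= t -> t <= s + h ->
     `|(phi (s + h) x - phi s x) / h - partial_t phi t x| <= L * h,
   (forall t x s k h, 0 < h -> 0 <= s <= t -> t <= s + k ->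
     `|slope h (phi s) x - partial_x phi t x| <= L * (k + h)) &
   forall t, [/\ on_dom Om (phi t), on_dom Om (partial_t phi t),
     on_dom Om (partial_x phi t) &
    [/\ continuous (phi t), continuous (partial_t phi t)
      & continuous (partial_x phi t)]]].
Proof.
move=> tp; have tt := test_partial_t tp; have tx := test_partial_x tp.
have [A1 A10 b1] := test_bounded tp; have [A2 A20 b2] := test_bounded tt;
  have [A3 A30 b3] := test_bounded tx.
have [A4 A40 b4] := test_lipschitz tp; have [A5 A50 b5] := test_lipschitz tt;
  have [A6 A60 b6] := test_lipschitz tx.
have [sp op _] := tp; have [_ dt_ dx_] := sp [::].
have [spt opt _] := tt; have [_ dtt_ dxt_] := spt [::].
have [spx opx _] := tx; have [_ dtx_ dxx_] := spx [::].
pose L := A1 + A2 + A3 + A4 + A5 + A6.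
have le1 (a : R) : a <= A1 -> a <= L by rewrite /L; lra.
have le2 (a : R) : a <= A2 -> a <= L by rewrite /L; lra.
have le3 (a : R) : a <= A3 -> a <= L by rewrite /L; lra.
have le4 : A4 <= L by rewrite /L; lra.
have le5 : A5 <= L by rewrite /L; lra.
have le6 : A6 <= L by rewrite /L; lra.
exists L; first by rewrite /L !addr_ge0.
split.
- by move=> t x; split; [apply: le1|apply: le2|apply: le3].
- by move=> t x s y; apply: le_trans (b4 t x s y) _; apply: ler_wpM2r => //;
    apply: addr_ge0.
- move=> t x s h h0 /andP[s0 st] tsh.
  have [c [cs cs' E]] := mean_value s (s + h) (fun r => dt_ r x).
  have -> : (phi (s + h) x - phi s x) / h = partial_t phi c x.
    by rewrite E addrAC subrr add0r mulfK// gt_eqF.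
  apply: le_trans (b5 c x t x) _; rewrite subrr normr0 addr0.
  have cin : s <= c <= s + h.
    have hh := ltW h0; have e1 : s + h - s = h by ring.
    rewrite e1 (ger0_norm hh) in cs cs'.
    by move: cs cs'; rewrite !ler_norml => /andP[c1 c2] /andP[c3 c4]; apply/andP;
      split; lra.
  apply: ler_pM => //; move: cin => /andP[c1 c2]; rewrite ler_norml; apply/andP;
    split; lra.
- move=> t x s k h h0 /andP[s0 st] tsk.
  have [c [cx _ E]] := mean_value x (x + h) (dx_ s).
  have -> : slope h (phi s) x = partial_x phi s c.
    by rewrite /slope E addrAC subrr add0r mulfK// gt_eqF.
  apply: le_trans (b6 s c t x) _.
  apply: ler_pM => //.
  rewrite addrAC subrr add0r (gtr0_norm h0) in cx.
  apply: lerD => //; rewrite distrC ger0_norm ?subr_ge0//; lra.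
- move=> t; split => //; split.
  + exact: (derivable_continuous (dx_ t)).
  + exact: (derivable_continuous (dxt_ t)).
  + exact: (derivable_continuous (dxx_ t)).
Qed.

End TestFunctions.

(** * Consistency of one time step *)

Section Consistency.
Context {R : realType}.
Local Notation mu := (@lebesgue_measure R).
Local Notation mR := (measurableTypeR R).

Lemma prod_close (a a' b b' be de : R) : `|b| <= be -> `|b - b'| <= de ->
  `|a * b - a' * b'| <= `|a - a'| * be + `|a'| * de.
Proof.
move=> h1 h2; have -> : a * b - a' * b' = (a - a') * b + a' * (b - b') by ring.
by apply: le_trans (ler_normD _ _) _; rewrite !normrM; apply: lerD;
  apply: ler_wpM2l.
Qed.

(** The products are compared by changing one factor at a time. The quadratic
    term is tractable because the slopes are bounded by [C], so that [q ^ 2 <=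
    C |q|]. *)
Lemma flux_close (C LB L2 L e h eU eP P q b Bv D px Bx B'v f' f : R) : 0 <= C ->
  0 <= LB -> 0 <= L2 -> 0 <= L ->
  0 <= e -> 0 <= h -> h <= e -> 0 <= eU -> `|P| <= C -> `|q| <= C ->
    `|P - q| <= eP ->
  `|b| <= 1 -> `|Bv| <= 1 -> `|b - Bv| <= LB * eU -> `|D| <= L ->
    `|D - px| <= L * e ->
  `|Bx| <= LB -> `|B'v| <= LB -> `|Bx - B'v| <= L2 * (eU + C * h) ->
    `|f'| <= L -> `|f' - f| <= L * e ->
  `|P * (Bx * P * f' + b * D) - (Bv * q * px + B'v * q ^+ 2 * f)| <=
  L * (1 + 2 * C * LB + C ^+ 2 * L2) * (eU + eP + e * `|q|).
Proof.
move=> C0 LB0 L20 L0 e0 h0 he eU0 PC qC ePh b1 Bv1 bB DL Dp BxL BvL BB fL ff.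
have eP0 : 0 <= eP by apply: le_trans ePh.
have q0 : 0 <= `|q| by [].
have -> : P * (Bx * P * f' + b * D) - (Bv * q * px + B'v * q ^+ 2 * f) =
  (P * (b * D) - q * (Bv * px)) + (P * (P * (Bx * f')) - q * (q * (B'v * f)))
    by ring.
have s1 : `|b * D - Bv * px| <= LB * eU * L + L * e.
  apply: le_trans (prod_close b Bv DL Dp) _; apply: lerD; first by apply: ler_wpM2r.
  by rewrite -[leRHS]mul1r; apply: ler_wpM2r => //; apply: mulr_ge0.
have s1' : `|b * D| <= L by rewrite normrM -[leRHS]mul1r; apply: ler_pM.
have s2 := prod_close P q s1' s1.
have t1 : `|Bx * f' - B'v * f| <= L2 * (eU + C * h) * L + LB * (L * e).
  apply: le_trans (prod_close Bx B'v fL ff) _; apply: lerD;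
    first by apply: ler_wpM2r.
  by apply: ler_wpM2r => //; apply: mulr_ge0.
have t1' : `|Bx * f'| <= LB * L by rewrite normrM; apply: ler_pM.
have t2 := prod_close P q t1' t1.
have t2' : `|P * (Bx * f')| <= C * (LB * L) by rewrite normrM; apply: ler_pM.
have t3 := prod_close P q t2' t2.
apply: le_trans (ler_normD _ _) _; apply: le_trans (lerD s2 t3) _.
have LBL : 0 <= LB * L by apply: mulr_ge0.
have z1 : `|P - q| * L <= eP * L by apply: ler_wpM2r.
have z2 : `|q| * (LB * eU * L + L * e) <= C * (LB * eU * L) + `|q| * (L * e).
  by rewrite mulrDr lerD2r; apply: ler_wpM2r => //; do ![apply: mulr_ge0 => //].
have z3 : `|P - q| * (C * (LB * L)) <= eP * (C * (LB * L))
  by apply: ler_wpM2r => //; apply: mulr_ge0.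
have z4 : `|q| * (`|P - q| * (LB * L)) <= C * (eP * (LB * L)).
  by apply: ler_pM => //; [by do ![apply: mulr_ge0 => //]|apply: ler_wpM2r].
have z5 : `|q| * (`|q| * (L2 * (eU + C * h) * L + LB * (L * e))) <=
   C * (C * (L2 * eU * L)) + `|q| * (C * (L2 * (C * e) * L + LB * (L * e))).
  have -> : `|q| * (`|q| * (L2 * (eU + C * h) * L + LB * (L * e))) =
     `|q| * `|q| * (L2 * eU * L) + `|q| * (`|q| * (L2 * (C * h)
       * L + LB * (L * e))) by ring.
  rewrite mulrA; apply: lerD.
    by rewrite [C * (C * _)]mulrA; apply: ler_wpM2r;
      [do ![apply: mulr_ge0 => //]|apply: ler_pM].
  rewrite -mulrA; apply: ler_wpM2l => //; apply: ler_pM => //.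
    by apply: addr_ge0; do ![apply: mulr_ge0 => //].
  rewrite lerD2r; apply: ler_wpM2r => //; apply: ler_wpM2l => //; exact: ler_wpM2l.
have E : L * (1 + 2 * C * LB + C ^+ 2 * L2) * (eU + eP + e * `|q|) =
  eP * L + (C * (LB * eU * L) + `|q| * (L * e)) + eP * (C * (LB * L))
    + C * (eP * (LB * L)) +
  (C * (C * (L2 * eU * L)) + `|q| * (C * (L2 * (C * e) * L + LB * (L * e)))) +
  (L * eU + L * C * LB * eU + L * C ^+ 2 * L2 * eP + L * (C * LB) * (e * `|q|))
    by ring.
have r0 : 0 <= L * eU + L * C * LB * eU + L * C ^+ 2 * L2 * eP + L * (C * LB)
  * (e * `|q|).
  by do ![apply: addr_ge0]; do ![apply: mulr_ge0 => //]; rewrite ?sqr_ge0.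
rewrite E [`|q| * (`|P - q| * (LB * L) + _)]mulrDr.
apply: le_trans (lerD (lerD z1 z2) (lerD z3 (lerD z4 z5))) _.
by apply: ler_wpDr => //; rewrite le_eqVlt; apply/orP; left; apply/eqP; ring.
Qed.


(** By the mean value theorem the difference quotient of [B (U x)] is the
    derivative of [B] at a point within [C h] of [U x], times the slope of
    [U]. All the remaining differences are controlled by the distances of the
    numerical quantities to [v] and [q]. *)
Lemma step_consistency Om (B : R -> R) (th C M LB L2 L h dt eta : R)
  (u0 u1 v q f0 f1 f ft fx : R -> R) :
  let U x := th * u1 x + (1 - th) * u0 x in
  let fk x := u1 x * ((f1 x - f0 x) / dt) -
    slope h U x * (slope h (fun x => B (U x)) x * f0 (x + h) + B (U x)
      * slope h f0 x) in
  let g x := v x * ft x - B (v x) * q x * fx x - derive1 B (v x) * q x ^+ 2 * f x in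
  0 <= th <= 1 -> 0 <= C -> 0 <= M -> 0 <= LB -> 0 <= L2 -> 0 <= L -> 0 < h ->
    0 < dt -> 0 <= eta ->
  (forall x, derivable B x 1) -> continuous (derive1 B) ->
    (forall s, 0 <= B s <= 1) ->
  (forall x y, `|x| <= 3 * M -> `|y| <= 3 * M -> `|B x - B y| <= LB * `|x - y|) ->
  (forall x, `|x| <= 3 * M -> `|derive1 B x| <= LB) ->
  (forall x y, `|x| <= 3 * M -> `|y| <= 3 * M ->
    `|derive1 B x - derive1 B y| <= L2 * `|x - y|) ->
  L1 Om u0 -> L1 Om u1 -> L1 Om v -> L1 Om q ->
  (forall x, `|u0 x| <= M) -> (forall x, `|u1 x| <= M) -> (forall x, `|v x| <= M) ->
  (forall x, `|slope h u0 x| <= C) -> (forall x, `|slope h u1 x| <= C) ->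
    (forall x, `|q x| <= C) ->
  [/\ on_dom Om f0, on_dom Om f1, on_dom Om f, on_dom Om ft & on_dom Om fx] ->
  [/\ continuous f0, continuous f1, continuous f, continuous ft & continuous fx] ->
  (forall x, `|f0 x| <= L) -> (forall x, `|f x| <= L) ->
    (forall x, `|ft x| <= L) -> (forall x, `|fx x| <= L) ->
  (forall x, `|slope h f0 x| <= L) -> (forall x, `|(f1 x - f0 x) / dt| <= L) ->
  (forall x, `|(f1 x - f0 x) / dt - ft x| <= L * (dt + h)) ->
    (forall x, `|slope h f0 x - fx x| <= L * (dt + h)) ->
  (forall x, `|f0 (x + h) - f x| <= L * (dt + h)) ->
  Int Om (fun x => `|u0 x - v x|) <= eta -> Int Om (fun x => `|u1 x - v x|)
    <= eta ->
  Int Om (fun x => `|slope h u0 x - q x|) <= eta ->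
    Int Om (fun x => `|slope h u1 x - q x|) <= eta ->
  [/\ L1 Om (fun x => u1 x * ((f1 x - f0 x) / dt)),
    L1 Om (fun x => slope h U x * (slope h (fun x => B (U x)) x * f0 (x + h)
      + B (U x) * slope h f0 x)),
    L1 Om g &
  `|Int Om fk - Int Om g| <= L * (1 + 2 * C * LB + C ^+ 2 * L2) *
     (3 * eta + (dt + h) * (Int Om (fun x => `|v x|) + Int Om (fun x => `|q x|)))].
Proof.
move=> U fk g th01 C0 M0 LB0 L20 L0 h0 dt0 eta0 dB cdB B01 BL B'b B'L u0L u1L vL
  qL u0M u1M vM p0C p1C qC
  [of0 of1 of_ oft ofx] [cf0 cf1 cf cft cfx] f0b fb ftb fxb sf0b Dtb Dtc sf0c f0c
    I0 I1 Ip0 Ip1.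
have /andP[t0 t1] := th01; have t1' : 0 <= 1 - th by rewrite subr_ge0.
have e0 : 0 <= dt + h by rewrite addr_ge0// ltW.
have he : h <= dt + h by rewrite lerDr ltW.
have de : dt <= dt + h by rewrite lerDl ltW.
have mcont (ff : R -> R) : continuous ff -> measurable_fun (setT : set mR)
  ff by exact: continuous_measurable_fun.
have mB : measurable_fun (setT : set mR) B by apply: mcont;
  exact: derivable_continuous.
have mB' : measurable_fun (setT : set mR) (derive1 B) by exact: mcont.
have UL : L1 Om U by apply: L1D; exact: L1Z.
have [oU mU _] := UL; have [ov mv _] := vL; have [oq mq _] := qL.
have UM x : `|U x| <= M.
  apply: le_trans (ler_normD _ _) _; rewrite !normrM (ger0_norm t0) (ger0_norm t1').
  have a1 := ler_wpM2l t0 (u1M x); have a2 := ler_wpM2l t1' (u0M x).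
  by apply: le_trans (lerD a1 a2) _; rewrite -mulrDl addrC subrK mul1r.
have sU x : slope h U x = th * slope h u1 x + (1 - th) * slope h u0 x.
  by rewrite /slope /U; field; rewrite gt_eqF.
have PC x : `|slope h U x| <= C.
  rewrite sU; apply: le_trans (ler_normD _ _) _; rewrite (normrM th)
    (normrM (1 - th)) (ger0_norm t0) (ger0_norm t1').
  have a1 := ler_wpM2l t0 (p1C x); have a2 := ler_wpM2l t1' (p0C x).
  by apply: le_trans (lerD a1 a2) _; rewrite -mulrDl addrC subrK mul1r.
have slL ff : L1 Om ff -> L1 Om (slope h ff).
  move=> ffL; have := L1Z h^-1 (L1B (L1_shift h ffL) ffL); congr L1;
    apply/funext => x; by rewrite mulrC.
have mslope ff : measurable_fun (setT : set mR) ff ->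
  measurable_fun (setT : set mR) (slope h ff).
  move=> mff; rewrite (_ : slope h ff = (fun x => h^-1 * (ff (x + h) - ff x)));
    last by apply/funext => x; rewrite mulrC.
  by apply: measurable_funM => //; apply: measurable_funB => //;
    exact: (measurableT_comp mff (measurable_shift h)).
have oslope ff : on_dom Om ff -> on_dom Om (slope h ff).
  by move=> off; exact: (on_dom_comp2 (fun a b => (a - b) / h)
    (on_dom_shift h off) off).
have M3 : M <= 3 * M by lra.
have xi x : exists z, [/\ `|z - U x| <= C * h,
  `|z| <= 3 * M & slope h (fun x => B (U x)) x = derive1 B z * slope h U x].
  have [c [c1 _ c2]] := mean_value (U x) (U (x + h)) dB.
  have Uh : `|U (x + h) - U x| <= C * h.
    by have := PC x; rewrite /slope normrM normfV (gtr0_norm h0) ler_pdivrMr.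
  exists c; split; first exact: le_trans c1 Uh.
    have := ler_normD (c - U x) (U x); rewrite subrK.
    have := ler_normB (U (x + h)) (U x); have := UM x; have := UM (x + h);
      move: c1; clear; lra.
  by rewrite /slope c2 mulrA.
have SB x : `|slope h (fun x => B (U x)) x| <= LB * C.
  have [z [z1 z2 ->]] := xi x; rewrite normrM; apply: ler_pM => //; exact: B'b.
pose W x := slope h (fun x => B (U x)) x * f0 (x + h) + B (U x) * slope h f0 x.
have oW : on_dom Om W.
  apply: (on_dom_comp2 (fun a b => a + b)); first exact: (on_dom_comp2 (fun a b
    => a * b) (oslope _ (on_dom_comp B oU)) (on_dom_shift h of0)).
  exact: (on_dom_comp2 (fun a b => a * b) (on_dom_comp B oU) (oslope _ of0)).
have mW : measurable_fun (setT : set mR) W.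
  apply: measurable_funD; apply: measurable_funM.
  - by apply: mslope; exact: (measurableT_comp mB mU).
  - exact: (measurableT_comp (mcont _ cf0) (measurable_shift h)).
  - exact: (measurableT_comp mB mU).
  - by apply: mslope; exact: mcont.
have Bb s : `|B s| <= 1 by have /andP[b0 b1] := B01 s; rewrite ger0_norm.
have Wb x : `|W x| <= LB * C * L + L.
  apply: le_trans (ler_normD _ _) _; rewrite (normrM (slope _ _ _))
    (normrM (B _)); apply: lerD; first by apply: ler_pM.
  by rewrite -[leRHS]mul1r; apply: ler_pM.
have F2L : L1 Om (fun x => slope h U x * W x) by exact: (L1M (slL _ UL) oW mW Wb).
pose Dt x := (f1 x - f0 x) / dt.
have oDt : on_dom Om Dt by exact: (on_dom_comp2 (fun a b => (a - b) / dt) of1 of0).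
have mDt : measurable_fun (setT : set mR) Dt.
  rewrite (_ : Dt = (fun x => dt^-1 * (f1 x - f0 x))); last by apply/funext => x;
    rewrite mulrC.
  by apply: measurable_funM => //; apply: measurable_funB; exact: mcont.
have F1L : L1 Om (fun x => u1 x * Dt x) by exact: (L1M u1L oDt mDt Dtb).
have G1L : L1 Om (fun x => v x * ft x) by exact: (L1M vL oft (mcont _ cft) ftb).
have G2L : L1 Om (fun x => q x * (B (v x) * fx x)).
  apply: (@L1M _ Om q _ L qL).
  - exact: (on_dom_comp2 (fun a b => a * b) (on_dom_comp B ov) ofx).
  - by apply: measurable_funM; [exact: (measurableT_comp mB mv)|exact: mcont].
  - by move=> x; rewrite normrM -[leRHS]mul1r; apply: ler_pM.
have G3L : L1 Om (fun x => q x * (q x * (derive1 B (v x) * f x))).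
  apply: (@L1M _ Om q _ (C * (LB * L)) qL).
  - exact: (on_dom_comp2 (fun a b => a * b) oq (on_dom_comp2 (fun a b => a * b)
      (on_dom_comp (derive1 B) ov) of_)).
  - apply: measurable_funM => //; apply: measurable_funM;
      [exact: (measurableT_comp mB' mv)|exact: mcont].
  - move=> x; rewrite !normrM; apply: ler_pM => //.
    by apply: ler_pM => //; apply: B'b; exact: le_trans (vM x) M3.
have gE : g = (fun x => v x * ft x - q x * (B (v x) * fx x)
  - q x * (q x * (derive1 B (v x) * f x))).
  by apply/funext => x; rewrite /g; ring.
have gL : L1 Om g by rewrite gE; apply: L1B => //; exact: L1B.
split => //.
have fkL : L1 Om fk by exact: L1B F1L F2L.
rewrite -I_B//; set K := L * _.
pose eU x := th * `|u1 x - v x| + (1 - th) * `|u0 x - v x|.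
pose eP x := th * `|slope h u1 x - q x| + (1 - th) * `|slope h u0 x - q x|.
have K1 : L <= K.
  rewrite /K -[leLHS]mulr1; apply: ler_wpM2l => //; rewrite -addrA lerDl.
  by apply: addr_ge0; do ![apply: mulr_ge0 => //]; rewrite ?sqr_ge0.
have K0 : 0 <= K by apply: le_trans K1.
pose dm x := K * (`|u1 x - v x| + eU x + eP x + (dt + h) * (`|v x| + `|q x|)).
have duL : L1 Om (fun x => `|u1 x - v x|) by apply/L1_norm/L1B.
have du0L : L1 Om (fun x => `|u0 x - v x|) by apply/L1_norm/L1B.
have dpL : L1 Om (fun x => `|slope h u1 x - q x|) by apply/L1_norm/L1B => //;
  exact: slL.
have dp0L : L1 Om (fun x => `|slope h u0 x - q x|) by apply/L1_norm/L1B => //;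
  exact: slL.
have eUL : L1 Om eU by apply: L1D; exact: L1Z.
have ePL : L1 Om eP by apply: L1D; exact: L1Z.
have vqL : L1 Om (fun x => `|v x| + `|q x|) by apply: L1D; exact: L1_norm.
have dmL : L1 Om dm.
  by apply: L1Z; apply: L1D; [apply: L1D => //; exact: L1D|exact: L1Z].
have ptw x : `|fk x - g x| <= dm x.
  have eU0 : 0 <= eU x by apply: addr_ge0; apply: mulr_ge0.
  have a1 := prod_close (u1 x) (v x) (Dtb x) (Dtc x).
  have UvU : `|U x - v x| <= eU x.
    have -> : U x - v x = th * (u1 x - v x) + (1 - th) * (u0 x - v x)
      by rewrite /U; ring.
    by apply: le_trans (ler_normD _ _) _; rewrite !normrM (ger0_norm t0)
      (ger0_norm t1').
  have Pq : `|slope h U x - q x| <= eP x.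
    have -> : slope h U x - q x = th * (slope h u1 x - q x) + (1 - th)
      * (slope h u0 x - q x) by rewrite sU; ring.
    by apply: le_trans (ler_normD _ _) _; rewrite (normrM th) (normrM (1 - th))
      (ger0_norm t0) (ger0_norm t1').
  have [z [z1 z2 zE]] := xi x.
  have v3 : `|v x| <= 3 * M by exact: le_trans (vM x) M3.
  have U3 : `|U x| <= 3 * M by exact: le_trans (UM x) M3.
  have bB : `|B (U x) - B (v x)| <= LB * eU x.
    by apply: le_trans (BL _ _ U3 v3) _; exact: ler_wpM2l.
  have BB : `|derive1 B z - derive1 B (v x)| <= L2 * (eU x + C * h).
    apply: le_trans (B'L _ _ z2 v3) _; apply: ler_wpM2l => //.
    have -> : z - v x = (U x - v x) + (z - U x) by ring.
    by apply: le_trans (ler_normD _ _) _; exact: lerD.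
  have a2 := flux_close C0 LB0 L20 L0 e0 (ltW h0) he eU0 (PC x) (qC x)
    Pq (Bb (U x)) (Bb (v x)) bB (sf0b x) (sf0c x)
    (B'b _ z2) (B'b _ v3) BB (f0b (x + h)) (f0c x).
  rewrite -zE -/K in a2.
  have -> : fk x - g x = (u1 x * Dt x - v x * ft x) -
     (slope h U x * (slope h (fun x => B (U x)) x * f0 (x + h) + B (U x)
       * slope h f0 x) -
      (B (v x) * q x * fx x + derive1 B (v x) * q x ^+ 2 * f x))
        by rewrite /fk /g /Dt; ring.
  apply: le_trans (ler_normB _ _) _; apply: le_trans (lerD a1 a2) _.
  have b1 : `|u1 x - v x| * L <= K * `|u1 x - v x| by rewrite mulrC;
    apply: ler_wpM2r.
  have b2 : `|v x| * (L * (dt + h)) <= K * ((dt + h) * `|v x|).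
    by rewrite mulrC -mulrA; apply: ler_wpM2r => //; apply: mulr_ge0.
  apply: le_trans (lerD (lerD b1 b2) (lexx _)) _.
  by rewrite /dm le_eqVlt; apply/orP; left; apply/eqP; ring.
have fgL : L1 Om (fun x => fk x - g x) by exact: L1B.
apply: le_trans (le_I_norm fgL dmL ptw) _.
rewrite /dm I_Z; last by apply: L1D; [apply: L1D => //; exact: L1D|exact: L1Z].
apply: ler_wpM2l => //.
rewrite I_D; [|by apply: L1D => //; exact: L1D|exact: L1Z].
rewrite I_Z//; rewrite I_D; [|exact: L1D|by []].
rewrite (I_D duL eUL) (I_D (L1_norm vL) (L1_norm qL)) lerD2r.
have mean (A1 A2 : R -> R) : L1 Om A1 -> L1 Om A2 -> Int Om A1 <= eta ->
  Int Om A2 <= eta ->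
   Int Om (fun x => th * A1 x + (1 - th) * A2 x) <= eta.
  move=> A1L A2L h1 h2; rewrite I_D; [|exact: L1Z|exact: L1Z]; rewrite !I_Z//.
  have a1 := ler_wpM2l t0 h1; have a2 := ler_wpM2l t1' h2.
  by apply: le_trans (lerD a1 a2) _; rewrite -mulrDl addrC subrK mul1r.
have i1 : Int Om eU <= eta by exact: mean.
have i2 : Int Om eP <= eta by exact: mean.
apply: le_trans (lerD (lerD I1 i1) i2) _.
by rewrite le_eqVlt; apply/orP; left; apply/eqP; ring.
Qed.

End Consistency.

(** * Passage to the limit *)

Section LimitOuter.
Context {R : realType}.

Fact arith_v (a d z zk c : R) : c * d <= c * z -> zk <= z ->
  zk + (c * (a + d) + zk) <= c * a + (c * z + 2 * z).
Proof. by rewrite mulrDr => h1 h2; lra. Qed.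

Fact arith_q (z z1 z2 z4 z6 A D : R) : z2 <= A -> z4 <= D ->
  z + (z1 + z2 + (z6 + z4) + z) <= z1 + z6 + (2 * z + A + D).
Proof. by move=> h1 h2; lra. Qed.

Fact arith_W (i1 i2 i c T t j : R) : 0 <= i1 -> 0 <= i2 -> 0 <= c ->
  0 <= c * T -> c * t <= c * T ->
  i <= j + i1 -> j <= 2 * c * t -> i <= i1 + i2 + 4 * c * T + 2 * c.
Proof. by move=> h1 h2 h3 h4 h5 h6 h7; lra. Qed.

Fact arith_W' (i1 i2 i c T t j : R) : 0 <= i1 -> 0 <= i2 -> 0 <= c ->
  0 <= c * T -> c * t <= c * T ->
  i <= j + i2 -> j <= 2 * (2 * c * t) + 2 * c -> i <= i1 + i2 + 4 * c * T + 2 * c.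
Proof. by move=> h1 h2 h3 h4 h5 h6 h7; lra. Qed.

Fact arith_W0 (i1 i2 c T : R) : 0 <= i1 -> 0 <= i2 -> 0 <= c -> 0 <= c * T ->
  0 <= i1 + i2 + 4 * c * T + 2 * c.
Proof. by move=> h1 h2 h3 h4; lra. Qed.

Section Limit.
Local Notation mu := (@lebesgue_measure R).
Local Notation mR := (measurableTypeR R).
Context (Om : domain) (B F : R -> R) (th C M K : R) (h dt : nat -> R) (w : nat ->
  nat -> int -> R)
  (u : nat -> nat -> R -> R).
Context (Hrun : forall k, run Om B F th C M K (h k) (dt k) (w k) (u k))
  (h0 : forall k, 0 < h k) (dt0 : forall k, 0 < dt k)
  (hc : h k @[k --> \oo] --> 0) (dtc : dt k @[k --> \oo]
    --> 0) (C0 : 0 <= C) (M0 : 0 <= M)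
  (th01 : 0 <= th <= 1).
Let Y k t := interp_at (h k) (dt k) (u k) t.
Let P k t := slope_at (h k) (dt k) (u k) t.
Context (v q : R -> R -> R)
  (vq : forall t, 0 <= t -> [/\ L1 Om (v t), L1 Om (q t), AC (v t) (q t),
    (forall x, `|v t x| <= M) & forall x, `|q t x| <= C])
  (vI : forall i t, 0 <= t <= i%:R -> Int Om (fun x => `|Y i t x - v t x|)
    <= 2^-1 ^+ i /\
    Int Om (fun x => `|P i t x - q t x|) <= 2^-1 ^+ i).

Let YL k t : L1 Om (Y k t). Proof. exact: (run_yL (Hrun k)). Qed.
Let PL k t : L1 Om (P k t). Proof. exact: (run_pL (Hrun k)). Qed.
Let vL t : 0 <= t -> L1 Om (v t). Proof. by move=> /vq[]. Qed.
Let qL t : 0 <= t -> L1 Om (q t). Proof. by move=> /vq[]. Qed.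

Lemma eventually_small (e T : R) : 0 < e -> exists k0 : nat, forall k,
  (k0 <= k)%N ->
  [/\ h k <= e, dt k <= e, (2^-1 : R) ^+ k <= e & T <= k%:R].
Proof.
move=> e0; have [n1 H1] := half_small e0.
have /cvgrPdist_lt/(_ _ e0)[n2 _ H2] := hc.
have /cvgrPdist_lt/(_ _ e0)[n3 _ H3] := dtc.
pose n4 := (Num.truncn T).+1.
exists (maxn (maxn n1 n2) (maxn n3 n4)) => k; rewrite !geq_max => /andP[/andP[k1
  k2] /andP[k3 k4]].
split.
- by have := H2 k k2; rewrite /= sub0r normrN (gtr0_norm (h0 k)) => /ltW.
- by have := H3 k k3; rewrite /= sub0r normrN (gtr0_norm (dt0 k)) => /ltW.
- exact: H1.
- by apply: (@le_trans _ _ n4%:R); [apply/ltW/truncnS_gt|rewrite ler_nat].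
Qed.

Lemma I_triangle (f1 f2 f3 : R -> R) : L1 Om f1 -> L1 Om f2 -> L1 Om f3 ->
  Int Om (fun x => `|f1 x - f3 x|) <= Int Om (fun x => `|f1 x - f2 x|)
    + Int Om (fun x => `|f2 x - f3 x|).
Proof.
move=> L1f L2f L3f; have := I_normD (L1B L1f L2f) (L1B L2f L3f).
rewrite (@eq_I _ Om (fun x => `|f1 x - f2 x + (f2 x - f3 x)|)
  (fun x => `|f1 x - f3 x|))//.
by move=> x; congr `|_|; ring.
Qed.

Lemma I_distC (f1 f2 : R -> R) : Int Om (fun x => `|f1 x - f2 x|)
  = Int Om (fun x => `|f2 x - f1 x|).
Proof. by apply: eq_I => x; exact: distrC. Qed.

(** The Lipschitz bound of the interpolations holds up to the time step, which
    tends to 0. *)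
Lemma v_time s t : 0 <= s -> 0 <= t -> Int Om (fun x => `|v s x - v t x|)
  <= 2 * C * `|s - t|.
Proof.
wlog st : s t / s <= t.
  move=> H s0 t0; case: (leP s t) => [st|/ltW ts]; first exact: H.
  by rewrite I_distC distrC; exact: H.
move=> s0 t0; apply/ler_addgt0Pr => e e0.
have C1 : 0 < 2 * C + 2 by rewrite ltr_wpDl// mulr_ge0.
have [|k hk] := @eventually_small (e / (2 * C + 2)) t; first by rewrite divr_gt0.
have [_ k1 k2 k3] := hk k (leqnn _).
have tk : 0 <= t <= k%:R by rewrite t0.
have sk : 0 <= s <= k%:R by rewrite s0 (le_trans st).
have [a1 _] := vI sk; have [a2 _] := vI tk.
have a3 := Y_time Hrun dt0 C0 k s0 st.
have b1 := I_triangle (vL s0) (YL k s) (vL t0).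
have b2 := I_triangle (YL k s) (YL k t) (vL t0).
rewrite I_distC in a1; rewrite I_distC in a3.
rewrite distrC (ger0_norm (_ : 0 <= t - s)) ?subr_ge0//.
apply: le_trans b1 _; apply: le_trans (lerD a1 (le_trans b2 (lerD a3 a2))) _.
have c1 : 2 * C * dt k <= 2 * C * (e / (2 * C + 2)) by apply: ler_wpM2l => //;
  rewrite mulr_ge0.
have -> : e = 2 * C * (e / (2 * C + 2)) + 2 * (e / (2 * C + 2)) by field;
  rewrite gt_eqF.
exact: arith_v.
Qed.

(** The interpolation inequality transfers the continuity in time from [v] to
    [q], at the price of the free parameter [r]. *)
Lemma q_time s t r : 0 <= s -> 0 <= t -> 0 < r ->
  Int Om (fun x => `|q s x - q t x|) <= 2 * (2 * C * `|s - t|) / r + 2 * C * r.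
Proof.
wlog st : s t / s <= t.
  move=> H s0 t0; case: (leP s t) => [st|/ltW ts]; first exact: H.
  by rewrite I_distC distrC; exact: H.
move=> s0 t0 r0; apply/ler_addgt0Pr => e e0.
pose D := 2 + 4 * C / r + 2 * C.
have D0 : 0 < D by rewrite /D -addrA ltr_wpDr// addr_ge0// ?divr_ge0// ?(ltW
  r0)// mulr_ge0.
have [|k hk] := @eventually_small (e / D) t; first by rewrite divr_gt0.
have [k0 k1 k2 k3] := hk k (leqnn _).
have tk : 0 <= t <= k%:R by rewrite t0.
have sk : 0 <= s <= k%:R by rewrite s0 (le_trans st).
have [_ a1] := vI sk; have [_ a2] := vI tk.
have a3 := Y_time Hrun dt0 C0 k s0 st.
have a4 := Y_P Hrun h0 C0 k k s t r0.
have b1 := I_triangle (qL s0) (PL k s) (qL t0).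
have b2 := I_triangle (PL k s) (PL k t) (qL t0).
rewrite I_distC in a1; rewrite I_distC in a3.
rewrite [`|s - t|]distrC (ger0_norm (_ : 0 <= t - s)) ?subr_ge0//.
apply: le_trans b1 _; apply: le_trans (lerD a1 (le_trans b2 (lerD a4 a2))) _.
have ri : 0 <= 2 / r by rewrite divr_ge0// ltW.
have c1 := ler_wpM2l ri a3.
have C2 : 0 <= 4 * C / r by rewrite divr_ge0 ?(ltW r0)// mulr_ge0.
have c2 := ler_wpM2l C2 k1.
have C3 : 0 <= 2 * C by rewrite mulr_ge0.
have c3 := ler_wpM2l C3 k0.
have E : e = 2 * (e / D) + 4 * C / r * (e / D) + 2 * C * (e / D).
  by rewrite -!mulrDl -/D mulrCA mulfV ?mulr1// gt_eqF.
rewrite [in leRHS]E.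
rewrite -[2 * Int Om _ / r]mulrAC.
apply: (@le_trans _ _ (e / D + (2 / r * (2 * C * (t - s + dt k))
  + C * (2 * r + h k + h k) + e / D))).
  by apply: lerD => //; apply: lerD => //; rewrite lerD2r.
have -> : 2 / r * (2 * C * (t - s + dt k)) = 2 * (2 * C * (t - s))
  / r + 4 * C / r * dt k by field; rewrite gt_eqF.
have -> : C * (2 * r + h k + h k) = 2 * C * r + 2 * C * h k by ring.
exact: arith_q.
Qed.

Lemma W11_continuity t (e : R) : 0 <= t -> 0 < e -> exists2 d : R,
  0 < d & forall s, 0 <= s -> `|s - t| <= d ->
  Int Om (fun x => `|v s x - v t x|) <= e /\ Int Om (fun x => `|q s x - q t x|)
    <= e.
Proof.
move=> t0 e0; have C1 : 0 < C + 1 by rewrite ltr_wpDl.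
pose r := e / (4 * (C + 1)).
have r0 : 0 < r by rewrite divr_gt0// mulr_gt0.
pose d := Num.min (e / (2 * (C + 1))) (e * r / (8 * (C + 1))).
have d0 : 0 < d.
  by rewrite lt_min; apply/andP; split; apply: divr_gt0 => //; apply: mulr_gt0.
have Cd1 : 2 * C * d <= e.
  apply: (@le_trans _ _ (2 * (C + 1) * (e / (2 * (C + 1)))));
    last by rewrite mulrC mulfVK// gt_eqF// mulr_gt0.
  apply: ler_pM; rewrite ?(ltW d0)// ?ge_min ?lexx// ?mulr_ge0//; lra.
have Cd2 : 2 * (2 * C * d) / r <= e / 2.
  rewrite ler_pdivrMr//.
  apply: (@le_trans _ _ (4 * (C + 1) * (e * r / (8 * (C + 1)))));
    last by rewrite le_eqVlt; apply/orP; left; apply/eqP; field; rewrite gt_eqF.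
  have -> : 2 * (2 * C * d) = 4 * C * d by ring.
  apply: ler_pM; rewrite ?(ltW d0)// ?ge_min ?lexx ?orbT// ?mulr_ge0//; lra.
have Cr : 2 * C * r <= e / 2.
  apply: (@le_trans _ _ (2 * (C + 1) * r)); first by apply: ler_wpM2r;
    [exact: ltW|lra].
  by rewrite le_eqVlt; apply/orP; left; apply/eqP; rewrite /r; field;
    rewrite gt_eqF.
exists d => // s s0 std.
have C3 : 0 <= 2 * C by rewrite mulr_ge0.
have c1 := ler_wpM2l C3 std.
split; first by apply: le_trans (v_time s0 t0) _; apply: le_trans c1 Cd1.
apply: le_trans (q_time s0 t0 r0) _.
have c2 : 2 * (2 * C * `|s - t|) / r <= 2 * (2 * C * d) / r.
  by apply: ler_wpM2r; [rewrite invr_ge0 ltW|apply: ler_wpM2l].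
by apply: le_trans (lerD (le_trans c2 Cd2) Cr) _; rewrite -splitr.
Qed.

Lemma vq_bounded (T : R) : 0 <= T -> exists2 W : R, 0 <= W & forall t,
  0 <= t <= T ->
  Int Om (fun x => `|v t x|) <= W /\ Int Om (fun x => `|q t x|) <= W.
Proof.
move=> T0; have z0 := lexx (0 : R).
pose W := Int Om (fun x => `|v 0 x|) + Int Om (fun x => `|q 0 x|)
  + 4 * C * T + 2 * C.
have n1 : 0 <= Int Om (fun x => `|v 0 x|) by apply: I_ge0.
have n2 : 0 <= Int Om (fun x => `|q 0 x|) by apply: I_ge0.
have n3 : 0 <= C * T by rewrite mulr_ge0.
exists W; first exact: arith_W0.
move=> t /andP[t0 tT].
have a1 := v_time t0 z0; have a2 := q_time t0 z0 ltr01.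
rewrite subr0 (ger0_norm t0) in a1 a2; rewrite divr1 mulr1 in a2.
have Ct : C * t <= C * T by apply: ler_wpM2l.
have tri (f1 f2 : R -> R) : L1 Om f1 -> L1 Om f2 -> Int Om (fun x => `|f1 x|)
  <= Int Om (fun x => `|f1 x - f2 x|) + Int Om (fun x => `|f2 x|).
  move=> L1f L2f; have := I_normD (L1B L1f L2f) L2f.
  by rewrite (@eq_I _ Om (fun x => `|f1 x - f2 x + f2 x|)
    (fun x => `|f1 x|))// => x; rewrite subrK.
have b1 := tri _ _ (vL t0) (vL z0); have b2 := tri _ _ (qL t0) (qL z0).
rewrite /W; split.
  exact: (arith_W n1 n2 C0 n3 Ct b1).
exact: (arith_W' n1 n2 C0 n3 Ct b2).
Qed.

Lemma joint_measurability : (forall t x, 0 <= t -> Y i t x @[i --> \oo]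
  --> v t x) ->
  measurable_fun ((`]0, +oo[%classic : set mR) `*` [set: mR])
    (fun z : mR * mR => v z.1 z.2).
Proof.
move=> cv.
have mY i : measurable_fun (setT : set (mR * mR)) (fun z => Y i z.1 z.2).
  rewrite (_ : (fun z => _) = (fun z => (fun n z => average (h i) (u i n) z.2)
    (Num.truncn (z.1 / dt i)) z)); last first.
    by apply/funext => z.
  apply: (@measurable_switch R _ _ (fun z : mR * mR => z.1 / dt i)
    (fun n z => average (h i) (u i n) z.2)).
    by apply: measurable_funM => //; exact: measurable_fst.
  move=> n; have [_ my _] := run_yL (Hrun i) n;
    exact: (measurableT_comp my measurable_snd).
apply: (@measurable_fun_cvg _ _ R _ (fun i z => Y i z.1 z.2)).
  by move=> i; exact: measurable_funTS (mY i).
move=> [t x] [/= + _]; rewrite in_itv/= andbT => t0; apply: cv; exact: ltW.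
Qed.


Section weak.
Context (B_C2 : C2 B) (B01 : forall s, 0 <= B s <= 1) (K0 : 0 <= K) (FL : L1 Om F)
  (phi : R -> R -> R) (tphi : test_fun2 Om phi).

Let flux k n x := u k n.+1 x * ((phi (n.+1%:R * dt k) x - phi (n%:R * dt k) x)
  / dt k).
Let diffusion k n x :=
  let U x := th * u k n.+1 x + (1 - th) * u k n x in
  slope (h k) U x * (slope (h k) (fun x => B (U x)) x * phi (n%:R * dt k) (x + h k)
     + B (U x) * slope (h k) (phi (n%:R * dt k)) x).
Let a k n := Int Om (fun x => flux k n x - diffusion k n x).
Definition weak_integrand (t x : R) := v t x * partial_t phi t x - B (v t x)
  * q t x * partial_x phi t x
  - derive1 B (v t x) * q t x ^+ 2 * phi t x.
Let G t := Int Om (weak_integrand t).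

(** The parameters are chosen in the order [eta], [r], [del]; the last one
    bounds the mesh sizes and the distance to the limit at once. *)
Lemma consistency (T e : R) : 0 <= T -> 0 < e -> exists k0, forall k,
  (k0 <= k)%N -> [/\ dt k <= 1, h k <= e &
  forall n t, n%:R * dt k <= t <= n.+1%:R * dt k -> t <= T ->
  [/\ L1 Om (flux k n), L1 Om (diffusion k n) & `|a k n - G t| <= e]].
Proof.
move=> T0 e0.
have [dB dB' cB''] := B_C2.
have cB' : continuous (derive1 B) by exact: (derivable_continuous dB').
have [LB1 LB10 hLB1] := locally_lipschitz (3 * M) dB cB'.
have [LB2 LB20 hLB2] := locally_bounded (3 * M) cB'.
have [L2 L20 hL2] := locally_lipschitz (3 * M) dB' cB''.
pose LB := LB1 + LB2.
have LB0 : 0 <= LB by exact: addr_ge0.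
have [L L0 [phib philip phit phix phic]] := test_estimates tphi.
have T10 : 0 <= T + 1 by rewrite addr_ge0.
have [W W0 hW] := vq_bounded T10.
pose Kc := L * (1 + 2 * C * LB + C ^+ 2 * L2).
have Kc0 : 0 <= Kc by apply: mulr_ge0 => //; do ![apply: addr_ge0 => //];
  do ![apply: mulr_ge0 => //]; rewrite ?sqr_ge0.
pose eta := e / (6 * (Kc + 1)).
have Kc1 : 0 < Kc + 1 by rewrite ltr_wpDl.
have eta0 : 0 < eta by apply: divr_gt0 => //; apply: mulr_gt0.
have C1 : 0 < C + 1 by rewrite ltr_wpDl.
pose r := eta / (4 * (C + 1)).
have r0 : 0 < r by apply: divr_gt0 => //; apply: mulr_gt0.
have Cr : 2 * C * r <= eta / 2.
  apply: (@le_trans _ _ (2 * (C + 1) * r)).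
    by apply: ler_wpM2r; [exact: ltW|rewrite ler_pM2l// lerDl].
  by rewrite le_eqVlt; apply/orP; left; apply/eqP; rewrite /r; field;
    rewrite gt_eqF.
pose D1 := 2 * (1 + 4 * C / r).
have D10 : 0 < D1 by apply: mulr_gt0 => //; rewrite ltr_wpDr// divr_ge0 ?(ltW
  r0)// mulr_ge0.
pose D2 := W + 2 + 2 * C.
have D20 : 0 < D2 by rewrite /D2 -addrA ltr_wpDl// ltr_wpDr// mulr_ge0.
pose D3 := 8 * (Kc + 1) * (W + 1).
have D30 : 0 < D3 by apply: mulr_gt0; [apply: mulr_gt0|rewrite ltr_wpDl].
(* With [h], [dt] and [2^-k] below [del], each of the error terms below is at
   most its share of [e]. *)
pose del := Num.min (Num.min 1 e) (Num.min (eta / D1) (Num.min (eta / D2)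
  (e / D3))).
have del0 : 0 < del by rewrite !lt_min ltr01 e0/=; apply/and3P; split;
  apply: divr_gt0.
have [k0 hk0] := @eventually_small del (T + 1) del0.
exists k0 => k kk; have [hs ds ps Tk] := hk0 k kk.
have le_del z : del <= z -> h k <= z /\ dt k <= z /\ (2^-1 : R) ^+ k <= z.
  by move=> dz; split; [|split]; apply: le_trans dz.
have [hs1 [ds1 _]] : h k <= 1 /\ dt k <= 1 /\ (2^-1 : R)
  ^+ k <= 1 by apply: le_del; rewrite /del !ge_min lexx.
have [hse _] : h k <= e /\ dt k <= e /\ (2^-1 : R) ^+ k <= e by apply: le_del;
  rewrite /del !ge_min lexx !orbT.
have [_ [d1 p1]] : h k <= eta / D1 /\ dt k <= eta / D1 /\
  (2^-1 : R) ^+ k <= eta / D1.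
  by apply: le_del; rewrite /del !ge_min lexx !orbT.
have [h2 [d2 p2]] : h k <= eta / D2 /\ dt k <= eta / D2 /\
  (2^-1 : R) ^+ k <= eta / D2.
  by apply: le_del; rewrite /del !ge_min lexx !orbT.
have [h3 [d3 _]] : h k <= e / D3 /\ dt k <= e / D3 /\ (2^-1 : R) ^+ k <= e / D3.
  by apply: le_del; rewrite /del !ge_min lexx !orbT.
split => // n t /andP[nt tn] tT.
have dk := dt0 k; have hk := h0 k.
have t0 : 0 <= t by apply: le_trans nt; rewrite mulr_ge0// ltW.
have nS : n.+1%:R * dt k = n%:R * dt k + dt k by rewrite -natr1 mulrDl mul1r.
have close m : m%:R * dt k <= t + dt k -> `|m%:R * dt k - t| <= dt k ->
   Int Om (fun x => `|u k m x - v t x|) <= eta /\ Int Om (fun x => `|slope (h k)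
     (u k m) x - q t x|) <= eta.
  move=> mt mtd; set s := m%:R * dt k in mt mtd *.
  have s0 : 0 <= s by rewrite /s mulr_ge0// ltW.
  have sT : s <= T + 1 by apply: le_trans mt _; apply: lerD.
  have sk : 0 <= s <= k%:R by rewrite s0 (le_trans sT).
  have [vs qs] := vI sk.
  (* At a time of the grid the interpolation is that of the corresponding
     step. *)
  have YE : Y k s = average (h k) (u k m).
    by rewrite /Y /interp_at /s mulfK ?gt_eqF// natrK.
  have PE : P k s = slope (h k) (u k m).
    by rewrite /P /slope_at /s mulfK ?gt_eqF// natrK.
  have [|_ qW] := hW s; first by rewrite s0.
  have pL : L1 Om (P k s) by exact: PL.
  have pW : Int Om (fun x => `|P k s x|) <= 1 + W.
    have := I_normD (L1B pL (qL s0)) (qL s0).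
    rewrite (@eq_I _ Om (fun x => `|P k s x - q s x + q s x|)
      (fun x => `|P k s x|)); last by move=> x; rewrite subrK.
    move=> /le_trans; apply; apply: lerD => //; apply: le_trans qs _;
      by have [_ [_ ->]] : h k <= 1 /\ dt k <= 1 /\ (2^-1 : R)
      ^+ k <= 1 by apply: le_del; rewrite /del !ge_min lexx.
  have uL : L1 Om (u k m) := run_uL (Hrun k) m.
  have uY : Int Om (fun x => `|u k m x - Y k s x|) <= h k * (1 + W).
    apply: (@le_trans _ _ (Int Om (fun x => h k * `|P k s x|))).
      apply: le_I; [by apply/L1_norm/L1B|by apply/L1Z/L1_norm|].
      by move=> x; rewrite distrC YE PE; exact: (run_yu (Hrun k)).
    by rewrite I_Z; [apply: ler_wpM2l => //; exact: ltW|exact: L1_norm].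
  have vst := v_time s0 t0; have qst := q_time s0 t0 r0.
  have C20 : 0 <= 2 * C by rewrite mulr_ge0.
  have v2 := ler_wpM2l C20 mtd.
  split.
    apply: le_trans (I_triangle uL (YL k s) (vL t0)) _.
    apply: le_trans (lerD uY (I_triangle (YL k s) (vL s0) (vL t0))) _.
    apply: (@le_trans _ _ (eta / D2 * (1 + W) + (eta / D2 + 2 * C * (eta / D2)))).
      apply: lerD; first by apply: ler_wpM2r => //; rewrite addr_ge0.
      apply: lerD; first by apply: le_trans vs p2.
      by apply: le_trans vst _; apply: le_trans v2 _; apply: ler_wpM2l.
    by rewrite le_eqVlt; apply/orP; left; apply/eqP; rewrite /D2; field;
      rewrite gt_eqF// -/D2.
  rewrite -PE; apply: le_trans (I_triangle pL (qL s0) (qL t0)) _.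
  apply: (@le_trans _ _ (eta / D1 + (2 * (2 * C * (eta / D1)) / r + eta / 2))).
    apply: lerD; first by apply: le_trans qs p1.
    apply: le_trans qst _; apply: lerD => //.
    apply: ler_wpM2r; first by rewrite invr_ge0 ltW.
    by apply: ler_wpM2l => //; apply: le_trans v2 _; apply: ler_wpM2l.
  have -> : eta / D1 + (2 * (2 * C * (eta / D1)) / r + eta / 2) = (1 + 4 * C / r)
    * (eta / D1) + eta / 2.
    by field; rewrite !gt_eqF.
  have -> : (1 + 4 * C / r) * (eta / D1) = eta / 2.
    by rewrite /D1; field; rewrite !gt_eqF// -?/D1//; move: D10;
      rewrite /D1 pmulr_rgt0// => z; move: z; rewrite -(pmulr_rgt0 _ r0)
      mulrDr mulrCA mulfV ?gt_eqF// !mulr1.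
  by rewrite -splitr.
have [||] := close n; [by apply: le_trans nt _;
  rewrite lerDl ltW|by rewrite ler0_norm ?subr_le0// opprB lerBlDl -nS|].
move=> I0 Ip0.
have [||] := close n.+1; [by rewrite nS lerD2r|by rewrite ger0_norm ?subr_ge0//
  nS lerBlDr [dt k + t]addrC lerD2r|].
move=> I1 Ip1.
have [uq1 uq2 _ vM qC] := vq t0.
have [on cn] : (forall s, [/\ on_dom Om (phi s), on_dom Om (partial_t phi s)
  & on_dom Om (partial_x phi s)]) /\
   forall s, [/\ continuous (phi s), continuous (partial_t phi s)
     & continuous (partial_x phi s)].
  by split=> s; have [oa ob oc [ca cb cc]] := phic s;
    [exact: And3 oa ob oc|exact: And3 ca cb cc].
have [on1 on2 on3] := on t; have [on4 _ _] := on (n%:R * dt k);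
  have [on5 _ _] := on (n.+1%:R * dt k).
have [cn1 cn2 cn3] := cn t; have [cn4 _ _] := cn (n%:R * dt k);
  have [cn5 _ _] := cn (n.+1%:R * dt k).
have ntr : 0 <= n%:R * dt k <= t by rewrite nt andbT mulr_ge0// ltW.
have tn' : t <= n%:R * dt k + dt k by rewrite -nS.
have BL x y : `|x| <= 3 * M -> `|y| <= 3 * M -> `|B x - B y| <= LB * `|x - y|.
  by move=> xM yM; apply: le_trans (hLB1 x y xM yM) _; apply: ler_wpM2r => //;
    rewrite lerDl.
have B'b x : `|x| <= 3 * M -> `|derive1 B x| <= LB.
  by move=> xM; apply: le_trans (hLB2 x xM) _; rewrite lerDr.
have hd0 : 0 <= dt k + h k by rewrite addr_ge0// ltW.
have Ldt : L * dt k <= L * (dt k + h k) by apply: ler_wpM2l => //;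
  rewrite lerDl ltW.
have slb x : `|slope (h k) (phi (n%:R * dt k)) x| <= L.
  rewrite /slope normrM normfV (gtr0_norm hk) ler_pdivrMr//;
    apply: le_trans (philip _ _ _ _) _.
  by rewrite subrr normr0 add0r addrAC subrr add0r (gtr0_norm hk).
have Dtb x : `|(phi (n.+1%:R * dt k) x - phi (n%:R * dt k) x) / dt k| <= L.
  rewrite normrM normfV (gtr0_norm dk) ler_pdivrMr//;
    apply: le_trans (philip _ _ _ _) _.
  by rewrite subrr normr0 addr0 nS addrAC subrr add0r (gtr0_norm dk).
have Dtc x : `|(phi (n.+1%:R * dt k) x - phi (n%:R * dt k) x)
  / dt k - partial_t phi t x| <= L * (dt k + h k).
  by apply: le_trans Ldt; rewrite nS; exact: phit.
have slc x : `|slope (h k) (phi (n%:R * dt k))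
  x - partial_x phi t x| <= L * (dt k + h k).
  exact: phix.
have f0c x : `|phi (n%:R * dt k) (x + h k) - phi t x| <= L * (dt k + h k).
  apply: le_trans (philip _ _ _ _) _; apply: ler_wpM2l => //; apply: lerD.
    by rewrite ler0_norm ?subr_le0// opprB lerBlDl.
  by rewrite addrAC subrr add0r (gtr0_norm hk).
have pb s x : `|phi s x| <= L by have [] := phib s x.
have ptb x : `|partial_t phi t x| <= L by have [] := phib t x.
have pxb x : `|partial_x phi t x| <= L by have [] := phib t x.
have ons : [/\ on_dom Om (phi (n%:R * dt k)), on_dom Om (phi (n.+1%:R * dt k)),
  on_dom Om (phi t), on_dom Om (partial_t phi t) & on_dom Om (partial_x phi t)]
  by exact: And5 on4 on5 on1 on2 on3.
have cns : [/\ continuous (phi (n%:R * dt k)), continuous (phi (n.+1%:R * dt k)),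
  continuous (phi t), continuous (partial_t phi t)
  & continuous (partial_x phi t)] by exact: And5 cn4 cn5 cn1 cn2 cn3.
have [R1 R2 R3 R4] := @step_consistency R Om B th C M LB L2 L (h k) (dt k)
  eta (u k n) (u k n.+1) (v t) (q t)
  (phi (n%:R * dt k)) (phi (n.+1%:R * dt k)) (phi t) (partial_t phi t)
    (partial_x phi t) th01 C0 M0 LB0 L20 L0 hk dk (ltW eta0) dB cB' B01
  BL B'b hL2 (run_uL (Hrun k) n) (run_uL (Hrun k) n.+1) uq1 uq2 (run_uM (Hrun k)
    n) (run_uM (Hrun k) n.+1) vM
  (run_pC (Hrun k) n) (run_pC (Hrun k) n.+1) qC ons cns (pb _) (pb _)
    ptb pxb slb Dtb Dtc slc f0c I0 I1 Ip0 Ip1.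
split; [exact: R1|exact: R2|]; apply: le_trans R4 _; rewrite -/Kc.
have [|vW qW] := hW t; first by rewrite t0 (le_trans tT)// lerDl.
apply: (@le_trans _ _ (Kc * (3 * eta + (e / D3 + e / D3) * (W + W)))).
  apply: ler_wpM2l => //; rewrite lerD2l; apply: ler_pM => //;
    [by apply: addr_ge0; apply: I_ge0|exact: lerD|exact: lerD].
apply: (@le_trans _ _ ((Kc + 1) * (3 * eta + (e / D3 + e / D3) * ((W + 1)
  + (W + 1))))).
  have e3 : 0 <= e / D3 by rewrite ltW// divr_gt0.
  apply: ler_pM => //.
  - by apply: addr_ge0; apply: mulr_ge0 => //;
      [exact: ltW|exact: addr_ge0|exact: addr_ge0].
  - by rewrite lerDl.
  - by rewrite lerD2l; apply: ler_wpM2l; [exact: addr_ge0|apply: lerD;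
      rewrite lerDl].
rewrite le_eqVlt; apply/orP; left; apply/eqP; rewrite /eta /D3; field.
by rewrite !gt_eqF// ltr_wpDl.
Qed.

Let uL k n : L1 Om (u k n). Proof. exact: (run_uL (Hrun k)). Qed.

(** Summation by parts in time: the two sums add up to the telescoping sum of
    [u^(n+1) phi^(n+1) - u^n phi^n]. *)
Lemma weak_sum k N : (forall n, (n < N)%N -> L1 Om (flux k n) /\
  L1 Om (diffusion k n)) ->
  \sum_(n < N) dt k * a k n = Int Om (fun x => u k N x * phi (N%:R * dt k) x)
    - Int Om (fun x => u k 0%N x * phi 0 x).
Proof.
have [L L0 [phib _ _ _ phic]] := test_estimates tphi.
have on s : on_dom Om (phi s) by have [] := phic s.
have mn s : measurable_fun (setT : set mR) (phi s).
  by have [_ _ _ [c1 _ _]] := phic s; exact: continuous_measurable_fun c1.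
have pb s x : `|phi s x| <= L by have [] := phib s x.
have upL m s : L1 Om (fun x => u k m x * phi s x) by exact: (L1M (uL k m) (on s)
  (mn s) (pb s)).
elim: N => [|N IH] H; first by rewrite big_ord0 mul0r subrr.
rewrite big_ord_recr /= IH; last by move=> n nN; apply: H; exact: ltnW.
have [f1L f2L] := H N (ltnSn N).
have dk : dt k != 0 by rewrite gt_eqF.
have E1 : dt k * Int Om (flux k N) = Int Om (fun x => u k N.+1 x * phi (N.+1%:R *
  dt k) x) - Int Om (fun x => u k N.+1 x * phi (N%:R * dt k) x).
  rewrite -I_Z// -I_B; [|exact: upL|exact: upL].
  by apply: eq_I => x; rewrite /flux; field.
have E2 : Int Om (fun x => (u k N.+1 x - u k N x) * phi (N%:R * dt k) x)
  = - (dt k * Int Om (diffusion k N)).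
  exact: (run_weak (Hrun k) N (on _) (mn _) (pb _)).
have E3 : Int Om (fun x => (u k N.+1 x - u k N x) * phi (N%:R * dt k) x) =
  Int Om (fun x => u k N.+1 x * phi (N%:R * dt k) x)
    - Int Om (fun x => u k N x * phi (N%:R * dt k) x).
  rewrite -I_B; [|exact: upL|exact: upL].
  by apply: eq_I => x; ring.
have -> : dt k * a k N = Int Om (fun x => u k N.+1 x * phi (N.+1%:R * dt k) x)
  - Int Om (fun x => u k N x * phi (N%:R * dt k) x).
  rewrite /a I_B// mulrBr E1; have {}E2 := esym E2; rewrite E3 in E2.
  have -> : dt k * Int Om (diffusion k N) = - (Int Om (fun x => u k N.+1 x * phi
    (N%:R * dt k) x) - Int Om (fun x => u k N x * phi (N%:R * dt k) x)).
    by rewrite -E2 opprK.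
  ring.
ring.
Qed.

(** The sum over the time steps is a Riemann sum of [G] up to an error that is
    uniform in time, since at every time of a cell the integrand is close to
    that of the cell. The function [G] is measurable as a limit of step
    functions in time. *)
Lemma weak_form : \int[mu]_(t in `[0, +oo[) G t + Int Om (fun x => F x * phi 0 x)
  = 0.
Proof.
have [L L0 [phib _ _ _ phic]] := test_estimates tphi.
have [_ _ [M1 hM1]] := tphi.
have [_ _ [M2 hM2]] := test_partial_t tphi.
have [_ _ [M3 hM3]] := test_partial_x tphi.
pose MM := `|M1| + `|M2| + `|M3|.
have MM0 : 0 <= MM by rewrite /MM !addr_ge0.
have leM1 : M1 <= MM by apply: le_trans (ler_norm _) _;
  rewrite /MM -addrA lerDl addr_ge0.
have leM2 : M2 <= MM by apply: le_trans (ler_norm _) _;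
  rewrite /MM addrAC lerDr addr_ge0.
have leM3 : M3 <= MM by apply: le_trans (ler_norm _) _; rewrite /MM lerDr addr_ge0.
pose T := MM + 1.
have T0 : 0 <= T by rewrite addr_ge0.
have MT : MM <= T by rewrite lerDl.
have phi0 t x : MM < t -> phi t x = 0.
  by move=> Mt; apply: hM1; left; apply: le_lt_trans leM1 (lt_le_trans Mt
    (ler_norm _)).
have G0 t : MM < t -> G t = 0.
  move=> Mt; rewrite /G (@eq_I _ Om _ (fun=> 0)) ?I_0// => x.
  rewrite /weak_integrand phi0// (hM2 t x); last by left;
    apply: le_lt_trans leM2 (lt_le_trans Mt (ler_norm _)).
  rewrite (hM3 t x); last by left; apply: le_lt_trans leM3 (lt_le_trans Mt
    (ler_norm _)).
  by rewrite !mulr0 !subr0.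
(* Nothing is known of [v] at negative times. *)
pose Gp t := if 0 <= t then G t else 0.
have cell k t : 0 <= t -> (Num.truncn (t / dt k))%:R * dt k <= t <= (Num.truncn
  (t / dt k)).+1%:R * dt k.
  move=> t0; have dk := dt0 k; have td : 0 <= t / dt k by rewrite divr_ge0// ltW.
  rewrite -ler_pdivlMr// truncn_le// td /=.
  by have := Num.Theory.truncnS_gt (t / dt k); rewrite ltr_pdivrMr// => /ltW.
have mGp : measurable_fun (setT : set mR) Gp.
  pose gk k (t : R) : R := if (0 <= t) && (t <= T)
    then a k (Num.truncn (t / dt k)) else 0.
  apply: (@measurable_fun_cvg _ mR R setT gk).
    move=> k; apply: measurable_fun_ifT => //.
      by apply: measurable_and; apply: measurable_fun_ler.
    have := @measurable_floorT R _ mR (fun t => t / dt k)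
      (fun j => a k (match j with Posz n => n | _ => 0%N end)).
    have mdiv : measurable_fun (setT : set mR) (fun t : R => t / dt k)
      by apply: measurable_funM.
    move=> /(_ mdiv) H.
    by move: H; congr measurable_fun; apply/funext => t; rewrite truncEfloor.
  move=> t _; apply/cvgrPdist_lt => e e0.
  have e2 : 0 < e / 2 by rewrite divr_gt0.
  have [k0 hk0] := consistency T0 e2; exists k0 => // k kk /=.
  rewrite /gk /Gp; have [_ _ hk] := hk0 k kk.
  case: (ltP t 0) => t0; first by rewrite subrr normr0.
  case: (leP t T) => tT /=; last by rewrite G0 ?subrr ?normr0//;
    apply: le_lt_trans tT.
  have [_ _ h1] := hk _ t (cell k t t0) tT.
  by rewrite distrC; apply: le_lt_trans h1 _; rewrite ltr_pdivrMr// mulr_natr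
    mulr2n ltrDl.
have GpL : LI Gp.
  have [k0 hk0] := consistency T0 ltr01; have [_ _ hk] := hk0 k0 (leqnn _).
  pose Nm := (Num.truncn (T / dt k0)).+1.
  apply: (@LI_bounded _ Gp (1 + \sum_(n < Nm) `|a k0 n|)) => // t.
  have S0 : 0 <= \sum_(n < Nm) `|a k0 n| by apply: sumr_ge0.
  rewrite /Gp; case: (ltP t 0) => t0; first by rewrite normr0 addr_ge0.
  have [tT|tT] : t <= T \/ T < t by case: (leP t T); [left|right].
    have [_ _ h1] := hk _ t (cell k0 t t0) tT.
    set n := Num.truncn (t / dt k0) in h1.
    have nN : (n < Nm)%N by rewrite ltnS; apply: le_truncn;
      rewrite ler_pM2r ?invr_gt0.
    have : `|a k0 n| <= \sum_(n < Nm) `|a k0 n|.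
      by rewrite (bigD1 (Ordinal nN))//= lerDl sumr_ge0.
    have := ler_normB (a k0 n) (a k0 n - G t); rewrite subKr => h2 h3.
    by apply: le_trans h2 _; rewrite addrC; exact: lerD.
  by rewrite G0 ?normr0 ?addr_ge0//; apply: le_lt_trans tT.
have GpT t : T < `|t| -> Gp t = 0.
  rewrite /Gp => Tt; case: (ltP t 0) => t0 //; apply: G0.
  by rewrite (ger0_norm t0) in Tt; apply: le_lt_trans Tt.
have intE : \int[mu]_(t in `[0, +oo[) G t = ii 0 T Gp.
  have -> : ii 0 T Gp = ii (- T) T Gp.
    have T0' : - T <= 0 by rewrite oppr_le0.
    rewrite [RHS](@ii_split _ _ 0)//.
    rewrite (@eq_ii_oo _ (- T) 0 Gp (fun=> 0))//; last 2 first.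
    - exact: LI_cst.
    - by move=> t /andP[_ t0]; rewrite /Gp leNgt t0.
    by rewrite ii_cst// mul0r add0r.
  rewrite -(Rintegral_supp GpT) [LHS]Rintegral_mkcond; apply: eq_Rintegral => t _.
  rewrite patchE /Gp mem_setE in_itv/= andbT//.
rewrite intE.
apply/eqP; rewrite -normr_eq0 eq_le normr_ge0 andbT; apply/ler_addgt0Pr => e e0;
  rewrite add0r.
pose D := T + 2 * L * K + 1.
have D0 : 0 < D by rewrite ltr_wpDl// addr_ge0// !mulr_ge0.
pose e1 := e / D.
have e10 : 0 < e1 by rewrite divr_gt0.
have [k0 hk0] := consistency T0 e10; have [dk1 hke hk] := hk0 k0 (leqnn _).
set k := k0 in dk1 hke hk *.
have dk := dt0 k; have hpos := h0 k.
(* The first [N] steps reach beyond the support of the test function but not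
   beyond [T]. *)
pose N := (Num.truncn (MM / dt k)).+1.
have N1 : MM < N%:R * dt k by rewrite -ltr_pdivrMr//; exact: truncnS_gt.
have N2 : N%:R * dt k <= T.
  rewrite /N -natr1 mulrDl mul1r; apply: lerD => //.
  by rewrite -ler_pdivlMr// truncn_le divr_ge0// ltW.
have N0 : 0 <= N%:R * dt k by rewrite mulr_ge0// ltW.
have s1 : ii 0 T Gp = ii 0 (N%:R * dt k) Gp.
  rewrite (@ii_split _ 0 (N%:R * dt k) T)//.
  rewrite [X in _ + X](@eq_ii_oo _ _ _ Gp (fun=> 0))//; last 2 first.
  - exact: LI_cst.
  - by move=> t /andP[t1 _]; rewrite /Gp; case: ifP => // _; apply: G0;
      apply: lt_trans t1.
  by rewrite ii_cst// mul0r addr0.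
have s2 : ii 0 (N%:R * dt k) Gp = \sum_(n < N) ii (n%:R * dt k)
  (n%:R * dt k + dt k) Gp.
  have := @ii_cat_h R 0 (dt k) Gp N (ltW dk) GpL; rewrite add0r => <-.
  by apply: eq_bigr => n _; rewrite add0r.
have nS (n : nat) : n.+1%:R * dt k = n%:R * dt k + dt k by rewrite -natr1 mulrDl
  mul1r.
have nT (n : nat) : (n < N)%N -> n.+1%:R * dt k <= T.
  by move=> nN; apply: le_trans N2; apply: ler_wpM2r; [exact: ltW|rewrite ler_nat].
have s3 : \sum_(n < N) dt k * a k n = - Int Om (fun x => u k 0%N x * phi 0 x).
  rewrite weak_sum; last first.
    move=> n nN; have t1 : n%:R * dt k <= n.+1%:R * dt k <= n.+1%:R * dt k by
      rewrite lexx nS lerDl ltW.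
    by have [r1 r2 _] := hk n _ t1 (nT n nN); split; [exact: r1|exact: r2].
  rewrite (@eq_I _ Om _ (fun=> 0)) ?I_0 ?sub0r// => x.
  by rewrite phi0// mulr0.
have s4 : `|ii 0 T Gp - \sum_(n < N) dt k * a k n| <= e1 * T.
  rewrite s1 s2 -sumrB; apply: le_trans (ler_norm_sum _ _ _) _.
  apply: (@le_trans _ _ (\sum_(n < N) e1 * dt k)).
    apply: ler_sum => n _.
    have c0 : n%:R * dt k <= n%:R * dt k + dt k by rewrite lerDl ltW.
    have cL : LI (fun t => Gp t - a k n) by apply: LIB => //; exact: LI_cst.
    have -> : ii (n%:R * dt k) (n%:R * dt k + dt k)
      Gp - dt k * a k n = ii (n%:R * dt k) (n%:R * dt k + dt k)
      (fun t => Gp t - a k n).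
      rewrite iiB//; last exact: LI_cst.
      by rewrite ii_cst// addrAC subrr add0r [a k n * _]mulrC.
    have -> : e1 * dt k = e1 * (n%:R * dt k + dt k - n%:R * dt k)
      by rewrite addrAC subrr add0r.
    apply: ii_bound => // t /andP[t1 t2].
    have t0 : 0 <= t by apply: le_trans t1; rewrite mulr_ge0// ltW.
    rewrite /Gp t0 distrC.
    have tn : n%:R * dt k <= t <= n.+1%:R * dt k by rewrite t1 nS t2.
    have tT : t <= T by apply: le_trans (nT n (ltn_ord n)); rewrite nS.
    by have [_ _ r3] := hk n t tn tT.
  rewrite sumr_const card_ord -[_ *+ N]mulr_natl mulrCA; apply: ler_wpM2l;
    first exact: ltW.
  by [].
have on0 : on_dom Om (phi 0) by have [] := phic 0.
have mn0 : measurable_fun (setT : set mR) (phi 0).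
  by have [_ _ _ [c1 _ _]] := phic 0; exact: continuous_measurable_fun c1.
have pb x : `|phi 0 x| <= L by have [] := phib 0 x.
have s5 : `|Int Om (fun x => u k 0%N x * phi 0 x)
  - Int Om (fun x => F x * phi 0 x)| <= e1 * (2 * L * K).
  rewrite -I_B; [|exact: (L1M (uL k 0%N) on0 mn0 pb)|exact: (L1M FL on0 mn0 pb)].
  have dL : L1 Om (fun x => u k 0%N x - F x) by exact: L1B.
  have dpL : L1 Om (fun x => u k 0%N x * phi 0 x - F x * phi 0 x).
    by apply: L1B; [exact: (L1M (uL k 0%N) on0 mn0 pb)|exact: (L1M FL on0 mn0 pb)].
  have ptw x : `|u k 0%N x * phi 0 x - F x * phi 0 x| <= L * `|u k 0%N x - F x|.
    by rewrite -mulrBl normrM mulrC; apply: ler_wpM2r.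
  apply: le_trans (le_I_norm dpL (L1Z L (L1_norm dL)) ptw) _.
  rewrite I_Z; last exact: L1_norm.
  have := run_init (Hrun k); move=> /(ler_wpM2l L0) /le_trans; apply.
  have -> : L * (2 * h k * K) = h k * (2 * L * K) by ring.
  by apply: ler_wpM2r => //; rewrite !mulr_ge0.
have -> : ii 0 T Gp + Int Om (fun x => F x * phi 0 x) =
  (ii 0 T Gp - \sum_(n < N) dt k * a k n) - (Int Om (fun x => u k 0%N x * phi 0
    x) - Int Om (fun x => F x * phi 0 x)).
  by rewrite s3; ring.
apply: le_trans (ler_normB _ _) _; apply: le_trans (lerD s4 s5) _.
rewrite -mulrDr; apply: (@le_trans _ _ (e1 * D));
  last by rewrite /e1 mulfVK// gt_eqF.
by apply: ler_wpM2l; [exact: ltW|rewrite /D lerDl].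
Qed.

End weak.
End Limit.

End LimitOuter.

(** * Conclusion *)

Section Assembly.
Context {R : realType}.
Local Notation mu := (@lebesgue_measure R).
Local Notation mR := (measurableTypeR R).
Implicit Types (Om : domain) (f g : R -> R).

Lemma I_ae Om f g : measurable_fun (setT : set mR) f ->
  measurable_fun (setT : set mR) g ->
  {ae mu, forall x, f x = g x} -> Int Om f = Int Om g.
Proof.
move=> mf mg fg; have mD := measurable_dom (R := R) Om.
rewrite /Int /Rintegral; congr fine; apply: ae_eq_integral => //.
- exact/measurable_EFinP/measurable_funTS.
- exact/measurable_EFinP/measurable_funTS.
- by apply: ae_imp fg => x -> _.
Qed.

Lemma Lnorm_oo_le d (T : measurableType d) (m : {measure set T ->
  \bar R}) (D : set T) (mD : measurable D)
    (f : T -> \bar R) (K : R) : 0 <= K -> (forall x, D x -> (`|f x| <= K%:E)%E) ->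
  ('N[mrestr m mD]_+oo[f] < +oo)%E.
Proof.
move=> K0 fK; rewrite unlock /Lnorm; case: ifP => _ //.
apply: le_lt_trans (ltry K); apply/ess_supP; exists (~` D); split.
- exact: measurableC.
- by rewrite /= /mrestr setICl measure0.
- by move=> x /= h Dx; apply: h; exact: fK.
Qed.

Lemma W11_dist Om (v1 q1 v2 q2 : R -> R) : AC v1 q1 -> AC v2 q2 -> L1 Om v1 ->
  L1 Om q1 -> L1 Om v2 -> L1 Om q2 ->
  W1norm Om 1%E (v1 \- v2) = (Int Om (fun x => `|v1 x - v2 x|)
    + Int Om (fun x => `|q1 x - q2 x|))%:E.
Proof. by move=> a1 a2 l1 l2 l3 l4; have [_ E] := W1norm_AC (ACB a1 a2)
  (L1B l1 l3) (L1B l2 l4); exact: E. Qed.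

Lemma cvg_subseq (a : nat -> R) (s : nat -> nat) (l : R)
  : {homo s : m n / (m < n)%N} ->
  a k @[k --> \oo] --> l -> a (s k) @[k --> \oo] --> l.
Proof.
move=> sh al; have sn n : (n <= s n)%N.
  by elim: n => // n IH; apply: leq_ltn_trans IH _; exact: sh.
apply/cvgrPdist_lt => e e0; have /cvgrPdist_lt/(_ _ e0)[N _ hN] := al.
by exists N => // n Nn; apply: hN; exact: leq_trans Nn (sn n).
Qed.

End Assembly.

Theorem theorem2p1 (R : realType) (Om : domain) (B w0 : R -> R) (theta : R)
    (dx dt : nat -> R) (w : nat -> nat -> int -> R)
    (B_C2 : C2 B) (B_01 : forall s, 0 <= B s <= 1)
    (w0_W11 : W1 Om 1%E w0) (w0_W1oo : W1 Om +oo%E w0)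
    (w0x_BV : BV_dom Om (weak_derive Om w0))
    (theta_01 : 0 <= theta <= 1)
    (adm : forall k, admissible Om theta (dx k) (dt k))
    (dx_0 : dx k @[k --> \oo] --> 0) (dt_0 : dt k @[k --> \oo] --> 0)
    (scheme : forall k,
       scheme_solution Om theta B w0 (dx k) (dt k) (w k)) :
  exists sigma : nat -> nat,
    {homo sigma : m n / (m < n)%N} /\
    exists v : R -> R -> R,
      cvg_W11 Om
        (fun k => interpolation (dx (sigma k)) (dt (sigma k)) (w (sigma k))) v
      /\ weak_solution Om B w0 v.
Proof.
have [F [g [g' [V [M [[FA FL gL w0F w0L] [M0 FM V0 [gg' og'] gV]]]]]]]
  := initial_data w0_W11 w0_W1oo w0x_BV.
have [dB dB' cB''] := B_C2.
have mB : measurable_fun (setT : set (measurableTypeR R)) B.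
  apply: continuous_measurable_fun; exact: (derivable_continuous dB).
have mB' : measurable_fun (setT : set (measurableTypeR R)) (derive1 B).
  apply: continuous_measurable_fun; exact: (derivable_continuous dB').
have cfl k : 2 * (dt k / dx k ^+ 2 * (1 - theta)) <= 1.
  have [dx0 dt0 hcfl _] := adm k; have /andP[t0 t1] := theta_01.
  have [th1|th1] : theta < 1 \/ theta = 1 by move: t1;
    rewrite le_eqVlt => /orP[/eqP|]; [right|left].
    have e0 : 0 < 2 * (1 - theta) by rewrite mulr_gt0// subr_gt0.
    have := hcfl th1; rewrite -[X in _ < X]mul1r ltr_pdivlMr// => /ltW;
      by rewrite mulrCA.
  by rewrite th1 subrr !mulr0.
have grid k : grid_ok Om (dx k) by have [dx0 _ _ h] := adm k; split.
have [k1 hk1] : exists k1, forall k, (k1 <= k)%N -> dx k <= 1.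
  have /cvgrPdist_lt/(_ _ ltr01)[k1 _ hk1] := dx_0; exists k1 => k kk.
  have := hk1 k kk; rewrite /= sub0r normrN => h; exact: le_trans (ler_norm _)
    (ltW h).
(* The estimates assume mesh sizes at most 1, which discards finitely many
   indices. *)
pose s1 k := (k + k1)%N.
have s1h : {homo s1 : m n / (m < n)%N} by move=> m n; rewrite /s1 ltn_add2r.
have h1 k : dx (s1 k) <= 1 by apply: hk1; exact: leq_addl.
have dt0 k : 0 < dt k by have [] := adm k.
have dx0 k : 0 < dx k by have [] := adm k.
pose C := 4 * V; have C0 : 0 <= C by rewrite mulr_ge0.
pose u k n := st (dx k) (w k n).
pose K := Int Om (fun x => `|g x|); have K0 : 0 <= K by apply: I_ge0.
have Hrun k : run Om B F theta C M K (dx (s1 k)) (dt (s1 k)) (w (s1 k)) (u (s1 k)).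
  exact: (run_estimates (grid _) (h1 k) (dt0 _) theta_01 (cfl _)
    B_01 mB (scheme _) FA FL gL w0F w0L M0 FM V0 gg' og' gV).
have far := @uniform_far R Om theta V B w0 F g g' (fun k => dx (s1 k))
  (fun k => dt (s1 k)) (fun k => w (s1 k))
  (fun k => grid _) h1 (fun k => dt0 _) theta_01 (fun k => cfl _)
    B_01 mB (fun k => scheme _) FA FL gL w0F w0L V0 gg' og' gV.
have [s2 [v [q [s2h vq cv vI q2]]]] := compactness Hrun (fun k => dx0 _)
  h1 (fun k => dt0 _) (cvg_subseq s1h dx_0) (cvg_subseq s1h dt_0) C0 far.
pose s k := s1 (s2 k).
have sh : {homo s : m n / (m < n)%N} by move=> m n mn; apply: s1h; exact: s2h.
have Hrun' k : run Om B F theta C M K (dx (s k)) (dt (s k)) (w (s k)) (u (s k))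
  by exact: Hrun.
have dxs := cvg_subseq sh dx_0; have dts := cvg_subseq sh dt_0.
have vL t : 0 <= t -> L1 Om (v t) by move=> /vq[].
have qL t : 0 <= t -> L1 Om (q t) by move=> /vq[].
have vA t : 0 <= t -> AC (v t) (q t) by move=> /vq[].
have ov t : 0 <= t -> on_dom Om (v t) by move=> /vL[].
have oq t : 0 <= t -> on_dom Om (q t) by move=> /qL[].
exists s; split => //; exists v; split.
  split.
    move=> t t0; split; first by have [W _] := W1norm_AC (vA t t0) (vL t t0)
      (qL t t0).
    have E r : 0 <= r -> W1norm Om 1%E (v r \- v t)
      = (Int Om (fun x => `|v r x - v t x|) + Int Om (fun x => `|q r x - q t
      x|))%:E.
      by move=> r0; apply: W11_dist; [exact: vA|exact: vA|exact: vL|exact: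
        qL|exact: vL|exact: qL].
    apply/fine_cvgP; split.
      by apply: filterS (withinT _ _) => r /=; rewrite in_itv/= andbT => r0;
        rewrite E.
    apply/cvgrPdist_le => e e0; have e2 : 0 < e / 2 by rewrite divr_gt0.
    have [d d0 hd] := W11_continuity Hrun' (fun k => dx0 _) (fun k => dt0 _)
      dxs dts C0 vq vI t0 e2.
    apply/nbhs_ballP; exists d => //= r; rewrite /ball /= => rt;
      rewrite in_itv/= andbT => r0.
    have rt' : `|r - t| <= d by rewrite distrC ltW.
    have [a1 a2] := hd r r0 rt'.
    rewrite E//= sub0r normrN ger0_norm; last by apply: addr_ge0; apply: I_ge0.
    by apply: le_trans (lerD a1 a2) _; rewrite -splitr.
  move=> T T0.
  have E k t : 0 <= t -> W1norm Om 1%E (interpolation (dx (s k)) (dt (s k))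
    (w (s k)) t \- v t) =
    (Int Om (fun x => `|interp_at (dx (s k)) (dt (s k)) (u (s k)) t x - v t x|) +
     Int Om (fun x => `|slope_at (dx (s k)) (dt (s k)) (u (s k)) t x - q t x|))%:E.
    move=> t0; rewrite (run_interp (Hrun' k)); apply: W11_dist.
    - exact: (run_AC (Hrun' k)).
    - exact: vA.
    - exact: (run_yL (Hrun' k)).
    - exact: (run_pL (Hrun' k)).
    - exact: vL.
    - exact: qL.
  have half0 : (2 * (2^-1 : R) ^+ k)%:E @[k --> \oo] --> (0 : R)%:E.
    apply: cvg_EFin; first exact: nearW.
    have h2 : `|2^-1 : R| < 1 by rewrite ger0_norm//; lra.
    exact: (cvg_geometric 2 h2).
  apply: (squeeze_cvge _ (cvg_cst _) half0).
  exists (Num.truncn T).+1 => // k /= kT.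
  have Tk : T <= k%:R.
    by apply: (@le_trans _ _ (Num.truncn T).+1%:R);
      [apply/ltW/truncnS_gt|rewrite ler_nat].
  apply/andP; split.
    apply: (@le_trans _ _ (W1norm Om 1%E (interpolation (dx (s k)) (dt (s k))
      (w (s k)) 0 \- v 0))).
      by rewrite E// lee_fin; apply: addr_ge0; apply: I_ge0.
    by apply: ereal_sup_ubound; exists 0 => //=; rewrite in_itv/= lexx ltW.
  apply: ge_ereal_sup => _ [t /= + <-]; rewrite in_itv/= => /andP[t0 tT].
  have tk : 0 <= t <= k%:R by rewrite t0 (le_trans tT).
  have [b1 b2] := vI k t tk.
  by rewrite E// lee_fin mulr_natl mulr2n; exact: lerD.
split.
  split.
  - exact: ov.
  - exact: (joint_measurability Hrun' cv).
  - apply: (@Lnorm_oo_le R _ _ _ _ _ _ M M0) => -[t x] [/= + _];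
      rewrite in_itv/= andbT => t0.
    by have [_ _ _ vM _] := vq t (ltW t0); rewrite lee_fin.
  - move=> T; have T0 : 0 <= `|T| by [].
    have [W W0 hW] := vq_bounded Hrun' (fun k => dx0 _) (fun k => dt0 _)
      dxs dts C0 vq vI T0.
    apply: (@Lnorm_oo_le R _ _ _ _ _ _ ((M * W) `^ 2^-1 + (M * C) `^ 2^-1)).
      by apply: addr_ge0; exact: powR_ge0.
    move=> t /=; rewrite in_itv/= => /andP[/ltW t0 /ltW tT].
    have [_ _ _ vM _] := vq t t0.
    have v2L : L1 Om (fun x => v t x ^+ 2).
      by have [ovt mvt _] := vL t t0; exact: (L1M (vL t t0) ovt mvt vM).
    have [q2L q2I] := q2 t t0.
    rewrite (W1norm2_AC (vA t t0) (ov t t0) (oq t t0) v2L q2L) lee_fin ger0_norm;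
      last by apply: addr_ge0; exact: powR_ge0.
    have v2I : Int Om (fun x => v t x ^+ 2) <= M * W.
      have [|vW _] := hW t; first by rewrite t0 (le_trans tT)// ler_norm.
      apply: (@le_trans _ _ (M * Int Om (fun x => `|v t x|)));
        last exact: ler_wpM2l.
      rewrite -I_Z; last exact: L1_norm (vL t t0).
      apply: le_I => //; first by apply/L1Z/L1_norm/vL.
      by move=> x; rewrite -[v t x ^+ 2]ger0_norm ?sqr_ge0// normrX expr2;
        apply: ler_wpM2r.
    have sq (z K' : R) : 0 <= z -> z <= K' -> z `^ 2^-1 <= K' `^ 2^-1.
      by move=> z0 zK; apply: ge0_ler_powR; rewrite ?nnegrE// (le_trans z0).
    by apply: lerD; apply: sq => //; apply: I_ge0 => x; exact: sqr_ge0.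
  - apply: (@Lnorm_oo_le R _ _ _ _ _ _ ((M * C) `^ 2^-1)); first exact: powR_ge0.
    move=> t /=; rewrite in_itv/= andbT => /ltW t0.
    have [q2L q2I] := q2 t t0.
    rewrite (Lnorm2_weak (vA t t0) (ov t t0) (oq t t0) q2L) lee_fin ger0_norm;
      last exact: powR_ge0.
    apply: ge0_ler_powR; rewrite ?nnegrE ?mulr_ge0//.
    by apply: I_ge0 => x; exact: sqr_ge0.
move=> phi tphi.
have H := weak_form Hrun' (fun k => dx0 _) (fun k => dt0 _)
  dxs dts C0 M0 theta_01 vq vI B_C2 B_01 K0 FL tphi.
have [L L0 [phib _ _ _ phic]] := test_estimates tphi.
have mc (f : R -> R) : continuous f -> measurable_fun (setT : set
  (measurableTypeR R)) f by exact: continuous_measurable_fun.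
refine (etrans (congr2 +%R _ _) H).
  apply: eq_Rintegral => t; rewrite inE /= in_itv/= andbT => t0.
  have [W wq] := weak_derive_AC (ov t t0) (oq t t0) (vA t t0).
  have [_ _ [mw _] _] := is_weak_derive_line W.
  have [_ mv _] := vL t t0; have [_ mq _] := qL t t0.
  have [_ _ _ [c1 c2 c3]] := phic t.
  have meas (f : R -> R) : measurable_fun (setT : set (measurableTypeR R)) f ->
     measurable_fun (setT : set (measurableTypeR R))
       (fun x => v t x * partial_t phi t x - B (v t x)
       * f x * partial_x phi t x - derive1 B (v t x) * f x ^+ 2 * phi t x).
    move=> mf; apply: measurable_funB; first apply: measurable_funB.
    - by apply: measurable_funM => //; exact: mc.
    - apply: measurable_funM; last exact: mc.
      by apply: measurable_funM => //; exact: (measurableT_comp mB mv).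
    - apply: measurable_funM; last exact: mc.
      apply: measurable_funM; first exact: (measurableT_comp mB' mv).
      exact: measurable_funX.
  apply: (@I_ae R Om _ _ (meas _ mw) (meas _ mq)).
  by apply: ae_imp wq => x ->.
have [_ _ _ [c1 _ _]] := phic 0.
apply: (@I_ae R Om (fun x => w0 x * phi 0 x) (fun x => F x * phi 0 x)).
- by apply: measurable_funM; [case: w0L|exact: mc].
- by apply: measurable_funM; [case: FL|exact: mc].
- by apply: ae_imp w0F => x ->.
Qed.
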